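(* Let $\gamma\in\mathbb{R}$. For any $u_0\in W(\mathbb{R})$ there is a unique maximal solution $u\in C(\mathbb{R},W(\mathbb{R}))\cap C^1(\mathbb{R},W'(\mathbb{R}))$ of $$i\partial_tu+\partial_x^2u+\gamma\delta(x)u+u\,\mathrm{Log}|u|^2=0\quad\text{in } W'(\mathbb{R}) \text{ for all } t\in\mathbb{R},$$ such that $u(0)=u_0$ and $\sup_{t\in\mathbb{R}}\|u(t)\|_{W(\mathbb{R})}<\infty$. Furthermore, energy and charge are conserved: for all $t\in\mathbb{R}$, $$E(u(t))=E(u_0)\quad\text{and}\quad \|u(t)\|_{L^2}^2=\|u_0\|_{L^2}^2,$$ where $E(u)=\frac12\|\partial_xu\|_{L^2}^2-\frac{\gamma}{2}|u(0)|^2-\frac12\int_{\mathbb{R}}|u|^2\mathrm{Log}|u|^2\,dx$ (here $u(0)$ in $E$ denotes the value at the point $x=0$).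
   Context: All functions of $x\in\mathbb{R}$ are complex-valued, $\mathrm{Log}$ is the natural logarithm, and $0\,\mathrm{Log}\,0=0$. $L^2(\mathbb{R})$ carries the real scalar product $(u,v)=\Re\int_{\mathbb{R}}u\overline{v}\,dx$, and duals are real duals accordingly. The space $W(\mathbb{R})=\{u\in H^1(\mathbb{R}): |u|^2\mathrm{Log}|u|^2\in L^1(\mathbb{R})\}$. Define $A:[0,\infty)\to[0,\infty)$ by $A(s)=-s^2\mathrm{Log}(s^2)$ for $0\le s\le e^{-3}$ and $A(s)=3s^2+4e^{-3}s-e^{-6}$ for $s\ge e^{-3}$. Let $L^A(\mathbb{R})=\{u\in L^1_{loc}(\mathbb{R}): A(|u|)\in L^1(\mathbb{R})\}$ with the Luxemburg norm $\|u\|_{L^A}=\inf\{k>0:\int_{\mathbb{R}}A(k^{-1}|u(x)|)\,dx\le 1\}$. Then $W(\mathbb{R})=H^1(\mathbb{R})\cap L^A(\mathbb{R})$ as a set, and it is a reflexive Banach space with norm $\|u\|_{W(\mathbb{R})}=\|u\|_{H^1}+\|u\|_{L^A}$; $W'(\mathbb{R})$ denotes its dual, with $W(\mathbb{R})\hookrightarrow L^2(\mathbb{R})\hookrightarrow W'(\mathbb{R})$. The expression $\partial_x^2u+\gamma\delta(x)u+u\,\mathrm{Log}|u|^2$, for $u\in W(\mathbb{R})$, is the element of $W'(\mathbb{R})$ given by $h\mapsto -\Re\int u'\overline{h'}\,dx+\gamma\Re[u(0)\overline{h(0)}]+\Re\int u\,\mathrm{Log}|u|^2\,\overline{h}\,dx$.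 *)

(* Defs.v *)
From HB Require Import structures.
From mathcomp Require Import all_boot all_order all_algebra.
From mathcomp Require Import complex.
From mathcomp Require Import all_classical all_reals all_analysis.

Set Implicit Arguments.
Unset Strict Implicit.
Unset Printing Implicit Defensive.
Import Order.TTheory GRing.Theory Num.Theory.
Import numFieldNormedType.Exports.

Local Open Scope classical_set_scope.
Local Open Scope ring_scope.

(* Elements of L^2, H^1, W are represented by functions R -> R[i]; two
   representatives denote the same element when they are equal a.e. *)

Section ComplexFunctions.
Context {R : realType}.
Implicit Types (u v h w f : R -> R[i]).

Local Notation mu := (@lebesgue_measure R).

Definition cmod (z : R[i]) : R := complex.Re `|z|.

Definition ae_equal u v : Prop := {ae mu, forall x, u x = v x}.

Definition cmeasurable f : Prop :=
  measurable_fun setT (fun x : measurableTypeR R => complex.Re (f x)) /\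
  measurable_fun setT (fun x : measurableTypeR R => complex.Im (f x)).

Definition cintegral f : R[i] :=
  Complex (\int[mu]_x (complex.Re (f x)))%R (\int[mu]_x (complex.Im (f x)))%R.

Definition L2norm f : \bar R := Lnorm mu 2%:E (fun x => (cmod (f x))%:E).

Definition L2 : set (R -> R[i]) :=
  [set f | cmeasurable f /\ (L2norm f < +oo)%E].

Definition L2dot u v : R := complex.Re (cintegral (fun x => u x * (v x)^*%C)).

Definition test_function (phi : R -> R) : Prop :=
  (forall n x, derivable (derive1n n phi) x 1) /\
  compact (closure [set x | phi x != 0]).

Definition L2_weak_derivative u : set (R -> R[i]) :=
  [set v | L2 v /\ forall phi : R -> R, test_function phi ->
    cintegral (fun x => u x * (derive1 phi x)%:C%C) =
    - cintegral (fun x => v x * (phi x)%:C%C)].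

Definition H1 : set (R -> R[i]) :=
  [set u | L2 u /\ L2_weak_derivative u !=set0].

(* u', determined a.e. when u is in H^1 *)
Definition wderiv u : R -> R[i] := xget (fun=> 0) (L2_weak_derivative u).

Definition H1norm u : \bar R :=
  (((L2norm u) ^+ 2 + (L2norm (wderiv u)) ^+ 2) `^ (2^-1))%E.

(* Pointwise values of u in H^1(R) are those of its continuous
   representative, which is unique. *)
Definition crepr u : R -> R[i] :=
  xget u [set w | [/\ continuous (fun x => complex.Re (w x)),
                      continuous (fun x => complex.Im (w x)) &
                      ae_equal w u]].

(* |z|^2 Log |z|^2; it vanishes at z = 0 *)
Definition sqlog (z : R[i]) : R := cmod z ^+ 2 * ln (cmod z ^+ 2).

Definition W : set (R -> R[i]) :=
  [set u | H1 u /\ mu.-integrable setT (fun x => (sqlog (u x))%:E)].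

Definition orliczA (s : R) : R :=
  if s <= expR (- 3) then - (s ^+ 2 * ln (s ^+ 2))
  else 3 * s ^+ 2 + 4 * expR (- 3) * s - expR (- 6).

Definition LAnorm u : \bar R :=
  ereal_inf [set k%:E | k in [set k : R | 0 < k /\
    (\int[mu]_x (orliczA (k^-1 * cmod (u x)))%:E <= 1)%E]].

Definition Wnorm u : \bar R := (H1norm u + LAnorm u)%E.

(* The dual W'(R): maps whose restriction to W is real-linear and bounded;
   values outside W are irrelevant. *)
Definition dual_norm (l : (R -> R[i]) -> R) : \bar R :=
  ereal_sup [set `|l h|%:E | h in [set h | W h /\ (Wnorm h <= 1)%E]].

Definition Wdual : set ((R -> R[i]) -> R) :=
  [set l | (forall (a : R) h w, W h -> W w ->
              l (fun x => a%:C%C * h x + w x) = a * l h + l w) /\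
           (dual_norm l < +oo)%E].

(* Multiplication by i on W'(R), extending u |-> i u on L^2:
   (i u, h) = (u, - i h). *)
Definition dual_muli (l : (R -> R[i]) -> R) : (R -> R[i]) -> R :=
  fun h => l (fun x => - 'i%C * h x).

(* u'' + gamma delta u + u Log |u|^2 as an element of W'(R) *)
Definition log_rhs (gamma : R) u : (R -> R[i]) -> R := fun h =>
  - L2dot (wderiv u) (wderiv h)
  + gamma * complex.Re (crepr u 0 * (crepr h 0)^*%C)
  + L2dot (fun x => u x * (ln (cmod (u x) ^+ 2))%:C%C) h.

Definition energy (gamma : R) u : R :=
  2^-1 * fine (L2norm (wderiv u)) ^+ 2
  - gamma / 2 * cmod (crepr u 0) ^+ 2
  - 2^-1 * \int[mu]_x sqlog (u x).

End ComplexFunctions.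

Section Evolution.
Context {R : realType}.
Implicit Types (I J : set R) (u v : R -> R -> R[i]).

Definition continuous_W I u : Prop :=
  (forall t, I t -> W (u t)) /\
  (forall t, I t ->
     Wnorm (fun x => u s x - u t x) @[s --> t] --> (0 : \bar R)%E).

(* For open I: t |-> (u t, .) is C^1 from I to W'(R), with derivative du. *)
Definition C1_Wdual I u (du : R -> (R -> R[i]) -> R) : Prop :=
  [/\ forall t, I t -> Wdual (du t),
      forall t, I t ->
        dual_norm (fun h => (s - t)^-1 * (L2dot (u s) h - L2dot (u t) h)
                            - du t h) @[s --> t^'] --> (0 : \bar R)%E &
      forall t, I t ->
        dual_norm (fun h => du s h - du t h) @[s --> t] --> (0 : \bar R)%E].

Definition solution (gamma : R) (u0 : R -> R[i]) I u : Prop :=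
  [/\ open I, is_interval I, I 0, continuous_W I u & ae_equal (u 0) u0] /\
  exists2 du, C1_Wdual I u du &
    forall t, I t -> forall h, W h ->
      dual_muli (du t) h + log_rhs gamma (u t) h = 0.

Definition maximal_solution (gamma : R) (u0 : R -> R[i]) I u : Prop :=
  solution gamma u0 I u /\
  forall J v, solution gamma u0 J v -> I `<=` J ->
    (forall t, I t -> ae_equal (v t) (u t)) -> J = I.

End Evolution.

(* Main.v *)
Require Import Defs.
From HB Require Import structures.
From mathcomp Require Import all_boot all_order all_algebra.
From mathcomp Require Import complex.
From mathcomp Require Import all_classical all_reals all_analysis.
From mathcomp Require Import measurable_realfun.
From mathcomp Require Import ring lra.

(* The equation is the Hamiltonian flow on L^2 of the energy, the symplectic
   structure being multiplication by i. Adding a multiple of the charge and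
   truncating the logarithm where |u|^2 > e^m turns the energy into a nonnegative
   convex lower semicontinuous functional Phi on W. The truncated nonlinearity a
   satisfies the Cazenave-Haraux inequality
     |Re ((a(z) - a(w)) conj (i (z - w)))| <= 2 |z - w|^2,
   so the Hamiltonian flows of the Yosida regularizations of Phi, which are
   globally Lipschitz and conserve the charge and the Moreau envelope, are
   quasi-contractive uniformly in the regularization parameter and converge. The
   limit satisfies Phi(u(t)) <= Phi(u(0)), and reversibility gives equality.
   Conservation laws and coercivity of the energy bound u(t) in the sup norm
   independently of m, so for large m the truncation is inactive.
   Continuity in W: since Phi is convex and constant along the flow, its excess
   over the tangent at u(t) tends to 0, hence so does the H^1 norm of u(s) - u(t);
   the Brezis-Lieb splitting then yields convergence of the Orlicz part.
   Uniqueness follows from the Cazenave-Haraux inequality and Gronwall's lemma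
   applied to |u - v|^2. *)

Set Implicit Arguments.
Unset Strict Implicit.
Unset Printing Implicit Defensive.
Import Order.TTheory GRing.Theory Num.Theory.
Import numFieldNormedType.Exports.

Local Open Scope classical_set_scope.
Local Open Scope ring_scope.

(** * Semi-inner product spaces *)

(** Functions are never quotiented by a.e. equality, so the L^2 scalar product is only
    semi-definite. The abstract part is therefore written for semi-inner products, and equality of
    vectors is replaced by null distance. The obstacle is that z Log |z|^2 is not Lipschitz at 0
    while the linear part is unbounded, which rules out a direct contraction argument in L^2. The
    Cazenave-Haraux inequality controls only the component of the difference along i (z - w), but
    this is the component seen by the L^2 distance of two Hamiltonian flows. The truncation level is
    where convexity would be lost: s^2 (m + 3 - Log s^2) has derivative 2 s (m + 2 - Log s^2), which
    increases exactly as long as Log s^2 <= m; beyond, the derivative continues as 4 s. Nonlinear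
    terms are estimated through a function [be] that bounds increments of the truncated nonlinearity
    by the size of the difference alone; this yields the Gateaux derivative, the Brezis-Lieb
    splitting and the weak continuity of the potential. No weak compactness is invoked: derivative
    bounds pass to the limit by Riesz representation on test functions. *)

Record semi_inner (R : realType) (V : lmodType R) (dot : V -> V -> R) : Prop :=
  SemiInner {
    semi_innerC : forall x y, dot x y = dot y x;
    semi_innerDl : forall x y z, dot (x + y) z = dot x z + dot y z;
    semi_innerZl : forall a x y, dot (a *: x) y = a * dot x y;
    semi_inner_ge0 : forall x, 0 <= dot x x }.

Section SemiInner.
Context (R : realType) (V : lmodType R) (dot : V -> V -> R).

Definition nrm (x : V) : R := Num.sqrt (dot x x).

Definition seq_lim (u : nat -> V) (l : V) : Prop :=
  forall e, 0 < e -> exists N, forall n, (N <= n)%N -> nrm (u n - l) <= e.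

Definition seq_cauchy (u : nat -> V) : Prop :=
  forall e, 0 < e -> exists N, forall m n, (N <= m)%N -> (N <= n)%N ->
    nrm (u m - u n) <= e.

Definition seq_complete : Prop :=
  forall u, seq_cauchy u -> exists l, seq_lim u l.

Hypothesis H : semi_inner dot.

Lemma dotC x y : dot x y = dot y x. Proof. exact: semi_innerC H _ _. Qed.
Lemma dotDl x y z : dot (x + y) z = dot x z + dot y z.
Proof. exact: semi_innerDl H _ _ _. Qed.
Lemma dotZl a x y : dot (a *: x) y = a * dot x y.
Proof. exact: semi_innerZl H _ _ _. Qed.
Lemma dot_ge0 x : 0 <= dot x x. Proof. exact: semi_inner_ge0 H _. Qed.
Lemma dotDr x y z : dot z (x + y) = dot z x + dot z y.
Proof. by rewrite dotC dotDl !(dotC z). Qed.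
Lemma dotZr a x y : dot y (a *: x) = a * dot y x.
Proof. by rewrite dotC dotZl dotC. Qed.
Lemma dotNl x y : dot (- x) y = - dot x y.
Proof. by rewrite -scaleN1r dotZl mulN1r. Qed.
Lemma dotNr x y : dot y (- x) = - dot y x.
Proof. by rewrite dotC dotNl dotC. Qed.
Lemma dotBl x y z : dot (x - y) z = dot x z - dot y z.
Proof. by rewrite dotDl dotNl. Qed.
Lemma dotBr x y z : dot z (x - y) = dot z x - dot z y.
Proof. by rewrite dotDr dotNr. Qed.
Lemma dot0l x : dot 0 x = 0. Proof. by rewrite -(scale0r x) dotZl mul0r. Qed.
Lemma dot0r x : dot x 0 = 0. Proof. by rewrite dotC dot0l. Qed.
Definition dotE := (dotDl, dotDr, dotNl, dotNr, dotZl, dotZr, dot0l, dot0r).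

Lemma nrm_ge0 x : 0 <= nrm x. Proof. exact: sqrtr_ge0. Qed.
Lemma nrm_sqr x : nrm x ^+ 2 = dot x x.
Proof. by rewrite sqr_sqrtr ?dot_ge0. Qed.
Lemma nrm_le x c : 0 <= c -> dot x x <= c ^+ 2 -> nrm x <= c.
Proof. by move=> c0 h; rewrite -(ger0_norm c0) -sqrtr_sqr ler_wsqrtr. Qed.

Lemma nrm_dot0 x : nrm x = 0 -> dot x x = 0.
Proof. by rewrite -nrm_sqr => ->; rewrite expr0n. Qed.

Lemma CauchySchwarz x y : `|dot x y| <= nrm x * nrm y.
Proof.
have sq : dot x y ^+ 2 <= dot x x * dot y y.
  have := dot_ge0 (dot y y *: x - dot x y *: y).
  rewrite !dotE (dotC y x); set a := dot x x; set b := dot x y; set c := dot y y.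
  have -> : c * (c * a) - c * (b * b) - (b * (c * b) - b * (b * c))
     = c * (a * c - b ^+ 2) by ring.
  have := dot_ge0 y; rewrite -/c le_eqVlt => /orP[/eqP c0 _|c0]; last first.
    by rewrite pmulr_rge0// subr_ge0.
  rewrite -c0 mulr0; case: (eqVneq b 0) => [->|b0]; first by rewrite expr0n.
  (* As [dot y y = 0], the square is affine in the coefficient of [y]; this coefficient gives it the
     value -1. *)
  have := dot_ge0 ((- (a + 1) / (2 * b)) *: y + x).
  rewrite !dotE (dotC y x) -/a -/b -/c -c0.
  have -> : - (a + 1) / (2 * b) * (- (a + 1) / (2 * b) * 0) +
     - (a + 1) / (2 * b) * b + (- (a + 1) / (2 * b) * b + a) = - 1 by field.
  by rewrite lerNr oppr0 ler10.
rewrite -sqrtr_sqr -sqrtrM ?dot_ge0// ler_wsqrtr//.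
Qed.

Lemma dot_le x y : dot x y <= nrm x * nrm y.
Proof. exact: le_trans (ler_norm _) (CauchySchwarz _ _). Qed.

Lemma nrmD x y : nrm (x + y) <= nrm x + nrm y.
Proof.
apply: nrm_le; first by rewrite addr_ge0 ?nrm_ge0.
rewrite !dotE (dotC y x) sqrrD !nrm_sqr.
by have := dot_le x y; lra.
Qed.

Lemma nrmZ a x : nrm (a *: x) = `|a| * nrm x.
Proof. by rewrite /nrm !dotE mulrA -expr2 sqrtrM ?sqr_ge0// sqrtr_sqr. Qed.

Lemma nrmN x : nrm (- x) = nrm x.
Proof. by rewrite -scaleN1r nrmZ normrN1 mul1r. Qed.

Lemma nrm0 : nrm 0 = 0. Proof. by rewrite /nrm dot0l sqrtr0. Qed.

Lemma nrmC x y : nrm (x - y) = nrm (y - x). Proof. by rewrite -opprB nrmN. Qed.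

Lemma nrm_triangle y x z : nrm (x - z) <= nrm (x - y) + nrm (y - z).
Proof. by rewrite -(subrKA y) nrmD. Qed.

Lemma nrm_diff x y : `|nrm x - nrm y| <= nrm (x - y).
Proof.
have h a b : nrm a - nrm b <= nrm (a - b).
  by rewrite lerBlDr -{1}(subrK b a) nrmD.
by rewrite ler_norml h andbT lerNl opprB nrmC h.
Qed.

Lemma nrm_null_dot x y : nrm x = 0 -> dot x y = 0.
Proof.
by move=> x0; apply/normr0_eq0/eqP; rewrite -normr_le0 normr_id
  (le_trans (CauchySchwarz _ _))// x0 mul0r.
Qed.

Lemma seq_lim_dot u l y : seq_lim u l ->
  forall e, 0 < e -> exists N, forall n, (N <= n)%N ->
    `|dot (u n) y - dot l y| <= e.
Proof.
move=> ul e e0; have y0 : 0 < nrm y + 1 by rewrite ltr_wpDl ?nrm_ge0.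
have [N hN] := ul _ (divr_gt0 e0 y0); exists N => n /hN h.
rewrite -dotBl (le_trans (CauchySchwarz _ _))//.
rewrite (le_trans (ler_wpM2r (nrm_ge0 _) h))// mulrAC ler_pdivrMr//.
by rewrite ler_pM2l// lerDl.
Qed.

Lemma invSn_lt (e : R) : 0 < e -> exists N, forall n, (N <= n)%N ->
  (n.+1%:R^-1 : R) <= e.
Proof.
move=> e0; exists (Num.truncn e^-1) => n hn.
rewrite invf_ple ?posrE ?ltr0n//.
have /ltW/le_trans -> // := truncnS_gt e^-1.
by rewrite ler_nat ltnS.
Qed.

(* By the uniform convexity hypothesis minimizing sequences are Cauchy. *)
Lemma minimizing_seq (D : set V) (F : V -> R) (k b : R) :
  seq_complete -> 0 < k -> D !=set0 -> (forall x, D x -> b <= F x) ->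
  (forall x y, D x -> D y -> D (2^-1 *: (x + y)) /\
     F (2^-1 *: (x + y)) <= 2^-1 * (F x + F y) - k * dot (x - y) (x - y)) ->
  exists i l u, [/\ forall x, D x -> i <= F x,
     forall n, D (u n) /\ F (u n) <= i + n.+1%:R^-1 & seq_lim u l].
Proof.
move=> cV k0 [x0 Dx0] Fb Fmid.
pose A := [set F x | x in D].
have infA : has_inf A.
  split; first by exists (F x0); exists x0.
  by exists b => _ [x Dx <-]; exact: Fb.
have Ai x : D x -> inf A <= F x.
  by move=> Dx; apply: ge_inf; [case: infA|exists x].
have ex n : exists x, D x /\ F x <= inf A + n.+1%:R^-1.
  have n0 : 0 < (n.+1%:R^-1 : R) by rewrite invr_gt0 ltr0n.
  have [_ [x Dx <-] /ltW h] := inf_adherent n0 infA.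
  by exists x.
have [u hu] := choice ex.
have cu : seq_cauchy u.
  move=> e e0; have [N hN] := @invSn_lt (k * e ^+ 2) (mulr_gt0 k0 (exprn_gt0 _ e0)).
  exists N => m n Nm Nn.
  apply: nrm_le; first exact: ltW.
  have [Dm Fm] := hu m; have [Dn Fn] := hu n.
  have [Dmn Fmn] := Fmid _ _ Dm Dn.
  have := Ai _ Dmn; have := hN _ Nm; have := hN _ Nn.
  move: Fm Fn Fmn; move: (m.+1%:R^-1) (n.+1%:R^-1) => r1 r2 h1 h2 h3 h4 h5 h6.
  by rewrite -(ler_pM2l k0); lra.
have [l hl] := cV _ cu.
by exists (inf A), l, u.
Qed.

(** The functional |x|^2 / 2 - l x satisfies the parallelogram identity required by [minimizing_seq]
    with constant 1/8. [S] need not be closed, so the minimizing sequence may leave [S] in the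
    limit; that limit represents [l], and its norm bound comes from passing to the limit in
    [l (u n) <= C * nrm (u n)]. *)
Lemma riesz_closure (S : set V) (l : V -> R) (C : R) :
  seq_complete -> S 0 -> (forall a x y, S x -> S y -> S (a *: x + y)) ->
  (forall a x y, S x -> S y -> l (a *: x + y) = a * l x + l y) ->
  0 <= C -> (forall x, S x -> `|l x| <= C * nrm x) ->
  exists v, [/\ forall x, S x -> l x = dot v x, nrm v <= C &
    exists2 u, (forall n, S (u n)) & seq_lim u v].
Proof.
move=> cV S0 SD lD C0 lC.
have l0 : l 0 = 0.
  by apply/normr0_eq0/eqP; rewrite -normr_le0 normr_id (le_trans (lC _ S0))// nrm0 mulr0.
have SZ a x : S x -> S (a *: x) by move=> Sx; rewrite -[_ *: _]addr0; exact: SD.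
have lZ a x : S x -> l (a *: x) = a * l x.
  by move=> Sx; rewrite -[_ *: _]addr0 lD// l0 addr0.
have lA x y : S x -> S y -> l (x + y) = l x + l y.
  by move=> Sx Sy; rewrite -{1}(scale1r x) lD// mul1r.
have SA x y : S x -> S y -> S (x + y).
  by move=> Sx Sy; rewrite -(scale1r x); exact: SD.
pose F x := 2^-1 * dot x x - l x.
have [||x Sx|x y Sx Sy|i [v [u [iF uF uv]]]] :=
    @minimizing_seq S F (8^-1) (- (2^-1 * C ^+ 2)) cV.
- lra.
- by exists 0.
- have := lC _ Sx; rewrite /F -nrm_sqr ler_norml => /andP[_ h].
  by have : 0 <= (C - nrm x) ^+ 2 := sqr_ge0 _; rewrite sqrrB; lra.
- split; first exact/SZ/SA.
  rewrite /F lZ ?lA//; last exact: SA.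
  by rewrite !dotE (dotC y x); lra.
have key x : S x -> l x = dot v x.
  move=> Sx.
  have main s : 0 <= s * (dot v x - l x) + 2^-1 * s ^+ 2 * dot x x.
    apply/ler_addgt0Pl => e e0.
    have e2 : 0 < e / 2 by rewrite divr_gt0.
    have [N1 hN1] := invSn_lt e2.
    have e3 : 0 < e / 2 / (`|s| + 1) by rewrite divr_gt0// ltr_wpDl.
    have [N2 hN2] := seq_lim_dot x uv e3.
    pose n := maxn N1 N2.
    have [Su Fu] := uF n; have := hN1 n (leq_maxl _ _); have hd := hN2 n (leq_maxr _ _).
    have := iF (s *: x + u n) (SD _ _ _ Sx Su).
    move: Fu; rewrite /F lD// !dotE (dotC x (u n)).
    have : s * dot (u n) x <= s * dot v x + e / 2.
      rewrite -lerBlDl -mulrBr (le_trans (ler_norm _))// normrM.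
      rewrite (le_trans (ler_wpM2l (normr_ge0 _) hd))//.
      rewrite mulrA ler_pdivrMr ?ltr_wpDl// mulrC ler_pM2l// lerDl//.
    move: (n.+1%:R^-1) => r; lra.
  apply/eqP; rewrite eq_sym -subr_eq0; apply/eqP.
  set a := dot v x - l x in main *.
  (* Close to the minimizer of the quadratic in [s]; the [+ 1] covers a null vector [x]. *)
  have := main (- a / (dot x x + 1)).
  have d0 : 0 < dot x x + 1 by rewrite ltr_wpDl ?dot_ge0.
  have -> : - a / (dot x x + 1) * a + 2^-1 * (- a / (dot x x + 1)) ^+ 2 * dot x x
    = - (a ^+ 2 * ((2^-1 * dot x x + 1) / (dot x x + 1) ^+ 2)).
    by field; rewrite gt_eqF.
  rewrite oppr_ge0 pmulr_lle0; last first.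
    by rewrite divr_gt0 ?exprn_gt0// ltr_wpDl// mulr_ge0 ?dot_ge0// invr_ge0.
  by move=> h; apply/eqP; rewrite -(sqrf_eq0 a) eq_le h sqr_ge0.
exists v; split => //; last by exists u => // n; case: (uF n).
have [->|v0] := eqVneq (nrm v) 0; first by [].
have vp : 0 < nrm v by rewrite lt_def v0 nrm_ge0.
rewrite -(ler_pM2r vp) -expr2 nrm_sqr.
apply/ler_addgt0Pr => e e0.
have e1 : 0 < e / 2 by rewrite divr_gt0.
have e2 : 0 < e / 2 / (C + 1) by rewrite divr_gt0// ltr_wpDl.
have [N1 hN1] := seq_lim_dot v uv e1.
have [N2 hN2] := uv _ e2.
pose n := maxn N1 N2.
have [Su _] := uF n.
have := hN1 n (leq_maxl _ _); rewrite ler_norml => /andP[h _].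
have := lC _ Su; rewrite key// (dotC v) => /(le_trans (ler_norm _)) h2.
have h3 : C * nrm (u n) <= C * nrm v + e / 2.
  have : nrm (u n) <= nrm v + e / 2 / (C + 1).
    have := nrm_diff (u n) v; rewrite ler_norml => /andP[_].
    by have := hN2 n (leq_maxr _ _); lra.
  move=> /(ler_wpM2l C0) /le_trans -> //.
  rewrite mulrDr lerD2l mulrA ler_pdivrMr ?ltr_wpDl// mulrC ler_pM2l// lerDl//.
lra.
Qed.

Lemma riesz (S : set V) (l : V -> R) (C : R) :
  seq_complete -> S 0 -> (forall a x y, S x -> S y -> S (a *: x + y)) ->
  (forall a x y, S x -> S y -> l (a *: x + y) = a * l x + l y) ->
  0 <= C -> (forall x, S x -> `|l x| <= C * nrm x) ->
  exists v, (forall x, S x -> l x = dot v x) /\ nrm v <= C.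
Proof.
move=> cV S0 SD lD C0 lC; have [v [lv vC _]] := riesz_closure cV S0 SD lD C0 lC.
by exists v.
Qed.

(** The vector representing [dot x] on [S] is the projection of [x] on the closure of [S]; the
    difference is orthogonal to [S], hence null. *)
Lemma orthogonal_dense (S : set V) (x : V) :
  seq_complete -> S 0 -> (forall a x y, S x -> S y -> S (a *: x + y)) ->
  (forall z, (forall y, S y -> dot z y = 0) -> nrm z = 0) ->
  forall e, 0 < e -> exists2 y, S y & nrm (x - y) <= e.
Proof.
move=> cV S0 SD orth e e0.
have [|||v [lv _ [u Su uv]]] := @riesz_closure S (dot x) (nrm x) cV S0 SD.
- by move=> a y z _ _; rewrite !dotE.
- exact: nrm_ge0.
- by move=> y _; exact: CauchySchwarz.
have xv : nrm (x - v) = 0 by apply: orth => y Sy; rewrite dotBl lv// subrr.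
have [N /(_ N (leqnn _)) hN] := uv _ e0; exists (u N) => //.
by rewrite (le_trans (nrm_triangle v _ _))// xv add0r nrmC.
Qed.

End SemiInner.

(** * Calculus for real- and vector-valued curves *)

Section ScalarDerivative.
Context (R : realType).
Implicit Types (f g : R -> R).

(** An epsilon form, so that [vderiv] can have the same shape in a space that carries a seminorm but
    no topology. *)
Definition sderiv f (t d : R) : Prop :=
  forall e : R, 0 < e -> exists2 r : R, 0 < r & forall s, `|s - t| < r ->
    `|f s - f t - (s - t) * d| <= e * `|s - t|.

Definition scont f (t : R) : Prop :=
  forall e : R, 0 < e -> exists2 r : R, 0 < r & forall s, `|s - t| < r ->
    `|f s - f t| <= e.

Lemma scontP f t : scont f t <-> {for t, continuous f}.
Proof.
split=> [h|h].
  apply/cvgrPdist_le => e e0; have [r r0 hr] := h _ e0.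
  near=> s; rewrite distrC; apply: hr; rewrite distrC.
  near: s; exact: cvgr_dist_lt.
move=> e e0; move/cvgrPdist_le/(_ _ e0): h => /nbhs_ballP[r r0 hr].
by exists r => // s sr; rewrite distrC; apply: hr; rewrite /ball/= distrC.
Unshelve. all: by end_near.
Qed.

Lemma sderivP f t d : sderiv f t d <-> is_derive t 1 f d.
Proof.
have quot k h : h != 0 -> h^-1 *: ((f \o shift t) (h *: 1) - f t) - k =
    h^-1 * (f (h + t) - f t - h * k).
  move=> h0; rewrite /= -[h%:A]/(h * 1) mulr1 -[_ *: _]/(_ * _).
  by rewrite [in RHS]mulrBr mulKf.
split=> [hd|hd].
  have cv : h^-1 *: ((f \o shift t) (h *: 1) - f t) @[h --> 0^'] --> d.
    apply/cvgrPdist_le => e e0; have [r r0 hr] := hd _ e0.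
    near=> h; have h0 : h != 0 by near: h; exact: nbhs_dnbhs_neq.
    rewrite distrC quot// normrM normfV ler_pdivrMl ?normr_gt0// [leRHS]mulrC.
    have := hr (h + t); rewrite addrK; apply.
    near: h; apply: dnbhs0_lt => //.
  split; first exact: cvgP cv.
  exact: cvg_lim cv.
case: hd => /[swap] <- df e e0.
move/cvgrPdist_le/(_ _ e0): df; rewrite -/('D_1 f t) => /nbhs_ballP[r /= r0 hr].
exists r => // s sr; case: (eqVneq s t) => [->|st].
  by rewrite !subrr mul0r subr0 normr0 mulr0.
have h0 : s - t != 0 by rewrite subr_eq0.
have := hr (s - t); rewrite /ball/= sub0r normrN => /(_ sr h0).
rewrite distrC -[f (_ + t)]/((f \o shift t) _) quot// subrK normrM normfV.
by rewrite ler_pdivrMl ?normr_gt0// [leRHS]mulrC.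
Unshelve. all: by end_near.
Qed.

Lemma sderiv_cont f t d : sderiv f t d -> scont f t.
Proof.
move=> /sderivP df; apply/scontP/differentiable_continuous.
by apply/derivable1_diffP; exact: ex_derive.
Qed.

Lemma sderiv_mvt f df a b : a <= b ->
  (forall t, a <= t <= b -> sderiv f t (df t)) ->
  exists2 c, a <= c <= b & f b - f a = df c * (b - a).
Proof.
move=> ab hd; have [||c cab ->] := @MVT_segment _ f df a b ab.
- by move=> x; rewrite in_itv/= => /andP[ax xb]; apply/sderivP/hd; rewrite !ltW.
- apply: derivable_within_continuous => x; rewrite in_itv/= => xab.
  by have /sderivP[] := hd _ xab.
- by exists c => //; move: cab; rewrite in_itv.
Qed.

Lemma sderiv_nonincr f df a b : a <= b ->
  (forall t, a <= t <= b -> sderiv f t (df t)) ->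
  (forall t, a <= t <= b -> df t <= 0) -> f b <= f a.
Proof.
move=> ab hd h0; have [c /h0 c0 e] := sderiv_mvt ab hd.
by rewrite -subr_le0 e mulr_le0_ge0// subr_ge0.
Qed.

Lemma sderiv_refl f t d : sderiv f (- t) d -> sderiv (f \o -%R) t (- d).
Proof.
move=> h e e0; have [r r0 hr] := h _ e0; exists r => // s sr /=.
have e1 : - s - - t = - (s - t) by rewrite opprB addrC opprK.
have := hr (- s); rewrite e1 normrN => /(_ sr).
by rewrite mulNr mulrN.
Qed.

Lemma sderivD f g t d k : sderiv f t d -> sderiv g t k ->
  sderiv (fun s => f s + g s) t (d + k).
Proof. by move=> /sderivP df /sderivP dg; apply/sderivP; apply: is_derive_eq. Qed.

Lemma sderivN f t d : sderiv f t d -> sderiv (fun s => - f s) t (- d).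
Proof. by move=> /sderivP df; apply/sderivP; apply: is_derive_eq. Qed.

Lemma sderivB f g t d k : sderiv f t d -> sderiv g t k ->
  sderiv (fun s => f s - g s) t (d - k).
Proof. by move=> df dg; exact: sderivD df (sderivN dg). Qed.

Lemma sderivZ f t d c : sderiv f t d -> sderiv (fun s => c * f s) t (c * d).
Proof. by move=> /sderivP df; apply/sderivP; apply: is_derive_eq. Qed.

Lemma sderiv_cst (c t : R) : sderiv (fun=> c) t 0.
Proof. by apply/sderivP; apply: is_derive_eq. Qed.

(** The function e^(-a t) D(t) - b t is nonincreasing, since e^(-a t) <= 1. *)
Lemma gronwall (D dD : R -> R) (a b T : R) : 0 <= a -> 0 <= b -> 0 <= T ->
  (forall t, 0 <= t <= T -> sderiv D t (dD t)) ->
  (forall t, 0 <= t <= T -> dD t <= a * D t + b) ->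
  D T <= expR (a * T) * (D 0 + b * T).
Proof.
move=> a0 b0 T0 hd hle.
pose f t := expR (- a * t) * D t - b * t.
pose df t := expR (- a * t) * (dD t - a * D t) - b.
have h t : 0 <= t <= T -> sderiv f t (df t).
  move=> /hd /sderivP dt; apply/sderivP; rewrite /f /df.
  apply: is_derive_eq.
  by rewrite /GRing.scale/=; ring.
have : f T <= f 0.
  apply: (sderiv_nonincr T0 h) => t tT; rewrite /df.
  have e1 : expR (- a * t) <= 1.
    by rewrite -[leRHS]expR0 ler_expR mulNr oppr_le0 mulr_ge0//; case/andP: tT.
  rewrite subr_le0 (@le_trans _ _ (expR (- a * t) * b))//.
    by rewrite ler_wpM2l ?expR_ge0// lerBlDl; exact: hle.
  by rewrite ler_piMl.
rewrite /f !mulr0 expR0 mul1r subr0 lerBlDr => h1.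
have -> : D T = expR (a * T) * (expR (- a * T) * D T).
  by rewrite mulrA -expRD mulNr subrr expR0 mul1r.
by rewrite ler_wpM2l ?expR_ge0.
Qed.

Lemma gronwall_abs (D dD : R -> R) (a b T : R) : 0 <= a -> 0 <= b ->
  (forall t, `|t| <= `|T| -> sderiv D t (dD t)) ->
  (forall t, `|t| <= `|T| -> `|dD t| <= a * D t + b) ->
  D T <= expR (a * `|T|) * (D 0 + b * `|T|).
Proof.
move=> a0 b0 hd hle; have [T0|T0] := leP 0 T.
  rewrite (ger0_norm T0) in hd hle *.
  apply: (@gronwall D dD) => // t /andP[t0 tT].
    by apply: hd; rewrite ger0_norm.
  by rewrite (le_trans (ler_norm _))// hle// ger0_norm.
rewrite (ltr0_norm T0) in hd hle *.
have := @gronwall (D \o -%R) (fun t => - dD (- t)) a b (- T) a0 b0.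
rewrite oppr_ge0 (ltW T0) /= opprK oppr0; apply => // t /andP[t0 tT].
  by apply: sderiv_refl; apply: hd; rewrite normrN ger0_norm.
rewrite (le_trans (ler_norm _))// normrN hle// normrN ger0_norm//.
Qed.

Lemma sderiv_unique f g d T : f 0 = g 0 ->
  (forall t, `|t| <= `|T| -> sderiv f t (d t)) ->
  (forall t, `|t| <= `|T| -> sderiv g t (d t)) -> f T = g T.
Proof.
move=> fg0 hf hg; pose D t := (f t - g t) ^+ 2.
have h t : `|t| <= `|T| -> sderiv D t 0.
  move=> tT; have /sderivP df := hf _ tT; have /sderivP dg := hg _ tT.
  apply/sderivP; rewrite /D.
  apply: is_derive_eq.
  by rewrite subrr scaler0 addr0.
have := @gronwall_abs D (fun=> 0) 0 0 T (lexx _) (lexx _) h.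
rewrite !mul0r expR0 mul1r addr0 [D 0]/D fg0 subrr expr0n /= => hD.
apply/eqP; rewrite -subr_eq0 -sqrf_eq0 eq_le sqr_ge0 andbT.
by apply: hD => t _; rewrite normr0 mul0r add0r.
Qed.

Lemma sderiv_local f g t d r : 0 < r -> (forall s, `|s - t| < r -> f s = g s) ->
  sderiv g t d -> sderiv f t d.
Proof.
move=> r0 fg hg e e0; have [r' r'0 h] := hg _ e0.
exists (Num.min r r'); first by rewrite lt_min r0.
move=> s; rewrite lt_min => /andP[s1 s2].
by rewrite !fg ?subrr ?normr0//; exact: h.
Qed.

(** The fundamental theorem differentiates the integral from [a] to [t] only for [t > a]. The base
    point is therefore moved to the left of [t]; after subtracting the value at 0 the result does
    not depend on it, so near a given [t] it may be taken fixed. *)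
Lemma antiderivative f : (forall t, scont f t) ->
  exists F, F 0 = 0 /\ forall t, sderiv F t (f t).
Proof.
move=> cf; pose mu := @lebesgue_measure R.
have cf' : continuous f by move=> t; apply/scontP.
pose P a t := (\int[mu]_(x in `[a, t]) f x) - (\int[mu]_(x in `[a, 0%R]) f x).
have P0 a : P a 0 = 0 by rewrite /P subrr.
have dP a t : a < t -> sderiv (P a) t (f t).
  move=> at'; apply/sderivP.
  have itf : mu.-integrable `[a, (t + 1)] (EFin \o f).
    apply: continuous_compact_integrable; first exact: segment_compact.
    exact: continuous_subspaceT.
  have tt : t < t + 1 by rewrite ltrDl.
  have [d1 d2] := continuous_FTC1_closed tt itf at' (cf' t).
  have h : is_derive t 1 (fun x => \int[mu]_(x in `[a, x]) f x) (f t).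
    split; [exact: d1|by rewrite -derive1E].
  rewrite /P; apply: is_derive_eq; rewrite subr0//.
have PP a b t : a < - `|t| -> b < - `|t| -> P a t = P b t.
  move=> ha hb; apply: (@sderiv_unique _ _ f); first by rewrite !P0.
    by move=> s st; apply: dP; rewrite (lt_le_trans ha)// lerNl (le_trans _ st)// -normrN ler_norm.
  by move=> s st; apply: dP; rewrite (lt_le_trans hb)// lerNl (le_trans _ st)// -normrN ler_norm.
exists (fun t => P (- (`|t| + 1)) t); split; first by rewrite P0.
move=> t; apply: (@sderiv_local _ (P (- (`|t| + 2))) _ _ 1) => //.
  move=> s st; apply: PP; first by rewrite ltrN2 ltrDl.
  rewrite ltrN2; have := ler_normD (s - t) t; rewrite subrK; lra.
apply: dP; have := ler_norm (- t); rewrite normrN; lra.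
Qed.

End ScalarDerivative.

(** * Differentiation and integration of curves in a complete semi-inner product space *)

Section VectorCalculus.
Context (R : realType) (V : lmodType R) (dot : V -> V -> R).
Hypothesis H : semi_inner dot.
Hypothesis cV : seq_complete dot.
Local Notation nrm := (nrm dot).
Implicit Types (u w : R -> V).

Definition vderiv u (t : R) (d : V) : Prop :=
  forall e : R, 0 < e -> exists2 r : R, 0 < r & forall s, `|s - t| < r ->
    nrm (u s - u t - (s - t) *: d) <= e * `|s - t|.

Definition vcont u (t : R) : Prop :=
  forall e : R, 0 < e -> exists2 r : R, 0 < r & forall s, `|s - t| < r ->
    nrm (u s - u t) <= e.

Lemma vderiv_cont u t d : vderiv u t d -> vcont u t.
Proof.
move=> h e e0; have [r r0 hr] := h _ (ltr01 : 0 < 1 :> R).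
have d0 : 0 < 1 + nrm d by rewrite ltr_wpDr ?nrm_ge0.
exists (Num.min r (e / (1 + nrm d))); first by rewrite lt_min r0 divr_gt0.
move=> s; rewrite lt_min => /andP[/hr h1]; rewrite ltr_pdivlMr// => h2.
rewrite -(subrK ((s - t) *: d) (u s - u t)).
apply: le_trans (nrmD H _ _) _; rewrite (nrmZ H).
by move: h1 h2; rewrite mul1r mulrDr mulr1; lra.
Qed.

Lemma vderiv_refl u t d : vderiv u (- t) d -> vderiv (u \o -%R) t (- d).
Proof.
move=> h e e0; have [r r0 hr] := h _ e0; exists r => // s sr /=.
have e1 : - s - - t = - (s - t) by rewrite opprB addrC opprK.
have := hr (- s); rewrite e1 normrN => /(_ sr).
by rewrite scaleNr scalerN.
Qed.

Lemma vderiv_shift u t a d : vderiv u (t + a) d -> vderiv (fun s => u (s + a)) t d.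
Proof.
move=> h e e0; have [r r0 hr] := h _ e0; exists r => // s sr /=.
have e1 : s + a - (t + a) = s - t by rewrite opprD addrACA subrr addr0.
by have := hr (s + a); rewrite e1 => /(_ sr).
Qed.

Lemma subACA (M : zmodType) (x y z k : M) : x - y - (z - k) = x - z - (y - k).
Proof. by rewrite opprD addrACA -opprD. Qed.

Lemma vderivB u w t d k : vderiv u t d -> vderiv w t k ->
  vderiv (fun s => u s - w s) t (d - k).
Proof.
move=> hu hw e e0; have e2 : 0 < e / 2 by rewrite divr_gt0.
have [r r0 hr] := hu _ e2; have [r' r'0 hr'] := hw _ e2.
exists (Num.min r r'); first by rewrite lt_min r0.
move=> s; rewrite lt_min => /andP[/hr h1 /hr' h2].
have -> : u s - w s - (u t - w t) - (s - t) *: (d - k) =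
  (u s - u t - (s - t) *: d) - (w s - w t - (s - t) *: k).
  by rewrite (subACA (u s)) scalerBr (subACA (u s - u t)).
apply: le_trans (nrmD H _ _) _; rewrite (nrmN H); move: h1 h2; lra.
Qed.


Lemma vderiv_dot u w t d k : vderiv u t d -> vderiv w t k ->
  sderiv (fun s => dot (u s) (w s)) t (dot d (w t) + dot (u t) k).
Proof.
move=> hu hw e e0.
pose K := nrm (w t) + nrm (u t) + nrm d + 1.
have K1 : 1 <= K by rewrite lerDr !addr_ge0 ?nrm_ge0.
have K0 : 0 < K by exact: lt_le_trans K1.
have e3 : 0 < e / (4 * K) by rewrite divr_gt0// mulr_gt0.
have [r r0 hr] := hu _ e3; have [r' r'0 hr'] := hw _ e3.
have e4 : 0 < e / (4 * K) by [].
have [r2 r20 hr2] := vderiv_cont hw e4.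
have [r3 r30 hr3] := vderiv_cont hw ltr01.
exists (Num.min (Num.min r r') (Num.min r2 r3)); first by rewrite !lt_min r0 r'0 r20 r30.
move=> s; rewrite !lt_min => /andP[/andP[/hr h1 /hr' h2] /andP[/hr2 h3 /hr3 h4]].
set A := u s - u t - (s - t) *: d in h1.
set B := w s - w t - (s - t) *: k in h2.
set C := w s - w t in h3 h4.
have -> : dot (u s) (w s) - dot (u t) (w t) - (s - t) * (dot d (w t) + dot (u t) k)
  = dot A (w t) + dot A C + (s - t) * dot d C + dot (u t) B.
  rewrite /A /B /C !(dotE H); ring.
have AC : `|dot A C| <= e / (4 * K) * `|s - t|.
  apply: le_trans (CauchySchwarz H _ _) _.
  rewrite -[leRHS]mulr1 ler_pM ?nrm_ge0//.
have Aw : `|dot A (w t)| <= e / (4 * K) * `|s - t| * nrm (w t).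
  by apply: le_trans (CauchySchwarz H _ _) _; rewrite ler_wpM2r ?nrm_ge0.
have uB : `|dot (u t) B| <= e / (4 * K) * `|s - t| * nrm (u t).
  by apply: le_trans (CauchySchwarz H _ _) _; rewrite mulrC ler_wpM2r ?nrm_ge0.
have dC : `|(s - t) * dot d C| <= e / (4 * K) * `|s - t| * nrm d.
  rewrite normrM mulrC; apply: le_trans (ler_wpM2r (normr_ge0 _) (CauchySchwarz H _ _)) _.
  rewrite [leRHS]mulrAC ler_wpM2r// mulrC ler_wpM2r ?nrm_ge0//.
have eK : e / (4 * K) * K = e / 4 by field; rewrite gt_eqF.
have eq1 : e / (4 * K) * `|s - t| * (nrm (w t) + nrm (u t) + nrm d + 1)
  = e / 4 * `|s - t| by rewrite -/K mulrAC eK.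
apply: le_trans (ler_normD _ _) _; apply: le_trans (lerD (ler_normD _ _) (lexx _)) _.
apply: le_trans (lerD (lerD (ler_normD _ _) (lexx _)) (lexx _)) _.
have : 0 <= e * `|s - t| by rewrite mulr_ge0 ?(ltW e0).
move: Aw AC dC uB eq1; move: (_ / (4 * K) * _) => c; lra.
Qed.

Lemma vderiv_cst x t : vderiv (fun=> x) t 0.
Proof. by move=> e e0; exists 1 => // s _; rewrite subrr scaler0 subr0 (nrm0 H) mulr_ge0 ?(ltW e0). Qed.

Lemma vderiv_dotl u t d h : vderiv u t d -> sderiv (fun s => dot (u s) h) t (dot d h).
Proof.
by move=> /vderiv_dot /(_ (vderiv_cst h t)); rewrite (dot0r H) addr0.
Qed.

Lemma vderiv_nrm2 u t d : vderiv u t d ->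
  sderiv (fun s => dot (u s) (u s)) t (2 * dot (u t) d).
Proof.
by move=> hu; have := vderiv_dot hu hu; rewrite (dotC H d) -mulr2n mulr_natl.
Qed.

(** Pairing the curve with the fixed vector [u T - u 0] reduces the mean value inequality to a
    monotone scalar function. *)
Lemma vderiv_bound u d phi dphi T : 0 <= T ->
  (forall t, 0 <= t <= T -> vderiv u t (d t)) ->
  (forall t, 0 <= t <= T -> sderiv phi t (dphi t)) ->
  (forall t, 0 <= t <= T -> nrm (d t) <= dphi t) ->
  nrm (u T - u 0) <= phi T - phi 0.
Proof.
move=> T0 du dp dle; pose h := u T - u 0.
pose f t := dot (u t) h - nrm h * phi t.
have ff : f T <= f 0.
  apply: (@sderiv_nonincr _ f (fun t => dot (d t) h - nrm h * dphi t) 0 T T0).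
    move=> t tT.
    exact: sderivB (vderiv_dotl h (du _ tT)) (sderivZ _ (dp _ tT)).
  move=> t tT; rewrite subr_le0 (le_trans (dot_le H _ _))// mulrC.
  by rewrite ler_wpM2l ?nrm_ge0// dle.
have pp : phi 0 <= phi T.
  rewrite -lerN2.
  apply: (@sderiv_nonincr _ (fun t => - phi t) (fun t => - dphi t) 0 T T0).
    by move=> t tT; exact: sderivN (dp _ tT).
  by move=> t tT; rewrite oppr_le0 (le_trans (nrm_ge0 _ _) (dle _ tT)).
have [h0|h0] := eqVneq (nrm h) 0; first by rewrite -/h h0 subr_ge0.
have hp : 0 < nrm h by rewrite lt_def h0 nrm_ge0.
rewrite -/h -(ler_pM2l hp) -expr2 (nrm_sqr H) {1}/h (dotBl H).
move: ff; rewrite /f; lra.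
Qed.

Lemma vcont_dotl u t h : vcont u t -> scont (fun s => dot (u s) h) t.
Proof.
move=> hu e e0; have d0 : 0 < nrm h + 1 by rewrite ltr_wpDl ?nrm_ge0.
have [r r0 hr] := hu _ (divr_gt0 e0 d0); exists r => // s /hr hs.
rewrite -(dotBl H) (le_trans (CauchySchwarz H _ _))//.
rewrite (le_trans (ler_wpM2r (nrm_ge0 _ _) hs))// mulrAC ler_pdivrMr//.
by rewrite ler_pM2l// lerDl.
Qed.

Lemma vcont_nrm u t : vcont u t -> scont (fun s => nrm (u s)) t.
Proof.
move=> hu e e0; have [r r0 hr] := hu _ e0; exists r => // s /hr.
exact: le_trans (nrm_diff H _ _).
Qed.

Lemma vcont_bounded u T : (forall t, vcont u t) -> 0 <= T ->
  exists2 K, 0 <= K & forall t, `|t| <= T -> nrm (u t) <= K.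
Proof.
move=> hu T0; have cf : continuous (fun s => nrm (u s)).
  by move=> t; apply/scontP/vcont_nrm.
have TT : - T <= T by lra.
have [c _ hc] := EVT_max TT (continuous_subspaceT cf).
exists (nrm (u c)); first exact: nrm_ge0.
by move=> t tT; apply: hc; rewrite in_itv/= -ler_norml.
Qed.

(** A weak integral: for each [x] the scalar curve [dot (g t) x] has an antiderivative [F x], which
    is linear and bounded in [x], and Riesz representation turns [F] into a curve of vectors. *)
Lemma vantiderivative (g : R -> V) : (forall t, vcont g t) ->
  exists G, nrm (G 0) = 0 /\ forall t, vderiv G t (g t).
Proof.
move=> cg.
have exF h := antiderivative (fun t => vcont_dotl h (cg t)).
have [F hF] := choice exF.
have lin t a x y : F (a *: x + y) t = a * F x t + F y t.
  apply: (@sderiv_unique _ _ (fun t => a * F x t + F y t) (fun t => dot (g t) (a *: x + y))).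
  - by rewrite !(proj1 (hF _)) mulr0 addr0.
  - by move=> s _; have [_] := hF (a *: x + y); exact.
  - move=> s _; rewrite !(dotE H); have [_ d1] := hF x; have [_ d2] := hF y.
    exact: sderivD (sderivZ _ (d1 _)) (d2 _).
have inc s t K x : 0 <= K -> (forall r, `|r| <= Num.max `|s| `|t| -> nrm (g r) <= K) ->
    `|F x t - F x s| <= K * `|t - s| * nrm x.
  wlog st : s t / s <= t.
    move=> W; case: (leP s t) => [|/ltW] st; first exact: W.
    by move=> K0 h; rewrite distrC (distrC t); apply: W => // r; rewrite maxC; exact: h.
  move=> K0 h; have [_ dF] := hF x.
  have [c /andP[sc ct] ->] := sderiv_mvt st (fun t _ => dF t).
  rewrite normrM mulrAC ler_wpM2r// (le_trans (CauchySchwarz H _ _))//.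
  rewrite ler_wpM2r ?nrm_ge0// h// le_max !ler_norml.
  have := ler_norm t; have := ler_norm (- s); rewrite normrN => h1 h2.
  apply/orP; case: (leP 0 c) => c0; [right|left]; apply/andP; split; lra.
have exG t : exists v, (forall x, F x t = dot v x).
  have [K K0 hK] := vcont_bounded cg (normr_ge0 t).
  have [|||||v [hv _]] := @riesz _ _ _ H setT (fun x => F x t) (K * `|t|) cV => //.
  - by rewrite mulr_ge0.
  - move=> x _; have := @inc 0 t K x K0; rewrite (proj1 (hF x)) !subr0; apply.
    by move=> r; rewrite normr0 max_r//; exact: hK.
  - by exists v => x; exact: hv.
have [G hG] := choice exG.
exists G; split.
  by rewrite /nrm -hG (proj1 (hF _)) sqrtr0.
move=> t e e0; have [r r0 hr] := cg t _ e0.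
exists r => // s sr.
set A := G s - G t - (s - t) *: g t.
(* Testing the remainder against itself leaves a single scalar curve, [F A], to which the mean value
   theorem applies. *)
have AA : dot A A <= e * `|s - t| * nrm A.
  rewrite {1}/A !(dotBl H) (dotZl H) -!hG.
  have [_ dF] := hF A.
  have key a b : a <= b -> (forall c, a <= c <= b -> `|c - t| < r) ->
      `|F A b - F A a - (b - a) * dot (g t) A| <= e * `|b - a| * nrm A.
    move=> ab h; have [c /h cr ->] := sderiv_mvt ab (fun t _ => dF t).
    rewrite mulrC -mulrBr -(dotBl H) normrM mulrAC mulrC ler_wpM2r//.
    by rewrite (le_trans (CauchySchwarz H _ _))// ler_wpM2r ?nrm_ge0// hr.
  apply: le_trans (ler_norm _) _.
  case: (leP t s) => [ts|/ltW st].
    apply: key => // c /andP[tc cs]; apply: le_lt_trans sr.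
    by rewrite !ger0_norm ?subr_ge0// lerB.
  have := @key s t st; rewrite -normrN (distrC t) => h.
  have -> : F A s - F A t - (s - t) * dot (g t) A =
    - (F A t - F A s - (t - s) * dot (g t) A) by ring.
  apply: h => c /andP[sc ct]; apply: le_lt_trans sr.
  by rewrite !ler0_norm ?subr_le0// !opprB lerB.
have [A0|A0] := eqVneq (nrm A) 0; first by rewrite A0 mulr_ge0 ?(ltW e0).
have Ap : 0 < nrm A by rewrite lt_def A0 nrm_ge0.
by rewrite -(ler_pM2r Ap) -expr2 (nrm_sqr H).
Qed.

End VectorCalculus.

(** * Global solutions of Lipschitz differential equations *)

Section LipschitzODE.
Context (R : realType) (V : lmodType R) (dot : V -> V -> R).
Hypothesis H : semi_inner dot.
Hypothesis cV : seq_complete dot.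
Local Notation nrm := (nrm dot).
Local Notation vderiv := (vderiv dot).
Local Notation vcont := (vcont dot).

Lemma vderiv_null u t d k : vderiv u t d -> nrm (d - k) = 0 -> vderiv u t k.
Proof.
move=> hu dk e e0; have [r r0 hr] := hu _ e0; exists r => // s /hr h.
rewrite -(subrKA ((s - t) *: d)) (le_trans (nrmD H _ _))// -scalerBr (nrmZ H) dk.
by rewrite mulr0 addr0.
Qed.

Lemma vderiv_bound_abs u d phi dphi T :
  (forall t, `|t| <= `|T| -> vderiv u t (d t)) ->
  (forall t, 0 <= t <= `|T| -> sderiv phi t (dphi t)) ->
  (forall t, `|t| <= `|T| -> nrm (d t) <= dphi `|t|) ->
  nrm (u T - u 0) <= phi `|T| - phi 0.
Proof.
case: (leP 0 T) => T0.
  rewrite (ger0_norm T0) => hu hp hd.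
  apply: (@vderiv_bound _ _ _ H u d phi dphi) => // t /andP[t0 tT].
    by apply: hu; rewrite ger0_norm.
  by have := hd t; rewrite ger0_norm//; exact.
rewrite (ltr0_norm T0) => hu hp hd.
have := @vderiv_bound _ _ _ H (u \o -%R) (fun t => - d (- t)) phi dphi (- T).
rewrite /= oppr_ge0 (ltW T0) opprK oppr0; apply => // t /andP[t0 tT].
  by apply: vderiv_refl; apply: hu; rewrite normrN ger0_norm.
by rewrite (nrmN H); have := hd (- t); rewrite normrN ger0_norm//; exact.
Qed.

Lemma ler_expR_id (x : R) : x <= expR x.
Proof. by have := expR_ge1Dx x; lra. Qed.

Lemma geometric_tail (e : R) : 0 < e -> exists N, forall n, (N <= n)%N ->
  (2^-1 : R) ^+ n <= e.
Proof.
move=> e0; have [N hN] := invSn_lt e0; exists N => n /hN; apply: le_trans.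
rewrite exprVn lef_pV2 ?posrE ?exprn_gt0 ?ltr0n// -natrX ler_nat.
exact: ltn_expl.
Qed.

(** Picard iteration measured with the weight e^(2 L |t|): each step contracts by 1/2 on the whole
    line, so no local solutions have to be glued. *)
Lemma lipschitz_ode (G : V -> V) (L : R) (x0 : V) : 0 < L ->
  (forall x y, nrm (G x - G y) <= L * nrm (x - y)) ->
  exists u, nrm (u 0 - x0) = 0 /\ forall t, vderiv u t (G (u t)).
Proof.
move=> L0 GL.
have Gc u t : vcont u t -> vcont (G \o u) t.
  move=> hu e e0; have [r r0 hr] := hu _ (divr_gt0 e0 L0); exists r => // s /hr h.
  by rewrite (le_trans (GL _ _))// mulrC -ler_pdivlMr.
(* One Picard step; the value at a discontinuous [u] is arbitrary. *)
have exS u : exists w, (forall t, vcont u t) ->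
    nrm (w 0 - x0) = 0 /\ forall t, vderiv w t (G (u t)).
  case: (pselect (forall t, vcont u t)) => hu; last by exists u.
  have [A [A0 dA]] := vantiderivative H cV (fun t => Gc _ _ (hu t)).
  exists (fun t => A t + x0) => _; split; first by rewrite addrK.
  move=> t e e0; have [r r0 hr] := dA t _ e0; exists r => // s /hr.
  by rewrite opprD addrACA subrr addr0.
have [S hS] := choice exS.
pose U k := iter k S (fun=> x0).
have Uc k t : vcont (U k) t.
  elim: k t => [|k IH] t; first exact: vderiv_cont (vderiv_cst H x0 t).
  by have [_ h] := hS _ IH; exact: vderiv_cont (h t).
have U0 k : nrm (U k.+1 0 - x0) = 0 by have [] := hS _ (Uc k).
have dU k t : vderiv (U k.+1) t (G (U k t)) by have [] := hS _ (Uc k).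
have dphi c t : sderiv (fun t => c * expR (2 * L * t)) t (c * (2 * L) * expR (2 * L * t)).
  apply/sderivP; apply: is_derive_eq; rewrite /GRing.scale/=; ring.
(* Integrating L c e^(2 L s) from 0 to |t| gives at most half of c e^(2 L |t|). *)
have gain (w1 w2 : R -> V) d1 d2 c T : 0 <= c -> nrm (w1 0 - x0) = 0 -> nrm (w2 0 - x0) = 0 ->
    (forall t, vderiv w1 t (d1 t)) -> (forall t, vderiv w2 t (d2 t)) ->
    (forall t, nrm (d1 t - d2 t) <= L * (c * expR (2 * L * `|t|))) ->
    nrm (w1 T - w2 T) <= 2^-1 * c * expR (2 * L * `|T|).
  move=> c0 h1 h2 dw1 dw2 hd.
  have w0 : nrm (w1 0 - w2 0) = 0.
    apply/eqP; rewrite eq_le nrm_ge0 andbT (le_trans (nrm_triangle H x0 _ _))//.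
    by rewrite h1 (nrmC H) h2 addr0.
  have := @vderiv_bound_abs (fun t => w1 t - w2 t) (fun t => d1 t - d2 t)
    (fun t => 2^-1 * c * expR (2 * L * t)) _ T (fun t _ => vderivB H (dw1 t) (dw2 t))
    (fun t _ => dphi _ t).
  have hh : forall t, `|t| <= `|T| ->
      nrm (d1 t - d2 t) <= 2^-1 * c * (2 * L) * expR (2 * L * `|t|).
    move=> t _; apply: le_trans (hd t) _.
    by rewrite le_eqVlt; apply/orP; left; apply/eqP; field.
  move=> /(_ hh); rewrite -{1}(subrK (w1 0 - w2 0) (w1 T - w2 T)) => h.
  have := nrmD H (w1 T - w2 T - (w1 0 - w2 0)) (w1 0 - w2 0).
  rewrite subrK w0 addr0 => /le_trans; apply; rewrite subrK in h.
  apply: le_trans h _; rewrite gerBl mulr_ge0 ?expR_ge0// mulr_ge0// invr_ge0.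
pose B := nrm (G x0) / (2 * L).
have B0 : 0 <= B by rewrite divr_ge0 ?nrm_ge0// mulr_ge0 ?(ltW L0).
have step k t : nrm (U k.+1 t - U k t) <= B * 2^-1 ^+ k * expR (2 * L * `|t|).
  elim: k t => [|k IH] t.
    rewrite expr0 mulr1.
    have := @vderiv_bound_abs (U 1) (fun=> G x0) (fun t => nrm (G x0) * t) (fun=> nrm (G x0)) t
      (fun t _ => dU 0 t) _ (fun t _ => lexx _).
    have hd : forall t0 : R, 0 <= t0 <= `|t| -> sderiv (fun t1 : R => nrm (G x0) * t1) t0 (nrm (G x0)).
      move=> s _; apply/sderivP; apply: is_derive_eq; rewrite /GRing.scale/=; ring.
    move=> /(_ hd); rewrite mulr0 subr0 => h.
    have := nrm_triangle H (U 1 0) (U 1 t) x0; rewrite U0 addr0 => /le_trans; apply.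
    apply: le_trans h _; rewrite /B mulrAC ler_pdivlMr ?mulr_gt0// -[leLHS]mulrA.
    by rewrite ler_wpM2l ?nrm_ge0// mulrC ler_expR_id.
  have := @gain (U k.+2) (U k.+1) (fun t => G (U k.+1 t)) (fun t => G (U k t))
     (B * 2^-1 ^+ k) t _ (U0 _) (U0 _) (dU _) (dU _).
  have bk : 0 <= B * 2^-1 ^+ k by rewrite mulr_ge0// exprn_ge0// invr_ge0.
  move=> /(_ bk) h; rewrite exprS mulrCA; apply: h => s.
  by rewrite (le_trans (GL _ _))// ler_wpM2l ?(ltW L0).
clearbody B.
have tele n m t : (n <= m)%N ->
    nrm (U m t - U n t) <= 2 * B * (2^-1 ^+ n - 2^-1 ^+ m) * expR (2 * L * `|t|).
  elim: m => [|m IH]; first by rewrite leqn0 => /eqP ->; rewrite !subrr mulr0 mul0r (nrm0 H).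
  rewrite leq_eqVlt => /orP[/eqP ->|]; first by rewrite !subrr mulr0 mul0r (nrm0 H).
  rewrite ltnS => /IH h; apply: le_trans (nrm_triangle H (U m t) _ _) _.
  apply: le_trans (lerD (step m t) h) _.
  by rewrite le_eqVlt; apply/orP; left; apply/eqP; rewrite exprS; field.
have tail n m t : (n <= m)%N ->
    nrm (U m t - U n t) <= 2 * B * 2^-1 ^+ n * expR (2 * L * `|t|).
  move=> nm; apply: le_trans (tele _ _ _ nm) _.
  have h : 2^-1 ^+ n - 2^-1 ^+ m <= 2^-1 ^+ n :> R by rewrite gerBl exprn_ge0// invr_ge0.
  apply: ler_wpM2r; first exact: expR_ge0.
  by apply: ler_wpM2l => //; rewrite mulr_ge0.
have small (c : R) : 0 <= c -> forall e : R, 0 < e -> exists N, forall n, (N <= n)%N -> c * 2^-1 ^+ n <= e.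
  move=> c0 e e0; have d0 : 0 < c + 1 by rewrite ltr_wpDl.
  have [N hN] := geometric_tail (divr_gt0 e0 d0); exists N => n /hN h.
  rewrite (le_trans (ler_wpM2l c0 h))// mulrA ler_pdivrMr// mulrC ler_pM2l// lerDl//.
have exu t : exists l, seq_lim dot (fun n => U n t) l.
  apply: cV => e e0.
  have c0 : 0 <= 2 * B * expR (2 * L * `|t|) by rewrite !mulr_ge0 ?expR_ge0.
  have [N hN] := small _ c0 _ e0; exists N => m n Nm Nn.
  wlog mn : m n Nm Nn / (n <= m)%N.
    by move=> W; case/orP: (leq_total n m) => h; [exact: W|rewrite (nrmC H); exact: W].
  by apply: le_trans (tail _ _ _ mn) _; rewrite mulrAC hN.
have [u hu] := choice exu.
have Uu n t : nrm (U n t - u t) <= 2 * B * 2^-1 ^+ n * expR (2 * L * `|t|).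
  rewrite (nrmC H).
  apply/ler_addgt0Pr => e e0; have [N hN] := hu t _ e0.
  have := hN (maxn N n) (leq_maxl _ _); have := tail _ _ t (leq_maxr N n).
  have := nrm_triangle H (U (maxn N n) t) (u t) (U n t); rewrite (nrmC H (u t) (U (maxn N n) t)); lra.
have uc t : vcont u t.
  move=> e e0; have e3 : 0 < e / 3 by rewrite divr_gt0.
  have c0 : 0 <= 2 * B * expR (2 * L * (`|t| + 1)) by rewrite !mulr_ge0 ?expR_ge0.
  have [N /(_ _ (leqnn N)) hN] := small _ c0 _ e3.
  have [r r0 hr] := Uc N t _ e3.
  exists (Num.min r 1); first by rewrite lt_min r0/=.
  move=> s; rewrite lt_min => /andP[/hr h1 h2].
  have bnd x : `|x| <= `|t| + 1 -> nrm (U N x - u x) <= e / 3.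
    move=> xt; apply: le_trans (Uu N x) _; apply: le_trans hN; rewrite mulrAC.
    rewrite ler_wpM2r ?exprn_ge0 ?invr_ge0// ler_wpM2l ?mulr_ge0//.
    by rewrite ler_expR ler_wpM2l// mulr_ge0 ?(ltW L0).
  have hs : `|s| <= `|t| + 1 by have := ler_normD (s - t) t; rewrite subrK; lra.
  have ht : `|t| <= `|t| + 1 by rewrite lerDl.
  have := bnd _ hs; have := bnd _ ht; rewrite (nrmC H (U N s) (u s)).
  have := nrm_triangle H (U N s) (u s) (u t).
  have := nrm_triangle H (U N t) (U N s) (u t); lra.
have [w0 dw] := hS _ uc.
have wu t : nrm (S u t - u t) = 0.
  apply/eqP; rewrite eq_le nrm_ge0 andbT; apply/ler_addgt0Pr => e e0.
  have e2 : 0 < e / 2 by rewrite divr_gt0.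
  have c0 : 0 <= 2 * B * expR (2 * L * `|t|) by rewrite !mulr_ge0 ?expR_ge0.
  have [N /(_ _ (leqnn N)) hN] := small _ c0 _ e2.
  have cN : 0 <= 2 * B * 2^-1 ^+ N by rewrite !mulr_ge0// exprn_ge0// invr_ge0.
  have := @gain (S u) (U N.+1) (fun t => G (u t)) (fun t => G (U N t)) _ t cN w0 (U0 _) dw (dU _).
  have hh : forall t0 : R,
      nrm (G (u t0) - G (U N t0)) <= L * (2 * B * 2^-1 ^+ N * expR (2 * L * `|t0|)).
    by move=> s; rewrite (le_trans (GL _ _))// ler_wpM2l ?(ltW L0)// (nrmC H) Uu.
  move=> /(_ hh) h1; have h2 := Uu N.+1 t.
  have := nrm_triangle H (U N.+1 t) (S u t) (u t).
  move: h1 h2 hN; rewrite exprS add0r.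
  set E := expR _; set q := 2^-1 ^+ N => h1 h2 hN; lra.
(* The pointwise limit [u] is known only up to null vectors; [S u] is at null distance from it and
   is differentiable by construction. *)
exists (S u); split => // t; apply: (@vderiv_null _ _ (G (u t))) => //.
apply/eqP; rewrite eq_le nrm_ge0 andbT (le_trans (GL _ _))//.
by rewrite (nrmC H) wu mulr0.
Qed.

End LipschitzODE.

(** * Hamiltonian flows of convex functionals *)

Section HamiltonianFlow.
Context (R : realType) (V : lmodType R) (dot : V -> V -> R).
Hypothesis H : semi_inner dot.
Hypothesis cV : seq_complete dot.
Local Notation nrm := (nrm dot).
Local Notation vderiv := (vderiv dot).
Local Notation vcont := (vcont dot).

(* [B x h] is the derivative of [Phi] at [x] in the direction [h]; the equation
   is [u' = - J (grad Phi u - kappa u)] in the sense of [hamiltonian_flow]. The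
   commutator bound [ham_acc] is what makes its flow quasi-contractive. *)
Record hamiltonian (J : V -> V) (D : set V) (Phi : V -> R) (B : V -> V -> R)
    (C : R) : Prop := Hamiltonian {
  ham_skew : forall x y, dot (J x) y = - dot x (J y);
  ham_isom : forall x y, dot (J x) (J y) = dot x y;
  ham_lin : forall a x y, D x -> D y -> D (a *: x + y);
  ham_J : forall x, D x -> D (J x);
  ham_ge0 : forall x, D x -> 0 <= Phi x;
  ham_odd : forall x h, D x -> D h -> B x (- h) = - B x h;
  ham_tangent : forall x y, D x -> D y -> Phi x + B x (y - x) <= Phi y;
  ham_gateaux : forall x h e, D x -> D h -> 0 < e ->
    exists2 r, 0 < r & forall s, 0 < s -> s <= r ->
      Phi (x + s *: h) <= Phi x + s * B x h + s * e;
  ham_lsc : forall u x c, (forall n, D (u n) /\ Phi (u n) <= c) ->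
    seq_lim dot u x -> D x /\ Phi x <= c;
  ham_acc0 : 0 <= C;
  ham_acc : forall x y, D x -> D y ->
    `|B x (J (x - y)) - B y (J (x - y))| <= C * dot (x - y) (x - y);
  ham_gauge : forall x, D x -> B x (J x) = 0;
  ham_weak : forall x h c e, D x -> D h -> 0 < e ->
    exists2 r, 0 < r & forall y, D y -> Phi y <= c -> nrm (y - x) <= r ->
      `|B y h - B x h| <= e }.

Variables (J : V -> V) (D : set V) (Phi : V -> R) (B : V -> V -> R) (C kappa : R).
Hypothesis X : hamiltonian J D Phi B C.

Let skew := ham_skew X.
Let Jdot x y : dot x (J y) = - dot (J x) y.
Proof. by rewrite skew opprK. Qed.
Let Jxx x : dot (J x) x = 0.
Proof. by have := skew x x; rewrite (dotC H x); lra. Qed.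
Let DB x y : D x -> D y -> D (x - y).
Proof. by move=> Dx Dy; rewrite addrC -scaleN1r; exact: (ham_lin X). Qed.
Let DD x y : D x -> D y -> D (x + y).
Proof. by move=> Dx Dy; rewrite -(scale1r x); exact: (ham_lin X). Qed.
Let D0 x : D x -> D 0.
Proof. by move=> Dx; rewrite -(subrr x); exact: DB. Qed.
Let DZ a x : D x -> D (a *: x).
Proof. by move=> Dx; rewrite -[_ *: _]addr0; apply: (ham_lin X) => //; exact: D0 Dx. Qed.

Lemma ham_mono x y : D x -> D y -> 0 <= B x (x - y) - B y (x - y).
Proof.
move=> Dx Dy; have := ham_tangent X Dx Dy; have := ham_tangent X Dy Dx.
by rewrite -(opprB x y) (ham_odd X)//; [lra|exact: DB].
Qed.

(** The tangent inequality at the midpoint is used in two opposite directions, whose linear terms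
    cancel by [ham_odd]. *)
Lemma ham_midpoint x y : D x -> D y -> D (2^-1 *: (x + y)) /\
  Phi (2^-1 *: (x + y)) <= 2^-1 * (Phi x + Phi y).
Proof.
move=> Dx Dy; set m := 2^-1 *: (x + y).
have Dm : D m by apply/DZ/DD.
split => //; have h1 := ham_tangent X Dm Dx; have h2 := ham_tangent X Dm Dy.
have e : y - m = - (x - m).
  apply/eqP; rewrite -subr_eq0 opprK addrACA -opprD -(addrC x).
  by rewrite /m -scalerDl (_ : 2^-1 + 2^-1 = 1) ?scale1r ?subrr//; lra.
rewrite e (ham_odd X) in h2 => //; [|exact: DB].
lra.
Qed.

(** The quadratic term makes the functional uniformly convex, so minimizing sequences converge
    strongly; the minimum is attained by [ham_lsc]. *)
Lemma prox_exists x0 lam u : D x0 -> 0 < lam -> exists v, D v /\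
  forall w, D w -> Phi v + dot (u - v) (u - v) / (2 * lam) <=
                   Phi w + dot (u - w) (u - w) / (2 * lam).
Proof.
move=> Dx0 l0; have l2 : 0 < (2 * lam)^-1 by rewrite invr_gt0 mulr_gt0.
pose F v := Phi v + dot (u - v) (u - v) / (2 * lam).
have [||w Dw|x y Dx Dy|i [v [un [iF uF uv]]]] :=
    @minimizing_seq _ _ dot D F (4^-1 / (2 * lam)) 0 cV.
- by rewrite mulr_gt0.
- by exists x0.
- by rewrite /F addr_ge0 ?(ham_ge0 X)// mulr_ge0 ?(dot_ge0 H)// ltW.
- have [Dm Pm] := ham_midpoint Dx Dy; split => //.
  rewrite /F.
  have -> : dot (u - 2^-1 *: (x + y)) (u - 2^-1 *: (x + y)) =
    2^-1 * (dot (u - x) (u - x) + dot (u - y) (u - y)) - 4^-1 * dot (x - y) (x - y).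
    by rewrite !(dotE H) (dotC H y x) (dotC H y u) (dotC H x u); lra.
  lra.
exists v.
have key (e : R) : 0 < e -> D v /\ Phi v <= i - dot (u - v) (u - v) / (2 * lam) + e.
  move=> e0; have e2 : 0 < e / 2 by rewrite divr_gt0.
  have [N1 hN1] := invSn_lt e2.
  pose K := nrm (u - v) + 1.
  have K0 : 0 < K by rewrite /K ltr_wpDl ?nrm_ge0.
  have e3 : 0 < e / 2 * lam / K by rewrite divr_gt0// mulr_gt0.
  have [N2 hN2] := uv _ e3.
  (* [ham_lsc] asks for a bound at every index, so the sequence is cut off where both estimates
     hold. *)
  apply: (ham_lsc X (u := fun n => un (maxn (maxn N1 N2) n))).
    move=> n; set k := maxn _ _; have [Duk] := uF k.
    have k1 : (N1 <= k)%N by rewrite !leq_max leqnn.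
    have k2 : (N2 <= k)%N by rewrite !leq_max leqnn orbT.
    have := hN1 k k1; have h2 := hN2 k k2.
    rewrite /F; move: (k.+1%:R^-1) => r hr hF; split => //.
    have : dot (u - v) (u - v) - e * lam <= dot (u - un k) (u - un k).
      have -> : dot (u - un k) (u - un k) = dot (u - v) (u - v) -
          2 * dot (u - v) (un k - v) + dot (un k - v) (un k - v).
        rewrite !(dotE H) (dotC H v u) (dotC H (un k) u) (dotC H (un k) v); ring.
      have : 2 * dot (u - v) (un k - v) <= e * lam.
        have := dot_le H (u - v) (un k - v).
        have : nrm (u - v) * nrm (un k - v) <= e / 2 * lam.
          apply: le_trans (ler_wpM2l (nrm_ge0 _ _) h2) _.
          rewrite mulrA ler_pdivrMr// mulrC ler_pM2l ?mulr_gt0//.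
          by rewrite /K lerDl.
        lra.
      have := dot_ge0 H (un k - v); lra.
    rewrite -(ler_pM2r l2) mulrBl.
    have -> : e * lam / (2 * lam) = e / 2 by field; rewrite gt_eqF.
    lra.
  move=> r r0; have [N hN] := uv _ r0; exists N => n Nn.
  by apply: hN; rewrite (leq_trans Nn)// leq_maxr.
split; first by have [] := key 1 ltr01.
move=> w Dw; apply: le_trans (iF _ Dw).
apply/ler_addgt0Pr => e /key[_]; lra.
Qed.

(** The Gateaux bound is one-sided, so minimality gives only an inequality in each direction; the
    direction [- h] supplies the converse. *)
Lemma prox_euler lam u v h : 0 < lam -> D v -> D h ->
  (forall w, D w -> Phi v + dot (u - v) (u - v) / (2 * lam) <=
                   Phi w + dot (u - w) (u - w) / (2 * lam)) ->
  dot (lam^-1 *: (u - v)) h = B v h.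
Proof.
move=> l0 Dv Dh vmin.
have main k : D k -> dot (lam^-1 *: (u - v)) k <= B v k.
  move=> Dk; apply/ler_addgt0Pr => e e0; have e2 : 0 < e / 2 by rewrite divr_gt0.
  have [r r0 hr] := ham_gateaux X Dv Dk e2.
  pose s := Num.min r (e * lam / (dot k k + 1)).
  have d0 : 0 < dot k k + 1 by rewrite ltr_wpDl ?(dot_ge0 H).
  have s0 : 0 < s by rewrite lt_min r0 divr_gt0 ?mulr_gt0.
  have sr : s <= r by rewrite ge_min lexx.
  have sk : s * dot k k <= e * lam.
    have : s * (dot k k + 1) <= e * lam by rewrite -ler_pdivlMr// ge_min lexx orbT.
    lra.
  have := hr s s0 sr; have := vmin (v + s *: k) (DD Dv (DZ s Dk)).
  have -> : dot (u - (v + s *: k)) (u - (v + s *: k)) =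
    dot (u - v) (u - v) - 2 * s * dot (u - v) k + s * (s * dot k k).
    rewrite !(dotE H) (dotC H v u) (dotC H k u) (dotC H k v); ring.
  rewrite (dotZl H) => h1 h2.
  rewrite -(ler_pM2l s0).
  have h3 : s * (s * dot k k) / (2 * lam) <= s * (e / 2).
    rewrite ler_pdivrMr ?mulr_gt0// -mulrA ler_pM2l//.
    have -> : e / 2 * (2 * lam) = e * lam by field.
    done.
  have h4 : 2 * s * dot (u - v) k / (2 * lam) = s * (lam^-1 * dot (u - v) k).
    by field; rewrite gt_eqF.
  have h5 : (dot (u - v) (u - v) - 2 * s * dot (u - v) k + s * (s * dot k k)) / (2 * lam)
    = dot (u - v) (u - v) / (2 * lam) - s * (lam^-1 * dot (u - v) k)
      + s * (s * dot k k) / (2 * lam) by rewrite -h4; ring.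
  move: h1; rewrite h5; lra.
apply: le_anti; rewrite main//=.
have := main (- h); rewrite -scaleN1r => /(_ (DZ _ Dh)).
by rewrite scaleN1r (dotNr H) (ham_odd X)// lerN2.
Qed.

Variable x0 : V.
Hypothesis Dx0 : D x0.

Let exP (lu : R * V) : exists v, 0 < lu.1 -> D v /\
  forall w, D w -> Phi v + dot (lu.2 - v) (lu.2 - v) / (2 * lu.1) <=
                   Phi w + dot (lu.2 - w) (lu.2 - w) / (2 * lu.1).
Proof.
case: (ltP 0 lu.1) => l0; last by exists 0.
by have [v hv] := prox_exists lu.2 Dx0 l0; exists v.
Qed.

Definition prox (lam : R) (u : V) : V := sval (cid (exP (lam, u))).
Definition yosida (lam : R) (u : V) : V := lam^-1 *: (u - prox lam u).
Definition envelope (lam : R) (u : V) : R :=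
  Phi (prox lam u) + dot (u - prox lam u) (u - prox lam u) / (2 * lam).

Lemma proxD lam u : 0 < lam -> D (prox lam u).
Proof. by rewrite /prox; case: cid => v /= h /h[]. Qed.

Lemma prox_min lam u w : 0 < lam -> D w ->
  envelope lam u <= Phi w + dot (u - w) (u - w) / (2 * lam).
Proof. by rewrite /envelope /prox; case: cid => v /= h /h[_]; exact. Qed.

Lemma yosidaE lam u h : 0 < lam -> D h ->
  dot (yosida lam u) h = B (prox lam u) h.
Proof.
move=> l0 Dh; apply: prox_euler => //; first exact: proxD.
by move=> w Dw; exact: prox_min.
Qed.

Lemma prox_yosida lam u : 0 < lam -> u = prox lam u + lam *: yosida lam u.
Proof.
by move=> l0; rewrite /yosida scalerA divff ?gt_eqF// scale1r addrC subrK.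
Qed.

(** Two parameters are allowed because flows at different scales are compared later. *)
Lemma yosida_mono lam mu u w : 0 < lam -> 0 < mu ->
  0 <= dot (yosida lam u - yosida mu w) (prox lam u - prox mu w).
Proof.
move=> l0 m0; have D1 := proxD u l0; have D2 := proxD w m0.
by rewrite (dotBl H) !yosidaE//; [exact: ham_mono|exact: DB|exact: DB].
Qed.

Lemma yosida_acc lam mu u w : 0 < lam -> 0 < mu ->
  `|dot (J (prox lam u - prox mu w)) (yosida lam u - yosida mu w)| <=
  C * dot (prox lam u - prox mu w) (prox lam u - prox mu w).
Proof.
move=> l0 m0; have D1 := proxD u l0; have D2 := proxD w m0.
rewrite (dotC H) (dotBl H) !yosidaE//; first exact: (ham_acc X).
  exact/(ham_J X)/DB.
exact/(ham_J X)/DB.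
Qed.

(** Square of the decomposition u = prox u + lam yosida u. All three terms are nonnegative, so
    dropping some of them gives both the nonexpansiveness of [prox] and the Lipschitz constant of
    [yosida]. *)
Lemma prox_diff lam u w : 0 < lam ->
  dot (u - w) (u - w) = dot (prox lam u - prox lam w) (prox lam u - prox lam w)
   + 2 * lam * dot (yosida lam u - yosida lam w) (prox lam u - prox lam w)
   + lam ^+ 2 * dot (yosida lam u - yosida lam w) (yosida lam u - yosida lam w).
Proof.
move=> l0; rewrite {1 2}(prox_yosida u l0) {1 2}(prox_yosida w l0).
have -> : prox lam u + lam *: yosida lam u - (prox lam w + lam *: yosida lam w) =
  (prox lam u - prox lam w) + lam *: (yosida lam u - yosida lam w).
  by rewrite opprD addrACA scalerBr.
move: (prox lam u - prox lam w) (yosida lam u - yosida lam w) => a b.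
by rewrite !(dotE H) (dotC H a b); ring.
Qed.

Lemma prox_lip lam u w : 0 < lam ->
  dot (prox lam u - prox lam w) (prox lam u - prox lam w) <= dot (u - w) (u - w).
Proof.
move=> l0; rewrite (prox_diff u w l0) -addrA lerDl addr_ge0//.
  by rewrite mulr_ge0 ?yosida_mono// mulr_ge0// ltW.
by rewrite mulr_ge0 ?sqr_ge0// (dot_ge0 H).
Qed.

Lemma yosida_lip lam u w : 0 < lam ->
  nrm (yosida lam u - yosida lam w) <= lam^-1 * nrm (u - w).
Proof.
move=> l0; apply: (nrm_le _); first by rewrite mulr_ge0 ?nrm_ge0// invr_ge0 ltW.
rewrite exprMn (nrm_sqr H) exprVn ler_pdivlMl ?exprn_gt0//.
rewrite (prox_diff u w l0) lerDr addr_ge0 ?(dot_ge0 H)//.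
by rewrite mulr_ge0 ?yosida_mono// mulr_ge0// ltW.
Qed.

(** The proximal point at one place is a competitor at the other, which bounds the increment from
    above by its linear part plus a square. Exchanging the two places gives the lower bound, up to
    the Lipschitz variation of [yosida]: the envelope is differentiable with gradient [yosida]. *)
Lemma envelope_diff lam u w : 0 < lam ->
  `|envelope lam w - envelope lam u - dot (yosida lam u) (w - u)| <=
  2 / lam * dot (w - u) (w - u).
Proof.
move=> l0; have li : 0 < lam^-1 by rewrite invr_gt0.
have up a b : envelope lam b <=
    envelope lam a + dot (yosida lam a) (b - a) + (2 * lam)^-1 * dot (b - a) (b - a).
  apply: le_trans (prox_min b l0 (proxD a l0)) _.
  rewrite /envelope /yosida; set p := prox lam a.
  have -> : dot (b - p) (b - p) = dot (a - p) (a - p) + 2 * dot (a - p) (b - a)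
      + dot (b - a) (b - a).
    rewrite !(dotE H) (dotC H p b) (dotC H a b) (dotC H p a); ring.
  rewrite (dotZl H) le_eqVlt; apply/orP; left; apply/eqP.
  by field; rewrite gt_eqF.
have h1 := up u w; have h2 := up w u.
have h3 : `|dot (yosida lam w - yosida lam u) (w - u)| <= lam^-1 * dot (w - u) (w - u).
  apply: le_trans (CauchySchwarz H _ _) _.
  apply: le_trans (ler_wpM2r (nrm_ge0 _ _) (yosida_lip _ _ l0)) _.
  by rewrite -mulrA -expr2 (nrm_sqr H).
have e1 : dot (yosida lam w) (u - w) = - dot (yosida lam w) (w - u).
  by rewrite -(dotNr H) opprB.
have e2 : dot (u - w) (u - w) = dot (w - u) (w - u).
  by rewrite -(opprB w u) (dotNl H) (dotNr H) opprK.
move: h3; rewrite (dotBl H) ler_norml => /andP[h3 h4].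
rewrite e1 e2 in h2.
have d0 : 0 <= lam^-1 * dot (w - u) (w - u) by rewrite mulr_ge0 ?(dot_ge0 H)// ltW.
have l2 : (2 * lam)^-1 = 2^-1 * lam^-1 by rewrite invfM.
rewrite l2 in h1 h2; rewrite ler_norml; apply/andP; split; lra.
Qed.

Lemma envelope_deriv lam u t d : 0 < lam -> vderiv u t d ->
  sderiv (fun s => envelope lam (u s)) t (dot (yosida lam (u t)) d).
Proof.
move=> l0 hu e e0; set p := yosida lam (u t).
have [r1 r10 hr1] := hu _ ltr01.
have p0 : 0 < 2 * (nrm p + 1) by rewrite mulr_gt0// ltr_wpDl ?nrm_ge0.
have [r2 r20 hr2] := hu _ (divr_gt0 e0 p0).
pose K := 2 / lam * (nrm d + 1) ^+ 2.
have K0 : 0 < K by rewrite mulr_gt0 ?divr_gt0// exprn_gt0// ltr_wpDl ?nrm_ge0.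
have K2 : 0 < e / (2 * K) by rewrite divr_gt0// mulr_gt0.
exists (Num.min (Num.min r1 r2) (e / (2 * K))); first by rewrite !lt_min r10 r20.
move=> s; rewrite !lt_min => /andP[/andP[/hr1 h1 /hr2 h2] h3].
have hs : nrm (u s - u t) <= (nrm d + 1) * `|s - t|.
  rewrite -(subrK ((s - t) *: d) (u s - u t)) (le_trans (nrmD H _ _))//.
  by rewrite (nrmZ H); move: h1; rewrite mul1r mulrDl mul1r mulrC; lra.
have hd : dot (u s - u t) (u s - u t) <= (nrm d + 1) ^+ 2 * `|s - t| ^+ 2.
  by rewrite -(nrm_sqr H) -exprMn lerXn2r ?nnegrE ?nrm_ge0// mulr_ge0// addr_ge0 ?nrm_ge0.
have -> : envelope lam (u s) - envelope lam (u t) - (s - t) * dot p d =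
  (envelope lam (u s) - envelope lam (u t) - dot p (u s - u t)) +
  dot p (u s - u t - (s - t) *: d).
  by rewrite (dotBr H (u s - u t)) (dotZr H); ring.
apply: le_trans (ler_normD _ _) _.
have a1 : `|dot p (u s - u t - (s - t) *: d)| <= e / 2 * `|s - t|.
  apply: le_trans (CauchySchwarz H _ _) _.
  apply: le_trans (ler_wpM2l (nrm_ge0 _ _) h2) _.
  rewrite mulrA ler_wpM2r// mulrA ler_pdivrMr//.
  have -> : e / 2 * (2 * (nrm p + 1)) = e * (nrm p + 1) by field.
  by rewrite mulrC ler_pM2l// lerDl.
have a2 : `|envelope lam (u s) - envelope lam (u t) - dot p (u s - u t)|
    <= e / 2 * `|s - t|.
  apply: le_trans (envelope_diff _ _ l0) _.
  have l20 : 0 <= 2 / lam by rewrite divr_ge0// ltW.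
  apply: le_trans (ler_wpM2l l20 hd) _.
  rewrite mulrA -/K expr2 mulrA ler_wpM2r//.
  have : K * `|s - t| <= K * (e / (2 * K)) by rewrite ler_pM2l// ltW.
  by have -> : K * (e / (2 * K)) = e / 2 by field; rewrite gt_eqF.
by move: a1 a2; lra.
Qed.

Definition hfield (lam : R) (u : V) : V := - J (yosida lam u - kappa *: u).

Lemma nrmJB x y : nrm (J x - J y) = nrm (x - y).
Proof.
rewrite /nrm; congr Num.sqrt; rewrite !(dotBl H) !(dotBr H) !(ham_isom X).
by [].
Qed.

Lemma nrmJ x : nrm (J x) = nrm x.
Proof. by rewrite /nrm (ham_isom X). Qed.

Lemma hfield_lip lam u w : 0 < lam ->
  nrm (hfield lam u - hfield lam w) <= (lam^-1 + `|kappa|) * nrm (u - w).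
Proof.
move=> l0; rewrite /hfield opprK addrC nrmJB opprB addrA.
rewrite (_ : yosida lam w - _ + _ - _ = - (yosida lam u - yosida lam w) + kappa *: (u - w)).
  apply: le_trans (nrmD H _ _) _; rewrite (nrmN H) (nrmZ H) mulrDl lerD2r.
  exact: yosida_lip.
rewrite scalerBr opprB; rewrite addrAC -!addrA; congr (_ + _).
by rewrite addrC -!addrA; congr (_ + _); rewrite addrC.
Qed.

Definition hsol (lam : R) (u : R -> V) : Prop :=
  forall t, vderiv u t (hfield lam (u t)).

Lemma hsol_exists lam x : 0 < lam -> exists u, nrm (u 0 - x) = 0 /\ hsol lam u.
Proof.
move=> l0; apply: (@lipschitz_ode _ _ _ H cV _ (lam^-1 + `|kappa|)).
  by rewrite ltr_pwDl// invr_gt0.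
by move=> a b; exact: hfield_lip.
Qed.

Lemma dot_hfield lam u h : dot (hfield lam u) h = dot (yosida lam u - kappa *: u) (J h).
Proof. by rewrite /hfield (dotNl H) skew opprK. Qed.

(** Regularization keeps the gauge invariance: [J u] splits into [J] of the proximal point, where
    [ham_gauge] applies, and a multiple of [J] of the Yosida vector, which is orthogonal to that
    vector. *)
Lemma yosida_gauge lam u : 0 < lam -> dot (yosida lam u) (J u) = 0.
Proof.
move=> l0; have e := prox_yosida u l0; set y := yosida lam u in e *.
rewrite Jdot [X in dot (J y) X]e (dotDr H) (dotZr H) Jxx mulr0 addr0 skew opprK.
by rewrite yosidaE// ?(ham_gauge X)//; [exact: proxD|exact/(ham_J X)/proxD].
Qed.

Lemma hsol_nrm lam u t : 0 < lam -> hsol lam u -> nrm (u t) = nrm (u 0).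
Proof.
move=> l0 hu; rewrite /nrm; congr Num.sqrt.
apply: (@sderiv_unique _ (fun t => dot (u t) (u t)) (fun=> dot (u 0) (u 0)) (fun=> 0)) => // s _.
  have := vderiv_nrm2 H (hu s); rewrite (dotC H) dot_hfield (dotBl H) yosida_gauge//.
  by rewrite (dotZl H) (dotC H) Jxx mulr0 subr0 mulr0.
exact: sderiv_cst.
Qed.

Lemma hsol_envelope lam u t : 0 < lam -> hsol lam u ->
  envelope lam (u t) = envelope lam (u 0).
Proof.
move=> l0 hu.
apply: (@sderiv_unique _ (fun t => envelope lam (u t)) (fun=> envelope lam (u 0)) (fun=> 0)) => // s _.
  have := envelope_deriv l0 (hu s); rewrite (dotC H) dot_hfield (dotBl H).
  rewrite (dotC H _ (J _)) Jxx (dotZl H) Jdot -(dotC H (yosida _ _)).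
  by rewrite -[dot (yosida _ _) _]opprK -?Jdot ?opprK ?yosida_gauge// ?mulr0 ?subr0 ?oppr0 ?mulr0 ?subr0.
exact: sderiv_cst.
Qed.


Lemma hsol_shift lam u a : hsol lam u -> hsol lam (fun t => u (t + a)).
Proof. by move=> hu t; exact: vderiv_shift (hu _). Qed.

(** Half the growth rate of the squared distance of two regularized flows. Skewness of [J] removes
    [kappa] and the terms quadratic in one Yosida vector; the commutator at the proximal points
    remains, with a cross term that vanishes for equal parameters. *)
Lemma dot_hfieldB lam mu a b : 0 < lam -> 0 < mu ->
  dot (a - b) (hfield lam a - hfield mu b) =
  dot (J (prox lam a - prox mu b)) (yosida lam a - yosida mu b)
  + (lam - mu) * dot (J (yosida mu b)) (yosida lam a).
Proof.
move=> l0 m0; rewrite (dotC H) (dotBl H) !dot_hfield.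
have e1 := prox_yosida a l0; have e2 := prox_yosida b m0.
set p := yosida lam a in e1 *; set q := yosida mu b in e2 *.
set P := prox lam a in e1 *; set Q := prox mu b in e2 *.
have -> : dot (p - kappa *: a) (J (a - b)) - dot (q - kappa *: b) (J (a - b)) =
   - dot (J (p - q)) (a - b).
  rewrite -(dotBl H) -Jdot.
  have -> : p - kappa *: a - (q - kappa *: b) = (p - q) - kappa *: (a - b).
    by rewrite (subACA p) scalerBr.
  by rewrite (dotBl H) (dotZl H) (dotC H (a - b)) Jxx mulr0 subr0.
have -> : a - b = (P - Q) + (lam *: p - mu *: q).
  by rewrite {1}e1 {1}e2 opprD addrACA.
move: (P - Q) => S; clearbody p q.
have -> : dot (J (p - q)) (S + (lam *: p - mu *: q)) =
   dot (J (p - q)) S + dot (J (p - q)) (lam *: p - mu *: q) by rewrite (dotDr H).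
have -> : dot (J (p - q)) (lam *: p - mu *: q) = (mu - lam) * dot (J q) p.
  rewrite skew (dotBl H) !Jdot !(dotDr H) !(dotNr H) !(dotZr H) !Jxx.
  have -> : dot (J p) q = - dot (J q) p by rewrite skew (dotC H).
  ring.
have -> : dot (J (p - q)) S = - dot (J S) (p - q) by rewrite skew (dotC H).
ring.
Qed.

(** The exponent involves only the commutator constant, hence is uniform in [lam], unlike the
    Lipschitz constant of the field. *)
Lemma hsol_contract lam u w t : 0 < lam -> hsol lam u -> hsol lam w ->
  nrm (u t - w t) <= expR (C * `|t|) * nrm (u 0 - w 0).
Proof.
move=> l0 hu hw; have C0 := ham_acc0 X.
have := @gronwall_abs _ (fun t => dot (u t - w t) (u t - w t))
  (fun t => 2 * dot (u t - w t) (hfield lam (u t) - hfield lam (w t)))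
  (2 * C) 0 t _ (lexx _) (fun t _ => vderiv_nrm2 H (vderivB H (hu t) (hw t))).
rewrite mulr_ge0// => /(_ isT) h.
apply: (nrm_le _); first by rewrite mulr_ge0 ?expR_ge0 ?nrm_ge0.
rewrite exprMn (nrm_sqr H) -expRM_natl mulr_natl.
have -> : (C * `|t|) *+ 2 = 2 * C * `|t| by rewrite -mulr_natl mulrA.
rewrite mul0r addr0 in h; apply: h => s _.
rewrite dot_hfieldB// subrr mul0r addr0 addr0 normrM ger0_norm// -mulrA ler_pM2l//.
apply: le_trans (yosida_acc _ _ l0 l0) _.
by rewrite ler_wpM2l// prox_lip.
Qed.

(** The equation is autonomous: the solution is compared with its own translate by a small time, and
    the contraction estimate is divided by that time. *)
Lemma hsol_speed lam u t : 0 < lam -> hsol lam u ->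
  nrm (hfield lam (u t)) <= expR (C * `|t|) * nrm (hfield lam (u 0)).
Proof.
move=> l0 hu; set E := expR _; have E0 : 0 < E by exact: expR_gt0.
apply/ler_addgt0Pr => e e0.
have e1 : 0 < e / 2 by rewrite divr_gt0.
have e2 : 0 < e / 2 / E by rewrite divr_gt0.
have [r1 r10 h1] := hu t _ e1; have [r2 r20 h2] := hu 0 _ e2.
pose h := Num.min r1 r2 / 2.
have m0 : 0 < Num.min r1 r2 by rewrite lt_min r10.
have h0 : 0 < h by rewrite divr_gt0.
have hm : h < Num.min r1 r2 by rewrite /h; lra.
have [hr1 hr2] : h < r1 /\ h < r2 by move: hm; rewrite lt_min => /andP[].
have := h1 (h + t); rewrite addrK gtr0_norm// => /(_ hr1) k1.
have := h2 h; rewrite subr0 gtr0_norm// => /(_ hr2) k2.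
have := hsol_contract t l0 (hsol_shift h hu) hu; rewrite add0r (addrC t) -/E => k3.
have k4 : h * nrm (hfield lam (u t)) <= nrm (u (h + t) - u t) + e / 2 * h.
  have := nrm_diff H (h *: hfield lam (u t)) (u (h + t) - u t).
  rewrite ler_norml => /andP[_]; rewrite (nrmZ H) (gtr0_norm h0).
  rewrite (nrmC H (h *: _)); move: k1; lra.
have k5 : nrm (u h - u 0) <= h * nrm (hfield lam (u 0)) + e / 2 / E * h.
  have := nrm_diff H (u h - u 0) (h *: hfield lam (u 0)).
  rewrite ler_norml => /andP[_]; rewrite (nrmZ H) (gtr0_norm h0); move: k2; lra.
rewrite -(ler_pM2l h0).
have k6 := ler_wpM2l (ltW E0) k5.
have k7 : E * (h * nrm (hfield lam (u 0)) + e / 2 / E * h) =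
  h * (E * nrm (hfield lam (u 0))) + e / 2 * h by field; rewrite gt_eqF.
move: k6; rewrite k7; lra.
Qed.

(** [yosida mu x] is the gradient at [prox mu x] and bounds all Yosida vectors there: monotonicity
    gives |p|^2 <= (q, p) for p the left and q the right vector. *)
Lemma yosida_le lam mu x : 0 < lam -> 0 < mu ->
  nrm (yosida lam (prox mu x)) <= nrm (yosida mu x).
Proof.
move=> l0 m0; have := yosida_mono (prox mu x) x l0 m0.
set w := prox mu x.
have -> : prox lam w - w = - (lam *: yosida lam w).
  by rewrite {2}(prox_yosida w l0) opprD addrA subrr sub0r.
rewrite (dotNr H) (dotZr H) oppr_ge0 pmulr_rle0// (dotBl H) subr_le0 => h.
have := dot_le H (yosida mu x) (yosida lam w) => h2.
set k := nrm (yosida lam w).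
have [k0|k0] := eqVneq k 0; first by rewrite k0 nrm_ge0.
have kp : 0 < k by rewrite lt_def k0 nrm_ge0.
by rewrite -(ler_pM2r kp) -expr2 (nrm_sqr H) (le_trans h).
Qed.

Lemma prox_dist lam x : 0 < lam -> D x ->
  dot (x - prox lam x) (x - prox lam x) <= 2 * lam * Phi x.
Proof.
move=> l0 Dx; have := prox_min x l0 Dx; rewrite subrr (dot0l H) mul0r addr0 /envelope.
have := ham_ge0 X (proxD x l0) => p0 h.
have : dot (x - prox lam x) (x - prox lam x) / (2 * lam) <= Phi x by lra.
by rewrite ler_pdivrMr ?mulr_gt0// mulrC.
Qed.

Lemma prox_Phi lam x : 0 < lam -> D x -> Phi (prox lam x) <= Phi x.
Proof.
move=> l0 Dx; have := prox_min x l0 Dx; rewrite subrr (dot0l H) mul0r addr0 /envelope.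
apply: le_trans; rewrite lerDl mulr_ge0 ?(dot_ge0 H)// invr_ge0 mulr_ge0// ltW//.
Qed.

(** The distance of the proximal points exceeds that of the solutions by at most [(lam + mu) * K].
    Inserted in the commutator bound, this gives Gronwall's inequality with a source of order
    [(lam + mu) * K ^+ 2]. *)
Lemma hsol_compare lam mu u w K T : 0 < lam -> 0 < mu -> 0 <= K ->
  hsol lam u -> hsol mu w -> nrm (u 0 - w 0) = 0 ->
  (forall t, `|t| <= `|T| -> nrm (yosida lam (u t)) <= K) ->
  (forall t, `|t| <= `|T| -> nrm (yosida mu (w t)) <= K) ->
  dot (u T - w T) (u T - w T) <=
    expR (4 * C * `|T|) * ((4 * C * (lam + mu) ^+ 2 + 2 * (lam + mu)) * K ^+ 2 * `|T|).
Proof.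
move=> l0 m0 K0 hu hw uw0 hK1 hK2; have C0 := ham_acc0 X.
have lm0 : 0 <= lam + mu by rewrite addr_ge0 ?ltW.
have := @gronwall_abs _ (fun t => dot (u t - w t) (u t - w t))
  (fun t => 2 * dot (u t - w t) (hfield lam (u t) - hfield mu (w t)))
  (4 * C) ((4 * C * (lam + mu) ^+ 2 + 2 * (lam + mu)) * K ^+ 2) T _ _
  (fun t _ => vderiv_nrm2 H (vderivB H (hu t) (hw t))).
rewrite (nrm_dot0 H uw0) add0r; apply.
- by rewrite mulr_ge0.
- by rewrite mulr_ge0 ?sqr_ge0// addr_ge0 ?mulr_ge0 ?sqr_ge0.
move=> t tT; rewrite dot_hfieldB//.
have e1 := prox_yosida (u t) l0; have e2 := prox_yosida (w t) m0.
have k1 := hK1 _ tT; have k2 := hK2 _ tT.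
have acc := yosida_acc (u t) (w t) l0 m0.
set p := yosida lam (u t) in e1 k1 acc *; set q := yosida mu (w t) in e2 k2 acc *.
set S := prox lam (u t) - prox mu (w t) in acc *; clearbody p q.
have hS : nrm S <= nrm (u t - w t) + (lam + mu) * K.
  have -> : S = (u t - w t) - (lam *: p - mu *: q).
    rewrite /S {2}e1 {2}e2; set a := prox _ _; set b := prox _ _.
    rewrite (subACA (a + lam *: p)) addrK (addrC b) opprD opprK.
    by rewrite opprD addrAC addNr add0r.
  apply: le_trans (nrmD H _ _) _; rewrite lerD2l (nrmN H).
  apply: le_trans (nrmD H _ _) _; rewrite (nrmN H (mu *: q)) !(nrmZ H) (gtr0_norm l0) (gtr0_norm m0).
  by rewrite mulrDl; apply: lerD; apply: ler_wpM2l => //; exact: ltW.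
have hS2 : dot S S <= 2 * dot (u t - w t) (u t - w t) + 2 * ((lam + mu) ^+ 2 * K ^+ 2).
  rewrite -!(nrm_sqr H) -exprMn.
  have : nrm S ^+ 2 <= (nrm (u t - w t) + (lam + mu) * K) ^+ 2.
    by rewrite lerXn2r ?nnegrE ?nrm_ge0// addr_ge0 ?nrm_ge0 ?mulr_ge0.
  have := sqr_ge0 (nrm (u t - w t) - (lam + mu) * K); rewrite sqrrB sqrrD; lra.
have hq : `|(lam - mu) * dot (J q) p| <= (lam + mu) * K ^+ 2.
  rewrite normrM ler_pM//.
    by apply: le_trans (ler_normB _ _) _; rewrite !gtr0_norm.
  apply: le_trans (CauchySchwarz H _ _) _; rewrite nrmJ expr2 ler_pM ?nrm_ge0//.
rewrite normrM ger0_norm//.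
have := ler_normD (dot (J S) (p - q)) ((lam - mu) * dot (J q) p).
have := ler_wpM2l C0 hS2.
have -> : (4 * C * (lam + mu) ^+ 2 + 2 * (lam + mu)) * K ^+ 2 =
  2 * (C * (2 * ((lam + mu) ^+ 2 * K ^+ 2))) + 2 * ((lam + mu) * K ^+ 2) by ring.
rewrite mulrDr; lra.
Qed.


(* The datum is regularized at scale [1/n] and the equation at scale [1/n^2]: the
   Yosida field is then [O(n^(1/2))] along the flow, which makes the error of
   [hsol_compare] tend to 0. *)
Let mun (n : nat) : R := n.+1%:R^-1.
Let lamn (n : nat) : R := (n.+1%:R ^+ 2)^-1.
Let mun0 n : 0 < mun n. Proof. by rewrite invr_gt0 ltr0n. Qed.
Let lamn0 n : 0 < lamn n. Proof. by rewrite invr_gt0 exprn_gt0// ltr0n. Qed.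
Let mun1 n : mun n <= 1. Proof. by rewrite invf_le1 ?ltr0n// ler1n. Qed.
Let lamnE n : lamn n = mun n * mun n. Proof. by rewrite /lamn /mun expr2 invfM. Qed.
Let mun_anti n m : (n <= m)%N -> mun m <= mun n.
Proof. by move=> nm; rewrite lef_pV2 ?posrE ?ltr0n// ler_nat ltnS. Qed.

Let munM n : mun n * n.+1%:R = 1. Proof. by rewrite mulVf// pnatr_eq0. Qed.

(** At the regularized datum the Yosida vector is at most |y - prox y| / mu, hence O(mu^(-1/2)) by
    [prox_dist], whatever [lam] is. [hsol_speed] propagates this along the flow, and speed and
    Yosida vector differ by a multiple of the conserved norm. *)
Lemma yosida_bound y T : D y -> 0 <= T -> exists2 Q, 0 <= Q &
  forall n lam u t, 0 < lam -> hsol lam u -> nrm (u 0 - prox (mun n) y) = 0 ->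
   `|t| <= T -> nrm (yosida lam (u t)) <= Num.sqrt n.+1%:R * Q.
Proof.
move=> Dy T0; have P0 := ham_ge0 X Dy; have C0 := ham_acc0 X.
set P := Phi y in P0; set E := expR (C * T).
have E0 : 0 <= E by exact: expR_ge0.
pose a := nrm y + (1 + 2 * P).
have a0 : 0 <= a by rewrite /a !addr_ge0 ?nrm_ge0// mulr_ge0.
have ka0 : 0 <= `|kappa| * a by rewrite mulr_ge0.
have P1 : 0 <= 1 + 2 * P by lra.
exists (E * ((1 + 2 * P) + `|kappa| * a) + `|kappa| * a).
  by apply: addr_ge0 => //; apply: mulr_ge0 => //; exact: addr_ge0.
move=> n lam u t l0 hu hu0 tT.
have s1 : 1 <= Num.sqrt n.+1%:R :> R by rewrite -[leLHS]sqrtr1 ler_wsqrtr// ler1n.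
set s := Num.sqrt n.+1%:R in s1 *.
set w := prox (mun n) y in hu0.
have dw := prox_dist (mun0 n) Dy; rewrite -/w -/P in dw.
have nw : nrm w <= a.
  have : nrm (y - w) <= 1 + 2 * P.
    apply: (nrm_le _); first by rewrite addr_ge0// mulr_ge0.
    apply: le_trans dw _; rewrite sqrrD.
    have : 2 * mun n * P <= 2 * P by rewrite ler_wpM2r// ger_pMr.
    have : 0 <= P ^+ 2 by rewrite sqr_ge0.
    rewrite expr1n exprMn; lra.
  by rewrite (nrmC H) => h; have := nrm_diff H w y; rewrite ler_norml /a; lra.
have nu0 : nrm (u 0) <= a.
  by have := nrm_diff H (u 0) w; rewrite hu0 ler_norml; lra.
have nut : nrm (u t) <= a by rewrite (hsol_nrm t l0 hu).
have ny : nrm (yosida lam (u 0)) <= s * (1 + 2 * P).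
  have h1 : nrm (yosida lam (u 0)) <= nrm (yosida lam w).
    have := nrm_diff H (yosida lam (u 0)) (yosida lam w).
    by have := yosida_lip (u 0) w l0; rewrite hu0 mulr0 ler_norml; lra.
  apply: le_trans h1 (le_trans (yosida_le y l0 (mun0 n)) _).
  apply: (nrm_le _); first by rewrite mulr_ge0 ?sqrtr_ge0// addr_ge0// mulr_ge0.
  rewrite /yosida (dotZl H) (dotZr H) exprMn sqr_sqrtr ?ler0n// /mun invrK.
  rewrite -/(mun n) -/w.
  have n0 : 0 < n.+1%:R :> R by rewrite ltr0n.
  rewrite ler_pM2l//.
  apply: le_trans (ler_wpM2l (ltW n0) dw) _.
  have -> : n.+1%:R * (2 * mun n * P) = 2 * P.
    by transitivity (mun n * n.+1%:R * (2 * P)); [ring|rewrite munM mul1r].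
  have : 0 <= P ^+ 2 by rewrite sqr_ge0.
  rewrite sqrrD expr1n exprMn; lra.
have nf : nrm (hfield lam (u 0)) <= s * (1 + 2 * P) + `|kappa| * a.
  rewrite /hfield (nrmN H) nrmJ; apply: le_trans (nrmD H _ _) _.
  by rewrite (nrmN H) (nrmZ H kappa) lerD// ler_wpM2l.
have nft := hsol_speed t l0 hu.
have Et : expR (C * `|t|) <= E by rewrite ler_expR ler_wpM2l.
have ht : nrm (hfield lam (u t)) <= E * (s * (1 + 2 * P) + `|kappa| * a).
  apply: le_trans nft _; apply: ler_pM => //; exact: nrm_ge0.
have hy : nrm (yosida lam (u t)) <= nrm (hfield lam (u t)) + `|kappa| * nrm (u t).
  rewrite /hfield (nrmN H) nrmJ -(nrmZ H kappa) -{1}(subrK (kappa *: u t) (yosida lam (u t))).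
  exact: nrmD.
apply: le_trans hy _.
have ka : 0 <= `|kappa| * a by rewrite mulr_ge0.
have h1 : `|kappa| * nrm (u t) <= s * (`|kappa| * a).
  rewrite (@le_trans _ _ (`|kappa| * a)) ?ler_wpM2l// ler_peMl//.
have h2 : `|kappa| * a <= s * (`|kappa| * a) by rewrite ler_peMl.
have h3 : E * (s * (1 + 2 * P) + `|kappa| * a) <= E * (s * ((1 + 2 * P) + `|kappa| * a)).
  by apply: ler_wpM2l => //; rewrite (mulrDr s (1 + 2 * P)) lerD2l.
rewrite (mulrDr s (E * _)) (mulrCA s E); apply: lerD => //; exact: le_trans h3.
Qed.

Let exZ (yn : V * nat) : exists u, nrm (u 0 - prox (mun yn.2) yn.1) = 0 /\ hsol (lamn yn.2) u.
Proof. exact: hsol_exists. Qed.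

Let Z (y : V) (n : nat) : R -> V := sval (cid (exZ (y, n))).
Let Z0 y n : nrm (Z y n 0 - prox (mun n) y) = 0.
Proof. by rewrite /Z; case: cid => u []. Qed.
Let Zsol y n : hsol (lamn n) (Z y n).
Proof. by rewrite /Z; case: cid => u []. Qed.

Lemma prox_lim y e : D y -> 0 < e -> exists N, forall n, (N <= n)%N ->
  nrm (prox (mun n) y - y) <= e.
Proof.
move=> Dy e0; have P0 := ham_ge0 X Dy.
have d0 : 0 < e ^+ 2 / (2 * Phi y + 1) by rewrite divr_gt0 ?exprn_gt0// ltr_wpDl// mulr_ge0.
have [N hN] := invSn_lt d0; exists N => n /hN; rewrite ler_pdivlMr; last first.
  by rewrite ltr_wpDl// mulr_ge0.
move=> h; apply: (nrm_le _); first exact: ltW.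
rewrite -(opprB y) (dotNl H) (dotNr H) opprK.
apply: le_trans (prox_dist (mun0 n) Dy) _; apply: le_trans h.
rewrite -/(mun n); have := mun0 n; lra.
Qed.

(** For n <= m, regularizing the equation costs at most a constant times lamn K^2, with K^2 of order
    n and lamn = mun^2, hence O(mun); regularizing the datum costs the distance between proximal
    points. *)
Lemma flow_cauchy y T e : D y -> 0 <= T -> 0 < e -> exists N, forall n m t,
  (N <= n)%N -> (N <= m)%N -> `|t| <= T -> nrm (Z y n t - Z y m t) <= e.
Proof.
move=> Dy T0 e0; have P0 := ham_ge0 X Dy; have C0 := ham_acc0 X.
have [Q Q0 hQ] := yosida_bound Dy T0.
pose A := expR (4 * C * T) * ((16 * C + 4) * Q ^+ 2 * T).
have A0 : 0 <= A by rewrite !mulr_ge0 ?expR_ge0 ?sqr_ge0// addr_ge0// mulr_ge0.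
pose E := expR (C * T).
have E0 : 0 < E by exact: expR_gt0.
have e8 : 0 < e / 4 / E by rewrite !divr_gt0.
have [N1 hN1] := prox_lim Dy e8.
have d0 : 0 < (e / 2) ^+ 2 / (A + 1) by rewrite divr_gt0 ?exprn_gt0 ?divr_gt0// ltr_wpDl.
have [N2 hN2] := invSn_lt d0.
exists (maxn N1 N2) => n m t.
wlog nm : n m / (n <= m)%N.
  move=> W h1 h2 h3; case/orP: (leq_total n m) => h; first exact: W.
  by rewrite (nrmC H); exact: W.
rewrite !geq_max => /andP[n1 n2] /andP[m1 m2] tT.
(* Intermediate solution, with the datum of index [n] and the equation of index [m], so that the two
   errors separate. *)
have [u [u0 hu]] := hsol_exists (prox (mun n) y) (lamn0 m).
have c1 : nrm (Z y n t - u t) <= e / 2.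
  apply: (nrm_le _); first by rewrite divr_ge0 ?(ltW e0).
  have Zu : nrm (Z y n 0 - u 0) = 0.
    apply/eqP; rewrite eq_le nrm_ge0 andbT (le_trans (nrm_triangle H (prox (mun n) y) _ _))//.
    by rewrite Z0 (nrmC H) u0 addr0.
  have K0 : 0 <= Num.sqrt n.+1%:R * Q by rewrite mulr_ge0// sqrtr_ge0.
  have := hsol_compare (lamn0 n) (lamn0 m) K0 (Zsol y n) hu Zu.
  move=> /(_ t) h; apply: le_trans (h _ _) _.
  - by move=> s st; apply: hQ (Z0 y n) (le_trans st tT) => //; exact: Zsol.
  - by move=> s st; apply: hQ u0 (le_trans st tT).
  rewrite exprMn sqr_sqrtr ?ler0n//.
  have n0 : 0 < n.+1%:R :> R by rewrite ltr0n.
  have L1 : lamn n + lamn m <= 2 * mun n * mun n.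
    have := mun_anti nm; have := mun0 m; rewrite !lamnE => a b.
    have : mun m * mun m <= mun n * mun n by apply: ler_pM => //; exact: ltW.
    lra.
  have L2 : lamn n + lamn m <= 2.
    have := mun1 n; have := mun0 n => a b; apply: le_trans L1 _.
    have : mun n * mun n <= 1 by rewrite mulr_ile1// ltW.
    lra.
  have L0 : 0 <= lamn n + lamn m by rewrite addr_ge0// ltW.
  set L := lamn n + lamn m in L0 L1 L2 *.
  have h1 : (4 * C * L ^+ 2 + 2 * L) <= (16 * C + 4) * (mun n * mun n).
    have : C * L ^+ 2 <= C * (2 * L) by rewrite ler_wpM2l// expr2 ler_wpM2r.
    have : C * L <= C * (2 * mun n * mun n) by rewrite ler_wpM2l.
    lra.
  apply: le_trans (_ : A * mun n <= _); last first.
    have := hN2 n n2; rewrite -/(mun n) ler_pdivlMr ?ltr_wpDl// => h2.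
    apply: le_trans h2; rewrite mulrC ler_pM2l// lerDl//.
  have X0 : 0 <= (4 * C * L ^+ 2 + 2 * L) * (n.+1%:R * Q ^+ 2).
    have nQ : 0 <= n.+1%:R * Q ^+ 2 by apply: mulr_ge0; [exact: ltW|exact: sqr_ge0].
    apply: mulr_ge0 => //; apply: addr_ge0; last by apply: mulr_ge0.
    by apply: mulr_ge0; [exact: mulr_ge0|exact: sqr_ge0].
  have h2 := ler_wpM2r (mulr_ge0 (ltW n0) (sqr_ge0 Q)) h1.
  have e1 : (16 * C + 4) * (mun n * mun n) * (n.+1%:R * Q ^+ 2) =
     (16 * C + 4) * Q ^+ 2 * mun n.
    transitivity (mun n * n.+1%:R * ((16 * C + 4) * Q ^+ 2 * mun n)); first by ring.
    by rewrite munM mul1r.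
  rewrite e1 in h2.
  have -> : A * mun n = expR (4 * C * T) * ((16 * C + 4) * Q ^+ 2 * mun n * T).
    by rewrite /A; ring.
  apply: ler_pM; [exact: expR_ge0|exact: mulr_ge0| |exact: ler_pM].
  by rewrite ler_expR; apply: ler_wpM2l => //; exact: mulr_ge0.
have c2 : nrm (u t - Z y m t) <= e / 2.
  apply: le_trans (hsol_contract t (lamn0 m) hu (Zsol y m)) _.
  have h : nrm (u 0 - Z y m 0) <= e / 2 / E.
    apply: le_trans (nrm_triangle H (prox (mun n) y) _ _) _; rewrite u0 add0r.
    apply: le_trans (nrm_triangle H y _ _) _.
    apply: le_trans (lerD (lexx _) (nrm_triangle H (prox (mun m) y) _ _)) _.
    rewrite (nrmC H (prox (mun m) y)) Z0 addr0 (nrmC H y).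
    have := hN1 n n1; have := hN1 m m1.
    have -> : e / 2 / E = e / 4 / E + e / 4 / E by field; rewrite gt_eqF.
    lra.
  rewrite (@le_trans _ _ (E * (e / 2 / E)))//; last first.
    by rewrite mulrC divfK// gt_eqF.
  by apply: ler_pM => //; rewrite ?expR_ge0 ?nrm_ge0// ler_expR ler_wpM2l.
apply: le_trans (nrm_triangle H (u t) _ _) _; lra.
Qed.

Let exU (yt : V * R) : exists l, D yt.1 -> seq_lim dot (fun n => Z yt.1 n yt.2) l.
Proof.
case: (pselect (D yt.1)) => Dy; last by exists 0.
suff [l hl] : exists l, seq_lim dot (fun n => Z yt.1 n yt.2) l by exists l.
apply: cV => e e0; have [N hN] := flow_cauchy Dy (normr_ge0 yt.2) e0.
by exists N => m n Nm Nn; exact: hN.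
Qed.

Definition hflow (y : V) (t : R) : V := sval (cid (exU (y, t))).

Let hflow_lim y t : D y -> seq_lim dot (fun n => Z y n t) (hflow y t).
Proof. by rewrite /hflow; case: cid => l /= h Dy; exact: h. Qed.

Lemma hflow_unif y T e : D y -> 0 <= T -> 0 < e -> exists N, forall n t,
  (N <= n)%N -> `|t| <= T -> nrm (Z y n t - hflow y t) <= e.
Proof.
move=> Dy T0 e0; have [N hN] := flow_cauchy Dy T0 e0; exists N => n t Nn tT.
apply/ler_addgt0Pr => r r0; have [M hM] := hflow_lim t Dy r0.
have := hM (maxn N M) (leq_maxr _ _).
have := hN n (maxn N M) t Nn (leq_maxl _ _) tT.
by have := nrm_triangle H (Z y (maxn N M) t) (Z y n t) (hflow y t); lra.
Qed.

(** The approximations need not lie in [D]. Their proximal points do, with [Phi] at most [Phi y],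
    and they have the same limit; lower semicontinuity and [ham_weak] are applied to them. *)
Let v (y : V) (n : nat) (t : R) : V := prox (lamn n) (Z y n t).

Let envZ y n t : D y -> envelope (lamn n) (Z y n t) <= Phi y.
Proof.
move=> Dy; rewrite (hsol_envelope _ (lamn0 n) (Zsol y n)).
apply: le_trans (prox_min _ (lamn0 n) (proxD y (mun0 n))) _.
by rewrite (nrm_dot0 H (Z0 y n)) mul0r addr0 prox_Phi.
Qed.

Let vPhi y n t : D y -> D (v y n t) /\ Phi (v y n t) <= Phi y.
Proof.
move=> Dy; split; first exact: proxD.
apply: le_trans (envZ n t Dy); rewrite /envelope -/(v y n t) lerDl.
by rewrite mulr_ge0 ?(dot_ge0 H)// invr_ge0 mulr_ge0// ltW.
Qed.

Let vZ y e : D y -> 0 < e -> exists N, forall n t, (N <= n)%N ->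
  nrm (v y n t - Z y n t) <= e.
Proof.
move=> Dy e0; have P0 := ham_ge0 X Dy.
have d0 : 0 < e ^+ 2 / (2 * Phi y + 1) by rewrite divr_gt0 ?exprn_gt0// ltr_wpDl// mulr_ge0.
have [N hN] := invSn_lt d0; exists N => n t /hN; rewrite ler_pdivlMr; last first.
  by rewrite ltr_wpDl// mulr_ge0.
rewrite -/(mun n) => h; apply: (nrm_le _); first exact: ltW.
rewrite -(opprB (Z y n t)) (dotNl H) (dotNr H) opprK.
have := envZ n t Dy; rewrite /envelope -/(v y n t).
have p0 := ham_ge0 X (proj1 (vPhi n t Dy)) => h2.
have : dot (Z y n t - v y n t) (Z y n t - v y n t) / (2 * lamn n) <= Phi y by lra.
rewrite ler_pdivrMr ?mulr_gt0// => /le_trans; apply; apply: le_trans h.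
have h3 : lamn n <= mun n by rewrite lamnE ger_pMr.
have := mun0 n => m0.
have : Phi y * lamn n <= Phi y * mun n by rewrite ler_wpM2l.
lra.
Qed.

Lemma hflow_v y T e : D y -> 0 <= T -> 0 < e -> exists N, forall n t,
  (N <= n)%N -> `|t| <= T -> nrm (v y n t - hflow y t) <= e.
Proof.
move=> Dy T0 e0; have e2 : 0 < e / 2 by rewrite divr_gt0.
have [N1 h1] := vZ Dy e2; have [N2 h2] := hflow_unif Dy T0 e2.
exists (maxn N1 N2) => n t; rewrite geq_max => /andP[/h1 a /h2 b] /b {b}.
by have := nrm_triangle H (Z y n t) (v y n t) (hflow y t); have := a t; lra.
Qed.

Lemma hflow_Phi_le y t : D y -> D (hflow y t) /\ Phi (hflow y t) <= Phi y.
Proof.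
move=> Dy; apply: (ham_lsc X (u := fun n => v y n t)); first by move=> n; exact: vPhi.
move=> e e0; have [N hN] := hflow_v Dy (normr_ge0 t) e0.
by exists N => n Nn; exact: hN.
Qed.

Lemma hflow_nrm y t : D y -> nrm (hflow y t) = nrm y.
Proof.
move=> Dy; apply/eqP; rewrite -subr_eq0 -normr_le0; apply/ler_addgt0Pr => e e0.
rewrite add0r; have e2 : 0 < e / 2 by rewrite divr_gt0.
have [N1 h1] := prox_lim Dy e2; have [N2 h2] := hflow_lim t Dy e2.
pose n := maxn N1 N2.
have := h1 n (leq_maxl _ _); have := h2 n (leq_maxr _ _) => a b.
have c := hsol_nrm t (lamn0 n) (Zsol y n).
have := nrm_diff H (Z y n 0) (prox (mun n) y); rewrite Z0 ler_norml => d.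
have := nrm_diff H (Z y n t) (hflow y t); have := nrm_diff H (prox (mun n) y) y.
rewrite !ler_norml => f g; apply/andP; split; lra.
Qed.

Lemma hflow_cont y t : D y -> vcont (hflow y) t.
Proof.
move=> Dy e e0; have e3 : 0 < e / 3 by rewrite divr_gt0.
have T0 : 0 <= `|t| + 1 by rewrite addr_ge0.
have [N hN] := hflow_unif Dy T0 e3.
have [r r0 hr] := vderiv_cont H (Zsol y N t) e3.
exists (Num.min r 1); first by rewrite lt_min r0/=.
move=> s; rewrite lt_min => /andP[/hr h1 h2].
have hs : `|s| <= `|t| + 1 by have := ler_normD (s - t) t; rewrite subrK; lra.
have ht : `|t| <= `|t| + 1 by rewrite lerDl.
have := hN N s (leqnn _) hs; have := hN N t (leqnn _) ht.
rewrite (nrmC H (Z y N s) (hflow y s)).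
have := nrm_triangle H (Z y N s) (hflow y s) (hflow y t).
by have := nrm_triangle H (Z y N t) (Z y N s) (hflow y t); lra.
Qed.

Lemma hflow0 y : D y -> nrm (hflow y 0 - y) = 0.
Proof.
move=> Dy; apply/eqP; rewrite eq_le nrm_ge0 andbT; apply/ler_addgt0Pr => e e0.
rewrite add0r; have e2 : 0 < e / 2 by rewrite divr_gt0.
have [N1 h1] := prox_lim Dy e2; have [N2 h2] := hflow_lim 0 Dy e2.
pose n := maxn N1 N2.
have := h1 n (leq_maxl _ _); have := h2 n (leq_maxr _ _).
have := nrm_triangle H (Z y n 0) (hflow y 0) y.
have := nrm_triangle H (prox (mun n) y) (Z y n 0) y; rewrite Z0 (nrmC H (Z y n 0) (hflow y 0)); lra.
Qed.

(* Both curves solve the regularized equation, so contraction identifies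
   the limits: the flow can be run backwards. *)
Lemma hflow_back y t : D y -> nrm (hflow (hflow y t) (- t) - y) = 0.
Proof.
move=> Dy; have [Dz _] := hflow_Phi_le t Dy; set z := hflow y t in Dz *.
apply/eqP; rewrite eq_le nrm_ge0 andbT; apply/ler_addgt0Pr => e e0.
rewrite add0r; have e4 : 0 < e / 4 by rewrite divr_gt0.
pose E := expR (C * `|t|).
have E0 : 0 < E by exact: expR_gt0.
have e8 : 0 < e / 8 / E by rewrite !divr_gt0.
have [N1 h1] := prox_lim Dy e4; have [N2 h2] := hflow_lim t Dy e8.
have [N3 h3] := prox_lim Dz e8; have [N4 h4] := hflow_lim (- t) Dz e4.
pose n := maxn (maxn N1 N2) (maxn N3 N4).
have n1 : (N1 <= n)%N by rewrite !leq_max leqnn.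
have n2 : (N2 <= n)%N by rewrite !leq_max leqnn orbT.
have n3 : (N3 <= n)%N by rewrite !leq_max leqnn !orbT.
have n4 : (N4 <= n)%N by rewrite !leq_max leqnn !orbT.
have := hsol_contract (- t) (lamn0 n) (Zsol z n) (hsol_shift t (Zsol y n)).
rewrite addNr add0r normrN -/E => c.
have d : nrm (Z z n 0 - Z y n t) <= e / 4 / E.
  have := nrm_triangle H (prox (mun n) z) (Z z n 0) (Z y n t); rewrite Z0.
  have := nrm_triangle H z (prox (mun n) z) (Z y n t).
  have := h3 n n3; have := h2 n n2; rewrite -/z (nrmC H (Z y n t) z).
  have -> : e / 4 / E = e / 8 / E + e / 8 / E by field; rewrite gt_eqF.
  lra.
have {}c : nrm (Z z n (- t) - Z y n 0) <= e / 4.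
  apply: le_trans c _; apply: le_trans (ler_wpM2l (ltW E0) d) _.
  by rewrite mulrC divfK// gt_eqF.
have := h1 n n1; have := h4 n n4; rewrite (nrmC H (Z z n (- t)) (hflow z (- t))).
have := nrm_triangle H (Z z n (- t)) (hflow z (- t)) y.
have := nrm_triangle H (Z y n 0) (Z z n (- t)) y.
have := nrm_triangle H (prox (mun n) y) (Z y n 0) y; rewrite Z0; lra.
Qed.

Lemma hflow_Phi y t : D y -> Phi (hflow y t) = Phi y.
Proof.
move=> Dy; have [Dz le1] := hflow_Phi_le t Dy; apply: le_anti; rewrite le1/=.
have [Dw le2] := hflow_Phi_le (- t) Dz.
(* The backward flow returns only to a point at null distance from [y]; lower semicontinuity on a
   constant sequence carries the bound over to [y]. *)
have lim : seq_lim dot (fun=> hflow (hflow y t) (- t)) y.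
  by move=> e e0; exists 0%N => n _; rewrite hflow_back// ltW.
by have [] := ham_lsc X (fun=> conj Dw le2) lim.
Qed.

(** The approximations are differentiable with derivative [B] at their proximal points. These have
    bounded [Phi] and are near [hflow y t] for large [n] and [s] near [t], so [ham_weak] bounds the
    derivative uniformly; the mean value estimate then passes to the limit in [n]. *)
Lemma hflow_deriv y t h : D y -> D h ->
  sderiv (fun s => dot (hflow y s) h) t
    (B (hflow y t) (J h) - kappa * dot (hflow y t) (J h)).
Proof.
move=> Dy Dh e e0; have DJ := ham_J X Dh.
set d := B _ _ - _.
have e2 : 0 < e / 2 by rewrite divr_gt0.
have [Dt _] := hflow_Phi_le t Dy.
have [r r0 hr] := ham_weak X (Phi y) Dt DJ e2.
pose K := `|kappa| * nrm (J h) + 1.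
have K0 : 0 < K by rewrite /K ltr_wpDl// mulr_ge0 ?nrm_ge0.
pose r' := Num.min r (e / 2 / K) / 2.
have r'0 : 0 < r' by rewrite divr_gt0// lt_min r0 !divr_gt0.
have [q q0 hq] := hflow_cont t Dy r'0.
have T0 : 0 <= `|t| + 1 by rewrite addr_ge0.
have [N1 hN1] := hflow_v Dy T0 r'0.
have [N2 hN2] := hflow_unif Dy T0 r'0.
have deriv n s : sderiv (fun s => dot (Z y n s) h) s
    (B (v y n s) (J h) - kappa * dot (Z y n s) (J h)).
  have := vderiv_dotl H h (Zsol y n s).
  by rewrite dot_hfield (dotBl H) (dotZl H kappa) yosidaE.
have close n s : (N1 <= n)%N -> (N2 <= n)%N -> `|s - t| < Num.min q 1 ->
    `|B (v y n s) (J h) - kappa * dot (Z y n s) (J h) - d| <= e.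
  move=> n1 n2; rewrite lt_min => /andP[/hq hs s1].
  have hs' : `|s| <= `|t| + 1 by have := ler_normD (s - t) t; rewrite subrK; lra.
  have a := hN1 n s n1 hs'; have b := hN2 n s n2 hs'.
  have rr : r' + r' = Num.min r (e / 2 / K) by rewrite /r'; field.
  have [Dv Pv] := vPhi n s Dy.
  have h1 : `|B (v y n s) (J h) - B (hflow y t) (J h)| <= e / 2.
    apply: hr => //; apply: le_trans (nrm_triangle H (hflow y s) _ _) _.
    apply: le_trans (lerD a hs) _; rewrite rr ge_min lexx//.
  have h2 : `|kappa * dot (Z y n s) (J h) - kappa * dot (hflow y t) (J h)| <= e / 2.
    rewrite -mulrBr -(dotBl H) normrM.
    apply: le_trans (ler_wpM2l (normr_ge0 _) (CauchySchwarz H _ _)) _.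
    have h3 : nrm (Z y n s - hflow y t) <= e / 2 / K.
      apply: le_trans (nrm_triangle H (hflow y s) _ _) _.
      apply: le_trans (lerD b hs) _; rewrite rr ge_min lexx orbT//.
    rewrite mulrCA; apply: le_trans (ler_wpM2r _ h3) _; first by rewrite mulr_ge0 ?nrm_ge0.
    rewrite mulrAC ler_pdivrMr// ler_pM2l// /K lerDl//.
  have -> : B (v y n s) (J h) - kappa * dot (Z y n s) (J h) - d =
    (B (v y n s) (J h) - B (hflow y t) (J h)) -
    (kappa * dot (Z y n s) (J h) - kappa * dot (hflow y t) (J h)) by rewrite /d; ring.
  apply: le_trans (ler_normB _ _) _; lra.
have mvt n a b : (N1 <= n)%N -> (N2 <= n)%N -> a <= b ->
    (forall c, a <= c <= b -> `|c - t| < Num.min q 1) ->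
    `|dot (Z y n b) h - dot (Z y n a) h - (b - a) * d| <= e * `|b - a|.
  move=> n1 n2 ab hc; have [c /hc cc ->] := sderiv_mvt ab (fun s _ => deriv n s).
  rewrite (mulrC (b - a)) -mulrBl normrM ler_wpM2r//; exact: close.
exists (Num.min q 1); first by rewrite lt_min q0/=.
move=> s sq.
have conv n : (N1 <= n)%N -> (N2 <= n)%N ->
    `|dot (Z y n s) h - dot (Z y n t) h - (s - t) * d| <= e * `|s - t|.
  move=> n1 n2; case: (leP t s) => [ts|/ltW st].
    apply: mvt => // c /andP[tc cs]; apply: le_lt_trans sq.
    by rewrite !ger0_norm ?subr_ge0// lerB.
  have := @mvt n s t n1 n2 st; rewrite (distrC t) => h'.
  rewrite -normrN.
  have -> : - (dot (Z y n s) h - dot (Z y n t) h - (s - t) * d) =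
    dot (Z y n t) h - dot (Z y n s) h - (t - s) * d by ring.
  apply: h' => c /andP[sc ct]; apply: le_lt_trans sq.
  by rewrite !ler0_norm ?subr_le0// !opprB lerB.
apply/ler_addgt0Pr => x xp; have x2 : 0 < x / 2 by rewrite divr_gt0.
have [M1 hM1] := seq_lim_dot H h (hflow_lim s Dy) x2.
have [M2 hM2] := seq_lim_dot H h (hflow_lim t Dy) x2.
pose n := maxn (maxn N1 N2) (maxn M1 M2).
have n1 : (N1 <= n)%N by rewrite !leq_max leqnn.
have n2 : (N2 <= n)%N by rewrite !leq_max leqnn orbT.
have n3 : (M1 <= n)%N by rewrite !leq_max leqnn !orbT.
have n4 : (M2 <= n)%N by rewrite !leq_max leqnn !orbT.
have := conv n n1 n2; have := hM1 n n3; have := hM2 n n4.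
rewrite !ler_norml => a b c; apply/andP; split; lra.
Qed.

Theorem hamiltonian_flow : exists u : R -> V,
  [/\ nrm (u 0 - x0) = 0, forall t, D (u t) /\ Phi (u t) = Phi x0,
      forall t, nrm (u t) = nrm x0, forall t, vcont u t &
      forall t h, D h -> sderiv (fun s => dot (u s) h) t
        (B (u t) (J h) - kappa * dot (u t) (J h))].
Proof.
exists (hflow x0); split.
- exact: hflow0.
- by move=> t; have [? _] := hflow_Phi_le t Dx0; rewrite hflow_Phi.
- by move=> t; exact: hflow_nrm.
- by move=> t; exact: hflow_cont.
- by move=> t h; exact: hflow_deriv.
Qed.

End HamiltonianFlow.

(** * The truncated nonlinearity *)

Section ScalarNonlinearity.
Context (R : realType) (m : R).
Implicit Types s t c g h : R.

(* [al] is the factor of the truncated nonlinearity: [s * al s] equals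
   [s * (m + 2 - ln s^2)] for [s^2 <= e^m] and [2 * s] beyond; [Th] is twice its
   primitive, and [be] bounds its increments. *)
Definition qf s : R := Num.max 0 (m - ln (s ^+ 2)).
Definition al s : R := 2 + qf s.
Definition be s : R := s * (6 + qf s).
Definition Th s : R := s ^+ 2 * (3 + qf s) - Num.max 0 (s ^+ 2 - expR m).

Lemma ln_sqr s : 0 < s -> ln (s ^+ 2) = 2 * ln s.
Proof. by move=> s0; rewrite lnXn// mulr_natl. Qed.

Lemma ln_le_sub1 (x : R) : 0 < x -> ln x <= x - 1.
Proof. by move=> x0; have := expR_ge1Dx (ln x); rewrite lnK ?posrE//; lra. Qed.

Lemma ln_diff s t : 0 < t -> 0 < s -> t * (ln s - ln t) <= s - t.
Proof.
move=> t0 s0; rewrite -ln_div ?posrE//.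
have := ln_le_sub1 (divr_gt0 s0 t0) => /(ler_wpM2l (ltW t0)).
by rewrite mulrBr mulr1 (mulrC t (s / t)) divfK// gt_eqF.
Qed.

Lemma qf_ge0 s : 0 <= qf s. Proof. by rewrite le_max lexx. Qed.
Lemma al_ge0 s : 0 <= al s. Proof. by rewrite addr_ge0 ?qf_ge0. Qed.
Lemma be_ge0 s : 0 <= s -> 0 <= be s.
Proof. by move=> s0; rewrite mulr_ge0// addr_ge0// qf_ge0. Qed.
Lemma be0 : be 0 = 0. Proof. by rewrite /be mul0r. Qed.

Lemma qfE s : 0 < s -> qf s = Num.max 0 (m - 2 * ln s).
Proof. by move=> s0; rewrite /qf ln_sqr. Qed.

Lemma qf_anti s t : 0 < s -> s <= t -> qf t <= qf s.
Proof.
move=> s0 st; have t0 := lt_le_trans s0 st; rewrite !qfE// ge_max !le_max lexx/=.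
by apply/orP; right; rewrite lerD2l lerN2 ler_pM2l// ler_ln ?posrE.
Qed.

Lemma qf_diff s t : 0 < t -> t <= s -> t * (qf t - qf s) <= 2 * (s - t).
Proof.
move=> t0 ts; have s0 := lt_le_trans t0 ts.
have h : qf t - qf s <= 2 * (ln s - ln t).
  have h2 : ln t <= ln s by rewrite ler_ln ?posrE.
  rewrite !qfE// lerBlDr ge_max; apply/andP; split.
    by rewrite addr_ge0 ?le_max ?lexx// mulr_ge0// subr_ge0.
  have : m - 2 * ln s <= Num.max 0 (m - 2 * ln s) by rewrite le_max lexx orbT.
  lra.
have := ler_wpM2l (ltW t0) h; have := ln_diff t0 s0; lra.
Qed.

Lemma qf_scale c s : 0 < c -> c <= 1 -> 0 < s -> qf (c * s) <= qf s - 2 * ln c.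
Proof.
move=> c0 c1 s0; rewrite !qfE ?mulr_gt0// lnM ?posrE//.
have lc : ln c <= 0 by rewrite ln_le0.
have : m - 2 * ln s <= Num.max 0 (m - 2 * ln s) by rewrite le_max lexx orbT.
have : 0 <= Num.max 0 (m - 2 * ln s) by rewrite le_max lexx.
by move=> a b; rewrite ge_max; apply/andP; split; lra.
Qed.

(** Scaling by [c] adds at most -2 ln c to [qf]. With r = sqrt c, -ln r <= 1/r lets half of the
    power of [c] absorb this logarithm. *)
Lemma be_scale c s : 0 <= c -> c <= 1 -> 0 <= s -> be (c * s) <= 2 * Num.sqrt c * be s.
Proof.
rewrite le_eqVlt => /orP[/eqP <- _ _|c0 c1]; first by rewrite mul0r be0 sqrtr0 mulr0 mul0r.
rewrite le_eqVlt => /orP[/eqP <-|s0]; first by rewrite mulr0 be0 mulr0.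
have r0 : 0 < Num.sqrt c by rewrite sqrtr_gt0.
set r := Num.sqrt c in r0 *; have rc : r ^+ 2 = c by rewrite sqr_sqrtr// ltW.
have r1 : r <= 1 by rewrite -sqrtr1 ler_wsqrtr.
have lnr : - ln r <= r^-1.
  by rewrite -lnV ?posrE// (le_trans (ln_le_sub1 _)) ?invr_gt0// gerBl.
have h : qf (c * s) <= qf s + 4 * r^-1.
  apply: le_trans (qf_scale c0 c1 s0) _.
  by rewrite -rc ln_sqr// lerD2l; lra.
rewrite /be -rc -mulrA.
have -> : 2 * r * (s * (6 + qf s)) = s * (2 * r * (6 + qf s)) by ring.
rewrite mulrCA ler_pM2l//.
have h2 := ler_wpM2l (sqr_ge0 r) h.
have e : r ^+ 2 * (qf s + 4 * r^-1) = r ^+ 2 * qf s + 4 * r by field; rewrite gt_eqF.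
rewrite e rc in h2.
have q0 := qf_ge0 s.
have h3 : r ^+ 2 * (6 + qf s) <= r * (6 + qf s).
  by rewrite ler_wpM2r ?addr_ge0// expr2 ger_pMr.
have h4 : 0 <= r * qf s by rewrite mulr_ge0// ltW.
rewrite rc in h3 *; lra.
Qed.

Lemma be_frac s t : 0 < s -> 0 <= t -> t <= s -> be t <= 2 * Num.sqrt (t / s) * be s.
Proof.
move=> s0 t0 ts; have := @be_scale (t / s) s; rewrite divfK ?gt_eqF//; apply.
- by rewrite divr_ge0// ltW.
- by rewrite ler_pdivrMr// mul1r.
- exact: ltW.
Qed.

Lemma be_mul c s : 1 <= c -> 0 <= s -> be (c * s) <= c * be s.
Proof.
move=> c1; rewrite le_eqVlt => /orP[/eqP <-|s0]; first by rewrite mulr0 be0 mulr0.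
have c0 : 0 < c := lt_le_trans ltr01 c1.
rewrite /be mulrA ler_pM2l ?mulr_gt0// lerD2l; apply: qf_anti => //.
by rewrite ler_peMl// ltW.
Qed.

Lemma be_mono s t : 0 <= s -> s <= t -> be s <= 2 * be t.
Proof.
move=> s0 st; have t0 := le_trans s0 st.
move: t0; rewrite le_eqVlt => /orP[/eqP t0|t0].
  have -> : s = 0 by apply: le_anti; rewrite s0 t0 st.
  by rewrite be0 mulr_ge0// be_ge0// t0.
apply: le_trans (be_frac t0 s0 st) _; apply: ler_wpM2r; first exact/be_ge0/ltW.
rewrite -[leRHS]mulr1 ler_pM2l// -[leRHS]sqrtr1 ler_wsqrtr//.
by rewrite ler_pdivrMr// mul1r.
Qed.

(** A substitute for Young's inequality: if h <= N g the first term suffices; otherwise g <= h / N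
    and [be_frac] gains the factor N^(-1/2). *)
Lemma pairing_strong N g h : 1 <= N -> 0 <= g -> 0 <= h ->
  be g * h <= N * (g * be g) + 2 * Num.sqrt N^-1 * (h * be h).
Proof.
move=> N1 g0 h0; have N0 : 0 < N := lt_le_trans ltr01 N1.
have b1 : 0 <= N * (g * be g) by apply: mulr_ge0; [exact: ltW|exact/mulr_ge0/be_ge0].
have b2 : 0 <= 2 * Num.sqrt N^-1 * (h * be h).
  by apply: mulr_ge0; [rewrite mulr_ge0 ?sqrtr_ge0|exact/mulr_ge0/be_ge0].
case: (leP h (N * g)) => hg.
  apply: le_trans (ler_wpM2l (be_ge0 g0) hg) _.
  by rewrite mulrCA (mulrC (be g)) lerDl.
have h1 : 0 < h by apply: le_lt_trans hg; rewrite mulr_ge0// ltW.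
have gN : g <= N^-1 * h by rewrite ler_pdivlMl// ltW.
have gh : g <= h by apply: le_trans gN _; rewrite ger_pMl// invf_le1.
apply: le_trans (_ : 2 * Num.sqrt N^-1 * (h * be h) <= _); last by rewrite lerDr.
rewrite mulrCA (mulrC h) ler_wpM2r//.
apply: le_trans (be_frac h1 g0 gh) _.
rewrite ler_wpM2r ?be_ge0// ler_pM2l// ler_wsqrtr// ler_pdivrMr//.
Qed.

(** Each term covers one regime: h small against g, g small against h, h below [e], and the
    remaining case, where g >= d e makes the logarithm bounded. After integration with bounded
    potential and g small in L^2, every term can be made small. *)
Lemma pairing_weak N d e g h : 1 <= N -> 0 < d -> d <= 1 -> 0 < e -> 0 <= g -> 0 <= h ->
  be g * h <= N^-1 * (g * be g) + 2 * Num.sqrt d * (h * be h)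
    + (6 + qf (d * e)) * (g * h) + 2 * N * (h * be h * (h < e)%R%:R).
Proof.
move=> N1 d0 d1 e0 g0 h0; have N0 : 0 < N := lt_le_trans ltr01 N1.
have q0 := qf_ge0 (d * e).
have b0 : 0 <= h * be h by rewrite mulr_ge0 ?be_ge0.
have b1 : 0 <= N^-1 * (g * be g).
  by apply: mulr_ge0; [rewrite invr_ge0 ltW|exact/mulr_ge0/be_ge0].
have b2 : 0 <= 2 * Num.sqrt d * (h * be h) by apply: mulr_ge0 => //; rewrite mulr_ge0 ?sqrtr_ge0.
have b3 : 0 <= (6 + qf (d * e)) * (g * h) by apply: mulr_ge0; [exact: addr_ge0|exact: mulr_ge0].
have b4 : 0 <= 2 * N * (h * be h * (h < e)%R%:R).
  by apply: mulr_ge0; apply: mulr_ge0 => //; exact: ltW.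
case: (leP (N * h) g) => hg.
  suff : be g * h <= N^-1 * (g * be g) by lra.
  by rewrite ler_pdivlMl// mulrCA (mulrC g) ler_wpM2l ?be_ge0.
have h1 : 0 < h by rewrite -(pmulr_rgt0 _ N0); apply: le_lt_trans hg.
case: (ltP g (d * h)) => gd.
  suff : be g * h <= 2 * Num.sqrt d * (h * be h) by lra.
  rewrite [leRHS]mulrCA (mulrC h) ler_wpM2r//.
  have gh : g <= h by apply: le_trans (ltW gd) _; rewrite ger_pMl.
  apply: le_trans (be_frac h1 g0 gh) _.
  by rewrite ler_wpM2r ?be_ge0// ler_pM2l// ler_wsqrtr// ler_pdivrMr// ltW.
case: (ltP h e) => he.
  suff : be g * h <= 2 * N * (h * be h) by move: b3; rewrite mulr1; lra.
  rewrite [leRHS]mulrCA (mulrC h) ler_wpM2r//.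
  apply: le_trans (be_mono g0 (ltW hg)) _; rewrite -mulrA ler_pM2l//.
  exact: be_mul.
suff : be g * h <= (6 + qf (d * e)) * (g * h) by rewrite !mulr0; lra.
rewrite [leRHS]mulrCA mulrA /be ler_wpM2r//; last first.
have ge : d * e <= g by apply: le_trans gd; rewrite ler_pM2l.
by rewrite ler_wpM2l// lerD2l qf_anti// mulr_gt0.
Qed.

Lemma Th_le s : 0 <= s -> Th s <= s * be s.
Proof.
move=> s0; rewrite /Th /be mulrA -expr2 lerBlDr.
have : 0 <= Num.max 0 (s ^+ 2 - expR m) by rewrite le_max lexx.
have := mulr_ge0 (sqr_ge0 s) (qf_ge0 s); have := sqr_ge0 s.
lra.
Qed.

Lemma Th_ge s : 0 <= s -> s ^+ 2 * (2 + qf s) <= Th s.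
Proof.
move=> s0; rewrite /Th.
have : Num.max 0 (s ^+ 2 - expR m) <= s ^+ 2.
  by rewrite ge_max sqr_ge0 gerBl expR_ge0.
lra.
Qed.

Lemma be_le_Th s : 0 <= s -> s * be s <= 3 * Th s.
Proof.
move=> s0; have := Th_ge s0; rewrite /be mulrA -expr2.
have := mulr_ge0 (sqr_ge0 s) (qf_ge0 s); lra.
Qed.

Lemma Th_ge0 s : 0 <= s -> 0 <= Th s.
Proof.
move=> s0; apply: le_trans (Th_ge s0); rewrite mulr_ge0 ?sqr_ge0//.
by rewrite addr_ge0// qf_ge0.
Qed.

Lemma sqr_le_Th s : 0 <= s -> s ^+ 2 <= Th s.
Proof.
move=> s0; apply: le_trans (Th_ge s0).
have := mulr_ge0 (sqr_ge0 s) (qf_ge0 s); have := sqr_ge0 s; lra.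
Qed.

Lemma Th0 : Th 0 = 0.
Proof. by rewrite /Th expr0n /= mul0r !sub0r max_l ?oppr0// oppr_le0 expR_ge0. Qed.

Lemma Th_small s : 0 < s -> s ^+ 2 <= expR m -> Th s = s ^+ 2 * (m + 3 - ln (s ^+ 2)).
Proof.
move=> s0 sm; rewrite /Th /qf max_r.
  by rewrite max_l ?subr_le0// subr0; ring.
by rewrite subr_ge0 -(expRK m) ler_ln ?posrE ?exprn_gt0 ?expR_gt0.
Qed.

Lemma Th_large s : 0 < s -> expR m <= s ^+ 2 -> Th s = 2 * s ^+ 2 + expR m.
Proof.
move=> s0 sm; rewrite /Th /qf max_l.
  by rewrite max_r ?subr_ge0//; ring.
by rewrite subr_le0 -(expRK m) ler_ln ?posrE ?exprn_gt0 ?expR_gt0.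
Qed.

Lemma al_small s : 0 < s -> s ^+ 2 <= expR m -> al s = m + 2 - ln (s ^+ 2).
Proof.
move=> s0 sm; rewrite /al /qf max_r; first by ring.
by rewrite subr_ge0 -(expRK m) ler_ln ?posrE ?exprn_gt0 ?expR_gt0.
Qed.

Lemma al_large s : 0 < s -> expR m <= s ^+ 2 -> al s = 2.
Proof.
move=> s0 sm; rewrite /al /qf max_l ?addr0//.
by rewrite subr_le0 -(expRK m) ler_ln ?posrE ?exprn_gt0 ?expR_gt0.
Qed.

(** Beyond the truncation this is the tangent inequality of ln at [expR m]. It lets the truncated
    functional control the true energy before any sup bound is known. *)
Lemma Th_ge_log s : 0 <= s -> s ^+ 2 * (m + 3 - ln (s ^+ 2)) <= Th s.
Proof.
rewrite le_eqVlt => /orP[/eqP <-|s0]; first by rewrite Th0 expr0n mul0r.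
case: (leP (s ^+ 2) (expR m)) => sm; first by rewrite Th_small.
rewrite Th_large//; last exact: ltW.
have := @ln_diff (expR m) (s ^+ 2) (exprn_gt0 _ s0) (expR_gt0 _).
rewrite expRK; lra.
Qed.

Lemma sal_mono s t : 0 <= s -> s <= t -> s * al s <= t * al t.
Proof.
rewrite le_eqVlt => /orP[/eqP <- st|s0 st]; first by rewrite mul0r mulr_ge0 ?al_ge0.
have := qf_diff s0 st; have := ler_wpM2r (qf_ge0 t) st; rewrite /al; lra.
Qed.

Lemma Th_tangent_small s t : 0 < s -> 0 < t -> s ^+ 2 <= expR m -> t ^+ 2 <= expR m ->
  Th s + 2 * (s * al s) * (t - s) <= Th t.
Proof.
move=> s0 t0 sm tm; rewrite (Th_small s0 sm) (Th_small t0 tm).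
pose f x := x ^+ 2 * (m + 3 - 2 * ln x).
have df x : 0 < x -> sderiv f x (2 * (x * (m + 2 - 2 * ln x))).
  move=> x0; apply/sderivP; have dl := is_derive1_ln x0.
  apply: is_derive_eq; rewrite /GRing.scale/=; field; by rewrite gt_eqF.
have sq_mono a b : 0 < a -> a <= b -> b ^+ 2 <= expR m -> a ^+ 2 <= expR m.
  by move=> a0 ab; apply: le_trans; rewrite lerXn2r ?nnegrE// ltW// (lt_le_trans a0).
have alE x : 0 < x -> x ^+ 2 <= expR m -> m + 2 - 2 * ln x = al x.
  by move=> x0 xm; rewrite al_small// ln_sqr.
rewrite !ln_sqr// -/(f s) -/(f t).
case: (leP s t) => [st|/ltW ts].
  have [c /andP[sc ct]] := sderiv_mvt st (fun x xst => df x (lt_le_trans s0 (proj1 (andP xst)))).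
  have c0 := lt_le_trans s0 sc; rewrite alE//; last exact: sq_mono tm.
  move=> e; have := sal_mono (ltW s0) sc => h.
  have : (s * al s) * (t - s) <= (c * al c) * (t - s) by rewrite ler_wpM2r ?subr_ge0.
  by move: e; rewrite -/(f s) -/(f t); lra.
have [c /andP[tc cs]] := sderiv_mvt ts (fun x xst => df x (lt_le_trans t0 (proj1 (andP xst)))).
have c0 := lt_le_trans t0 tc; rewrite alE//; last exact: sq_mono sm.
move=> e; have := sal_mono (ltW c0) cs => h.
have : (c * al c) * (s - t) <= (s * al s) * (s - t) by rewrite ler_wpM2r ?subr_ge0.
by move: e; lra.
Qed.

(** The two formulas for [Th] meet at M = e^(m/2). For points on different sides, the tangent
    inequalities are chained at M, where monotonicity of [s * al s] gives the comparison of
    slopes. *)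
Lemma Th_tangent s t : 0 <= s -> 0 <= t -> Th s + 2 * (s * al s) * (t - s) <= Th t.
Proof.
move=> s0 t0.
have [z|s1] := eqVneq s 0; first by rewrite z Th0 mul0r mulr0 mul0r addr0 Th_ge0.
have {s1}sp : 0 < s by rewrite lt_def s1.
have [z|t1] := eqVneq t 0.
  rewrite z Th0 sub0r; have := Th_le s0; rewrite /be /al mulrA -expr2.
  have := Th_ge s0; have : Th s <= s ^+ 2 * (3 + qf s).
    by rewrite gerBl le_max lexx.
  have := mulr_ge0 (sqr_ge0 s) (qf_ge0 s); have := sqr_ge0 s; lra.
have {t1}tp : 0 < t by rewrite lt_def t1.
pose M := expR (m / 2).
have M0 : 0 < M by exact: expR_gt0.
have M2 : M ^+ 2 = expR m.
  by rewrite expr2 -expRD; congr expR; lra.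
have large a b : 0 < a -> 0 < b -> expR m <= a ^+ 2 -> expR m <= b ^+ 2 ->
    Th a + 2 * (a * al a) * (b - a) <= Th b.
  move=> a0 b0 am bm; rewrite !Th_large// al_large//.
  by have := sqr_ge0 (a - b); rewrite sqrrB; lra.
have leM a : 0 < a -> a <= M -> a ^+ 2 <= expR m.
  by move=> a0 aM; rewrite -M2 lerXn2r ?nnegrE// ltW.
have geM a : 0 < a -> M <= a -> expR m <= a ^+ 2.
  by move=> a0 aM; rewrite -M2 lerXn2r ?nnegrE// ltW.
case: (leP s M) => [sM|/ltW sM]; case: (leP t M) => [tM|/ltW tM].
- by apply: Th_tangent_small => //; exact: leM.
- have h1 := large M t M0 tp (geM _ M0 (lexx _)) (geM _ tp tM).
  have h2 := Th_tangent_small sp M0 (leM _ sp sM) (leM _ M0 (lexx _)).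
  have := sal_mono s0 sM => h.
  have : (s * al s) * (t - M) <= (M * al M) * (t - M) by rewrite ler_wpM2r ?subr_ge0.
  lra.
- have h1 := large s M sp M0 (geM _ sp sM) (geM _ M0 (lexx _)).
  have h2 := Th_tangent_small M0 tp (leM _ M0 (lexx _)) (leM _ tp tM).
  have := sal_mono (ltW M0) sM => h.
  have : (M * al M) * (M - t) <= (s * al s) * (M - t) by rewrite ler_wpM2r ?subr_ge0.
  lra.
- by apply: large => //; exact: geM.
Qed.

End ScalarNonlinearity.

(** * Pointwise inequalities for the nonlinearity on the complex plane *)

Section ComplexPointwise.
Context (R : realType).
Implicit Types (z w g h : R[i]) (x : R).

Definition cdot z w : R :=
  complex.Re z * complex.Re w + complex.Im z * complex.Im w.

Lemma ReD z w : complex.Re (z + w) = complex.Re z + complex.Re w.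
Proof. by case: z w => a b [c d]. Qed.
Lemma ImD z w : complex.Im (z + w) = complex.Im z + complex.Im w.
Proof. by case: z w => a b [c d]. Qed.
Lemma ReN z : complex.Re (- z) = - complex.Re z. Proof. by case: z. Qed.
Lemma ImN z : complex.Im (- z) = - complex.Im z. Proof. by case: z. Qed.
Lemma ReZ x z : complex.Re (x%:C%C * z) = x * complex.Re z.
Proof. by case: z => a b /=; rewrite mul0r subr0. Qed.
Lemma ImZ x z : complex.Im (x%:C%C * z) = x * complex.Im z.
Proof. by case: z => a b /=; rewrite mul0r addr0. Qed.
Lemma Rei z : complex.Re ('i%C * z) = - complex.Im z.
Proof. by case: z => a b /=; rewrite mul0r mul1r sub0r. Qed.
Lemma Imi z : complex.Im ('i%C * z) = complex.Re z.
Proof. by case: z => a b /=; rewrite mul0r mul1r add0r. Qed.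
Definition cpx := (ReD, ImD, ReN, ImN, ReZ, ImZ, Rei, Imi).

(** The complex plane as an instance of the abstract theory, from which [cmod] inherits its
    inequalities. *)
Lemma cdot_semi_inner : @semi_inner R (Rcomplex R) cdot.
Proof.
split.
- by move=> z w; rewrite /cdot; ring.
- by move=> [a b] [c d] [e f]; rewrite /cdot /=; ring.
- by move=> x [a b] [c d]; rewrite /cdot /=; ring.
- by move=> z; rewrite addr_ge0 ?sqr_ge0.
Qed.

Lemma cmodE z : cmod z = @nrm R (Rcomplex R) cdot z.
Proof. by case: z => a b; rewrite /cmod /nrm /cdot /= !expr2. Qed.

Lemma cmod_ge0 z : 0 <= cmod z. Proof. by rewrite cmodE nrm_ge0. Qed.
Lemma cmod_sqr z : cmod z ^+ 2 = cdot z z.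
Proof. by rewrite cmodE (nrm_sqr cdot_semi_inner). Qed.
Lemma cmod0 : cmod (0 : R[i]) = 0. Proof. by rewrite cmodE (nrm0 cdot_semi_inner). Qed.
Lemma cdotC z w : cdot z w = cdot w z. Proof. exact: dotC cdot_semi_inner _ _. Qed.
Lemma cdot_norm_le z w : `|cdot z w| <= cmod z * cmod w.
Proof. by rewrite !cmodE; exact: (CauchySchwarz cdot_semi_inner). Qed.
Lemma cdot_le z w : cdot z w <= cmod z * cmod w.
Proof. exact: le_trans (ler_norm _) (cdot_norm_le _ _). Qed.
Lemma cmodD z w : cmod (z + w) <= cmod z + cmod w.
Proof. by rewrite !cmodE; exact: (nrmD cdot_semi_inner). Qed.
Lemma cmodN z : cmod (- z) = cmod z.
Proof. by rewrite !cmodE; exact: (nrmN cdot_semi_inner). Qed.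
Lemma cmodB z w : cmod (z - w) <= cmod z + cmod w.
Proof. by rewrite -(cmodN w) cmodD. Qed.
Lemma cmodC z w : cmod (z - w) = cmod (w - z). Proof. by rewrite -opprB cmodN. Qed.
Lemma cmod_diff z w : `|cmod z - cmod w| <= cmod (z - w).
Proof. by rewrite !cmodE; exact: (nrm_diff cdot_semi_inner). Qed.
Lemma cmodZ x z : cmod (x%:C%C * z) = `|x| * cmod z.
Proof.
rewrite !cmodE /nrm /cdot !cpx.
have -> : x * complex.Re z * (x * complex.Re z) + x * complex.Im z * (x * complex.Im z)
  = x ^+ 2 * (complex.Re z * complex.Re z + complex.Im z * complex.Im z) by ring.
by rewrite sqrtrM ?sqr_ge0// sqrtr_sqr.
Qed.
Lemma cmodi z : cmod ('i%C * z) = cmod z.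
Proof. by rewrite !cmodE /nrm /cdot !cpx mulrNN addrC. Qed.
Lemma cmod_Re z : `|complex.Re z| <= cmod z.
Proof.
rewrite -(sqrtr_sqr (complex.Re z)) cmodE /nrm ler_wsqrtr// /cdot -!expr2 lerDl sqr_ge0//.
Qed.
Lemma cmod_Im z : `|complex.Im z| <= cmod z.
Proof.
rewrite -(sqrtr_sqr (complex.Im z)) cmodE /nrm ler_wsqrtr// /cdot -!expr2 lerDr sqr_ge0//.
Qed.
Lemma cmod_eq0 z : cmod z = 0 -> z = 0.
Proof.
move=> z0; have := cmod_Re z; have := cmod_Im z; rewrite z0 !normr_le0.
by case: z {z0} => a b /= /eqP -> /eqP ->.
Qed.

Lemma Re_mul_conj z w : complex.Re (z * w^*%C) = cdot z w.
Proof. by case: z w => a b [c d]; rewrite /cdot /=; ring. Qed.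

Variable m : R.
Local Notation al := (al m).
Local Notation be := (be m).

Definition cal z : R[i] := (al (cmod z))%:C%C * z.
Definition cTh z : R := Th m (cmod z).
Definition cbe z : R := be (cmod z).

Lemma cbe_ge0 z : 0 <= cbe z. Proof. exact/be_ge0/cmod_ge0. Qed.
Lemma cTh_ge0 z : 0 <= cTh z. Proof. exact/Th_ge0/cmod_ge0. Qed.

Lemma cdot_cal z w : cdot (cal z) w = al (cmod z) * cdot z w.
Proof. by rewrite /cal /cdot !cpx; ring. Qed.

Lemma cTh_tangent z w : cTh z + 2 * cdot (cal z) (w - z) <= cTh w.
Proof.
apply: le_trans (Th_tangent m (cmod_ge0 z) (cmod_ge0 w)).
rewrite /cTh lerD2l -mulrA ler_pM2l// cdot_cal (mulrC (cmod z)) -mulrA.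
rewrite ler_wpM2l ?al_ge0//.
have -> : cdot z (w - z) = cdot z w - cdot z z by rewrite /cdot !cpx; ring.
rewrite mulrBr -expr2 cmod_sqr lerD2r; exact: cdot_le.
Qed.

(** The pairing equals (phi |w| - phi |z|) Re (z conj (i w)). The last factor vanishes for z = w, so
    it is at most |z - w| times the smaller modulus, which pays for the singularity of [phi] at
    0. *)
Lemma radial_commutator (phi : R -> R) z w :
  (forall s t, 0 < t -> t <= s -> t * `|phi t - phi s| <= 2 * (s - t)) ->
  `|cdot ((phi (cmod z))%:C%C * z - (phi (cmod w))%:C%C * w) ('i%C * (z - w))|
    <= 2 * cmod (z - w) ^+ 2.
Proof.
move=> hphi.
have -> : cdot ((phi (cmod z))%:C%C * z - (phi (cmod w))%:C%C * w) ('i%C * (z - w)) =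
   (phi (cmod w) - phi (cmod z)) * cdot z ('i%C * w).
  by rewrite /cdot !cpx; ring.
have h1 : `|cdot z ('i%C * w)| <= cmod (z - w) * cmod w.
  have -> : cdot z ('i%C * w) = cdot (z - w) ('i%C * w) by rewrite /cdot !cpx; ring.
  by rewrite -(cmodi w) cdot_norm_le.
have h2 : `|cdot z ('i%C * w)| <= cmod (z - w) * cmod z.
  have -> : cdot z ('i%C * w) = cdot (z - w) ('i%C * z) by rewrite /cdot !cpx; ring.
  by rewrite -(cmodi z) cdot_norm_le.
have wlogh s t c : 0 <= t -> t <= s -> 0 <= c -> s - t <= c -> forall y, y <= c * t ->
   `|phi t - phi s| * y <= 2 * c ^+ 2.
  move=> t0 ts c0 stc y yt; move: t0; rewrite le_eqVlt => /orP[/eqP t0|t0].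
    rewrite -t0 mulr0 in yt; rewrite (@le_trans _ _ 0)//; last by rewrite mulr_ge0// sqr_ge0.
    by rewrite mulr_ge0_le0.
  apply: le_trans (ler_wpM2l (normr_ge0 _) yt) _.
  have := ler_wpM2l c0 (hphi s t t0 ts); have := ler_wpM2l c0 stc.
  rewrite expr2; lra.
have d := cmod_diff z w; move: d; rewrite ler_norml => /andP[d1 d2].
rewrite normrM; case: (leP (cmod w) (cmod z)) => wz.
  by apply: (wlogh (cmod z)) => //; rewrite ?cmod_ge0//.
rewrite distrC; apply: (wlogh (cmod w)) => //; rewrite ?cmod_ge0 ?(ltW wz)//.
by move: d1; lra.
Qed.

Lemma cal_acc z w : `|cdot (cal z - cal w) ('i%C * (z - w))| <= 2 * cmod (z - w) ^+ 2.
Proof.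
apply: radial_commutator => s t t0 ts; rewrite /al.
have -> : 2 + qf m t - (2 + qf m s) = qf m t - qf m s by ring.
by rewrite ger0_norm ?subr_ge0 ?qf_anti// qf_diff.
Qed.

Lemma cal_gauge z : cdot (cal z) ('i%C * z) = 0.
Proof. by rewrite /cal /cdot !cpx; ring. Qed.

(** Origin of the 6 in [be]. For |w| <= |z| the increment splits as al(|z|) (z - w) plus (al(|z|) -
    al(|w|)) w. The second part is at most 2 |z - w|; in the first, |z - w| <= 2 |z| gives qf |z| <=
    qf |z - w| + 2, to which [al] adds 2. *)
Lemma cal_diff z w : cmod (cal z - cal w) <= cbe (z - w).
Proof.
wlog wz : z w / cmod w <= cmod z.
  move=> W; case: (leP (cmod w) (cmod z)) => [|/ltW]; first exact: W.
  by move=> /W; rewrite cmodC /cbe (cmodC w z).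
have -> : cal z - cal w =
   (al (cmod z))%:C%C * (z - w) + (al (cmod z) - al (cmod w))%:C%C * w.
  apply/eqP; rewrite eq_complex; apply/andP; split; apply/eqP; rewrite /cal !cpx; ring.
apply: le_trans (cmodD _ _) _; rewrite !cmodZ ger0_norm ?al_ge0//.
have [d0|d0] := eqVneq (cmod (z - w)) 0.
  have := cmod_diff z w; rewrite d0 normr_le0 subr_eq0 => /eqP ->.
  by rewrite subrr normr0 mul0r mulr0 addr0 /cbe d0 be0.
have dp : 0 < cmod (z - w) by rewrite lt_def d0 cmod_ge0.
have dz : cmod (z - w) <= 2 * cmod z by have := cmodB z w; lra.
have h1 : `|al (cmod z) - al (cmod w)| * cmod w <= 2 * cmod (z - w).
  have := cmod_ge0 w; rewrite le_eqVlt => /orP[/eqP <-|w0].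
    by rewrite mulr0 mulr_ge0// cmod_ge0.
  rewrite distrC /al (_ : 2 + _ - _ = qf m (cmod w) - qf m (cmod z)); last by ring.
  rewrite ger0_norm ?subr_ge0 ?qf_anti// mulrC; apply: le_trans (qf_diff m w0 wz) _.
  by rewrite ler_pM2l//; apply: le_trans (ler_norm _) (cmod_diff _ _).
have h2 : qf m (cmod z) <= qf m (cmod (z - w)) + 2.
  apply: le_trans (_ : qf m (2^-1 * cmod (z - w)) <= _).
    by apply: qf_anti; [rewrite mulr_gt0|lra].
  apply: le_trans (qf_scale m _ _ dp) _; [lra|lra|].
  rewrite lerD2l lnV ?posrE// mulrN opprK.
  by have := @ln_le_sub1 R 2; rewrite ltr0n => /(_ isT); lra.
have h3 := ler_wpM2r (cmod_ge0 (z - w)) h2.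
rewrite /cbe /be /al; move: h1 h3; rewrite /al; lra.
Qed.

Lemma cal0 : cal 0 = 0. Proof. by rewrite /cal mulr0. Qed.

Lemma cal_le z : cmod (cal z) <= cbe z.
Proof. by have := cal_diff z 0; rewrite cal0 !subr0. Qed.

Lemma cdot_calB z w h : `|cdot (cal z) h - cdot (cal w) h| <= cbe (z - w) * cmod h.
Proof.
have -> : cdot (cal z) h - cdot (cal w) h = cdot (cal z - cal w) h.
  by rewrite /cdot !cpx; ring.
apply: le_trans (cdot_norm_le _ _) _; rewrite ler_wpM2r ?cmod_ge0//; exact: cal_diff.
Qed.

Lemma cbe_scale x z : 0 <= x -> x <= 1 -> cbe (x%:C%C * z) <= 2 * Num.sqrt x * cbe z.
Proof. by move=> x0 x1; rewrite /cbe cmodZ ger0_norm// be_scale// cmod_ge0. Qed.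

(** The tangent at the displaced point bounds the increment; moving that tangent back to [z] costs
    [be] of the displacement, hence an error of order x sqrt x. *)
Lemma cTh_gateaux z h x : 0 <= x -> x <= 1 ->
  cTh (z + x%:C%C * h) <= cTh z + 2 * x * cdot (cal z) h
     + 4 * x * Num.sqrt x * (cmod h * cbe h).
Proof.
move=> x0 x1; set w := z + x%:C%C * h.
have := cTh_tangent w z.
have -> : cdot (cal w) (z - w) = - (x * cdot (cal w) h) by rewrite /w /cdot !cpx; ring.
have := cdot_calB w z h; rewrite (_ : w - z = x%:C%C * h); last by rewrite /w addrAC subrr add0r.
rewrite ler_norml => /andP[_ h1] h2.
have h3 := ler_wpM2r (cmod_ge0 h) (cbe_scale h x0 x1).
have := ler_wpM2l x0 (le_trans h1 h3); lra.
Qed.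

Lemma cTh_deriv z h x : sderiv (fun x => cTh (z + x%:C%C * h)) x
  (2 * cdot (cal (z + x%:C%C * h)) h).
Proof.
move=> e e0; pose K := 4 * (cmod h * cbe h) + 1.
have K0 : 0 < K by rewrite /K ltr_wpDl// mulr_ge0// mulr_ge0 ?cmod_ge0 ?cbe_ge0.
pose r := Num.min 1 ((e / K) ^+ 2).
have r0 : 0 < r by rewrite lt_min ltr01 exprn_gt0// divr_gt0.
exists r => // y yr; set d := `|y - x| in yr *.
have d0 : 0 <= d by rewrite /d.
have [d1 d2] : d <= 1 /\ d <= (e / K) ^+ 2.
  by move: yr; rewrite lt_min => /andP[/ltW ? /ltW ?].
set a := z + x%:C%C * h; set b := z + y%:C%C * h.
have ba : b - a = (y - x)%:C%C * h.
  by apply/eqP; rewrite eq_complex; apply/andP; split; apply/eqP; rewrite /a /b !cpx; ring.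
have t1 := cTh_tangent a b; have t2 := cTh_tangent b a.
have e1 : cdot (cal a) (b - a) = (y - x) * cdot (cal a) h by rewrite ba /cdot !cpx; ring.
have e2 : cdot (cal b) (a - b) = - ((y - x) * cdot (cal b) h).
  by rewrite -opprB ba /cdot !cpx; ring.
rewrite e1 in t1; rewrite e2 in t2.
have cb : `|cdot (cal b) h - cdot (cal a) h| <= 2 * Num.sqrt d * cbe h * cmod h.
  apply: le_trans (cdot_calB b a h) _; rewrite ler_wpM2r ?cmod_ge0// ba.
  have -> : cbe ((y - x)%:C%C * h) = cbe (d%:C%C * h).
    by rewrite /cbe !cmodZ /d normr_id.
  exact: cbe_scale.
have s1 : Num.sqrt d <= e / K.
  rewrite -(ger0_norm (ltW (divr_gt0 e0 K0))) -sqrtr_sqr ler_wsqrtr//.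
have key : `|(y - x) * (cdot (cal b) h - cdot (cal a) h)| <= d * (e / 2).
  rewrite normrM -/d ler_wpM2l//; apply: le_trans cb _.
  have hh : 0 <= cmod h * cbe h by rewrite mulr_ge0 ?cmod_ge0 ?cbe_ge0.
  have := ler_wpM2r hh s1.
  have : e / K * (4 * (cmod h * cbe h) + 1) = e by rewrite -/K divfK// gt_eqF.
  have : 0 <= e / K by rewrite divr_ge0 ?ltW.
  by move: (e / K) => k; lra.
move: key; rewrite !ler_norml -/a -/b => /andP[k1 k2].
have := mulr_ge0 d0 (ltW e0); rewrite (mulrC e d).
by move=> k3; apply/andP; split; lra.
Qed.

(** Mean value theorem for x -> cTh (g + x z) - cTh (x z) on [0, 1]: the derivative compares [cal]
    at two points that differ by [g], and [cal_diff] depends on that difference alone. *)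
Lemma brezis_lieb z g : `|cTh (z + g) - cTh z - cTh g| <= 2 * (cbe g * cmod z).
Proof.
pose f x := cTh (g + x%:C%C * z) - cTh (0 + x%:C%C * z).
have df x (_ : 0 <= x <= 1) : sderiv f x
    (2 * cdot (cal (g + x%:C%C * z)) z - 2 * cdot (cal (0 + x%:C%C * z)) z).
  exact: sderivB (cTh_deriv _ _ _) (cTh_deriv _ _ _).
have [c _] := sderiv_mvt ler01 df.
rewrite /f !mul1r !mul0r !addr0 !add0r subr0 mulr1 {4}/cTh cmod0 Th0 subr0 => e.
rewrite (addrC z) e -mulrBr normrM ger0_norm// ler_pM2l//.
apply: le_trans (cdot_calB _ _ _) _.
by rewrite (_ : g + _ - _ = g)// addrK.
Qed.

End ComplexPointwise.

(** * Integration on the line *)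

Section RealIntegrals.
Context (R : realType).
Local Notation mu := (@lebesgue_measure R).
Implicit Types f g : R -> R.

Definition meas f : Prop := measurable_fun setT (f : measurableTypeR R -> R).
Definition Itg f : Prop := mu.-integrable setT (EFin \o f).
Definition Int f : R := (\int[mu]_x f x)%R.

Lemma ae_imp (P Q : R -> Prop) : (forall x, P x -> Q x) ->
  {ae mu, forall x, P x} -> {ae mu, forall x, Q x}.
Proof. by move=> PQ; apply: filterS => //; exact: (ae_filter_ringOfSetsType mu). Qed.

Lemma ae_and (P Q : R -> Prop) : {ae mu, forall x, P x} -> {ae mu, forall x, Q x} ->
  {ae mu, forall x, P x /\ Q x}.
Proof. by move=> hP hQ; apply: filterI => //; exact: (ae_filter_ringOfSetsType mu). Qed.

Lemma ae_all (P : R -> Prop) : (forall x, P x) -> {ae mu, forall x, P x}.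
Proof.
move=> hP; exists set0; split => //; rewrite ?measure0//.
by move=> x /=; have := hP x.
Qed.

Lemma meas_EFin f : meas f ->
  measurable_fun (setT : set (g_sigma_algebraType R.-ocitv.-measurable)) (EFin \o f).
Proof. by move=> /measurable_EFinP. Qed.

Lemma Itg_meas f : Itg f -> meas f.
Proof. by move=> /measurable_int /measurable_EFinP. Qed.

Lemma ItgD f g : Itg f -> Itg g -> Itg (fun x => f x + g x).
Proof. by move=> hf hg; apply: eq_integrable (integrableD _ hf hg). Qed.

Lemma ItgZ (k : R) f : Itg f -> Itg (fun x => k * f x).
Proof. by move=> hf; apply: eq_integrable (integrableZl _ k hf). Qed.

Lemma ItgN f : Itg f -> Itg (fun x => - f x).
Proof. by move=> hf; apply: eq_integrable (integrableN hf). Qed.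

Lemma ItgB f g : Itg f -> Itg g -> Itg (fun x => f x - g x).
Proof. by move=> hf hg; exact: ItgD hf (ItgN hg). Qed.

Lemma Itg0 : Itg (fun=> 0).
Proof. exact: integrable0. Qed.

Lemma Itg_le f g : meas f -> (forall x, `|f x| <= g x) -> Itg g -> Itg f.
Proof.
move=> mf fg ig; apply: (le_integrable _ _ _ ig) => //; first exact: meas_EFin.
by move=> x _ /=; rewrite lee_fin (le_trans (fg x))// ler_norm.
Qed.

Lemma Itg_abs f : Itg f -> Itg (fun x => `|f x|).
Proof. by move=> hf; apply: eq_integrable (integrable_abse hf). Qed.

Lemma IntD f g : Itg f -> Itg g -> Int (fun x => f x + g x) = Int f + Int g.
Proof. by move=> hf hg; rewrite /Int RintegralD. Qed.

Lemma IntB f g : Itg f -> Itg g -> Int (fun x => f x - g x) = Int f - Int g.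
Proof. by move=> hf hg; rewrite /Int RintegralB. Qed.

Lemma IntZ (k : R) f : Itg f -> Int (fun x => k * f x) = k * Int f.
Proof. by move=> hf; rewrite /Int RintegralZl. Qed.

Lemma IntN f : Itg f -> Int (fun x => - f x) = - Int f.
Proof.
move=> hf; rewrite -mulN1r -IntZ//; congr Int; apply/funext => x; rewrite mulN1r//.
Qed.

Lemma Int0 : Int (fun=> 0) = 0.
Proof. by rewrite /Int /Rintegral integral0. Qed.

Lemma Int_le f g : Itg f -> Itg g -> (forall x, f x <= g x) -> Int f <= Int g.
Proof. by move=> hf hg fg; rewrite /Int le_Rintegral// => x _; exact: fg. Qed.

Lemma Int_ge0 f : (forall x, 0 <= f x) -> 0 <= Int f.
Proof. by move=> f0; rewrite /Int Rintegral_ge0. Qed.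

Lemma Int_abs f g : Itg f -> Itg g -> (forall x, `|f x| <= g x) -> `|Int f| <= Int g.
Proof.
move=> hf hg fg; rewrite ler_norml -(IntN hg); apply/andP; split.
  by apply: Int_le => //; [exact: ItgN|move=> x; have := fg x; rewrite ler_norml => /andP[]].
by apply: Int_le => // x; exact: le_trans (ler_norm _) (fg x).
Qed.

Lemma IntE f : Itg f -> (\int[mu]_x (f x)%:E)%E = (Int f)%:E.
Proof. by move=> hf; rewrite /Int /Rintegral fineK//; exact: integrable_fin_num. Qed.

Lemma ge0_ItgP f : meas f -> (forall x, 0 <= f x) ->
  Itg f <-> (\int[mu]_x (f x)%:E < +oo)%E.
Proof.
move=> mf f0; split => [|h]; first by move=> /IntE ->; rewrite ltry.
apply/integrableP; split; first exact: meas_EFin.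
by under eq_integral => x _ do rewrite [`|_|%E]gee0_abs ?lee_fin//.
Qed.

Lemma Int_ae f g : Itg f -> meas g -> {ae mu, forall x, f x = g x} ->
  Itg g /\ Int g = Int f.
Proof.
move=> hf mg fg; have mf := Itg_meas hf.
have fg' : ae_eq mu setT (EFin \o f) (EFin \o g).
  by apply: ae_imp fg => x /= -> _.
split; last first.
  rewrite /Int /Rintegral; congr fine; apply/esym/ae_eq_integral => //; exact: meas_EFin.
apply/integrableP; split; first exact: meas_EFin.
move/integrableP : hf => [_].
rewrite (@ae_eq_integral _ _ _ mu setT (fun x => `|(g x)%:E|%E) (fun x => `|(f x)%:E|%E))//.
- by apply: measurableT_comp => //; exact: meas_EFin.
- by apply: measurableT_comp => //; exact: meas_EFin.
- by apply: ae_imp fg => x /= -> _.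
Qed.

Lemma Int_eq0 f : Itg f -> (forall x, 0 <= f x) -> Int f = 0 ->
  {ae mu, forall x, f x = 0}.
Proof.
move=> hf f0 if0.
have : ae_eq mu setT (EFin \o f) (cst 0%E).
  apply/(ae_eq_integral_abs mu measurableT (meas_EFin (Itg_meas hf))).
  under eq_integral => x _ do rewrite [`|_|%E]gee0_abs ?lee_fin//.
  by rewrite IntE// if0.
by apply: ae_imp => x /= /(_ I) [].
Qed.

Lemma Int_fatou (f_ : nat -> R -> R) f c : (forall n, Itg (f_ n)) ->
  (forall n x, 0 <= f_ n x) -> meas f -> (forall n, Int (f_ n) <= c) ->
  {ae mu, forall x, f_ n x @[n --> \oo] --> f x} -> (forall x, 0 <= f x) ->
  Itg f /\ Int f <= c.
Proof.
move=> hf f0 mf fc cf fp.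
have mf_ n := meas_EFin (Itg_meas (hf n)).
(* The exceptional null set is removed from the domain, so that the lower limit equals [f] at every
   remaining point. *)
have [N [mN N0 subN]] := cf.
have lemf : (\int[mu]_x (f x)%:E <= c%:E)%E.
  rewrite (@ge0_negligible_integral _ _ _ _ _ N)//; first last.
  - by move=> x _; rewrite lee_fin.
  - exact: meas_EFin.
  have mTN : measurable ([set: measurableTypeR R] `\` N) by exact: measurableD.
  have -> : (\int[mu]_(x in [set: R] `\` N) (f x)%:E =
      \int[mu]_(x in [set: R] `\` N) limn_einf (fun n => (f_ n x)%:E))%E.
    apply: eq_integral => x /set_mem[_ Nx].
    have cx : f_ n x @[n --> \oo] --> f x by apply: contrapT => /subN.
    have cE : (f_ n x)%:E @[n --> \oo] --> (f x)%:E by apply: cvg_EFin cx; exact: nearW.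
    rewrite is_cvg_limn_einfE; first by apply/esym/cvg_lim.
    by apply/cvg_ex; eexists; exact: cE.
  apply: le_trans (fatou mu mTN (fun n => measurable_funS measurableT (@subsetT _ _) (mf_ n)) _) _.
    by move=> n x _; rewrite lee_fin.
  rewrite limn_einf_lim; apply: lime_le; first exact: is_cvg_einfs.
  apply: nearW => n; apply: ge_ereal_inf.
  exists (\int[mu]_(x in [set: R] `\` N) (EFin \o f_ n) x)%E; first by exists n => /=.
  rewrite -(@ge0_negligible_integral _ _ _ _ setT N)//; last first.
    by move=> x _; rewrite lee_fin.
  by rewrite IntE// lee_fin.
have hi : Itg f by apply/ge0_ItgP => //; apply: le_lt_trans lemf (ltry _).
by split => //; move: lemf; rewrite IntE// lee_fin.
Qed.

Lemma Int_dominated (f_ : nat -> R -> R) f g : (forall n, meas (f_ n)) -> meas f ->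
  Itg g -> (forall n x, `|f_ n x| <= g x) ->
  {ae mu, forall x, f_ n x @[n --> \oo] --> f x} ->
  Itg f /\ forall e, 0 < e -> exists N, forall n, (N <= n)%N -> `|Int (f_ n) - Int f| <= e.
Proof.
move=> mf_ mf ig fg cf.
have hn n : Itg (f_ n) by apply: Itg_le ig.
have [||||intf _ cv] := @dominated_convergence _ _ _ mu setT measurableT
  (fun n => EFin \o f_ n) (EFin \o f) (EFin \o g) _ _ _ ig.
- by move=> n; exact: meas_EFin.
- exact: meas_EFin.
- by apply: ae_imp cf => x cx _; apply: cvg_EFin cx; exact: nearW.
- by apply: ae_all => x n _; rewrite lee_fin.
split => // e e0.
have : (fun n => (Int (f_ n))%:E) @ \oo --> (Int f)%:E.
  rewrite -IntE//; apply: cvg_trans cv; apply: near_eq_cvg; apply: nearW => n /=.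
  by rewrite IntE.
move=> /fine_cvg /= /cvgrPdist_le/(_ _ e0) [N _ hN].
by exists N => n Nn; rewrite distrC; exact: hN.
Qed.

Lemma cauchy_slim (u : nat -> R) :
  (forall e, 0 < e -> exists N, forall m n, (N <= m)%N -> (N <= n)%N -> `|u m - u n| <= e) ->
  cvgn u.
Proof.
move=> h; apply/cauchy_cvgP/cauchy_ballP => e e0.
have e2 : 0 < e / 2 by rewrite divr_gt0.
have [N hN] := h _ e2.
exists ([set u n | n in [set n | (N <= n)%N]], [set u n | n in [set n | (N <= n)%N]]).
  by split; exists N => // n Nn; exists n.
move=> [_ _] [/= [m Nm <-] [n Nn <-]]; apply: le_lt_trans (hN _ _ Nm Nn) _; lra.
Qed.

End RealIntegrals.

(** * Square-integrable complex functions and their completeness *)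

Section L2Functions.
Context (R : realType).
Local Notation mu := (@lebesgue_measure R).
Implicit Types (f g : R -> R) (u v : R -> R[i]).

Lemma cmod_le_ReIm (z : R[i]) : cmod z <= `|complex.Re z| + `|complex.Im z|.
Proof.
rewrite cmodE; apply: nrm_le; first by rewrite addr_ge0.
have : 0 <= `|complex.Re z| * `|complex.Im z| by rewrite mulr_ge0.
by rewrite /cdot -!expr2 sqrrD !real_normK ?num_real//; lra.
Qed.

Lemma meas_comp (phi : R -> R) f : measurable_fun setT phi -> meas f ->
  meas (fun x => phi (f x)).
Proof. by move=> hphi hf; exact: (measurableT_comp hphi hf). Qed.
Lemma meas_cst (c : R) : meas (fun=> c). Proof. exact: measurable_cst. Qed.
Lemma measD f g : meas f -> meas g -> meas (fun x => f x + g x).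
Proof. exact: measurable_funD. Qed.
Lemma measB f g : meas f -> meas g -> meas (fun x => f x - g x).
Proof. exact: measurable_funB. Qed.
Lemma measM f g : meas f -> meas g -> meas (fun x => f x * g x).
Proof. exact: measurable_funM. Qed.
Lemma measN f : meas f -> meas (fun x => - f x).
Proof.
move=> hf; have := measM (meas_cst (-1)) hf; apply: eq_measurable_fun => x _.
by rewrite mulN1r.
Qed.
Lemma meas_max f g : meas f -> meas g -> meas (fun x => Num.max (f x) (g x)).
Proof. exact: measurable_maxr. Qed.
Lemma meas_sqr f : meas f -> meas (fun x => f x ^+ 2).
Proof. exact: measurable_funX. Qed.
Lemma meas_abs f : meas f -> meas (fun x => `|f x|).
Proof. by move=> hf; apply: (measurableT_comp (@normr_measurable R setT) hf). Qed.
Lemma meas_sqrt f : meas f -> meas (fun x => Num.sqrt (f x)).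
Proof.
by move=> hf; apply: meas_comp => //; apply: continuous_measurable_fun; exact: sqrt_continuous.
Qed.
Lemma meas_ln f : meas f -> meas (fun x => ln (f x)).
Proof. by move=> hf; apply: meas_comp => //; exact: measurable_ln. Qed.

Lemma cmeas_cdot u v : cmeasurable u -> cmeasurable v ->
  meas (fun x => cdot (u x) (v x)).
Proof. by move=> [a b] [c d]; apply: measD; apply: measM. Qed.
Lemma cmeas_cmod u : cmeasurable u -> meas (fun x => cmod (u x)).
Proof.
move=> hu; have := meas_sqrt (cmeas_cdot hu hu); apply: eq_measurable_fun => x _.
by rewrite cmodE.
Qed.
Lemma cmeasD u v : cmeasurable u -> cmeasurable v -> cmeasurable (fun x => u x + v x).
Proof.
move=> [a b] [c d]; split.
  by have := measD a c; apply: eq_measurable_fun => x _; rewrite ReD.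
by have := measD b d; apply: eq_measurable_fun => x _; rewrite ImD.
Qed.
Lemma cmeasN u : cmeasurable u -> cmeasurable (fun x => - u x).
Proof.
move=> [a b]; split.
  by have := measN a; apply: eq_measurable_fun => x _; rewrite ReN.
by have := measN b; apply: eq_measurable_fun => x _; rewrite ImN.
Qed.
Lemma cmeasB u v : cmeasurable u -> cmeasurable v -> cmeasurable (fun x => u x - v x).
Proof. by move=> hu hv; exact: cmeasD hu (cmeasN hv). Qed.
Lemma cmeasM f u : meas f -> cmeasurable u -> cmeasurable (fun x => (f x)%:C%C * u x).
Proof.
move=> hf [a b]; split.
  by have := measM hf a; apply: eq_measurable_fun => x _; rewrite ReZ.
by have := measM hf b; apply: eq_measurable_fun => x _; rewrite ImZ.
Qed.
Lemma cmeasZ (c : R) u : cmeasurable u -> cmeasurable (fun x => c%:C%C * u x).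
Proof. by move=> hu; exact: cmeasM (meas_cst c) hu. Qed.
Lemma cmeasi u : cmeasurable u -> cmeasurable (fun x => 'i%C * u x).
Proof.
move=> [a b]; split.
  by have := measN b; apply: eq_measurable_fun => x _; rewrite Rei.
by move: a; apply: eq_measurable_fun => x _; rewrite Imi.
Qed.
Lemma cmeas0 : cmeasurable (fun=> 0 : R[i]).
Proof. by split; exact: meas_cst. Qed.

Definition L2c u : Prop := cmeasurable u /\ Itg (fun x => cmod (u x) ^+ 2).
Definition sqn u : R := Int (fun x => cmod (u x) ^+ 2).

Lemma Lnorm2E u : L2norm u = ((\int[mu]_x (cmod (u x) ^+ 2)%:E) `^ 2^-1)%E.
Proof.
rewrite /L2norm unlock; congr (_ `^ _)%E; apply: eq_integral => x _.
by rewrite gee0_abs ?lee_fin ?cmod_ge0// poweR_EFin powR_mulrn ?cmod_ge0.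
Qed.

Lemma L2P u : L2 u <-> L2c u.
Proof.
split=> -[mu_ h]; split => //.
  apply/ge0_ItgP; [exact: meas_sqr (cmeas_cmod mu_)|by move=> x; rewrite sqr_ge0|].
  by move: h; rewrite Lnorm2E; apply: lty_poweRy; rewrite invr_neq0.
by rewrite Lnorm2E poweR_lty// IntE// ltry.
Qed.

Lemma L2normE u : L2c u -> L2norm u = (Num.sqrt (sqn u))%:E.
Proof.
move=> [_ hu]; rewrite Lnorm2E IntE// poweR_EFin powR12_sqrt//.
by apply: Int_ge0 => x; rewrite sqr_ge0.
Qed.

Lemma sqn_ge0 u : 0 <= sqn u. Proof. by apply: Int_ge0 => x; rewrite sqr_ge0. Qed.

Lemma Itg_cdot u v : L2c u -> L2c v -> Itg (fun x => cdot (u x) (v x)).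
Proof.
move=> [mu_ hu] [mv hv]; apply: Itg_le (ItgD hu hv); first exact: cmeas_cdot.
move=> x; apply: le_trans (cdot_norm_le _ _) _.
have := sqr_ge0 (cmod (u x) - cmod (v x)); have := sqr_ge0 (cmod (u x)).
by have := sqr_ge0 (cmod (v x)); rewrite sqrrB; lra.
Qed.

Lemma Itg_cmod2 u v : L2c u -> L2c v -> Itg (fun x => cmod (u x) * cmod (v x)).
Proof.
move=> [mu_ hu] [mv hv]; apply: Itg_le (ItgD hu hv).
  by apply: measM; exact: cmeas_cmod.
move=> x; rewrite ger0_norm ?mulr_ge0 ?cmod_ge0//.
have := sqr_ge0 (cmod (u x) - cmod (v x)); have := sqr_ge0 (cmod (u x)).
by have := sqr_ge0 (cmod (v x)); rewrite sqrrB; lra.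
Qed.

Lemma L2c_D u v : L2c u -> L2c v -> L2c (fun x => u x + v x).
Proof.
move=> [mu_ hu] [mv hv]; split; first exact: cmeasD.
apply: Itg_le (ItgZ 2 (ItgD hu hv)); first exact: meas_sqr (cmeas_cmod (cmeasD mu_ mv)).
move=> x; rewrite ger0_norm ?sqr_ge0//.
have h := cmodD (u x) (v x).
have : cmod (u x + v x) ^+ 2 <= (cmod (u x) + cmod (v x)) ^+ 2.
  by rewrite lerXn2r ?nnegrE ?addr_ge0 ?cmod_ge0.
by have := sqr_ge0 (cmod (u x) - cmod (v x)); rewrite sqrrB sqrrD; lra.
Qed.

Lemma L2c_Z (c : R) u : L2c u -> L2c (fun x => c%:C%C * u x).
Proof.
move=> [mu_ hu]; split; first exact: cmeasZ.
by move: (ItgZ (c ^+ 2) hu); congr Itg; apply/funext => x; rewrite cmodZ exprMn real_normK// num_real.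
Qed.

Lemma L2c_N u : L2c u -> L2c (fun x => - u x).
Proof.
move=> [mu_ hu]; split; first exact: cmeasN.
by move: hu; congr Itg; apply/funext => x; rewrite cmodN.
Qed.

Lemma L2c_B u v : L2c u -> L2c v -> L2c (fun x => u x - v x).
Proof. by move=> hu hv; exact: L2c_D hu (L2c_N hv). Qed.

Lemma L2c_i u : L2c u -> L2c (fun x => 'i%C * u x).
Proof.
move=> [mu_ hu]; split; first exact: cmeasi.
by move: hu; congr Itg; apply/funext => x; rewrite cmodi.
Qed.

Lemma L2c_0 : L2c (fun=> 0).
Proof.
split; first exact: cmeas0.
by have := Itg0 R; congr Itg; apply/funext => x; rewrite cmod0 expr0n.
Qed.

Lemma sqn_ae u v : L2c u -> cmeasurable v -> ae_equal u v -> L2c v /\ sqn v = sqn u.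
Proof.
move=> [mu_ hu] mv uv.
have [||hv e] := @Int_ae _ _ (fun x => cmod (v x) ^+ 2) hu; last by split.
- exact: meas_sqr (cmeas_cmod mv).
- by apply: ae_imp uv => x ->.
Qed.

Lemma sqn_eq0 u : L2c u -> sqn u = 0 -> ae_equal u (fun=> 0).
Proof.
move=> [mu_ hu] u0; have := Int_eq0 hu (fun x => sqr_ge0 _) u0.
by apply: ae_imp => x /eqP; rewrite sqrf_eq0 => /eqP /cmod_eq0.
Qed.

Lemma cvg0_slim (a : nat -> R) : (forall n, 0 <= a n) ->
  (forall e, 0 < e -> exists N, forall n, (N <= n)%N -> a n <= e) ->
  a n @[n --> \oo] --> 0.
Proof.
move=> a0 h; apply/cvgrPdist_le => e e0; have [N hN] := h _ e0.
by exists N => // n Nn /=; rewrite sub0r normrN ger0_norm// hN.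
Qed.

(** Strictly increasing indices with [N k <= fast N k], used to extract a rapidly converging
    subsequence. *)
Definition fast (N : nat -> nat) := fix fast k :=
  if k is j.+1 then maxn (fast j).+1 (N k) else N 0%N.

Lemma fast_ge N k : (N k <= fast N k)%N.
Proof. by case: k => //= k; rewrite leq_maxr. Qed.
Lemma fast_mono N j k : (j <= k)%N -> (fast N j <= fast N k)%N.
Proof.
elim: k => [|k IH]; first by rewrite leqn0 => /eqP ->.
rewrite leq_eqVlt => /orP[/eqP -> //|]; rewrite ltnS => /IH /leq_trans; apply.
by rewrite /= (leq_trans (leqnSn _)) ?leq_maxl.
Qed.
Lemma fast_id N k : (k <= fast N k)%N.
Proof. by elim: k => //= k IH; rewrite leq_max ltnS IH. Qed.

Lemma nneseries_le_cst (a : nat -> R) (c : R) : (forall k, 0 <= a k) ->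
  (forall n, \sum_(0 <= k < n) a k <= c) -> (\sum_(0 <= k <oo) (a k)%:E <= c%:E)%E.
Proof.
move=> a0 h; apply: lime_le; first by apply: is_cvg_nneseries => k _ _; rewrite lee_fin.
by apply: nearW => n; rewrite sumEFin lee_fin.
Qed.

(** Riesz-Fischer with squares only, so that Minkowski's inequality is avoided: a weighted series of
    squared increments of a subsequence has finite integral, hence is finite a.e. and forces
    pointwise convergence; Fatou's lemma then gives convergence of the whole sequence. *)
Lemma L2_complete_seq (w : nat -> R -> R[i]) : (forall n, L2c (w n)) ->
  (forall e, 0 < e -> exists N, forall m n, (N <= m)%N -> (N <= n)%N ->
     sqn (fun x => w m x - w n x) <= e) ->
  exists u phi, [/\ L2c u, forall k, (k <= phi k)%N,
    {ae mu, forall x, cmod (w (phi k) x - u x) @[k --> \oo] --> 0} &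
    forall e, 0 < e -> exists N, forall n, (N <= n)%N -> sqn (fun x => w n x - u x) <= e].
Proof.
move=> hw cw.
have q0 k : 0 < (16^-1 : R) ^+ k by rewrite exprn_gt0// invr_gt0.
have [N hN] := choice (fun k => cw _ (q0 k)).
pose phi := fast N.
(* The increments are at most 16^(-k) in squared norm, so the weight 4^k still leaves a summable
   series, while finiteness of the sum at [x] bounds the k-th increment there by a multiple of
   2^(-k). *)
pose d k x := 4 ^+ k * cmod (w (phi k.+1) x - w (phi k) x) ^+ 2.
have d0 k x : 0 <= d k x by rewrite mulr_ge0 ?sqr_ge0// exprn_ge0.
have wB m n : L2c (fun x => w m x - w n x) by exact: L2c_B.
have dI k : Itg (d k) by apply: ItgZ; have [_] := wB (phi k.+1) (phi k).
have dle k : Int (d k) <= 4^-1 ^+ k.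
  rewrite /d IntZ; last by have [_] := wB (phi k.+1) (phi k).
  have h : sqn (fun x => w (phi k.+1) x - w (phi k) x) <= 16^-1 ^+ k.
    apply: hN; last exact: fast_ge.
    by rewrite (leq_trans (fast_ge _ _))// fast_mono.
  rewrite (le_trans (ler_wpM2l _ h)) ?exprn_ge0// -exprMn.
  by rewrite (_ : 4 * 16^-1 = 4^-1)//; lra.
have sumle n : \sum_(0 <= k < n) (4^-1 : R) ^+ k <= 2.
  suff -> : \sum_(0 <= k < n) (4^-1 : R) ^+ k = 4 / 3 * (1 - 4^-1 ^+ n).
    have : 0 <= (4^-1 : R) ^+ n by rewrite exprn_ge0// invr_ge0.
    lra.
  elim: n => [|n IH]; first by rewrite big_nil expr0 subrr mulr0.
  by rewrite big_nat_recr//= IH exprS; lra.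
pose G x := (\sum_(0 <= k <oo) (d k x)%:E)%E.
have GI : (\int[mu]_x G x <= 2%:E)%E.
  rewrite /G integral_nneseries//; first last.
  - by move=> k x _; rewrite lee_fin.
  - by move=> k; exact: meas_EFin (Itg_meas (dI k)).
  have -> : (\sum_(0 <= n <oo) \int[mu]_x (d n x)%:E = \sum_(0 <= n <oo) (Int (d n))%:E)%E.
    by apply: eq_eseriesr => k _; rewrite IntE.
  apply: nneseries_le_cst => [k|n]; first exact: Int_ge0.
  by apply: le_trans (sumle n); apply: ler_sum => k _; exact: dle.
have G0 x : (0 <= G x)%E by apply: nneseries_ge0 => k _ _; rewrite lee_fin.
have Gint : mu.-integrable setT G.
  apply/integrableP; split.
    apply: ge0_emeasurable_sum => [k x _ _|k _]; first by rewrite lee_fin.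
    exact: meas_EFin (Itg_meas (dI k)).
  under eq_integral => x _ do rewrite [`|_|%E]gee0_abs//.
  exact: le_lt_trans GI (ltry _).
have Gfin := integrable_ae measurableT Gint.
have tele x : G x \is a fin_num -> forall j k, (j <= k)%N ->
    cmod (w (phi k) x - w (phi j) x) <=
      2 * Num.sqrt (fine (G x)) * (2^-1 ^+ j - 2^-1 ^+ k).
  move=> Gx.
  have term k : d k x <= fine (G x).
    rewrite -lee_fin fineK// /G.
    have := @nneseries_lim_ge _ (fun k => (d k x)%:E) xpredT 0 k.+1.
    have h0 : forall n, (0 <= n)%N -> true -> (0%R <= (d n x)%:E)%E.
      by move=> n _ _; rewrite lee_fin.
    move=> /(_ h0) h; apply: le_trans h.
    by rewrite sumEFin lee_fin big_nat_recr//= lerDr sumr_ge0.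
  have step k : cmod (w (phi k.+1) x - w (phi k) x) <= Num.sqrt (fine (G x)) * 2^-1 ^+ k.
    have : (2 ^+ k * cmod (w (phi k.+1) x - w (phi k) x)) ^+ 2 <= fine (G x).
      apply: le_trans (term k); rewrite /d exprMn -exprM mulnC exprM.
      by rewrite (_ : 2 ^+ 2 = 4)//; lra.
    move=> /ler_wsqrtr; rewrite sqrtr_sqr ger0_norm; last first.
      by rewrite mulr_ge0 ?cmod_ge0// exprn_ge0.
    by rewrite exprVn ler_pdivlMr ?exprn_gt0// mulrC.
  move=> j; elim=> [|k IH]; first by rewrite leqn0 => /eqP ->; rewrite !subrr mulr0 cmod0.
  rewrite leq_eqVlt => /orP[/eqP ->|]; first by rewrite !subrr mulr0 cmod0.
  rewrite ltnS => /IH h.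
  have := cmodD (w (phi k.+1) x - w (phi k) x) (w (phi k) x - w (phi j) x).
  rewrite subrKA => /le_trans; apply; apply: le_trans (lerD (step k) h) _.
  by rewrite exprS; set s := Num.sqrt _; lra.
have [M [mM M0 subM]] := Gfin.
have GxM x : ~ M x -> G x \is a fin_num.
  by move=> Mx; apply: contrapT => h; apply: Mx; apply: subM => /(_ I).
pose re k x := complex.Re (w (phi k) x); pose im k x := complex.Im (w (phi k) x).
have cau x : ~ M x -> cvgn (re^~ x) /\ cvgn (im^~ x).
  move=> /GxM Gx; have t := tele x Gx.
  have small e : 0 < e -> exists n, forall j k, (n <= j)%N -> (n <= k)%N ->
      cmod (w (phi k) x - w (phi j) x) <= e.
    move=> e0; set s := Num.sqrt _ in t.
    have s0 : 0 <= s by rewrite sqrtr_ge0.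
    have d2 : 0 < 2 * s + 1 by lra.
    have [n hn] := geometric_tail (divr_gt0 e0 d2).
    exists n => j k; wlog jk : j k / (j <= k)%N.
      move=> W nj nk; case/orP: (leq_total j k) => h; first exact: W.
      by rewrite cmodC; exact: W.
    move=> nj nk; apply: le_trans (t _ _ jk) _; have := hn _ nj.
    rewrite ler_pdivlMr// => h1.
    have : 0 <= (2^-1 : R) ^+ k by rewrite exprn_ge0// invr_ge0.
    have : 0 <= (2^-1 : R) ^+ j by rewrite exprn_ge0// invr_ge0.
    move: h1; move: ((2^-1 : R) ^+ k) ((2^-1 : R) ^+ j) => a b h1 h2 h3.
    have := mulr_ge0 s0 h3; lra.
  split; apply: cauchy_slim => e /small[n hn]; exists n => j k nj nk;
    apply: le_trans (hn _ _ nk nj).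
    by rewrite /re -ReN -ReD cmod_Re.
  by rewrite /im -ImN -ImD cmod_Im.
(* The value 0 on the null set makes [u] an everywhere limit of measurable functions. *)
pose u x : R[i] := if pselect (M x) then 0 else Complex (limn (re^~ x)) (limn (im^~ x)).
have mu_ : cmeasurable u.
  have mTM : measurable (~` M) by exact: measurableC.
  have mi : meas (\1_(~` M)) by exact: measurable_indic.
  split.
    apply: (@measurable_fun_cvg _ _ _ _ (fun k x => re k x * \1_(~` M) x)).
      by move=> k; apply: measM => //; have [[]] := hw (phi k).
    move=> x _; rewrite /u indicE; case: pselect => Mx /=.
      by have -> : (x \in ~` M) = false; [by apply: memNset => /(_ Mx)|]; under eq_fun do rewrite mulr0; exact: cvg_cst.
    have -> : (x \in ~` M) = true by apply: mem_set.
    under eq_fun do rewrite mulr1.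
    by have [] := cau x Mx.
  apply: (@measurable_fun_cvg _ _ _ _ (fun k x => im k x * \1_(~` M) x)).
    by move=> k; apply: measM => //; have [[]] := hw (phi k).
  move=> x _; rewrite /u indicE; case: pselect => Mx /=.
    by have -> : (x \in ~` M) = false; [by apply: memNset => /(_ Mx)|]; under eq_fun do rewrite mulr0; exact: cvg_cst.
  have -> : (x \in ~` M) = true by apply: mem_set.
    under eq_fun do rewrite mulr1.
  by have [] := cau x Mx.
have cae x : ~ M x -> forall e, 0 < e -> exists n, forall k, (n <= k)%N ->
    cmod (w (phi k) x - u x) <= e.
  move=> Mx e e0; have e2 : 0 < e / 2 by rewrite divr_gt0.
  have [c1 c2] := cau x Mx.
  move/cvgrPdist_le: (c1) => /(_ _ e2)[n1 _ h1].
  move/cvgrPdist_le: (c2) => /(_ _ e2)[n2 _ h2].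
  exists (maxn n1 n2) => k; rewrite geq_max => /andP[/h1 a /h2 b].
  rewrite /u; case: pselect => //= _.
  set z := _ - _.
  have := cmod_le_ReIm z.
  have -> : complex.Re z = re k x - limn (re^~ x) by rewrite /z ReD ReN.
  have -> : complex.Im z = im k x - limn (im^~ x) by rewrite /z ImD ImN.
  by move: a b; rewrite /= (distrC (limn (re^~ x))) (distrC (limn (im^~ x))); lra.
have ae0 : {ae mu, forall x, cmod (w (phi k) x - u x) @[k --> \oo] --> 0}.
  exists M; split => // x /= h; apply: contrapT => Mx; apply: h.
  by apply: cvg0_slim => [k|]; [exact: cmod_ge0|exact: cae].
have fat n c (J : nat) : (forall j, (J <= j)%N -> sqn (fun x => w (phi j) x - w n x) <= c) ->
    Itg (fun x => cmod (w n x - u x) ^+ 2) /\ sqn (fun x => w n x - u x) <= c.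
  move=> hc; apply: (@Int_fatou _ (fun k x => cmod (w n x - w (phi (k + J)%N) x) ^+ 2)).
  - by move=> k; have [_] := wB n (phi (k + J)%N).
  - by move=> k x; rewrite sqr_ge0.
  - by apply: meas_sqr; apply: cmeas_cmod; apply: cmeasB => //; have [] := hw n.
  - move=> k; have := hc (k + J)%N (leq_addl _ _); congr (_ <= _).
    by rewrite /sqn; congr Int; apply/funext => x; rewrite cmodC.
  - apply: ae_imp ae0 => x h.
    have h' : cmod (w (phi (k + J)%N) x - u x) @[k --> \oo] --> 0.
      by move: h; rewrite -(cvg_shiftn J).
    rewrite !expr2; apply: cvgM.
      apply/cvgrPdist_le => e e0; move/cvgrPdist_le: h' => /(_ _ e0)[k0 _ hk].
      exists k0 => // k /hk /=; rewrite sub0r normrN ger0_norm ?cmod_ge0//.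
      apply: le_trans; apply: le_trans (cmod_diff _ _) _.
      by rewrite opprB addrC subrKA.
    apply/cvgrPdist_le => e e0; move/cvgrPdist_le: h' => /(_ _ e0)[k0 _ hk].
    exists k0 => // k /hk /=; rewrite sub0r normrN ger0_norm ?cmod_ge0//.
    apply: le_trans; apply: le_trans (cmod_diff _ _) _.
    by rewrite opprB addrC subrKA.
  - by move=> x; rewrite sqr_ge0.
have lim e : 0 < e -> exists n0, forall n, (n0 <= n)%N ->
    Itg (fun x => cmod (w n x - u x) ^+ 2) /\ sqn (fun x => w n x - u x) <= e.
  move=> /cw[n0 hn0]; exists n0 => n nn; apply: (fat n e n0) => j jn.
  by apply: hn0 => //; rewrite (leq_trans jn)// fast_id.
exists u, phi; split => //.
- have [n0 /(_ _ (leqnn n0))[hI _]] := lim _ ltr01.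
  have h : L2c (fun x => w n0 x - u x) by split => //; apply: cmeasB => //; have [] := hw n0.
  have := L2c_B (hw n0) h; congr L2c; apply/funext => x.
  by rewrite opprB addrC subrK.
- exact: fast_id.
- by move=> e /lim[n0 h]; exists n0 => n /h[].
Qed.

End L2Functions.

(** * Test functions and one-dimensional Sobolev functions *)

Section SmoothFunctions.
Context (R : realType).
Implicit Types (f g : R -> R) (n k : nat).

Lemma sderivM f g x d e : sderiv f x d -> sderiv g x e ->
  sderiv (fun s => f s * g s) x (d * g x + f x * e).
Proof.
move=> /sderivP df /sderivP dg; apply/sderivP; apply: is_derive_eq.
by rewrite /GRing.scale/=; ring.
Qed.

Lemma sderiv_affine f (c b x l : R) : sderiv f (c * x + b) l ->
  sderiv (fun s => f (c * s + b)) x (c * l).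
Proof.
move=> hf e e0; have c0 : 0 < `|c| + 1 by rewrite ltr_wpDl.
have [r r0 hr] := hf _ (divr_gt0 e0 c0); exists (r / (`|c| + 1)); first by rewrite divr_gt0.
move=> s sr; have e1 : c * s + b - (c * x + b) = c * (s - x) by ring.
have := hr (c * s + b); rewrite e1 normrM => h.
rewrite (_ : (s - x) * (c * l) = c * (s - x) * l); last by ring.
apply: le_trans (h _) _.
  rewrite ltr_pdivlMr// in sr; apply: le_lt_trans sr; rewrite mulrC.
  by rewrite ler_wpM2l// lerDl.
by rewrite mulrA ler_wpM2r// mulrAC ler_pdivrMr// ler_pM2l// lerDl.
Qed.

Lemma sderiv_expR f x d : sderiv f x d -> sderiv (fun s => expR (f s)) x (expR (f x) * d).
Proof.
by move=> /sderivP df; apply/sderivP.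
Qed.

Lemma sderivX f n x d : sderiv f x d ->
  sderiv (fun s => f s ^+ n) x (n%:R * f x ^+ n.-1 * d).
Proof.
move=> df; elim: n => [|n IH].
  by rewrite !mul0r; apply: sderiv_local (sderiv_cst 1 x) => //; exact: ltr01.
have := sderivM df IH; under eq_fun do rewrite -exprS.
congr sderiv; case: n {IH} => [|n] /=; first by rewrite !mul0r mulr0 !expr0; ring.
by rewrite exprS -!natr1; ring.
Qed.

(** Recursion on the first derivative, so that closure under algebraic operations follows by
    induction from the differentiation rules. *)
Fixpoint nd n f : Prop :=
  if n is k.+1 then (forall x, derivable f x 1) /\ nd k (derive1 f) else True.

Lemma smoothP f : (forall n x, derivable (derive1n n f) x 1) <-> forall n, nd n f.
Proof.
split=> [h n|h n].
  elim: n f h => [//|n IH] f h; split; first exact: (h 0%N).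
  by apply: IH => k x; have := h k.+1 x; rewrite /derive1n iterSr.
elim: n f h => [|n IH] f h x; first by have [] := h 1%N.
by rewrite /derive1n iterSr; apply: IH => k; have [] := h k.+1.
Qed.

Lemma nd_sderiv n f x : nd n.+1 f -> sderiv f x (derive1 f x).
Proof. by move=> [/(_ x) h _]; apply/sderivP; rewrite derive1E; exact: derivableP. Qed.

Lemma ndS n f g : (forall x, sderiv f x (g x)) -> nd n g -> nd n.+1 f.
Proof.
move=> fg ng; split=> [x|]; first by have /sderivP[] := fg x.
suff -> : derive1 f = g by [].
by apply/funext => x; rewrite derive1E; have /sderivP[_ ->] := fg x.
Qed.

Lemma sderiv_derive1 f x d : sderiv f x d -> derive1 f x = d.
Proof. by move=> /sderivP[_ <-]; rewrite derive1E. Qed.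

Lemma nd_pred n f : nd n.+1 f -> nd n f.
Proof. by elim: n f => [//|n IH] f [h1 h2]; split => //; exact: IH. Qed.

Lemma ndD n f g : nd n f -> nd n g -> nd n (fun x => f x + g x).
Proof.
elim: n f g => [//|n IH] f g hf hg.
apply: (@ndS n _ (fun x => derive1 f x + derive1 g x)).
  by move=> x; exact: sderivD (nd_sderiv x hf) (nd_sderiv x hg).
by apply: IH; [case: hf|case: hg].
Qed.

Lemma ndZ n f c : nd n f -> nd n (fun x => c * f x).
Proof.
elim: n f => [//|n IH] f hf.
apply: (@ndS n _ (fun x => c * derive1 f x)).
  by move=> x; exact: sderivZ (nd_sderiv x hf).
by apply: IH; case: hf.
Qed.

Lemma ndM n f g : nd n f -> nd n g -> nd n (fun x => f x * g x).
Proof.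
elim: n f g => [//|n IH] f g hf hg.
apply: (@ndS n _ (fun x => derive1 f x * g x + f x * derive1 g x)).
  by move=> x; exact: sderivM (nd_sderiv x hf) (nd_sderiv x hg).
by apply: ndD; apply: IH; (try exact: nd_pred); [case: hf|case: hg].
Qed.

Lemma nd_affine n f c b : nd n f -> nd n (fun x => f (c * x + b)).
Proof.
elim: n f => [//|n IH] f hf.
apply: (@ndS n _ (fun x => c * derive1 f (c * x + b))).
  by move=> x; apply: sderiv_affine; exact: nd_sderiv hf.
by apply: ndZ; apply: IH; case: hf.
Qed.

Lemma nd_cst n (c : R) : nd n (fun=> c).
Proof.
elim: n c => [//|n IH] c; apply: (@ndS n _ (fun=> 0)) => // x; exact: sderiv_cst.
Qed.

(** The family x^(-k) e^(-1/x), extended by 0, is closed under differentiation up to linear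
    combinations; smoothness of e^(-1/x) is therefore proved for all its members at once. *)
Definition ek k (x : R) : R := if 0 < x then x^-1 ^+ k * expR (- x^-1) else 0.

(** The inequality t <= e^t at t = y / (n + 1), raised to the power n + 1. *)
Lemma expr_le_expR (y : R) n : 0 <= y -> y ^+ n.+1 <= n.+1%:R ^+ n.+1 * expR y.
Proof.
move=> y0; have n0 : 0 < n.+1%:R :> R by rewrite ltr0n.
rewrite (_ : expR y = expR (y / n.+1%:R) ^+ n.+1); last first.
  by rewrite -expRM_natl mulrC divfK// gt_eqF.
rewrite -exprMn lerXn2r ?nnegrE ?mulr_ge0 ?expR_ge0//.
have := expR_ge1Dx (y / n.+1%:R) => h.
have := ler_wpM2l (ltW n0) h; rewrite mulrDr mulr1 mulrC divfK ?gt_eqF//.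
by move=> /(le_trans _); apply; rewrite lerDr ltW.
Qed.

Lemma sderiv_ek k x : sderiv (ek k) x (- k%:R * ek k.+1 x + ek k.+2 x).
Proof.
case: (ltgtP x 0) => x0.
- have nx : 0 < - x by rewrite oppr_gt0.
  rewrite /ek ltNge (ltW x0)/= mulr0 addr0.
  apply: (@sderiv_local _ _ (fun=> 0) _ _ (- x)) => //; last exact: sderiv_cst.
  move=> s; rewrite ltr_norml => /andP[_ h]; rewrite ltNge (_ : s <= 0)//=; lra.
- rewrite /ek x0.
  apply: (@sderiv_local _ _ (fun x => x^-1 ^+ k * expR (- x^-1)) _ _ x) => //.
    move=> s; rewrite ltr_norml => /andP[h _]; rewrite (_ : 0 < s)//; lra.
  have dV : sderiv (fun s => s^-1) x (- x^-1 ^+ 2).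
    apply/sderivP; have := @is_deriveV _ id x 1 1; rewrite gt_eqF// => /(_ isT _) h.
    move: h => /=; congr is_derive.
    by rewrite -exprVn /GRing.scale/= mulr1.
  have := sderivM (sderivX k dV) (sderiv_expR (sderivN dV)).
  congr sderiv; case: k => [|k] /=; first by rewrite !mul0r expr0 exprS expr1 oppr0 mul0r; ring.
  by rewrite !exprS; ring.
- rewrite x0 /ek ltxx mulr0 addr0 => e e0.
  (* Bounds y^(k+2) e^(-y); with y = 1/s this gives x^(-k) e^(-1/x) = O(x^2) at 0, hence derivative
     0 there. *)
  pose C : R := k.+2%:R ^+ k.+2.
  have C0 : 0 < C by rewrite exprn_gt0// ltr0n.
  exists (e / C); first by rewrite divr_gt0.
  move=> s; rewrite ltxx/= mulr0 !subr0 => sr; case: (ltP 0 s) => s0; last by rewrite normr0 mulr_ge0 ?(ltW e0).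
  rewrite gtr0_norm// in sr.
  have y0 : 0 < s^-1 by rewrite invr_gt0.
  rewrite gtr0_norm ?mulr_gt0 ?exprn_gt0 ?expR_gt0// gtr0_norm//.
  have := expr_le_expR k.+1 (ltW y0); rewrite -/C => h.
  have h2 : s^-1 ^+ k * expR (- s^-1) <= C * s ^+ 2.
    rewrite expRN ler_pdivrMr ?expR_gt0// mulrAC.
    rewrite -ler_pdivrMr ?exprn_gt0// -exprVn; apply: le_trans h.
    by rewrite [leLHS](_ : _ = s^-1 ^+ k.+2)// !exprS expr0; ring.
  apply: le_trans h2 _; rewrite expr2 mulrA ler_wpM2r ?(ltW s0)//.
  by rewrite mulrC -ler_pdivlMr// ltW.
Qed.

Lemma nd_ek n k : nd n (ek k).
Proof.
elim: n k => [//|n IH] k.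
apply: (@ndS n _ _ (sderiv_ek k)); apply: ndD => //; exact: ndZ.
Qed.

Definition bump (x : R) : R := ek 0 (1 * x + 1) * ek 0 (-1 * x + 1).

Lemma nd_bump n : nd n bump.
Proof. by apply: ndM; apply: nd_affine; exact: nd_ek. Qed.

Lemma ek_ge0 k x : 0 <= ek k x.
Proof.
rewrite /ek; case: ltP => // x0.
by rewrite mulr_ge0 ?expR_ge0// exprn_ge0// invr_ge0 ltW.
Qed.

Lemma bump_ge0 x : 0 <= bump x. Proof. by rewrite mulr_ge0 ?ek_ge0. Qed.

Lemma bump_out x : 1 <= `|x| -> bump x = 0.
Proof.
rewrite /bump /ek mul1r mulN1r; case: (leP 0 x) => x0.
  rewrite ger0_norm// => x1; have /negbTE -> : ~~ (0 < - x + 1) by rewrite -leNgt; lra.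
  by rewrite mulr0.
rewrite ltr0_norm// => x1; have /negbTE -> : ~~ (0 < x + 1) by rewrite -leNgt; lra.
by rewrite mul0r.
Qed.

Lemma bump_gt0 x : `|x| < 1 -> 0 < bump x.
Proof.
rewrite ltr_norml => /andP[a b]; rewrite /bump /ek mul1r mulN1r.
have -> : 0 < x + 1 by lra.
have -> : 0 < - x + 1 by lra.
by rewrite !expr0 !mul1r mulr_gt0 ?expR_gt0.
Qed.

Lemma smooth_step : exists Hs rho : R -> R,
  [/\ forall n, nd n Hs, forall n, nd n rho, forall x, sderiv Hs x (rho x),
      forall x, 1 <= `|x| -> rho x = 0 &
      [/\ forall x, 0 <= Hs x <= 1, forall x, x <= -1 -> Hs x = 0 &
          forall x, 1 <= x -> Hs x = 1]].
Proof.
have db x : sderiv bump x (derive1 bump x) := nd_sderiv x (nd_bump 1).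
have [F [F0 dF]] := antiderivative (fun t => sderiv_cont (db t)).
have nF n : nd n F.
  by case: n => // n; apply: (@ndS n F bump) => //; exact: nd_bump.
have cst a b : a <= b -> (forall x, a <= x <= b -> bump x = 0) -> F a = F b.
  move=> ab h; have [c /h bc] := sderiv_mvt ab (fun t _ => dF t).
  by rewrite bc mul0r => /eqP; rewrite subr_eq0 => /eqP.
have mono a b : a <= b -> F a <= F b.
  move=> ab; have [c _] := sderiv_mvt ab (fun t _ => dF t).
  by move=> /eqP; rewrite -subr_ge0 => /eqP ->; rewrite mulr_ge0 ?bump_ge0// subr_ge0.
have c0 : 0 < F 1 - F (-1).
  have h0 : (0 : R) <= 2^-1 by rewrite invr_ge0.
  have [c /andP[c1 c2] e] := sderiv_mvt h0 (fun t _ => dF t).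
  have : 0 < F 2^-1 - F 0.
    rewrite e subr0 mulr_gt0 ?invr_gt0// bump_gt0// ltr_norml; apply/andP; split; lra.
  have := @mono (-1) 0; have := @mono 2^-1 1.
  have -> : (2^-1 : R) <= 1 by lra.
  have -> : (-1 : R) <= 0 by lra.
  by move=> /(_ isT) a /(_ isT) b; lra.
set c := F 1 - F (-1) in c0.
have Fm x : x <= -1 -> F x = F (-1).
  by move=> x1; apply: cst => // y /andP[xy y1]; apply: bump_out; rewrite ler0_norm; lra.
have Fp x : 1 <= x -> F x = F 1.
  by move=> x1; apply/esym/cst => // y /andP[y1 yx]; apply: bump_out; rewrite ger0_norm; lra.
exists (fun x => c^-1 * F x + (- c^-1 * F (-1))), (fun x => c^-1 * bump x); split.
- by move=> n; apply: ndD; [exact: ndZ|exact: nd_cst].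
- by move=> n; apply: ndZ; exact: nd_bump.
- move=> x; rewrite -[X in sderiv _ _ X]addr0.
  by apply: sderivD; [exact: sderivZ|exact: sderiv_cst].
- by move=> x /bump_out ->; rewrite mulr0.
have eH x : c^-1 * F x + - c^-1 * F (-1) = (F x - F (-1)) / c by field; rewrite gt_eqF.
split=> [x|x x1|x x1]; rewrite eH; last by rewrite Fp// mulfV// gt_eqF.
- rewrite divr_ge0 ?(ltW c0) ?subr_ge0//=; last first.
    by case: (leP x (-1)) => [/Fm ->//|/ltW]; exact: mono.
  rewrite ler_pdivrMr// mul1r /c lerD2r.
  by case: (leP 1 x) => [/Fp ->//|/ltW]; exact: mono.
- by rewrite Fm// subrr mul0r.
Qed.

Lemma test_functionP f : test_function f <->
  (forall n, nd n f) /\ exists A : R, forall x, A < `|x| -> f x = 0.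
Proof.
split=> -[h1 h2]; split; try exact/smoothP.
  have [M [_ hM]] := compact_bounded h2; exists (M + 1) => x xM.
  apply: contrapT => /eqP fx.
  have : `|x| <= M + 1 by apply: hM; [rewrite ltrDl|exact: subset_closure].
  by rewrite leNgt xM.
case: h2 => A hA.
apply: (@subclosed_compact _ _ (`[- A, A])); [exact: closed_closure|exact: segment_compact|].
have cI : closed (`[- A, A] : set R) by exact: interval_closed.
rewrite [X in _ `<=` X](closure_id _).1//; apply: closure_subset => x /= /eqP fx.
rewrite in_itv/= -ler_norml leNgt; apply/negP => /hA; exact: fx.
Qed.

End SmoothFunctions.

(** * Mollification and the continuous representative of a weakly differentiable function *)

Section RealSobolev.
Context (R : realType).
Local Notation mu := (@lebesgue_measure R).
Implicit Types (f g : R -> R).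

Definition L2r f : Prop := meas f /\ Itg (fun x => f x ^+ 2).
Definition rsqn f : R := Int (fun x => f x ^+ 2).

Lemma rsqn_ge0 f : 0 <= rsqn f. Proof. by apply: Int_ge0 => x; rewrite sqr_ge0. Qed.

Lemma Itg_mul f g : L2r f -> L2r g -> Itg (fun x => f x * g x).
Proof.
move=> [mf hf] [mg hg]; apply: Itg_le (ItgD hf hg); first exact: measM.
move=> x; have := sqr_ge0 (f x - g x); have := sqr_ge0 (f x + g x).
rewrite sqrrB sqrrD => h1 h2; have := sqr_ge0 (f x); have := sqr_ge0 (g x) => h3 h4.
rewrite ler_norml; apply/andP; split; lra.
Qed.

(** The discriminant of a nonnegative quadratic, obtained at k = x / a; a vanishing leading
    coefficient is treated apart. *)
Lemma le_quadratic_opt (x a b : R) : 0 <= a -> 0 <= b ->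
  (forall k, 2 * k * x <= k ^+ 2 * a + b) -> x ^+ 2 <= a * b.
Proof.
move=> a0 b0 h; case: (eqVneq a 0) => [a00|an0].
  rewrite a00 mul0r; case: (eqVneq x 0) => [->|x0]; first by rewrite expr0n.
  have := h ((b + 1) / (2 * x)); rewrite a00 mulr0 add0r.
  have -> : 2 * ((b + 1) / (2 * x)) * x = b + 1 by field.
  lra.
have ap : 0 < a by rewrite lt_def an0.
have := h (x / a); have -> : 2 * (x / a) * x = 2 * (x ^+ 2 / a) by field.
have -> : (x / a) ^+ 2 * a = x ^+ 2 / a by field.
move=> hh; have : x ^+ 2 / a <= b by lra.
by rewrite ler_pdivrMr// mulrC.
Qed.

Lemma Int_CauchySchwarz f g : L2r f -> L2r g ->
  Int (fun x => f x * g x) ^+ 2 <= rsqn f * rsqn g.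
Proof.
move=> hf hg; apply: le_quadratic_opt; try exact: rsqn_ge0.
move=> k; rewrite -IntZ; last exact: Itg_mul.
have [_ i1] := hf; have [_ i2] := hg.
rewrite /rsqn -IntZ// -IntD//; last exact: ItgZ.
apply: Int_le; [by apply: ItgZ; exact: Itg_mul|by apply: ItgD => //; exact: ItgZ|].
by move=> x; have := sqr_ge0 (k * f x - g x); rewrite sqrrB exprMn; lra.
Qed.

Definition ind (a b x : R) : R := \1_(`[a, b]%classic) x.

Lemma indE a b x : ind a b x = (if a <= x <= b then 1 else 0).
Proof.
rewrite /ind indicE; case: ifP => h; first by rewrite mem_set//= in_itv.
by rewrite memNset//= in_itv/= h.
Qed.

Lemma Itg_ind a b : Itg (ind a b).
Proof. exact: integrable_indic_itv. Qed.

Lemma Int_ind a b : a <= b -> Int (ind a b) = b - a.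
Proof.
move=> ab; apply: EFin_inj; rewrite -IntE; last exact: Itg_ind.
rewrite (@integral_indic _ _ _ mu)//.
by rewrite setIT [LHS]lebesgue_measure_itv/= lte_fin; case: ltgtP ab => // -> _; rewrite subrr.
Qed.

Lemma ae_dense (P : R -> Prop) (x e : R) : {ae mu, forall x, P x} -> 0 < e ->
  exists2 y, `|y - x| < e & P y.
Proof.
move=> [N [mN N0 subN]] e0; apply: contrapT => h.
have sub : `[x, x + e / 2] `<=` N.
  move=> y /=; rewrite in_itv/= => /andP[xy yx]; apply: subN => /= Py; apply: h.
  by exists y => //; rewrite ger0_norm ?subr_ge0//; lra.
have : (mu `[x, (x + e / 2)%R] <= mu N)%E by apply: le_measure; rewrite ?inE//; exact: measurable_itv.
rewrite N0 lebesgue_measure_itv/= lte_fin ifT; last by lra.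
rewrite -EFinB lee_fin; lra.
Qed.

Lemma meas_continuous f : (forall x, scont f x) -> meas f.
Proof. by move=> h; apply: continuous_measurable_fun => x; exact/scontP. Qed.

Lemma continuous_segment_bounded f (A : R) : (forall x, scont f x) ->
  exists2 M : R, 0 <= M & forall x, `|x| <= A -> `|f x| <= M.
Proof.
move=> hf.
have cI : compact (f @` `[- A, A]).
  apply: continuous_compact; last exact: segment_compact.
  by apply: continuous_subspaceT => x; exact/scontP.
have [M [_ hM]] := compact_bounded cI; exists (`|M| + 1); first by rewrite addr_ge0.
move=> x xA; apply: hM; first by rewrite (le_lt_trans (ler_norm _))// ltrDl.
by exists x => //=; rewrite in_itv/= -ler_norml.
Qed.

Lemma continuous_compact_bound f (A : R) : (forall x, scont f x) ->
  (forall x, A < `|x| -> f x = 0) -> exists2 M : R, 0 <= M &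
  forall x, `|f x| <= M * ind (- A) A x.
Proof.
move=> cf f0; have [M M0 hM] := continuous_segment_bounded A cf.
exists M => // x; rewrite indE -ler_norml; case: (leP `|x| A) => xA; first by rewrite mulr1 hM.
by rewrite f0// normr0 mulr0.
Qed.

Lemma ind_sqr a b x : ind a b x ^+ 2 = ind a b x.
Proof. by rewrite indE; case: ifP; rewrite ?expr1n ?expr0n. Qed.

Lemma ind_ge0 a b x : 0 <= ind a b x.
Proof. by rewrite indE; case: ifP. Qed.

Lemma Itg_compact f (A : R) : (forall x, scont f x) -> (forall x, A < `|x| -> f x = 0) -> Itg f.
Proof.
move=> cf f0; have [M M0 hM] := continuous_compact_bound cf f0.
apply: Itg_le (ItgZ M (Itg_ind (- A) A)) => //; exact: meas_continuous.
Qed.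

Lemma L2r_compact f (A : R) : (forall x, scont f x) -> (forall x, A < `|x| -> f x = 0) -> L2r f.
Proof.
move=> cf f0; have [M M0 hM] := continuous_compact_bound cf f0.
split; first exact: meas_continuous.
apply: Itg_le (ItgZ (M ^+ 2) (Itg_ind (- A) A)); first by apply: meas_sqr; exact: meas_continuous.
move=> x; rewrite ger0_norm ?sqr_ge0// -ind_sqr -exprMn -real_normK ?num_real//.
by rewrite lerXn2r ?nnegrE ?mulr_ge0 ?ind_ge0.
Qed.

Lemma test_cont f x : test_function f -> scont f x.
Proof. by move=> /test_functionP[/(_ 1%N) h _]; exact: sderiv_cont (nd_sderiv x h). Qed.

Lemma test_L2r f : test_function f -> L2r f.
Proof.
move=> tf; have := tf => /test_functionP[_ [A hA]].
by apply: (@L2r_compact _ A) => // x; exact: test_cont.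
Qed.

Lemma test_sderiv f x : test_function f -> sderiv f x (derive1 f x).
Proof. by move=> /test_functionP[/(_ 1%N) h _]; exact: nd_sderiv h. Qed.

Lemma test_derive1 f : test_function f -> test_function (derive1 f).
Proof.
move=> tf; have := tf => /test_functionP[nf [A hA]]; apply/test_functionP; split.
  by move=> n; have [] := nf n.+1.
exists A => x Ax; apply: sderiv_derive1.
apply: (@sderiv_local _ _ (fun=> 0) _ _ (`|x| - A)); [by rewrite subr_gt0| |exact: sderiv_cst].
move=> s sx; apply: hA; have := lerB_dist x s; rewrite distrC; lra.
Qed.

Lemma testZD (c : R) f g : test_function f -> test_function g ->
  test_function (fun x => c * f x + g x).
Proof.
move=> /test_functionP[nf [A hA]] /test_functionP[ng [B hB]]; apply/test_functionP; split.
  by move=> n; apply: ndD => //; exact: ndZ.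
exists (Num.max A B) => x; rewrite gt_max => /andP[a b].
by rewrite hA// hB// mulr0 addr0.
Qed.

Lemma test_derive1ZD (c : R) f g : test_function f -> test_function g ->
  derive1 (fun x => c * f x + g x) = (fun x => c * derive1 f x + derive1 g x).
Proof.
move=> tf tg; apply/funext => x; apply: sderiv_derive1.
by apply: sderivD; [apply: sderivZ|]; exact: test_sderiv.
Qed.

Lemma Int_FTC f F a b : a < b -> (forall x, scont f x) -> (forall x, sderiv F x (f x)) ->
  (forall x, ~~ (a <= x <= b) -> f x = 0) -> Int f = F b - F a.
Proof.
move=> ab cf dF f0; apply: EFin_inj; rewrite EFinB -(@continuous_FTC2 _ f F a b)//.
- rewrite /Int /Rintegral [RHS]integral_mkcond.
  rewrite (_ : (fun x => (f x)%:E) \_ `[a, b] = EFin \o f); last first.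
    apply/funext => x; rewrite patchE; case: ifPn => //= h.
    rewrite f0//; apply: contra h => h; exact: mem_set.
  rewrite fineK//; apply: integrable_fin_num => //.
  apply: (@Itg_compact _ (Num.max `|a| `|b|)) => // x.
  rewrite gt_max => /andP[h1 h2]; apply: f0; apply/negP => /andP[ax xb].
  have := ler_norm b; have := ler_norm (- a); rewrite normrN.
  case: (leP 0 x) h1 h2 => x0; [rewrite (ger0_norm x0)|rewrite (ltr0_norm x0)]; lra.
- by apply: continuous_subspaceT => x; exact/scontP.
- split.
  + by move=> x _; have /sderivP[] := dF x.
  + apply: cvg_at_right_filter; apply/scontP; exact: sderiv_cont (dF a).
  + apply: cvg_at_left_filter; apply/scontP; exact: sderiv_cont (dF b).
- by move=> x _; exact: sderiv_derive1.
Qed.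


Lemma locally_integrable_L2r f : L2r f -> locally_integrable setT f.
Proof.
move=> [mf hf]; split => //; first exact: openT.
move=> K _ cK; have mK : measurable (K : set (measurableTypeR R)) by exact: compact_measurable.
have h : mu.-integrable K (EFin \o (fun x => 1 + f x ^+ 2)).
  have hf' : mu.-integrable K (EFin \o (fun x => f x ^+ 2)) by exact: integrableS hf.
  have h1 : mu.-integrable K (EFin \o cst (1 : R)).
    by apply: continuous_compact_integrable => //; apply: continuous_subspaceT => x; exact: cvg_cst.
  exact: integrableD h1 hf'.
have /integrableP[_] : mu.-integrable K (EFin \o f).
  apply: le_integrable h => //; first by apply: measurable_funTS; exact: meas_EFin.
  move=> x _ /=; rewrite lee_fin [leRHS]ger0_norm ?addr_ge0 ?sqr_ge0//.
  have := sqr_ge0 (`|f x| - 1); rewrite sqrrB real_normK ?num_real// expr1n mulr1.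
  by have := normr_ge0 (f x); lra.
by [].
Qed.

Lemma lebesgue_pt_avg f (a : R) : L2r f -> lebesgue_pt f a -> forall e : R, 0 < e ->
  exists2 r : R, 0 < r & forall d, 0 < d -> d < r ->
    Itg (fun x => `|f x - f a| * \1_(ball a d) x) /\
    Int (fun x => `|f x - f a| * \1_(ball a d) x) <= d * e.
Proof.
move=> [mf hf] la e e0.
(* Half of [e], because the ball of radius [d] over which the average is taken has length 2 d. *)
have : \forall r \near 0^'+, (davg f a r < (e / 2)%:E)%E.
  apply: (la [set y | (y < (e / 2)%:E)%E]); apply: open_nbhs_nbhs; split; first exact: open_ereal_lt_ereal.
  by rewrite /= lte_fin divr_gt0.
move=> [r /= r0 hr]; exists r => // d d0 dr.
have mb : measurable (ball a d : set (measurableTypeR R)) by exact: measurable_ball.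
have hi : Itg (fun x => `|f x - f a| * \1_(ball a d) x).
  apply: Itg_le (ItgD hf (ItgZ (1 + `|f a|) (Itg_ind (a - d) (a + d)))).
    apply: measM; last exact: measurable_indic.
    by apply: meas_abs; apply: measB => //; exact: meas_cst.
  move=> x; rewrite normrM normr_id indicE indE.
  have s0 := sqr_ge0 (f x).
  case: (boolP (x \in (ball a d : set R))) => [/set_mem|_] /=; last first.
    rewrite normr0 mulr0 addr_ge0// mulr_ge0// ?addr_ge0//; by case: ifP.
  rewrite /ball/= ltr_norml => /andP[h1 h2]; rewrite ifT; last by apply/andP; split; lra.
  rewrite normr1 !mulr1; apply: le_trans (ler_normB _ _) _.
  have := sqr_ge0 (`|f x| - 1); rewrite sqrrB real_normK ?num_real// expr1n mulr1.
  by have := normr_ge0 (f x); lra.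
split=> //; have := hr d; rewrite /= sub0r normrN gtr0_norm// => /(_ dr d0).
rewrite /davg /iavg lebesgue_measure_ball ?(ltW d0)// inver mulrn_eq0/= gt_eqF//=.
rewrite integral_mkcond.
rewrite (_ : (fun y => _) \_ _ = EFin \o (fun x => `|f x - f a| * \1_(ball a d) x)); last first.
  by apply/funext => x /=; rewrite patchE indicE; case: ifP => /=; rewrite ?mulr1 ?mulr0.
rewrite IntE// -EFinM lte_fin ltr_pdivrMl ?pmulrn_rgt0// => /ltW h.
apply: le_trans h _; rewrite -mulr_natl; lra.
Qed.

(** The kernels are derivatives of rescaled smooth steps, hence have integral 1. The difference of
    two kernels is the derivative of a difference of steps: a smoothed indicator of [a, b], at most
    1 in modulus and supported in the interval enlarged by 1/(n+1) on each side. *)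
Lemma mollifier : exists2 psi : nat -> R -> R -> R,
  (forall n a, test_function (psi n a)) &
  [/\ forall f a, L2r f -> lebesgue_pt f a -> forall e : R, 0 < e ->
        exists N, forall n, (N <= n)%N -> `|Int (fun x => f x * psi n a x) - f a| <= e &
      forall a b n, a <= b -> exists2 phi, test_function phi &
        ((forall x, derive1 phi x = psi n a x - psi n b x) /\
        rsqn phi <= b - a + 2 / n.+1%:R)].
Proof.
have [Hs [rho [nH nrho dH rho0 [H01 Hm Hp]]]] := smooth_step R.
pose k n : R := n.+1%:R.
have k1 n : 1 <= k n by rewrite ler1n.
have k0 n : 0 < k n by rewrite ltr0n.
have kE n : n.+1%:R = k n by [].
clearbody k.
pose psi n a x := k n * rho (k n * x + (- (k n * a))).
pose H n a x := Hs (k n * x + (- (k n * a))).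
have dHn n a x : sderiv (H n a) x (psi n a x) by apply: sderiv_affine.
have arg n (a x : R) : k n * x - k n * a = k n * (x - a) by ring.
have psi0 n (a x : R) : (k n)^-1 <= `|x - a| -> psi n a x = 0.
  move=> xa; rewrite /psi rho0 ?mulr0// arg normrM gtr0_norm//.
  by rewrite -(mulfV (lt0r_neq0 (k0 n))) ler_pM2l.
have kV n : (k n)^-1 <= 1 by rewrite invf_le1.
have tpsi n a : test_function (psi n a).
  apply/test_functionP; split; first by move=> j; apply: ndZ; exact: nd_affine.
  exists (`|a| + 1) => x xa; apply: psi0; have := kV n; have := lerB_dist x a; lra.
have cH n (a x : R) : (x <= a - (k n)^-1 -> H n a x = 0) * (a + (k n)^-1 <= x -> H n a x = 1).
  have kk := mulfV (lt0r_neq0 (k0 n)).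
  split=> xa; rewrite /H arg; [rewrite Hm//|rewrite Hp//].
    by rewrite -kk -mulrN ler_pM2l//; lra.
  by rewrite -kk ler_pM2l//; lra.
exists psi => //; split.
- move=> f a hf la e e0.
  have trho : test_function rho.
    by apply/test_functionP; split => //; exists 1 => x /ltW; exact: rho0.
  have := trho => /test_functionP[_ [A hA]].
  have [M M0 hM] := continuous_compact_bound (fun x => test_cont x trho) hA.
  have hM' x : `|rho x| <= M.
    by apply: le_trans (hM x) _; rewrite indE; case: ifP; rewrite ?mulr1 ?mulr0.
  have M1 : 0 < M + 1 by lra.
  have [r r0 hr] := lebesgue_pt_avg hf la (divr_gt0 e0 M1).
  have r2 : 0 < r / 2 by lra.
  have [N hN] := invSn_lt r2; exists N => n /hN; rewrite kE => nr'.
  have nr : (k n)^-1 < r by lra.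
  have kp : 0 < (k n)^-1 by rewrite invr_gt0.
  have [hI hb] := hr (k n)^-1 kp nr.
  have i1 := Itg_mul hf (test_L2r (tpsi n a)).
  have i2 : Itg (psi n a).
    have /test_functionP[_ [B hB]] := tpsi n a.
    by apply: (@Itg_compact _ B) => // x; exact: test_cont.
  have one : Int (psi n a) = 1.
    rewrite (@Int_FTC _ (H n a) (a - (k n)^-1) (a + (k n)^-1))//.
    + by rewrite (cH n a (a - _)).1// (cH n a (a + _)).2// subr0.
    + lra.
    + by move=> x; exact: test_cont.
    + move=> x; rewrite negb_and -!ltNge => /orP h; apply: psi0.
      by case: h => h; [rewrite ler0_norm|rewrite ger0_norm]; lra.
  rewrite -[X in _ - X]mulr1 -one -IntZ// -IntB//; last exact: ItgZ.
  apply: le_trans (Int_abs _ (ItgZ (k n * M) hI) _) _.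
  + by apply: ItgB => //; exact: ItgZ.
  + move=> x; rewrite -mulrBl normrM [leRHS]mulrCA ler_wpM2l//.
    rewrite indicE; case: (boolP (x \in (ball a (k n)^-1 : set R))) => /= [_|].
      by rewrite mulr1 /psi normrM gtr0_norm// ler_wpM2l// ltW.
    move=> /negP xb; rewrite psi0 ?normr0 ?mulr0// leNgt; apply/negP => h; apply: xb.
    by apply/mem_set; rewrite /ball/= distrC.
  + rewrite IntZ//; apply: le_trans (ler_wpM2l _ hb) _; first by rewrite mulr_ge0// ltW.
    have -> : k n * M * ((k n)^-1 * (e / (M + 1))) = e * (M / (M + 1)).
      by field; rewrite !gt_eqF.
    rewrite -[leRHS]mulr1 ler_pM2l// ler_pdivrMr//; lra.
- move=> a b n ab; pose phi x := H n a x - H n b x.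
  have kp : 0 < (k n)^-1 by rewrite invr_gt0.
  have phi0 x : ~~ (a - (k n)^-1 <= x <= b + (k n)^-1) -> phi x = 0.
    rewrite negb_and -!ltNge => /orP[h|h]; rewrite /phi.
      by rewrite !(cH n _ x).1 ?subrr//; lra.
    by rewrite !(cH n _ x).2 ?subrr//; lra.
  have dphi x : sderiv phi x (psi n a x - psi n b x) by apply: sderivB.
  have tphi : test_function phi.
    apply/test_functionP; split.
      move=> j; have -> : phi = (fun x => H n a x + (-1) * H n b x).
        by apply/funext => x; rewrite mulN1r.
      by apply: ndD; last apply: ndZ; apply: nd_affine.
    exists (`|a| + `|b| + 1) => x; rewrite ltr_normr => /orP h; apply: phi0.
    rewrite negb_and -!ltNge; apply/orP.
    have := kV n; have := ler_norm (- a); have := ler_norm a; have := ler_norm b; have := ler_norm (- b).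
    rewrite !normrN => p1 p2 p3 p4 p5; have := normr_ge0 a; have := normr_ge0 b.
    by case: h => h; [right|left]; lra.
  exists phi => //; split=> [x|]; first exact: sderiv_derive1.
  have -> : b - a + 2 / n.+1%:R = Int (ind (a - (k n)^-1) (b + (k n)^-1)).
    by rewrite Int_ind ?(kE n); lra.
  have [_ i2] := test_L2r tphi.
  apply: Int_le => //; first exact: Itg_ind.
  move=> x; rewrite indE; case: ifPn => [_|/phi0 ->]; last by rewrite expr0n.
  rewrite -real_normK ?num_real// expr_le1// ler_norml.
  have /andP[p1 p2] := H01 (k n * x + - (k n * a)).
  have /andP[p3 p4] := H01 (k n * x + - (k n * b)).
  by rewrite /phi /H; apply/andP; split; lra.
Qed.

Lemma lim_sqr_le (X : nat -> R) (l G d : R) : X n @[n --> \oo] --> l ->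
  (forall n, X n ^+ 2 <= G * (d + 2 / n.+1%:R)) -> l ^+ 2 <= G * d.
Proof.
move=> cX hX.
have c1 : X n ^+ 2 @[n --> \oo] --> l ^+ 2 by rewrite !expr2; under eq_fun do rewrite expr2; exact: cvgM.
have c2 : G * (d + 2 / n.+1%:R) @[n --> \oo] --> G * (d + 2 * 0).
  apply: cvgMr; apply: cvgD; first exact: cvg_cst.
  by apply: cvgMr; exact: cvg_harmonic.
rewrite mulr0 addr0 in c2.
by apply: ler_cvg_to c1 c2 _; exact: nearW.
Qed.

(** At a Lebesgue point [f] is the limit of its mollifications, all of which vanish. *)
Lemma weak_zero f : L2r f -> (forall phi, test_function phi -> Int (fun x => f x * phi x) = 0) ->
  {ae mu, forall x, f x = 0}.
Proof.
move=> hf h0; have [psi tpsi [cpsi _]] := mollifier.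
apply: ae_imp (lebesgue_differentiation (locally_integrable_L2r hf)) => x lx.
apply/eqP; rewrite -normr_le0; apply/ler_addgt0Pl => e e0; rewrite addr0.
by have [N /(_ _ (leqnn N))] := cpsi f x hf lx e e0; rewrite h0// sub0r normrN.
Qed.

(** A set of full measure is dense: each point is approached by good points [A n x] within 1/(n+1),
    and the Hölder bound makes the values there converge and passes to their limits. *)
Lemma holder_extension (P : R -> Prop) f (G : R) : 0 <= G -> {ae mu, forall x, P x} ->
  (forall a b, P a -> P b -> (f b - f a) ^+ 2 <= G * `|b - a|) ->
  exists2 w : R -> R, (forall a b, (w b - w a) ^+ 2 <= G * `|b - a|) &
    forall x, P x -> w x = f x.
Proof.
move=> G0 aeP hf.
have n0 n : 0 < n.+1%:R^-1 :> R by rewrite invr_gt0.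
pose A n x := s2val (cid2 (ae_dense x aeP (n0 n))).
have A1 n x : `|A n x - x| < n.+1%:R^-1 := s2valP (cid2 (ae_dense x aeP (n0 n))).
have AP n x : P (A n x) := s2valP' (cid2 (ae_dense x aeP (n0 n))).
have cA x : cvgn (fun n => f (A n x)).
  apply: cauchy_slim => e e0.
  have G1 : 0 < 2 * G + 1 by lra.
  have [N hN] := invSn_lt (divr_gt0 (exprn_gt0 2 e0) G1); exists N => i j /hN hi /hN hj.
  rewrite -(@ler_pXn2r _ 2)// ?nnegrE ?(ltW e0)// real_normK ?num_real//.
  apply: le_trans (hf _ _ (AP j x) (AP i x)) _.
  have h1 : `|A i x - A j x| <= 2 * (e ^+ 2 / (2 * G + 1)).
    have := ler_distD x (A i x) (A j x); rewrite (distrC x).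
    have := A1 i x; have := A1 j x; move: hi hj.
    move: (i.+1%:R^-1) (j.+1%:R^-1) => p q; lra.
  apply: le_trans (ler_wpM2l G0 h1) _.
  have -> : G * (2 * (e ^+ 2 / (2 * G + 1))) = e ^+ 2 * (2 * G / (2 * G + 1)).
    by field; rewrite gt_eqF.
  rewrite -[leRHS]mulr1 ler_wpM2l ?sqr_ge0// ler_pdivrMr//; lra.
exists (fun x => limn (fun n => f (A n x))) => [a b|x Px].
  apply: (@lim_sqr_le (fun n => f (A n b) - f (A n a))); first exact: cvgB.
  move=> n; apply: le_trans (hf _ _ (AP n a) (AP n b)) _; rewrite ler_wpM2l//.
  have := A1 n a; have := A1 n b.
  have := ler_distD b (A n b) (A n a); have := ler_distD a b (A n a); rewrite (distrC a).
  move: (n.+1%:R^-1) => p; lra.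
apply/eqP; rewrite -subr_eq0 -sqrf_eq0 eq_le sqr_ge0 andbT.
have := @lim_sqr_le (fun n => f (A n x) - f x) (limn (fun n => f (A n x)) - f x) G 0.
rewrite mulr0; apply; first by apply: cvgB => //; exact: cvg_cst.
move=> n; apply: le_trans (hf _ _ Px (AP n x)) _; rewrite ler_wpM2l// add0r.
have := A1 n x; have := n0 n; move: (n.+1%:R^-1) => p; lra.
Qed.

(* Testing against smoothed indicators of [a, b], whose square norm is close to
   [b - a], bounds [f b - f a] at Lebesgue points. *)
Lemma weak_derivative_holder f g : L2r f -> L2r g ->
  (forall phi, test_function phi ->
    Int (fun x => f x * derive1 phi x) = - Int (fun x => g x * phi x)) ->
  exists2 w : R -> R, (forall a b, (w b - w a) ^+ 2 <= rsqn g * `|b - a|) &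
    {ae mu, forall x, w x = f x}.
Proof.
move=> hf hg fg; have [psi tpsi [cpsi dpsi]] := mollifier.
have leb := lebesgue_differentiation (locally_integrable_L2r hf).
have [|w hw wf] := holder_extension (rsqn_ge0 g) leb (f := f); last first.
  by exists w => //; apply: ae_imp leb; exact: wf.
move=> a b; wlog ab : a b / a <= b.
  move=> W la lb; case: (leP a b) => [|/ltW] ab; first exact: W.
  by rewrite -opprB sqrrN distrC; exact: W.
move=> la lb.
pose X n := Int (fun x => f x * psi n a x) - Int (fun x => f x * psi n b x).
have bX n : X n ^+ 2 <= rsqn g * (b - a + 2 / n.+1%:R).
  have [phi tphi [dphi bphi]] := dpsi a b n ab.
  have -> : X n = - Int (fun x => g x * phi x).
    rewrite -(fg _ tphi) /X -IntB; [|exact: Itg_mul hf (test_L2r (tpsi _ _))..].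
    by congr Int; apply/funext => x; rewrite dphi; ring.
  rewrite sqrrN; apply: le_trans (Int_CauchySchwarz hg (test_L2r tphi)) _.
  by rewrite ler_wpM2l ?rsqn_ge0.
have cX : X n @[n --> \oo] --> f a - f b.
  apply: cvgB; apply/cvgrPdist_le => d d0.
    by have [N h] := cpsi f a hf la _ d0; exists N => // n /h; rewrite distrC.
  by have [N h] := cpsi f b hf lb _ d0; exists N => // n /h; rewrite distrC.
by rewrite -opprB sqrrN ger0_norm ?subr_ge0//; exact: lim_sqr_le cX bX.
Qed.

End RealSobolev.

(** * The space of square-integrable functions *)

Section L2SpaceDef.
Context (R : realType).

Definition L2mem : {pred R -> Rcomplex R} := fun u => `[< L2c (u : R -> R[i]) >].

Lemma scalecE (a : R) (z : Rcomplex R) : a *: z = a%:C%C * (z : R[i]) :> R[i].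
Proof. by case: z => x y; rewrite /GRing.scale/=; congr Complex; ring. Qed.

Lemma L2mem_submod : submod_closed L2mem.
Proof.
split; first by apply/asboolP; exact: L2c_0.
move=> a u v /asboolP hu /asboolP hv; apply/asboolP.
have := L2c_D (L2c_Z a hu) hv; congr L2c; apply/funext => x; rewrite -scalecE//.
Qed.

HB.instance Definition _ := GRing.isSubmodClosed.Build R (R -> Rcomplex R) L2mem L2mem_submod.

Record L2sub := MkL2 { L2fun : R -> Rcomplex R; _ : L2fun \in L2mem }.

HB.instance Definition _ := [isSub of L2sub for L2fun].
HB.instance Definition _ := [Choice of L2sub by <:].
HB.instance Definition _ := [SubChoice_isSubLmodule of L2sub by <:].

Record L2model := {
  L2carrier : lmodType R;
  L2to : L2carrier -> R -> R[i];
  L2of : (R -> R[i]) -> L2carrier;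
  L2toD : forall u v x, L2to (u + v) x = L2to u x + L2to v x;
  L2toZ : forall (a : R) u x, L2to (a *: u) x = a%:C%C * L2to u x;
  L2to_inj : forall u v, L2to u = L2to v -> u = v;
  L2to_L2c : forall u, L2c (L2to u);
  L2ofK : forall f, L2c f -> L2to (L2of f) = f }.

(* Opaque on purpose: it keeps unification from unfolding the operations. *)
Lemma L2_model : L2model.
Proof.
exists L2sub (fun u => L2fun u : R -> R[i]) (fun f => insubd 0 (f : R -> Rcomplex R)).
- by [].
- by move=> a u x; rewrite -scalecE.
- exact: val_inj.
- by move=> u; have /asboolP := valP u.
- by move=> f hf; rewrite -[L2fun _]/(val _) insubdK//; apply/asboolP.
Qed.

(** Elements are functions rather than classes, so that the operations hold at every point and [fn]
    recovers the representative used in the statement; a.e. equality is null distance, by [nrm0_ae]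
    and [ae_nrm0]. *)
Definition L2space : Type := L2carrier L2_model.
HB.instance Definition _ := GRing.Lmodule.on L2space.
Definition fn (u : L2space) : R -> R[i] := L2to u.
Definition toL2 (f : R -> R[i]) : L2space := L2of L2_model f.

End L2SpaceDef.

Coercion fn : L2space >-> Funclass.
Arguments fn : simpl never.

Section L2SpaceTheory.
Context (R : realType).
Local Notation mu := (@lebesgue_measure R).
Local Notation V := (L2space R).
Implicit Types (u v h : V).

Lemma L2c_fn u : L2c (fn u). Proof. exact: L2to_L2c. Qed.
Lemma toL2E (f : R -> R[i]) : L2c f -> fn (toL2 f) = f. Proof. exact: L2ofK. Qed.
Lemma fnD u v x : fn (u + v) x = u x + v x. Proof. exact: L2toD. Qed.
Lemma fnZ (a : R) u x : fn (a *: u) x = a%:C%C * u x. Proof. exact: L2toZ. Qed.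
Lemma fn0 x : fn (0 : V) x = 0. Proof. by rewrite -(scale0r 0) fnZ mul0r. Qed.
Lemma fnN u x : fn (- u) x = - u x.
Proof. by apply/eqP; rewrite -addr_eq0 -fnD addNr fn0. Qed.
Lemma fnB u v x : fn (u - v) x = u x - v x. Proof. by rewrite fnD fnN. Qed.
Lemma L2space_eq u v : (forall x, u x = v x) -> u = v.
Proof. by move=> h; apply: L2to_inj; apply/funext => x; exact: h. Qed.

Definition dot u v : R := Int (fun x => cdot (u x) (v x)).
Definition Ji u : V := toL2 (fun x => 'i%C * u x).

Lemma JiE u x : Ji u x = 'i%C * u x.
Proof. by rewrite /Ji toL2E//; exact: L2c_i (L2c_fn u). Qed.

Lemma Itg_dot u v : Itg (fun x => cdot (u x) (v x)).
Proof. by apply: Itg_cdot; exact: L2c_fn. Qed.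

Lemma dotuu u : dot u u = sqn (fn u).
Proof. by rewrite /dot /sqn; congr Int; apply/funext => x; rewrite cmod_sqr. Qed.

Lemma dot_inner : semi_inner dot.
Proof.
split.
- by move=> u v; congr Int; apply/funext => x; rewrite cdotC.
- move=> u v h; rewrite -IntD; [|exact: Itg_dot..].
  by congr Int; apply/funext => x; rewrite fnD /cdot !cpx; ring.
- move=> a u v; rewrite -IntZ; last exact: Itg_dot.
  by congr Int; apply/funext => x; rewrite fnZ /cdot !cpx; ring.
- by move=> u; rewrite dotuu sqn_ge0.
Qed.

Local Notation nrm := (nrm dot).

Lemma nrm_sqn u : nrm u ^+ 2 = sqn (fn u).
Proof. by rewrite (nrm_sqr dot_inner) dotuu. Qed.

Lemma sqnB u v : sqn (fun x => u x - v x) = nrm (u - v) ^+ 2.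
Proof. by rewrite nrm_sqn; congr sqn; apply/funext => x; rewrite fnB. Qed.

Lemma L2_seq_lim_ae (w : nat -> V) : seq_cauchy dot w -> exists (u : V) (phi : nat -> nat),
  [/\ forall n, (n <= phi n)%N, {ae mu, forall x, cmod (w (phi k) x - u x) @[k --> \oo] --> 0} &
      seq_lim dot w u].
Proof.
move=> cw; have [|e e0|u [phi [hu hphi ae hl]]] := @L2_complete_seq R (fun n => fn (w n)).
- by move=> n; exact: L2c_fn.
- have e1 : 0 < Num.sqrt e by rewrite sqrtr_gt0.
  have [N hN] := cw _ e1; exists N => m n Nm Nn; rewrite sqnB.
  rewrite -(sqr_sqrtr (ltW e0)) lerXn2r ?nnegrE ?nrm_ge0 ?sqrtr_ge0//; exact: hN.
- exists (toL2 u), phi; rewrite toL2E//; split => // e e0.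
  have [N hN] := hl _ (exprn_gt0 2 e0); exists N => n /hN h.
  rewrite -(@ler_pXn2r _ 2)// ?nnegrE ?nrm_ge0 ?(ltW e0)//.
  by rewrite -sqnB toL2E.
Qed.

Lemma L2_seq_complete : seq_complete dot.
Proof. by move=> w /L2_seq_lim_ae[u [_ [_ _ h]]]; exists u. Qed.

Lemma nrm0_ae u v : nrm (u - v) = 0 -> ae_equal (fn u) (fn v).
Proof.
move=> h; have : sqn (fn (u - v)) = 0 by rewrite -nrm_sqn h expr0n.
move=> /(sqn_eq0 (L2c_fn _)); apply: ae_imp => x; rewrite fnB => /eqP.
by rewrite subr_eq0 => /eqP.
Qed.

Lemma ae_nrm0 u v : ae_equal (fn u) (fn v) -> nrm (u - v) = 0.
Proof.
move=> uv; apply/eqP; rewrite -sqrf_eq0 nrm_sqn; apply/eqP.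
have [|_ ->] := @sqn_ae R _ _ (@L2c_0 R) (L2c_fn (u - v)).1.
  by apply: ae_imp uv => x; rewrite fnB => ->; rewrite subrr.
by rewrite /sqn; under eq_fun do rewrite cmod0 expr0n; exact: Int0.
Qed.

Lemma L2dotE u v : L2dot (fn u) (fn v) = dot u v.
Proof. by rewrite /L2dot /cintegral /=; congr Int; apply/funext => x; rewrite Re_mul_conj. Qed.

Lemma Ji_skew u v : dot (Ji u) v = - dot u (Ji v).
Proof.
rewrite /dot -IntN; last exact: Itg_dot.
by congr Int; apply/funext => x; rewrite !JiE /cdot !cpx; ring.
Qed.

Lemma Ji_isom u v : dot (Ji u) (Ji v) = dot u v.
Proof. by congr Int; apply/funext => x; rewrite !JiE /cdot !cpx; ring. Qed.

Lemma Ji_lin (a : R) u v : Ji (a *: u + v) = a *: Ji u + Ji v.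
Proof.
apply: L2space_eq => x; rewrite !(JiE, fnD, fnZ) mulrDr; congr (_ + _).
by rewrite mulrCA.
Qed.

Definition test : set V :=
  [set u | test_function (fun x => complex.Re (u x)) /\
           test_function (fun x => complex.Im (u x))].
Definition dtest u : V := toL2 (fun x =>
  Complex (derive1 (fun x => complex.Re (u x)) x) (derive1 (fun x => complex.Im (u x)) x)).

Lemma cmod2E (z : R[i]) : cmod z ^+ 2 = complex.Re z ^+ 2 + complex.Im z ^+ 2.
Proof. by rewrite cmod_sqr /cdot !expr2. Qed.

Lemma L2cP (f : R -> R[i]) : L2c f <->
  L2r (fun x => complex.Re (f x)) /\ L2r (fun x => complex.Im (f x)).
Proof.
split=> [[[m1 m2] h]|[[m1 h1] [m2 h2]]].
  split; split => //; apply: Itg_le h; try exact: meas_sqr;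
    move=> x; rewrite ger0_norm ?sqr_ge0// cmod2E ?lerDl ?lerDr sqr_ge0//.
split=> //; move: (ItgD h1 h2); congr Itg; apply/funext => x; by rewrite cmod2E.
Qed.

Lemma sqn_ReIm (f : R -> R[i]) : L2c f ->
  sqn f = rsqn (fun x => complex.Re (f x)) + rsqn (fun x => complex.Im (f x)).
Proof.
move=> /L2cP[[_ h1] [_ h2]]; rewrite /rsqn -IntD//.
by congr Int; apply/funext => x; rewrite cmod2E.
Qed.

Lemma dtestE u x : test u -> dtest u x =
  Complex (derive1 (fun x => complex.Re (u x)) x) (derive1 (fun x => complex.Im (u x)) x).
Proof.
move=> [t1 t2]; rewrite /dtest toL2E//; apply/L2cP; split => /=; apply: test_L2r;
  exact: test_derive1.
Qed.

Lemma test0 : test 0.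
Proof.
split; under eq_fun do rewrite fn0;
  by apply/test_functionP; split; [move=> n; exact: nd_cst|exists 0].
Qed.

Lemma testD (a : R) u v : test u -> test v -> test (a *: u + v).
Proof.
move=> [u1 u2] [v1 v2]; split.
  by have := testZD a u1 v1; congr test_function; apply/funext => x; rewrite fnD fnZ !cpx.
by have := testZD a u2 v2; congr test_function; apply/funext => x; rewrite fnD fnZ !cpx.
Qed.

Lemma dtestD (a : R) u v : test u -> test v -> dtest (a *: u + v) = a *: dtest u + dtest v.
Proof.
move=> tu tv; apply: L2space_eq => x; rewrite (dtestE x (testD a tu tv)) [RHS]fnD fnZ (dtestE x tu) (dtestE x tv).
have [u1 u2] := tu; have [v1 v2] := tv.
apply/eqP; rewrite eq_complex !cpx /=; apply/andP; split; apply/eqP.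
  rewrite -(congr1 (@^~ x) (test_derive1ZD a u1 v1)); congr (derive1 _ x).
  by apply/funext => y; rewrite fnD fnZ !cpx.
rewrite -(congr1 (@^~ x) (test_derive1ZD a u2 v2)); congr (derive1 _ x).
by apply/funext => y; rewrite fnD fnZ !cpx.
Qed.

Definition retest (f : R -> R) : V := toL2 (fun x => (f x)%:C%C).
Definition imtest (f : R -> R) : V := toL2 (fun x => 'i%C * (f x)%:C%C).

Lemma L2c_real (f : R -> R) : L2r f -> L2c (fun x => (f x)%:C%C).
Proof. by move=> hf; apply/L2cP; split => //=; split; [exact: meas_cst|under eq_fun do rewrite expr0n; exact: Itg0]. Qed.

Lemma retestE f x : test_function f -> retest f x = (f x)%:C%C.
Proof. by move=> tf; rewrite /retest toL2E//; exact: L2c_real (test_L2r tf). Qed.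
Lemma imtestE f x : test_function f -> imtest f x = 'i%C * (f x)%:C%C.
Proof. by move=> tf; rewrite /imtest toL2E//; exact: L2c_i (L2c_real (test_L2r tf)). Qed.

Lemma test_function0 : test_function (fun=> 0 : R).
Proof. by apply/test_functionP; split; [move=> n; exact: nd_cst|exists 0]. Qed.

Lemma retest_test f : test_function f -> test (retest f).
Proof.
move=> tf; split; first by move: (tf); congr test_function; apply/funext => x; rewrite retestE.
by move: test_function0; congr test_function; apply/funext => x; rewrite retestE.
Qed.

Lemma imtest_test f : test_function f -> test (imtest f).
Proof.
move=> tf; split; last by move: (tf); congr test_function; apply/funext => x; rewrite imtestE// !cpx.
by move: test_function0; congr test_function; apply/funext => x; rewrite imtestE// !cpx/= oppr0.
Qed.

Lemma derive1_cst0 x : derive1 (fun=> 0 : R) x = 0.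
Proof. by apply: sderiv_derive1; exact: sderiv_cst. Qed.

Lemma dtest_re f x : test_function f -> dtest (retest f) x = (derive1 f x)%:C%C.
Proof.
move=> tf; rewrite dtestE; last exact: retest_test.
congr Complex; first by congr (derive1 _ x); apply/funext => y; rewrite retestE.
by rewrite -[RHS](derive1_cst0 x); congr (derive1 _ x); apply/funext => y; rewrite retestE.
Qed.

Lemma dtest_im f x : test_function f -> dtest (imtest f) x = 'i%C * (derive1 f x)%:C%C.
Proof.
move=> tf; rewrite dtestE; last exact: imtest_test.
apply/eqP; rewrite eq_complex !cpx /=; apply/andP; split; apply/eqP; last first.
  by congr (derive1 _ x); apply/funext => y; rewrite imtestE// !cpx.
by rewrite oppr0 -[RHS](derive1_cst0 x); congr (derive1 _ x); apply/funext => y; rewrite imtestE// !cpx/= oppr0.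
Qed.

Lemma dot_ReIm u v : dot u v = Int (fun x => complex.Re (u x) * complex.Re (v x)) +
  Int (fun x => complex.Im (u x) * complex.Im (v x)).
Proof.
have /L2cP[u1 u2] := L2c_fn u; have /L2cP[v1 v2] := L2c_fn v.
by rewrite -IntD//; exact: Itg_mul.
Qed.

Lemma dot_re u f : test_function f -> dot u (retest f) = Int (fun x => complex.Re (u x) * f x).
Proof.
move=> tf; congr Int; apply/funext => x; rewrite retestE// /cdot /=; ring.
Qed.
Lemma dot_im u f : test_function f -> dot u (imtest f) = Int (fun x => complex.Im (u x) * f x).
Proof.
move=> tf; congr Int; apply/funext => x; rewrite imtestE// /cdot !cpx /=; ring.
Qed.

Lemma test_orthogonal u : (forall v, test v -> dot u v = 0) -> nrm u = 0.
Proof.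
move=> h; have /L2cP[u1 u2] := L2c_fn u.
have z1 := weak_zero u1 (fun f tf => etrans (esym (dot_re u tf)) (h _ (retest_test tf))).
have z2 := weak_zero u2 (fun f tf => etrans (esym (dot_im u tf)) (h _ (imtest_test tf))).
rewrite -[u]subr0; apply: ae_nrm0; apply: ae_imp (ae_and z1 z2) => x [].
by rewrite fn0; case: (u x) => a b /= -> ->.
Qed.

Lemma test_dense u (e : R) : 0 < e -> exists2 v, test v & nrm (u - v) <= e.
Proof.
move=> e0; apply: (orthogonal_dense dot_inner u L2_seq_complete _ _ _ e0).
- exact: test0.
- exact: testD.
- exact: test_orthogonal.
Qed.

Lemma ReMr (z : R[i]) (a : R) : complex.Re (z * a%:C%C) = complex.Re z * a.
Proof. by rewrite mulrC ReZ mulrC. Qed.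
Lemma ImMr (z : R[i]) (a : R) : complex.Im (z * a%:C%C) = complex.Im z * a.
Proof. by rewrite mulrC ImZ mulrC. Qed.

(** Integration by parts for the real scalar product and complex test functions; [wdP] splits these
    into real and imaginary parts to recover the given notion. *)
Definition wd u v : Prop := forall h, test h -> dot u (dtest h) = - dot v h.

Lemma wdP u v : L2_weak_derivative (fn u) (fn v) <-> wd u v.
Proof.
split=> [[_ h] k tk|h].
  have [t1 t2] := tk.
  have [e1 _] := h _ t1; have [_ e2] := h _ t2.
  rewrite !dot_ReIm.
  have -> : Int (fun x => complex.Re (u x) * complex.Re (dtest k x)) =
      - Int (fun x => complex.Re (v x) * complex.Re (k x)).
    move: e1; rewrite /= => e1; transitivity (Int (fun x => complex.Re (u x * (derive1 (fun y => complex.Re (k y)) x)%:C%C))).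
      by congr Int; apply/funext => x; rewrite dtestE//= ReMr.
    rewrite [LHS]e1; congr (- _); congr Int; apply/funext => x; by rewrite ReMr.
  have -> : Int (fun x => complex.Im (u x) * complex.Im (dtest k x)) =
      - Int (fun x => complex.Im (v x) * complex.Im (k x)).
    transitivity (Int (fun x => complex.Im (u x * (derive1 (fun y => complex.Im (k y)) x)%:C%C))).
      by congr Int; apply/funext => x; rewrite dtestE//= ImMr.
    rewrite [LHS]e2; congr (- _); congr Int; apply/funext => x; by rewrite ImMr.
  by rewrite opprD.
split; first exact/L2P/L2c_fn.
move=> f tf; have tf' := test_derive1 tf.
have h1 := h _ (retest_test tf); have h2 := h _ (imtest_test tf).
rewrite dot_re// in h1; rewrite dot_im// in h2.
apply/eqP; rewrite eq_complex /=; apply/andP; split; apply/eqP.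
  transitivity (- Int (fun x => complex.Re (v x) * f x)).
    rewrite -h1; congr Int; apply/funext => x; rewrite dtest_re// ReMr /cdot /=; ring.
  by congr (- _); congr Int; apply/funext => x; rewrite ReMr.
transitivity (- Int (fun x => complex.Im (v x) * f x)).
  rewrite -h2; congr Int; apply/funext => x; rewrite dtest_im// ImMr /cdot !cpx /=; ring.
by congr (- _); congr Int; apply/funext => x; rewrite ImMr.
Qed.

End L2SpaceTheory.

(** * The space H^1 inside the semi-inner product space *)

Section Sobolev.
Context (R : realType).
Local Notation mu := (@lebesgue_measure R).
Local Notation V := (L2space R).
Local Notation dot := (@dot R).
Local Notation nrm := (nrm dot).
Local Notation HI := (@dot_inner R).
Implicit Types (u v h k : V).

Lemma wd_unique u v v' : wd u v -> wd u v' -> nrm (v - v') = 0.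
Proof.
move=> h h'; apply: test_orthogonal => k tk; rewrite (dotBl HI).
by have := h _ tk; rewrite (h' _ tk) => /oppr_inj ->; rewrite subrr.
Qed.

Lemma wd_lin (a : R) u v h k : wd u v -> wd h k -> wd (a *: u + h) (a *: v + k).
Proof.
move=> uv hk q tq; rewrite !(dotDl HI) !(dotZl HI) (uv _ tq) (hk _ tq).
by rewrite mulrN opprD.
Qed.

Lemma test_Ji h : test h -> test (Ji h).
Proof.
move=> [t1 t2]; split; last first.
  by move: t1; congr test_function; apply/funext => x; rewrite JiE !cpx.
have := testZD (-1) t2 (@test_function0 R); congr test_function; apply/funext => x.
by rewrite JiE !cpx mulN1r addr0.
Qed.

Lemma dtest_Ji h : test h -> dtest (Ji h) = Ji (dtest h).
Proof.
move=> th; apply: L2space_eq => x; rewrite JiE (dtestE x th) (dtestE x (test_Ji th)).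
have [t1 t2] := th.
apply/eqP; rewrite eq_complex !cpx /=; apply/andP; split; apply/eqP; last first.
  by congr (derive1 _ x); apply/funext => y; rewrite JiE !cpx.
rewrite -mulN1r -[RHS]addr0 -[X in _ + X](derive1_cst0 x).
rewrite -(congr1 (@^~ x) (test_derive1ZD (-1) t2 (@test_function0 R))).
by congr (derive1 _ x); apply/funext => y; rewrite JiE !cpx mulN1r addr0.
Qed.

Lemma wd_Ji u v : wd u v -> wd (Ji u) (Ji v).
Proof.
move=> uv h th; rewrite !Ji_skew opprK -dtest_Ji// uv ?opprK//; exact: test_Ji.
Qed.

Definition Dv u : V := toL2 (wderiv (fn u)).

Lemma H1_ex u : H1 (fn u) <-> exists v, wd u v.
Proof.
split=> [[_ [v hv]]|[v hv]]; last by split; [exact/L2P/L2c_fn|exists (fn v); apply/wdP].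
have [/L2P l2 _] := hv; exists (toL2 v); apply/wdP; rewrite toL2E//.
Qed.

Lemma wderivP u : H1 (fn u) -> L2_weak_derivative (fn u) (wderiv (fn u)).
Proof. by move=> [_ [v hv]]; apply: (xgetPex (fun=> 0)); exists v. Qed.

Lemma DvE u : H1 (fn u) -> fn (Dv u) = wderiv (fn u).
Proof. by move=> /wderivP [/L2P h _]; rewrite /Dv toL2E. Qed.

Lemma wd_Dv u : H1 (fn u) -> wd u (Dv u).
Proof. by move=> hu; apply/wdP; rewrite DvE//; exact: wderivP. Qed.

Lemma H1_lin (a : R) u v : H1 (fn u) -> H1 (fn v) -> H1 (fn (a *: u + v)).
Proof.
move=> hu hv; apply/H1_ex; exists (a *: Dv u + Dv v).
by apply: wd_lin; exact: wd_Dv.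
Qed.

Lemma Dv_lin (a : R) u v : H1 (fn u) -> H1 (fn v) ->
  nrm (Dv (a *: u + v) - (a *: Dv u + Dv v)) = 0.
Proof.
move=> hu hv; apply: (@wd_unique (a *: u + v)); first exact/wd_Dv/H1_lin.
by apply: wd_lin; exact: wd_Dv.
Qed.

Lemma H1_Ji u : H1 (fn u) -> H1 (fn (Ji u)).
Proof. by move=> hu; apply/H1_ex; exists (Ji (Dv u)); apply: wd_Ji; exact: wd_Dv. Qed.

Lemma Dv_Ji u : H1 (fn u) -> nrm (Dv (Ji u) - Ji (Dv u)) = 0.
Proof.
move=> hu; apply: (@wd_unique (Ji u)); first exact/wd_Dv/H1_Ji.
by apply: wd_Ji; exact: wd_Dv.
Qed.

Lemma dot_nrm0 u v h : nrm (u - v) = 0 -> dot u h = dot v h.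
Proof.
by move=> /(nrm_null_dot HI h); rewrite (dotBl HI) => /eqP; rewrite subr_eq0 => /eqP.
Qed.

Lemma nrm_nrm0 u v : nrm (u - v) = 0 -> nrm u = nrm v.
Proof.
move=> h; apply/eqP; rewrite -subr_eq0 -normr_le0 -h; exact: nrm_diff HI _ _.
Qed.

Lemma dot_Dv_lin (a : R) u v h : H1 (fn u) -> H1 (fn v) ->
  dot (Dv (a *: u + v)) h = a * dot (Dv u) h + dot (Dv v) h.
Proof. by move=> hu hv; rewrite (dot_nrm0 _ (Dv_lin a hu hv)) (dotDl HI) (dotZl HI). Qed.

Lemma H1B u v : H1 (fn u) -> H1 (fn v) -> H1 (fn (u - v)).
Proof. by move=> hu hv; rewrite -scaleN1r addrC; exact: H1_lin. Qed.

Lemma dot_DvB u v h : H1 (fn u) -> H1 (fn v) -> dot (Dv (u - v)) h = dot (Dv u) h - dot (Dv v) h.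
Proof. by move=> hu hv; rewrite -scaleN1r addrC dot_Dv_lin// mulN1r addrC. Qed.

Lemma DvB u v : H1 (fn u) -> H1 (fn v) -> nrm (Dv (u - v) - (Dv u - Dv v)) = 0.
Proof.
move=> hu hv; rewrite -[X in Dv (_ + X)]scaleN1r (addrC u) -[X in _ - (_ + X)]scaleN1r.
by rewrite (addrC (Dv u)); exact: Dv_lin.
Qed.

(** The functional h -> -(u, h') on test functions is a limit of functionals bounded by [C], so
    Riesz representation produces the weak derivative together with its bound. *)
Lemma H1_closed (w : nat -> V) u (C : R) : 0 <= C -> (forall n, H1 (fn (w n))) ->
  (forall n, nrm (Dv (w n)) <= C) -> seq_lim dot w u -> H1 (fn u) /\ nrm (Dv u) <= C.
Proof.
move=> C0 hw hC wu.
have [||v [lv vC]] := @riesz _ _ _ HI (@test R) (fun h => - dot u (dtest h)) C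
  (@L2_seq_complete R) (@test0 R) (@testD R) _ C0.
- by move=> a x y tx ty; rewrite dtestD// (dotDr HI) (dotZr HI) opprD mulrN.
- move=> h th; rewrite normrN; apply/ler_addgt0Pr => e e0.
  have e1 : 0 < e / (nrm (dtest h) + 1) by rewrite divr_gt0// ltr_wpDl// nrm_ge0.
  have [N /(_ N (leqnn _)) hN] := wu _ e1.
  have -> : dot u (dtest h) = - dot (Dv (w N)) h - dot (w N - u) (dtest h).
    by rewrite -(wd_Dv (hw N) th) (dotBl HI); ring.
  apply: le_trans (ler_normB _ _) _; rewrite normrN; apply: lerD.
    by apply: le_trans (CauchySchwarz HI _ _) _; rewrite ler_wpM2r ?nrm_ge0.
  apply: le_trans (CauchySchwarz HI _ _) _.
  apply: le_trans (ler_wpM2r (nrm_ge0 _ _) hN) _.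
  rewrite mulrAC ler_pdivrMr ?ltr_wpDl ?nrm_ge0// ler_wpM2l ?(ltW e0)// lerDl//.
have uv : wd u v by move=> h th; rewrite -lv// opprK.
have hu : H1 (fn u) by apply/H1_ex; exists v.
by split => //; rewrite (nrm_nrm0 (wd_unique (wd_Dv hu) uv)).
Qed.

Lemma holder_cont (f : R -> R) (G : R) : 0 <= G ->
  (forall a b, (f b - f a) ^+ 2 <= G * `|b - a|) -> forall x, scont f x.
Proof.
move=> G0 hf x e e0; exists (e ^+ 2 / (G + 1)); first by rewrite divr_gt0 ?exprn_gt0// ltr_wpDl.
move=> s hs; rewrite -(@ler_pXn2r _ 2)// ?nnegrE ?(ltW e0)// real_normK ?num_real//.
apply: le_trans (hf _ _) _; apply: le_trans (ler_wpM2l G0 (ltW hs)) _.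
by rewrite mulrA ler_pdivrMr ?ltr_wpDl// mulrC ler_wpM2l ?sqr_ge0// lerDl.
Qed.

Lemma H1_holder u v : wd u v -> exists2 w : R -> R[i],
  forall a b, cmod (w b - w a) ^+ 2 <= nrm v ^+ 2 * `|b - a| & ae_equal w (fn u).
Proof.
move=> /wdP[_ uv]; have /L2cP[u1 u2] := L2c_fn u; have /L2cP[v1 v2] := L2c_fn v.
have [|w1 hw1 e1] := weak_derivative_holder u1 v1.
  move=> f tf; have [e _] := uv _ tf.
  transitivity (Int (fun x => complex.Re (u x * (derive1 f x)%:C%C))).
    by congr Int; apply/funext => x; rewrite ReMr.
  by rewrite [LHS]e; congr (- _); congr Int; apply/funext => x; rewrite ReMr.
have [|w2 hw2 e2] := weak_derivative_holder u2 v2.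
  move=> f tf; have [_ e] := uv _ tf.
  transitivity (Int (fun x => complex.Im (u x * (derive1 f x)%:C%C))).
    by congr Int; apply/funext => x; rewrite ImMr.
  by rewrite [LHS]e; congr (- _); congr Int; apply/funext => x; rewrite ImMr.
exists (fun x => Complex (w1 x) (w2 x)) => [a b|].
  rewrite cmod2E !cpx /= nrm_sqn (sqn_ReIm (L2c_fn v)) mulrDl; exact: lerD.
apply: ae_imp (ae_and e1 e2) => x [-> ->]; by case: (u x).
Qed.

Lemma continuous_ae_eq (f g : R -> R) : continuous f -> continuous g ->
  {ae mu, forall x, f x = g x} -> f = g.
Proof.
move=> cf cg fg; apply/funext => x; apply/eqP; rewrite -subr_eq0 -normr_le0.
apply/ler_addgt0Pl => e e0; rewrite addr0.
have e2 : 0 < e / 2 by rewrite divr_gt0.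
have /scontP/(_ _ e2) [r1 r10 h1] := cf x; have /scontP/(_ _ e2) [r2 r20 h2] := cg x.
have r0 : 0 < Num.min r1 r2 by rewrite lt_min r10.
have [y] := ae_dense x fg r0; rewrite lt_min => /andP[/h1 k1 /h2 k2] e'.
move: k1 k2; rewrite e' !ler_norml => /andP[p1 p2] /andP[p3 p4]; apply/andP; split; lra.
Qed.

Definition ccont (w : R -> R[i]) := continuous (fun x => complex.Re (w x)) /\
  continuous (fun x => complex.Im (w x)).

Lemma creprE (f w : R -> R[i]) : ccont w -> ae_equal w f -> crepr f = w.
Proof.
move=> [c1 c2] wf; rewrite /crepr; case: xgetP => [w' _ [d1 d2 wf']|/(_ w) h]; last by exfalso; apply: h.
have ww : ae_equal w' w by apply: ae_imp (ae_and wf wf') => x [-> ->].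
have eR := continuous_ae_eq d1 c1 (ae_imp (fun x e => congr1 (@complex.Re R) e) ww).
have eI := continuous_ae_eq d2 c2 (ae_imp (fun x e => congr1 (@complex.Im R) e) ww).
apply/funext => x; have := congr1 (@^~ x) eR; have := congr1 (@^~ x) eI => /=.
by case: (w x) (w' x) => a b [c d] /= -> ->.
Qed.

Lemma ccont_holder (w : R -> R[i]) (G : R) : 0 <= G ->
  (forall a b, cmod (w b - w a) ^+ 2 <= G * `|b - a|) -> ccont w.
Proof.
move=> G0 h; split=> x; apply/scontP; apply: (holder_cont G0) => a b;
  apply: le_trans (h a b); rewrite cmod2E !cpx ?lerDl ?lerDr sqr_ge0//.
Qed.

Lemma crepr_spec u : H1 (fn u) -> [/\ ccont (crepr (fn u)), ae_equal (crepr (fn u)) (fn u) &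
  forall a b, cmod (crepr (fn u) b - crepr (fn u) a) ^+ 2 <= nrm (Dv u) ^+ 2 * `|b - a|].
Proof.
move=> hu; have [w hw wu] := H1_holder (wd_Dv hu).
have cw := ccont_holder (sqr_ge0 _) hw.
by rewrite (creprE cw wu).
Qed.

Lemma crepr_lin (a : R) u v x : H1 (fn u) -> H1 (fn v) ->
  crepr (fn (a *: u + v)) x = a%:C%C * crepr (fn u) x + crepr (fn v) x.
Proof.
move=> /crepr_spec[[c1 c2] e _] /crepr_spec[[d1 d2] e' _].
rewrite (@creprE _ (fun x => a%:C%C * crepr (fn u) x + crepr (fn v) x))//.
  split=> y.
    under eq_fun do rewrite !cpx.
    by apply: cvgD; [apply: cvgMr; exact: c1|exact: d1].
  under eq_fun do rewrite !cpx.
  by apply: cvgD; [apply: cvgMr; exact: c2|exact: d2].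
by apply: ae_imp (ae_and e e') => y [-> ->]; rewrite fnD fnZ.
Qed.

Lemma cmeas_ccont (w : R -> R[i]) : ccont w -> cmeasurable w.
Proof. by move=> [c1 c2]; split; apply: continuous_measurable_fun. Qed.

(** Average |w(x)|^2 <= 2 |w(y)|^2 + 2 |u'|^2 l over y in [x, x + l]. The free length [l] allows an
    arbitrarily small coefficient on the derivative. *)
Lemma H1_sup u x (l : R) : H1 (fn u) -> 0 < l ->
  cmod (crepr (fn u) x) ^+ 2 <= 2 / l * nrm u ^+ 2 + 2 * l * nrm (Dv u) ^+ 2.
Proof.
move=> hu l0; have [cw wu hw] := crepr_spec hu.
set w := crepr (fn u) in cw wu hw *; set G := nrm (Dv u) ^+ 2 in hw *.
have uw : ae_equal (fn u) w by apply: ae_imp wu => y ->.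
have [[_ iw] sw] := sqn_ae (L2c_fn u) (cmeas_ccont cw) uw.
rewrite nrm_sqn -sw.
have h : Int (fun y => cmod (w x) ^+ 2 * ind x (x + l) y) <=
    Int (fun y => 2 * cmod (w y) ^+ 2 + 2 * (G * l) * ind x (x + l) y).
  apply: Int_le.
  - by apply: ItgZ; exact: Itg_ind.
  - by apply: ItgD; [exact: ItgZ|apply: ItgZ; exact: Itg_ind].
  move=> y; rewrite indE; case: ifP => [/andP[xy yx]|_]; last first.
    by rewrite !mulr0 addr0 mulr_ge0// sqr_ge0.
  rewrite !mulr1.
  have h1 : cmod (w x) ^+ 2 <= (cmod (w y) + cmod (w x - w y)) ^+ 2.
    rewrite lerXn2r ?nnegrE ?addr_ge0 ?cmod_ge0//.
    by have := cmodD (w y) (w x - w y); rewrite addrC subrK.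
  have h2 : cmod (w x - w y) ^+ 2 <= G * l.
    apply: le_trans (hw y x) _; rewrite ler_wpM2l ?sqr_ge0// ler0_norm; lra.
  apply: le_trans h1 _.
  have := sqr_ge0 (cmod (w y) - cmod (w x - w y)).
  rewrite sqrrB sqrrD; lra.
rewrite IntZ in h; last exact: Itg_ind.
rewrite IntD in h; [|exact: ItgZ|apply: ItgZ; exact: Itg_ind].
rewrite !IntZ// in h; [|exact: Itg_ind..].
rewrite Int_ind in h; last by lra.
rewrite -/(sqn w) (_ : x + l - x = l) in h; last by ring.
rewrite -(ler_pM2r l0); apply: le_trans h _.
rewrite le_eqVlt; apply/orP; left; apply/eqP; field; by rewrite gt_eqF.
Qed.

End Sobolev.

(** * The truncated energy *)

Section NonlinearFunctional.
Context (R : realType) (m : R).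
Local Notation mu := (@lebesgue_measure R).
Local Notation V := (L2space R).
Local Notation dot := (@dot R).
Local Notation nrm := (nrm dot).
Local Notation HI := (@dot_inner R).
Local Notation cTh := (cTh m).
Local Notation cal := (cal m).
Local Notation cbe := (cbe m).
Implicit Types (u v h g k : V).

Lemma meas_qf (f : R -> R) : meas f -> meas (fun x => qf m (f x)).
Proof.
move=> mf; apply: meas_max; first exact: meas_cst.
by apply: measB; [exact: meas_cst|apply: meas_ln; exact: meas_sqr].
Qed.

Lemma meas_cbe (f : R -> R[i]) : cmeasurable f -> meas (fun x => cbe (f x)).
Proof.
move=> mf; have mc := cmeas_cmod mf; apply: measM => //.
by apply: measD; [exact: meas_cst|exact: meas_qf].
Qed.

Lemma meas_cTh (f : R -> R[i]) : cmeasurable f -> meas (fun x => cTh (f x)).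
Proof.
move=> mf; have mc := cmeas_cmod mf; apply: measB.
  by apply: measM; [exact: meas_sqr|apply: measD; [exact: meas_cst|exact: meas_qf]].
apply: meas_max; first exact: meas_cst.
by apply: measB; [exact: meas_sqr|exact: meas_cst].
Qed.

Lemma cmeas_cal (f : R -> R[i]) : cmeasurable f -> cmeasurable (fun x => cal (f x)).
Proof.
move=> mf; apply: cmeasM => //; apply: measD; first exact: meas_cst.
by apply: meas_qf; exact: cmeas_cmod.
Qed.

Definition LTh u : Prop := Itg (fun x => cTh (u x)).
(** Its derivative is [2 * Ppot u h]; the factor 1/2 in [Phi] absorbs the 2. *)
Definition Kpot u : R := Int (fun x => cTh (u x)).
Definition Ppot u h : R := Int (fun x => cdot (cal (u x)) (h x)).

Lemma cmeas_fn u : cmeasurable (fn u). Proof. by have [] := L2c_fn u. Qed.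

Lemma K_ge0 u : 0 <= Kpot u. Proof. by apply: Int_ge0 => x; exact: cTh_ge0. Qed.

Lemma Itg_self u : LTh u -> Itg (fun x => cmod (u x) * cbe (u x)).
Proof.
move=> hu; apply: Itg_le (ItgZ 3 hu).
  by apply: measM; [exact: cmeas_cmod (cmeas_fn u)|exact: meas_cbe (cmeas_fn u)].
move=> x; rewrite ger0_norm; last by rewrite mulr_ge0 ?cmod_ge0 ?cbe_ge0.
exact: be_le_Th (cmod_ge0 _).
Qed.

Lemma Int_self u : LTh u -> Int (fun x => cmod (u x) * cbe (u x)) <= 3 * Kpot u.
Proof.
move=> hu; rewrite /Kpot -IntZ//; apply: Int_le; [exact: Itg_self|exact: ItgZ|].
by move=> x; exact: be_le_Th (cmod_ge0 _).
Qed.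

Lemma pair_le (z w : R[i]) : cbe z * cmod w <= cmod z * cbe z + 2 * (cmod w * cbe w).
Proof.
have := pairing_strong m (lexx 1) (cmod_ge0 z) (cmod_ge0 w).
by rewrite invr1 sqrtr1 mulr1 mul1r.
Qed.

Lemma Itg_pair u h : LTh u -> LTh h -> Itg (fun x => cbe (u x) * cmod (h x)).
Proof.
move=> hu hh; apply: Itg_le (ItgD (Itg_self hu) (ItgZ 2 (Itg_self hh))).
  by apply: measM; [exact: meas_cbe (cmeas_fn u)|exact: cmeas_cmod (cmeas_fn h)].
by move=> x; rewrite ger0_norm ?pair_le// mulr_ge0 ?cmod_ge0 ?cbe_ge0.
Qed.

Lemma Itg_cal u h : LTh u -> LTh h -> Itg (fun x => cdot (cal (u x)) (h x)).
Proof.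
move=> hu hh; apply: Itg_le (Itg_pair hu hh).
  by apply: cmeas_cdot; [exact: cmeas_cal (cmeas_fn u)|exact: cmeas_fn].
move=> x; apply: le_trans (cdot_norm_le _ _) _.
by rewrite ler_wpM2r ?cmod_ge0// cal_le.
Qed.

Lemma cThN (z : R[i]) : cTh (- z) = cTh z. Proof. by rewrite /cTh cmodN. Qed.

(** Brezis-Lieb with the mixed term bounded by [pair_le] and [be_le_Th]; the larger coefficient is 1
    + 2 * 2 * 3. *)
Lemma cTh_add (z w : R[i]) : cTh (z + w) <= 13 * (cTh z + cTh w).
Proof.
have := brezis_lieb m z w; rewrite ler_norml => /andP[_].
have := pair_le w z; have := be_le_Th m (cmod_ge0 z); have := be_le_Th m (cmod_ge0 w).
have := cTh_ge0 m z; have := cTh_ge0 m w; rewrite /cTh /cbe.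
move: (Th m (cmod (z + w))) (Th m (cmod z)) (Th m (cmod w)) => a b c.
move: (cmod w * be m (cmod w)) (cmod z * be m (cmod z)) (be m (cmod w) * cmod z) => d e f.
lra.
Qed.

(** The doubling condition: [be_scale] handles contractions and [be_mul] dilations. *)
Lemma cTh_mul (a : R) (z : R[i]) : cTh (a%:C%C * z) <= 3 * (2 + `|a| ^+ 2) * cTh z.
Proof.
have z0 := cmod_ge0 z; set c := `|a|.
have c0 : 0 <= c by exact: normr_ge0.
rewrite /cTh cmodZ -/c.
apply: le_trans (Th_le m (mulr_ge0 c0 z0)) _.
rewrite -mulrA (mulrCA 3); set s := cmod z in z0 *.
apply: le_trans (_ : (2 + c ^+ 2) * (s * be m s) <= _); last first.
  by rewrite ler_wpM2l ?be_le_Th// addr_ge0// sqr_ge0.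
have b0 := be_ge0 m z0; have sb := mulr_ge0 z0 b0.
case: (leP c 1) => c1.
  have := be_scale m c0 c1 z0 => h.
  have : c * s * be m (c * s) <= 2 * (s * be m s).
    apply: le_trans (ler_wpM2l (mulr_ge0 c0 z0) h) _.
    have q1 : Num.sqrt c <= 1 by rewrite -sqrtr1 ler_wsqrtr.
    have q0 : 0 <= Num.sqrt c by exact: sqrtr_ge0.
    have -> : c * s * (2 * Num.sqrt c * be m s) = 2 * (s * be m s) * (c * Num.sqrt c) by ring.
    by apply: ler_piMr; [exact: mulr_ge0|exact: mulr_ile1].
  by have := mulr_ge0 (sqr_ge0 c) sb; rewrite mulrDl; lra.
have := be_mul m (ltW c1) z0 => /(ler_wpM2l (mulr_ge0 c0 z0)) /le_trans; apply.
have -> : c * s * (c * be m s) = c ^+ 2 * (s * be m s) by ring.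
by rewrite mulrDl lerDr mulr_ge0.
Qed.

Lemma LTh_lin (a : R) u v : LTh u -> LTh v -> LTh (a *: u + v).
Proof.
move=> hu hv.
apply: Itg_le (ItgZ 13 (ItgD (ItgZ (3 * (2 + `|a| ^+ 2)) hu) hv)); first exact: meas_cTh (cmeas_fn _).
move=> x; rewrite ger0_norm ?cTh_ge0// fnD fnZ; apply: le_trans (cTh_add _ _) _.
by rewrite ler_pM2l// lerD2r cTh_mul.
Qed.

Lemma LThB u v : LTh u -> LTh v -> LTh (u - v).
Proof. by move=> hu hv; rewrite addrC -scaleN1r; exact: LTh_lin. Qed.

Lemma KB u v : LTh u -> LTh v -> Kpot (u - v) <= 13 * (Kpot u + Kpot v).
Proof.
move=> hu hv; rewrite /Kpot -IntD// -IntZ; last exact: ItgD.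
apply: Int_le; [exact: LThB|by apply: ItgZ; exact: ItgD|].
by move=> x; rewrite fnB; apply: le_trans (cTh_add _ _) _; rewrite cThN.
Qed.

Lemma LTh_Ji u : LTh u -> LTh (Ji u).
Proof. by congr Itg; apply/funext => x; rewrite JiE /cTh cmodi. Qed.

Lemma K_tangent u v : LTh u -> LTh v -> Kpot u + 2 * Ppot u (v - u) <= Kpot v.
Proof.
move=> hu hv; have hc := Itg_cal hu (LThB hv hu).
rewrite /Kpot /Ppot -IntZ// -IntD//; last exact: ItgZ.
apply: Int_le => //; first by apply: ItgD => //; exact: ItgZ.
by move=> x; rewrite fnB; exact: cTh_tangent.
Qed.

Lemma K_gateaux u h (s : R) : LTh u -> LTh h -> 0 <= s -> s <= 1 ->
  Kpot (u + s *: h) <= Kpot u + 2 * s * Ppot u h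
    + 4 * s * Num.sqrt s * Int (fun x => cmod (h x) * cbe (h x)).
Proof.
move=> hu hh s0 s1; have hc := Itg_cal hu hh; have hs := Itg_self hh.
have hus : LTh (u + s *: h) by rewrite addrC; exact: LTh_lin.
rewrite /Kpot /Ppot -IntZ// -[4 * s * _ * _]IntZ// -IntD//; last exact: ItgZ.
rewrite -IntD//; [|by apply: ItgD => //; exact: ItgZ|exact: ItgZ].
apply: Int_le => //; first by apply: ItgD; [apply: ItgD => //|]; exact: ItgZ.
by move=> x; rewrite fnD fnZ; exact: cTh_gateaux.
Qed.

Lemma P_lin (a : R) u h k : LTh u -> LTh h -> LTh k -> Ppot u (a *: h + k) = a * Ppot u h + Ppot u k.
Proof.
move=> hu hh hk; have i1 := Itg_cal hu hh; have i2 := Itg_cal hu hk.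
rewrite /Ppot -(IntZ a i1) -(IntD (ItgZ a i1) i2).
by congr Int; apply/funext => x; rewrite fnD fnZ /cdot !cpx; ring.
Qed.

Lemma P_acc u v : LTh u -> LTh v ->
  `|Ppot u (Ji (u - v)) - Ppot v (Ji (u - v))| <= 2 * dot (u - v) (u - v).
Proof.
move=> hu hv; have hJ := LTh_Ji (LThB hu hv).
have iu := Itg_cal hu hJ; have iv := Itg_cal hv hJ.
rewrite /Ppot -IntB// dotuu /sqn -IntZ; last by have [] := L2c_fn (u - v).
apply: Int_abs; [exact: ItgB|by apply: ItgZ; have [] := L2c_fn (u - v)|].
move=> x; rewrite JiE fnB.
have -> : cdot (cal (u x)) ('i%C * (u x - v x)) - cdot (cal (v x)) ('i%C * (u x - v x)) =
  cdot (cal (u x) - cal (v x)) ('i%C * (u x - v x)) by rewrite /cdot !cpx; ring.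
exact: cal_acc.
Qed.

Lemma P_gauge u : Ppot u (Ji u) = 0.
Proof. by rewrite /Ppot -[RHS](Int0 R); congr Int; apply/funext => x; rewrite JiE cal_gauge. Qed.

Lemma P_diff u v h : LTh u -> LTh v -> LTh h ->
  `|Ppot u h - Ppot v h| <= Int (fun x => cbe (fn (u - v) x) * cmod (h x)).
Proof.
move=> hu hv hh; rewrite /Ppot -IntB; [|exact: Itg_cal..].
apply: Int_abs; [by apply: ItgB; exact: Itg_cal|by apply: Itg_pair => //; exact: LThB|].
by move=> x; rewrite fnB; exact: cdot_calB.
Qed.

(** Dominated convergence: at a point where [h] is nonzero the cut-off is eventually 0, and where
    [h] is zero the integrand vanishes. *)
Lemma small_values h (eta : R) : LTh h -> 0 < eta -> exists2 d : R, 0 < d &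
  Int (fun x => cmod (h x) * cbe (h x) * (cmod (h x) < d)%R%:R) <= eta /\
  Itg (fun x => cmod (h x) * cbe (h x) * (cmod (h x) < d)%R%:R).
Proof.
move=> hh eta0; have i0 := Itg_self hh; have mh := cmeas_cmod (cmeas_fn h).
pose F n x := cmod (h x) * cbe (h x) * (cmod (h x) < n.+1%:R^-1)%R%:R.
have mF n : meas (F n).
  apply: measM; first exact: Itg_meas i0.
  have : measurable_fun [set: measurableTypeR R] (fun x => cmod (h x) < n.+1%:R^-1).
    apply: measurable_fun_ltr => //; exact: measurable_cst.
  move=> mb; have := measurable_fun_ifT mb (meas_cst 1) (meas_cst 0).
  by apply: eq_measurable_fun => x _; case: (cmod _ < _).
have s0 x : 0 <= cmod (h x) * cbe (h x) by rewrite mulr_ge0 ?cmod_ge0 ?cbe_ge0.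
have bF n x : `|F n x| <= cmod (h x) * cbe (h x).
  by rewrite /F; case: ltP => _ /=; rewrite ?mulr1 ?mulr0 ?normr0// ger0_norm.
have cF : {ae mu, forall x, F n x @[n --> \oo] --> 0}.
  apply: ae_all => x; apply/cvgrPdist_le => e e0.
  case: (eqVneq (cmod (h x)) 0) => [z|hn].
    by apply: nearW => n; rewrite /F z !mul0r subr0 normr0 ltW.
  have hp : 0 < cmod (h x) by rewrite lt_def hn cmod_ge0.
  have [N hN] := invSn_lt hp; exists N => // n /hN Nn.
  by rewrite /= /F ltNge Nn /= mulr0 subr0 normr0 ltW.
have [_ cv] := Int_dominated mF (meas_cst 0) i0 bF cF.
have [N /(_ N (leqnn _))] := cv _ eta0; rewrite Int0 subr0 => /(le_trans (ler_norm _)) h1.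
exists N.+1%:R^-1; first by rewrite invr_gt0.
by split; [exact: h1|exact: Itg_le (mF N) (bF N) i0].
Qed.

Lemma Itg_sqr u : Itg (fun t => cmod (u t) ^+ 2). Proof. by have [] := L2c_fn u. Qed.

Lemma Int_cmod_CS u h : Int (fun t => cmod (u t) * cmod (h t)) <= nrm u * nrm h.
Proof.
have lu : L2r (fun t => cmod (u t)) by split; [exact: cmeas_cmod (cmeas_fn _)|exact: Itg_sqr].
have lh : L2r (fun t => cmod (h t)) by split; [exact: cmeas_cmod (cmeas_fn _)|exact: Itg_sqr].
have := Int_CauchySchwarz lu lh; rewrite -[rsqn _]/(sqn (fn u)) -[rsqn (fun t => cmod (h t))]/(sqn (fn h)).
rewrite -!nrm_sqn -exprMn ler_pXn2r ?nnegrE ?mulr_ge0 ?nrm_ge0//.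
by apply: Int_ge0 => t; rewrite mulr_ge0 ?cmod_ge0.
Qed.

(** [pairing_weak] integrated, with a quarter of [eta] for each term. The order of choice matters:
    [N] from the bound on the potential, [d] from the size of [h], [e] from [small_values], and the
    radius last, since the third constant blows up with small [d * e]. *)
Lemma pairing_vanish h (C eta : R) : LTh h -> 0 <= C -> 0 < eta ->
  exists2 r : R, 0 < r & forall g, LTh g -> Kpot g <= C -> nrm g <= r ->
    Int (fun x => cbe (g x) * cmod (h x)) <= eta.
Proof.
move=> hh C0 eta0; have ih := Itg_self hh.
pose S := Int (fun x => cmod (h x) * cbe (h x)).
have S0 : 0 <= S by apply: Int_ge0 => x; rewrite mulr_ge0 ?cmod_ge0 ?cbe_ge0.
have e4 : 0 < eta / 4 by rewrite divr_gt0.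
pose N := 12 * C / eta + 1.
have N1 : 1 <= N by rewrite lerDr divr_ge0 ?mulr_ge0// ltW.
have N0 : 0 < N := lt_le_trans ltr01 N1.
have t1 : N^-1 * (3 * C) <= eta / 4.
  rewrite ler_pdivrMl//.
  have -> : N * (eta / 4) = 3 * C + eta / 4 by rewrite /N; field; rewrite gt_eqF.
  lra.
have S1 : 0 < 8 * S + eta by lra.
pose d := (eta / (8 * S + eta)) ^+ 2.
have q0 : 0 < eta / (8 * S + eta) by rewrite divr_gt0.
have q1 : eta / (8 * S + eta) <= 1 by rewrite ler_pdivrMr//; lra.
have d0 : 0 < d by rewrite exprn_gt0.
have d1 : d <= 1 by rewrite expr_le1// ltW.
have t2 : 2 * Num.sqrt d * S <= eta / 4.
  rewrite sqrtr_sqr gtr0_norm//.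
  have -> : 2 * (eta / (8 * S + eta)) * S = eta * (2 * S) / (8 * S + eta) by field; rewrite gt_eqF.
  rewrite ler_pdivrMr//.
  have := mulr_ge0 (ltW eta0) (ltW eta0); lra.
have e5 : 0 < eta / (8 * N) by rewrite divr_gt0// mulr_gt0.
have [e e0 [h1 i1]] := small_values hh e5.
have t4 : 2 * N * Int (fun x => cmod (h x) * cbe (h x) * (cmod (h x) < e)%R%:R) <= eta / 4.
  apply: le_trans (ler_wpM2l _ h1) _; first by rewrite mulr_ge0// ltW.
  by have -> : 2 * N * (eta / (8 * N)) = eta / 4 by field; rewrite gt_eqF.
pose M := 6 + qf m (d * e).
have M0 : 0 < M by rewrite ltr_wpDr ?qf_ge0.
pose T := M * (nrm h + 1).
have T0 : 0 < T by rewrite mulr_gt0// ltr_wpDl// nrm_ge0.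
exists (eta / 4 / T); first by rewrite divr_gt0.
move=> g hg gC gr; have ig := Itg_self hg.
have i2 : Itg (fun x => cmod (g x) * cmod (h x)) by apply: Itg_cmod2; exact: L2c_fn.
have cs := Int_cmod_CS g h.
have t3 : M * Int (fun x => cmod (g x) * cmod (h x)) <= eta / 4.
  apply: le_trans (ler_wpM2l (ltW M0) cs) _.
  apply: le_trans (_ : M * (eta / 4 / T * (nrm h + 1)) <= _).
    rewrite ler_pM2l//; apply: ler_pM; rewrite ?nrm_ge0// lerDl//.
  rewrite le_eqVlt; apply/orP; left; apply/eqP.
  have hn : nrm h + 1 != 0 by rewrite gt_eqF// ltr_wpDl// nrm_ge0.
  by rewrite /T; field; rewrite hn gt_eqF.
pose G x := N^-1 * (cmod (g x) * cbe (g x)) + 2 * Num.sqrt d * (cmod (h x) * cbe (h x))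
    + M * (cmod (g x) * cmod (h x)) + 2 * N * (cmod (h x) * cbe (h x) * (cmod (h x) < e)%R%:R).
have j1 := ItgZ N^-1 ig; have j2 := ItgZ (2 * Num.sqrt d) ih.
have j3 := ItgZ M i2; have j4 := ItgZ (2 * N) i1.
have iG : Itg G := ItgD (ItgD (ItgD j1 j2) j3) j4.
apply: le_trans (Int_le (Itg_pair hg hh) iG _) _.
  by move=> x; exact: pairing_weak (cmod_ge0 _) (cmod_ge0 _).
rewrite /G (IntD (ItgD (ItgD j1 j2) j3) j4) (IntD (ItgD j1 j2) j3) (IntD j1 j2).
rewrite (IntZ _ ig) (IntZ _ ih) (IntZ _ i2) (IntZ _ i1) -/S.
have t1' : N^-1 * Int (fun x => cmod (g x) * cbe (g x)) <= eta / 4.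
  apply: le_trans t1; rewrite ler_pM2l ?invr_gt0//; apply: le_trans (Int_self hg) _.
  by rewrite ler_pM2l.
lra.
Qed.

End NonlinearFunctional.

(** * The truncated energy as a Hamiltonian *)

Section LogHamiltonian.
Context (R : realType) (gamma m : R).
Local Notation mu := (@lebesgue_measure R).
Local Notation V := (L2space R).
Local Notation dot := (@dot R).
Local Notation nrm := (nrm dot).
Local Notation HI := (@dot_inner R).
Local Notation LTh := (LTh m).
Local Notation Kpot := (Kpot m).
Local Notation Ppot := (Ppot m).
Implicit Types (u v h g k x y : V).

Definition at0 u : R[i] := crepr (fn u) 0.

Lemma at0_lin (a : R) u v : H1 (fn u) -> H1 (fn v) ->
  at0 (a *: u + v) = a%:C%C * at0 u + at0 v.
Proof. exact: crepr_lin. Qed.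

Lemma at0_Ji u : H1 (fn u) -> at0 (Ji u) = 'i%C * at0 u.
Proof.
move=> /crepr_spec[[c1 c2] e _]; rewrite /at0 (@creprE R _ (fun t : R => 'i%C * crepr (fn u) t))//.
  split=> y.
    under eq_fun do rewrite !cpx.
    by apply: cvgN; exact: c2.
  by under eq_fun do rewrite !cpx; exact: c1.
by apply: ae_imp e => x ->; rewrite JiE.
Qed.

(* Chosen so that the delta interaction is absorbed by the kinetic energy. *)
Definition cQ : R := 8 * `|gamma| * (`|gamma| + 1).

(** The form of -u'' - gamma delta u, shifted by [cQ] to be nonnegative. *)
Definition Qform u v : R := dot (Dv u) (Dv v) - gamma * cdot (at0 u) (at0 v) + cQ * dot u v.

Lemma cQ_ge0 : 0 <= cQ. Proof. by rewrite mulr_ge0// ?mulr_ge0// addr_ge0. Qed.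

Lemma QC u v : Qform u v = Qform v u.
Proof. by rewrite /Qform (dotC HI) cdotC (dotC HI u). Qed.

Lemma cdot_linl (a : R) (z w k : R[i]) : cdot (a%:C%C * z + w) k = a * cdot z k + cdot w k.
Proof. by rewrite /cdot !cpx; ring. Qed.

Lemma Q_linl (a : R) u v h : H1 (fn u) -> H1 (fn v) -> Qform (a *: u + v) h = a * Qform u h + Qform v h.
Proof.
move=> hu hv; rewrite /Qform dot_Dv_lin// at0_lin// (dotDl HI) (dotZl HI) cdot_linl.
move: (dot _ _) (dot _ _) (dot _ _) (dot _ _) (cdot _ _) (cdot _ _) cQ; intros; ring.
Qed.

Lemma Q_linr (a : R) u v h : H1 (fn u) -> H1 (fn v) -> Qform h (a *: u + v) = a * Qform h u + Qform h v.
Proof. by move=> hu hv; rewrite QC Q_linl// !(QC h). Qed.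

Lemma QBl u v h : H1 (fn u) -> H1 (fn v) -> Qform (u - v) h = Qform u h - Qform v h.
Proof. by move=> hu hv; rewrite addrC -scaleN1r Q_linl// mulN1r addrC. Qed.

Lemma QBr u v h : H1 (fn u) -> H1 (fn v) -> Qform h (u - v) = Qform h u - Qform h v.
Proof. by move=> hu hv; rewrite QC QBl// !(QC h). Qed.

Lemma at0_bound u (l : R) : H1 (fn u) -> 0 < l ->
  cmod (at0 u) ^+ 2 <= 2 / l * nrm u ^+ 2 + 2 * l * nrm (Dv u) ^+ 2.
Proof. by move=> hu l0; exact: H1_sup. Qed.

Lemma delta_form u : H1 (fn u) ->
  `|gamma| * cmod (at0 u) ^+ 2 <= cQ * nrm u ^+ 2 + 2^-1 * nrm (Dv u) ^+ 2.
Proof.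
move=> hu; have g0 := normr_ge0 gamma; have g1 : 0 < `|gamma| + 1 by rewrite ltr_wpDl.
(* This length leaves at most half of the squared derivative, and its coefficient on the squared
   norm is exactly [cQ]. *)
have l0 : 0 < (4 * (`|gamma| + 1))^-1 by rewrite invr_gt0 mulr_gt0.
have := ler_wpM2l g0 (at0_bound hu l0) => /le_trans; apply.
rewrite mulrDr; apply: lerD.
  by rewrite le_eqVlt; apply/orP; left; apply/eqP; rewrite /cQ invrK; ring.
move: (nrm (Dv u) ^+ 2) (sqr_ge0 (nrm (Dv u))) => d d0.
rewrite !mulrA; apply: ler_wpM2r => //.
by rewrite ler_pdivrMr ?mulr_gt0//; move: `|gamma| g0 => a; lra.
Qed.

Lemma Q_coercive u : H1 (fn u) -> 2^-1 * nrm (Dv u) ^+ 2 <= Qform u u.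
Proof.
move=> hu; have := delta_form hu; rewrite /Qform -!(nrm_sqr HI) -cmod_sqr.
have := cQ_ge0.
have : gamma * cmod (at0 u) ^+ 2 <= `|gamma| * cmod (at0 u) ^+ 2.
  by rewrite ler_wpM2r ?sqr_ge0// ler_norm.
move: (nrm u ^+ 2) (nrm (Dv u) ^+ 2) (cmod _ ^+ 2) cQ => a b c d; lra.
Qed.

Lemma Q_ge0 u : H1 (fn u) -> 0 <= Qform u u.
Proof. by move=> /Q_coercive; apply: le_trans; rewrite mulr_ge0 ?sqr_ge0. Qed.

Lemma Q_Ji u : H1 (fn u) -> Qform u (Ji u) = 0.
Proof.
move=> hu; rewrite /Qform at0_Ji// (dotC HI (Dv u)) (dot_nrm0 _ (Dv_Ji hu)).
have J0 v : dot v (Ji v) = 0 by have := Ji_skew v v; rewrite (dotC HI); lra.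
rewrite (dotC HI) !J0 /cdot !cpx; ring.
Qed.

(** The length [l] is fixed first to make the derivative term small, then [r] for the L^2 term:
    convergence in L^2 with bounded derivatives is uniform convergence. *)
Lemma sup_small (a M : R) : 0 < a -> 0 < M -> exists l r : R, [/\ 0 < l, 0 < r &
  forall n d, 0 <= n -> n <= r -> 0 <= d -> d <= M ->
    2 / l * n ^+ 2 + 2 * l * d ^+ 2 <= a ^+ 2].
Proof.
move=> a0 M0; have [l l0 lE] : exists2 l : R, 0 < l & 2 * l * M ^+ 2 = a ^+ 2 / 2.
  exists (a ^+ 2 / (4 * M ^+ 2)); last by field; rewrite gt_eqF.
  by apply: divr_gt0; [exact: exprn_gt0|apply: mulr_gt0 => //; exact: exprn_gt0].
have l1 : 0 < 1 + l by lra.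
exists l, (a * l / (2 * (1 + l))); split => //; first by rewrite divr_gt0// mulr_gt0.
move=> n d n0 nr d0 dM.
have h1 : 2 * l * d ^+ 2 <= a ^+ 2 / 2.
  by rewrite -lE ler_pM2l ?mulr_gt0// lerXn2r// nnegrE ltW.
have h2 : 2 / l * n ^+ 2 <= a ^+ 2 / 2.
  apply: le_trans (_ : 2 / l * (a * l / (2 * (1 + l))) ^+ 2 <= _).
    apply: ler_wpM2l; first by rewrite divr_ge0// ltW.
    by rewrite lerXn2r// nnegrE (le_trans n0 nr).
  have -> : 2 / l * (a * l / (2 * (1 + l))) ^+ 2 = a ^+ 2 / 2 * (l / (1 + l) ^+ 2).
    by field; rewrite !gt_eqF.
  apply: ler_piMr; first by rewrite divr_ge0// sqr_ge0.
  rewrite ler_pdivrMr ?exprn_gt0// mul1r sqrrD expr1n.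
  by have := sqr_ge0 l; lra.
lra.
Qed.

(** Weak continuity on H^1-bounded sets: the derivative of [h] is approximated by a test function,
    on which one derivative can be moved, and the point value at 0 is controlled by [sup_small]. *)
Lemma Q_weak h x (C e : R) : H1 (fn h) -> H1 (fn x) -> 0 <= C -> 0 < e ->
  exists2 r : R, 0 < r & forall y, H1 (fn y) -> nrm (Dv y) <= C -> nrm (y - x) <= r ->
    `|Qform y h - Qform x h| <= e.
Proof.
move=> hh hx C0 e0; have e3 : 0 < e / 4 by rewrite divr_gt0.
pose M := C + nrm (Dv x) + 1.
have M1 : 1 <= M by rewrite lerDr addr_ge0// nrm_ge0.
have M0 : 0 < M := lt_le_trans ltr01 M1.
have [t tt ht] := test_dense (Dv h) (divr_gt0 e3 M0).
pose T := nrm (dtest t) + 1.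
have T0 : 0 < T by rewrite ltr_wpDl// nrm_ge0.
pose G := `|gamma| * (cmod (at0 h)) + 1.
have G0 : 0 < G by rewrite ltr_wpDl// mulr_ge0// cmod_ge0.
pose a := e / 4 / G.
have a0 : 0 < a by rewrite divr_gt0.
have [l [r3 [l0 r30 h3]]] := sup_small a0 M0.
pose N := cQ * nrm h + 1.
have N0 : 0 < N by rewrite ltr_wpDl// mulr_ge0 ?cQ_ge0// nrm_ge0.
exists (Num.min (e / 4 / T) (Num.min r3 (e / 4 / N))).
  by rewrite !lt_min r30 !divr_gt0.
move=> y hy yC; rewrite !le_min => /and3P[yr1 yr2 yr3].
have hyx : H1 (fn (y - x)) by exact: H1B.
have nD : nrm (Dv (y - x)) <= M.
  rewrite (nrm_nrm0 (DvB hy hx)).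
  apply: le_trans (nrmD HI _ _) _; rewrite (nrmN HI) /M -addrA.
  by apply: lerD => //; rewrite lerDl.
rewrite -QBl//.
have b1 : `|dot (Dv (y - x)) (Dv h)| <= e / 4 + e / 4.
  have -> : dot (Dv (y - x)) (Dv h) = dot (Dv (y - x)) (Dv h - t) + dot (Dv (y - x)) t.
    by rewrite (dotBr HI); ring.
  apply: le_trans (ler_normD _ _) _; apply: lerD.
    apply: le_trans (CauchySchwarz HI _ _) _.
    apply: le_trans (ler_pM (nrm_ge0 _ _) (nrm_ge0 _ _) nD ht) _.
    by rewrite mulrC divfK// gt_eqF.
  rewrite -normrN -(wd_Dv hyx tt); apply: le_trans (CauchySchwarz HI _ _) _.
  apply: le_trans (_ : e / 4 / T * T <= _); last by rewrite divfK// gt_eqF.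
  by apply: ler_pM; rewrite ?nrm_ge0// lerDl.
have b2 : `|gamma * cdot (at0 (y - x)) (at0 h)| <= e / 4.
  rewrite normrM; have ca : cmod (at0 (y - x)) <= a.
    rewrite -(@ler_pXn2r _ 2)// ?nnegrE ?cmod_ge0 ?(ltW a0)//.
    apply: le_trans (at0_bound hyx l0) _.
    by apply: h3; rewrite ?nrm_ge0.
  apply: le_trans (ler_wpM2l (normr_ge0 _) (cdot_norm_le _ _)) _.
  apply: le_trans (_ : a * G <= _); last by rewrite /a divfK// gt_eqF.
  rewrite mulrCA; apply: ler_pM; rewrite ?cmod_ge0 ?mulr_ge0 ?cmod_ge0//.
  by rewrite /G lerDl.
have b3 : `|cQ * dot (y - x) h| <= e / 4.
  rewrite normrM (ger0_norm cQ_ge0).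
  apply: le_trans (ler_wpM2l cQ_ge0 (CauchySchwarz HI _ _)) _.
  apply: le_trans (_ : e / 4 / N * N <= _); last by rewrite divfK// gt_eqF.
  rewrite mulrCA; apply: ler_pM; rewrite ?nrm_ge0 ?mulr_ge0 ?nrm_ge0 ?cQ_ge0//.
  by rewrite /N lerDl.
rewrite /Qform; move: b1 b2 b3; move: (dot _ _) (gamma * _) (cQ * _) => p q s; rewrite !ler_norml => /andP[p1 p2] /andP[p3 p4] /andP[p5 p6].
by clear -p1 p2 p3 p4 p5 p6; apply/andP; split; lra.
Qed.

Definition DW : set V := [set u | H1 (fn u) /\ LTh u].
(* [Phi] is the energy of the truncated equation plus [(cQ + m + 3) / 2] times the
   charge. *)
Definition Phi u : R := 2^-1 * Qform u u + 2^-1 * Kpot u.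
Definition Bform u h : R := Qform u h + Ppot u h.

Lemma Phi_Dv u : DW u -> nrm (Dv u) ^+ 2 <= 4 * Phi u.
Proof. by move=> [hu _]; have := Q_coercive hu; have := K_ge0 m u; rewrite /Phi; lra. Qed.

Lemma Phi_K u : DW u -> Kpot u <= 2 * Phi u.
Proof. by move=> [hu _]; have := Q_ge0 hu; rewrite /Phi; lra. Qed.

Lemma DWB u v : DW u -> DW v -> DW (u - v).
Proof. by move=> [a b] [c d]; split; [exact: H1B|exact: LThB]. Qed.

Lemma Phi_tangent x y : DW x -> DW y ->
  Phi y = Phi x + Bform x (y - x) + 2^-1 * Qform (y - x) (y - x)
    + 2^-1 * (Kpot y - Kpot x - 2 * Ppot x (y - x)).
Proof.
move=> [hx kx] [hy ky]; rewrite /Phi /Bform QBl ?QBr//; try exact: H1B.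
rewrite (QC y x); move: (Qform _ _) (Qform _ _) (Qform _ _) (Kpot _) (Kpot _) (Ppot _ _); intros; lra.
Qed.

(** Brezis-Lieb at the limit point; [be_scale] shows that [be] of the increment tends to 0. *)
Lemma cTh_cvg (z : nat -> R[i]) (w : R[i]) : cmod (z k - w) @[k --> \oo] --> 0 ->
  cTh m (z k) @[k --> \oo] --> cTh m w.
Proof.
move=> /cvgrPdist_le h; pose A := (1 + 2 * cmod w) * (2 * be m 1) + 1.
have b0 := be_ge0 m ler01; have w0 := cmod_ge0 w.
have A0 : 0 < A by apply: ltr_wpDl => //; apply: mulr_ge0; lra.
apply/cvgrPdist_le => e e0.
have q0 : 0 < e / A by rewrite divr_gt0.
have d0 : 0 < Num.min 1 ((e / A) ^+ 2) by rewrite lt_min ltr01 exprn_gt0.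
move: (h _ d0); apply: filterS => k; rewrite sub0r normrN ger0_norm ?cmod_ge0//.
rewrite le_min => /andP[g1 g2]; set g := cmod (z k - w) in g1 g2.
have g0 : 0 <= g := cmod_ge0 _.
have hb : be m g <= 2 * (e / A) * be m 1.
  have := be_scale m g0 g1 ler01; rewrite mulr1 => /le_trans; apply.
  apply: ler_wpM2r => //; apply: ler_wpM2l => //.
  by rewrite -(gtr0_norm q0) -sqrtr_sqr ler_wsqrtr.
have := brezis_lieb m w (z k - w); rewrite subrKC => hbl.
have h1 : cTh m (z k - w) <= g * be m g := Th_le m g0.
have t0 := cTh_ge0 m (z k - w).
have h2 : g * be m g <= be m g by rewrite ler_piMl// be_ge0.
have h3 : `|cTh m (z k) - cTh m w| <= be m g + 2 * (be m g * cmod w).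
  move: hbl; rewrite /cbe -/g !ler_norml => /andP[p1 p2]; apply/andP; split; lra.
rewrite distrC; apply: le_trans h3 _.
have -> : be m g + 2 * (be m g * cmod w) = be m g * (1 + 2 * cmod w) by ring.
apply: le_trans (_ : 2 * (e / A) * be m 1 * (1 + 2 * cmod w) <= _).
  by apply: ler_wpM2r => //; lra.
have -> : 2 * (e / A) * be m 1 * (1 + 2 * cmod w) = e / A * (A - 1) by rewrite /A; ring.
rewrite mulrBr divfK ?gt_eqF// mulr1; lra.
Qed.

Lemma B_weak x h (c e : R) : DW x -> DW h -> 0 < e ->
  exists2 r : R, 0 < r & forall y, DW y -> Phi y <= c -> nrm (y - x) <= r ->
    `|Bform y h - Bform x h| <= e.
Proof.
move=> [hx kx] [hh kh] e0; have e2 : 0 < e / 2 by rewrite divr_gt0.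
have C1 : 0 <= Num.sqrt (4 * `|c|) by exact: sqrtr_ge0.
have [r1 r10 h1] := Q_weak hh hx C1 e2.
have C2 : 0 <= 13 * (2 * `|c| + Kpot x) by rewrite mulr_ge0// addr_ge0 ?mulr_ge0// K_ge0.
have [r2 r20 h2] := pairing_vanish kh C2 e2.
exists (Num.min r1 r2); first by rewrite lt_min r10.
move=> y [hy ky] yc; rewrite le_min => /andP[yr1 yr2].
have c1 := ler_norm c.
have q1 : `|Qform y h - Qform x h| <= e / 2.
  apply: h1 => //; apply: nrm_le => //; rewrite sqr_sqrtr ?mulr_ge0// -(nrm_sqr HI).
  by have := Phi_Dv (conj hy ky); lra.
have q2 : `|Ppot y h - Ppot x h| <= e / 2.
  apply: le_trans (P_diff ky kx kh) _; apply: h2 => //; first exact: LThB.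
  apply: le_trans (KB ky kx) _; rewrite ler_pM2l// lerD2r.
  by have := Phi_K (conj hy ky); lra.
rewrite /Bform; move: q1 q2; move: (Qform _ _) (Qform _ _) (Ppot _ _) (Ppot _ _) => ? ? ? ?; rewrite !ler_norml => /andP[p1 p2] /andP[p3 p4].
by clear -p1 p2 p3 p4; apply/andP; split; lra.
Qed.

(** The quadratic part is lower semicontinuous because Q(y,y) >= 2 Q(y,x) - Q(x,x) with the right
    side weakly continuous; the potential part follows from Fatou's lemma on an a.e. convergent
    subsequence. Only the sum is bounded, so the quadratic bound is first subtracted from [c]. *)
Lemma Phi_lsc (u : nat -> V) x (c : R) : (forall n, DW (u n) /\ Phi (u n) <= c) ->
  seq_lim dot u x -> DW x /\ Phi x <= c.
Proof.
move=> hu ux.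
have c0 : 0 <= c.
  have [[h0 k0] ?] := hu 0%N; have := Q_ge0 h0; have := K_ge0 m (u 0%N).
  by move=> *; apply: le_trans (_ : Phi (u 0%N) <= _); rewrite // /Phi addr_ge0// mulr_ge0.
have C0 : 0 <= Num.sqrt (4 * c) by exact: sqrtr_ge0.
have uC n : nrm (Dv (u n)) <= Num.sqrt (4 * c).
  have [Dn Pn] := hu n; apply: nrm_le => //; rewrite sqr_sqrtr ?mulr_ge0// -(nrm_sqr HI).
  by apply: le_trans (Phi_Dv Dn) _; rewrite ler_pM2l.
have [hx xC] := H1_closed C0 (fun n => (hu n).1.1) uC ux.
have [|x' [phi [phin ae ux']]] := @L2_seq_lim_ae R u.
  move=> e e0; have e2 : 0 < e / 2 by rewrite divr_gt0.
  have [N hN] := ux _ e2; exists N => i j /hN hi /hN hj.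
  apply: le_trans (nrm_triangle HI x _ _) _; rewrite (nrmC HI x).
  by move: hi hj; move: (nrm _) (nrm _) => p q; lra.
have xx' : nrm (x' - x) = 0.
  apply/eqP; rewrite eq_le nrm_ge0 andbT; apply/ler_addgt0Pl => e e0; rewrite addr0.
  have e2 : 0 < e / 2 by rewrite divr_gt0.
  have [N1 h1] := ux _ e2; have [N2 h2] := ux' _ e2.
  apply: le_trans (nrm_triangle HI (u (maxn N1 N2)) _ _) _; rewrite (nrmC HI x').
  by have := h1 _ (leq_maxl N1 N2); have := h2 _ (leq_maxr N1 N2); move: (nrm _) (nrm _) => p q; lra.
have aex : {ae mu, forall t, cmod (u (phi k) t - x t) @[k --> \oo] --> 0}.
  by apply: ae_imp (ae_and ae (nrm0_ae xx')) => t [+ <-].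
have key (e : R) : 0 < e -> LTh x /\ Kpot x <= 2 * c - Qform x x + e.
  move=> e0; have e2 : 0 < e / 2 by rewrite divr_gt0.
  have [r r0 hr] := Q_weak hx hx C0 e2.
  have [N hN] := ux _ r0.
  refine (@Int_fatou R (fun j t => cTh m (fn (u (phi (j + N)%N)) t)) (fun t => cTh m (fn x t)) (2 * c - Qform x x + e) _ _ _ _ _ _).
  - by move=> k; have [[_]] := hu (phi (k + N)%N).
  - by move=> k t; exact: cTh_ge0.
  - exact: meas_cTh (cmeas_fn x).
  - move=> k; rewrite -/(Kpot (u (phi (k + N)%N))); set y := u _.
    have [[hy ky] yc] : DW y /\ Phi y <= c := hu _.
    have := hr y hy (uC _) (hN _ (leq_trans (leq_addl k N) (phin _))).
    have := Q_ge0 (H1B hy hx); rewrite QBl// !QBr// (QC x y).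
    move: yc; rewrite /Phi ler_norml => yc q0 /andP[q1 q2].
    move: (Qform y y) (Qform y x) (Qform x x) (Kpot y) yc q0 q1 q2 => *; lra.
  - apply: ae_imp aex => t ht; apply: cTh_cvg; have ht' := ht.
    by rewrite -(cvg_shiftn N) in ht'.
  - by move=> t; exact: cTh_ge0.
have [kx _] := key 1 ltr01; split => //.
apply/ler_addgt0Pr => e e0; have [_] := key e e0; rewrite /Phi.
by move: (Qform x x) (Kpot x) => *; lra.
Qed.

Lemma log_hamiltonian : hamiltonian dot (@Ji R) DW Phi Bform 2.
Proof.
split.
- exact: Ji_skew.
- exact: Ji_isom.
- by move=> a x y [hx kx] [hy ky]; split; [exact: H1_lin|exact: LTh_lin].
- by move=> x [hx kx]; split; [exact: H1_Ji|exact: LTh_Ji].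
- by move=> x [hx kx]; have := Q_ge0 hx; have := K_ge0 m x; rewrite /Phi; lra.
- move=> x h [hx kx] [hh kh]; rewrite -scaleN1r -[_ *: h]addr0.
  have h0 : H1 (fn (0 : V)) by rewrite -(subrr x); exact: H1B.
  have k0 : LTh 0 by rewrite -(subrr x); exact: LThB.
  have z : Bform x 0 = 0.
    have := Q_linr 1 x h0 h0; have := P_lin 1 kx k0 k0; rewrite scale1r addr0 /Bform; lra.
  by move: z; rewrite /Bform Q_linr// P_lin//; lra.
- move=> x y Dx Dy; rewrite (Phi_tangent Dx Dy).
  have [hx kx] := Dx; have [hy ky] := Dy.
  have := Q_ge0 (H1B hy hx); have := K_tangent kx ky; lra.
- move=> x h e [hx kx] [hh kh] e0.
  pose S := Int (fun t => cmod (fn h t) * cbe m (fn h t)).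
  have S0 : 0 <= S by apply: Int_ge0 => t; rewrite mulr_ge0 ?cmod_ge0 ?cbe_ge0.
  have Q0 := Q_ge0 hh.
  pose q := e / (Qform h h + 2 * S + e).
  have d0 : 0 < Qform h h + 2 * S + e by lra.
  have q0 : 0 < q by rewrite divr_gt0.
  have q1 : q <= 1 by rewrite ler_pdivrMr//; lra.
  exists (q ^+ 2); first by rewrite exprn_gt0.
  move=> s s0 sq.
  have s1 : s <= 1 by apply: le_trans sq _; rewrite expr_le1// ltW.
  have rs : Num.sqrt s <= q by rewrite -(gtr0_norm q0) -sqrtr_sqr ler_wsqrtr.
  have ss : s <= Num.sqrt s.
    rewrite -{1}(sqr_sqrtr (ltW s0)) expr2 ler_piMl ?sqrtr_ge0//.
    by rewrite -sqrtr1 ler_wsqrtr.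
  have kb := K_gateaux kx kh (ltW s0) s1.
  have -> : Phi (x + s *: h) = 2^-1 * (Qform x x + 2 * s * Qform x h + s ^+ 2 * Qform h h) + 2^-1 * Kpot (x + s *: h).
    rewrite /Phi addrC [x + _]addrC Q_linl// !Q_linr// (QC h x); ring.
  have fin : 2^-1 * s * Qform h h + 2 * Num.sqrt s * S <= e.
    have e1 : s * Qform h h <= q * Qform h h by rewrite ler_wpM2r//; lra.
    have e2 : Num.sqrt s * S <= q * S by rewrite ler_wpM2r.
    have e3 : q * Qform h h + 2 * (q * S) + q * e = e by rewrite /q; field; rewrite gt_eqF.
    have e4 : 0 <= q * e by rewrite mulr_ge0// ltW.
    have e5 : 0 <= q * Qform h h by rewrite mulr_ge0// ltW.
    lra.
  have := ler_wpM2l (ltW s0) fin; move: kb; rewrite /Phi /Bform -/S; lra.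
- exact: Phi_lsc.
- by [].
- move=> x y [hx kx] [hy ky].
  have hJ := H1_Ji (H1B hx hy).
  (* The linear part commutes with multiplication by i, so it drops out of the commutator. *)
  have -> : Bform x (Ji (x - y)) - Bform y (Ji (x - y)) = Ppot x (Ji (x - y)) - Ppot y (Ji (x - y)).
    have := QBl (Ji (x - y)) hx hy; rewrite (Q_Ji (H1B hx hy)) /Bform; lra.
  exact: P_acc.
- by move=> x [hx kx]; rewrite /Bform Q_Ji// P_gauge addr0.
- by move=> x h c e Dx Dh e0; exact: B_weak.
Qed.

End LogHamiltonian.

(** * A priori bounds and the global flow *)

Section LogFlow.
Context (R : realType) (gamma : R).
Local Notation mu := (@lebesgue_measure R).
Local Notation V := (L2space R).
Local Notation dot := (@dot R).
Local Notation nrm := (nrm dot).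
Local Notation HI := (@dot_inner R).
Implicit Types (u v h x : V) (m : R).

Lemma cal_log m (z : R[i]) : cmod z ^+ 2 <= expR m ->
  cal m z = (m + 2)%:C%C * z - z * (ln (cmod z ^+ 2))%:C%C.
Proof.
move=> zm; case: (eqVneq (cmod z) 0) => [/cmod_eq0 ->|z0]; first by rewrite cal0 mulr0 mul0r subr0.
have zp : 0 < cmod z by rewrite lt_def z0 cmod_ge0.
by rewrite /cal (al_small zp zm) rmorphB/= mulrBl (mulrC z).
Qed.

Lemma sqlog_cTh m (z : R[i]) : cmod z ^+ 2 <= expR m ->
  sqlog z = (m + 3) * cmod z ^+ 2 - cTh m z.
Proof.
move=> zm; rewrite /sqlog /cTh; case: (eqVneq (cmod z) 0) => [->|z0].
  by rewrite Th0 expr0n/= mul0r mulr0 subr0.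
have zp : 0 < cmod z by rewrite lt_def z0 cmod_ge0.
by rewrite (Th_small zp zm); ring.
Qed.

Lemma sqlog_cTh_le m (z : R[i]) : (m + 3) * cmod z ^+ 2 - sqlog z <= cTh m z.
Proof. by apply: le_trans (Th_ge_log m (cmod_ge0 z)); rewrite /sqlog; lra. Qed.

Lemma qf_change m m' (s : R) : qf m' s <= qf m s + `|m' - m|.
Proof.
rewrite /qf; have h := ler_norm (m' - m); have h0 := normr_ge0 (m' - m).
move: (ln _) (`|_|) h h0 => l d h h0; rewrite ge_max; apply/andP; split.
  by rewrite addr_ge0// le_max lexx.
have : m - l <= Num.max 0 (m - l) by rewrite le_max lexx orbT.
lra.
Qed.

(** Changing the level moves [qf] by at most |m' - m|, and the square is itself dominated by
    [Th]. *)
Lemma LTh_change m m' u : LTh m u -> LTh m' u.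
Proof.
move=> hu; apply: Itg_le (ItgZ (2 + `|m' - m|) hu); first exact: meas_cTh (cmeas_fn u).
move=> t; rewrite ger0_norm ?cTh_ge0//; set s := cmod (u t).
have s0 : 0 <= s by exact: cmod_ge0.
have h1 := Th_ge m s0; have h2 := sqr_le_Th m s0.
have : cTh m' (u t) <= s ^+ 2 * (3 + qf m' s).
  by rewrite /cTh /Th lerBlDr lerDl le_max lexx.
move=> /le_trans; apply; have := ler_wpM2l (sqr_ge0 s) (qf_change m m' s).
have := ler_wpM2l (normr_ge0 (m' - m)) h2.
have -> : cTh m (u t) = Th m s by [].
move: h1 h2; rewrite mulrDr; move: (Th m s) (qf m' s) (qf m s) (s ^+ 2) `|m' - m| => a b c d f.
by move=> *; lra.
Qed.

Lemma H1_bounded u (l : R) : H1 (fn u) -> 0 < l ->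
  {ae mu, forall t, cmod (u t) ^+ 2 <= 2 / l * nrm u ^+ 2 + 2 * l * nrm (Dv u) ^+ 2}.
Proof.
move=> hu l0; have [_ e _] := crepr_spec hu.
by apply: ae_imp e => t <-; exact: H1_sup.
Qed.

Lemma H1_exp_bound u : H1 (fn u) -> exists m, {ae mu, forall t, cmod (u t) ^+ 2 <= expR m}.
Proof.
move=> hu; set M := 2 / 1 * nrm u ^+ 2 + 2 * 1 * nrm (Dv u) ^+ 2 + 1.
have M0 : 0 < M.
  by rewrite ltr_wpDl// addr_ge0// mulr_ge0 ?sqr_ge0// divr_ge0.
exists (ln M); apply: ae_imp (H1_bounded hu ltr01) => t; rewrite lnK ?posrE//.
by move=> /le_trans; apply; rewrite lerDl.
Qed.

Lemma meas_sqlog u : meas (fun t => sqlog (u t)).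
Proof.
have mc := cmeas_cmod (cmeas_fn u).
by apply: measM; [exact: meas_sqr|apply: meas_ln; exact: meas_sqr].
Qed.

Lemma Int_sqlog m u : LTh m u -> {ae mu, forall t, cmod (u t) ^+ 2 <= expR m} ->
  Itg (fun t => sqlog (u t)) /\
  Int (fun t => sqlog (u t)) = (m + 3) * nrm u ^+ 2 - Kpot m u.
Proof.
move=> hu ub; have i1 := ItgB (ItgZ (m + 3) (Itg_sqr u)) hu.
have [|hi e] := Int_ae i1 (meas_sqlog u).
  by apply: ae_imp ub => t /sqlog_cTh ->.
split=> //; rewrite e (IntB (ItgZ (m + 3) (Itg_sqr u)) hu) (IntZ _ (Itg_sqr u)).
by rewrite nrm_sqn.
Qed.

(** An element of H^1 is essentially bounded; beyond a bound on |u|^2 of the form e^m' truncation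
    changes nothing, and different levels define the same space. *)
Lemma WP m u : W (fn u) <-> DW m u.
Proof.
split=> -[hu hl]; split => //.
  have mc := cmeas_cmod (cmeas_fn u).
  apply: Itg_le (ItgD (ItgZ (3 + `|m|) (Itg_sqr u)) (Itg_abs hl)); first exact: meas_cTh (cmeas_fn u).
  move=> t; rewrite ger0_norm ?cTh_ge0//; set s := cmod (u t).
  have : cTh m (u t) <= s ^+ 2 * (3 + qf m s).
    by rewrite /cTh /Th lerBlDr lerDl le_max lexx.
  move=> /le_trans; apply; rewrite /sqlog -/s normrM (ger0_norm (sqr_ge0 s)).
  rewrite (mulrC (3 + _)) -mulrDr; apply: ler_wpM2l; first exact: sqr_ge0.
  rewrite -[leRHS]addrA lerD2l /qf ge_max; apply/andP; split; first by rewrite addr_ge0.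
  by apply: lerD; [exact: ler_norm|rewrite -normrN ler_norm].
have [m' hm'] := H1_exp_bound hu.
by have [] := Int_sqlog (LTh_change m' hl) hm'.
Qed.

Lemma W_ex (f : R -> R[i]) : W f -> fn (toL2 f) = f.
Proof. by move=> [[/L2P h _] _]; rewrite toL2E. Qed.

Definition L2energy u : R :=
  2^-1 * nrm (Dv u) ^+ 2 - gamma / 2 * cmod (at0 u) ^+ 2 - 2^-1 * Int (fun t => sqlog (u t)).

Lemma L2norm_nrm u : L2norm (fn u) = (nrm u)%:E.
Proof. by rewrite (L2normE (L2c_fn u)) -nrm_sqn sqrtr_sqr ger0_norm// nrm_ge0. Qed.

Lemma energyE u : H1 (fn u) -> energy gamma (fn u) = L2energy u.
Proof. by move=> hu; rewrite /energy -DvE// L2norm_nrm. Qed.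

(** Truncation can only raise the potential, so no sup bound on [u] is assumed; [Phi_energy_eq]
    gives equality under such a bound. *)
Lemma Phi_energy m u : DW m u -> L2energy u + 2^-1 * (cQ gamma + m + 3) * nrm u ^+ 2 <= Phi gamma m u.
Proof.
move=> Du; have [hu ku] := Du; have [_ hl] := (WP m u).2 Du.
have hl' : Itg (fun t => sqlog (u t)) := hl.
have : (m + 3) * nrm u ^+ 2 - Int (fun t => sqlog (u t)) <= Kpot m u.
  rewrite nrm_sqn /sqn -(IntZ _ (Itg_sqr u)) -(IntB (ItgZ _ (Itg_sqr u)) hl').
  apply: Int_le => //; first exact: ItgB (ItgZ _ (Itg_sqr u)) hl'.
  by move=> t; exact: sqlog_cTh_le.
rewrite /Phi /L2energy /Qform -!(nrm_sqr HI) -cmod_sqr.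
move: (Kpot m u) (Int _) (nrm u ^+ 2) (nrm (Dv u) ^+ 2) (cmod _ ^+ 2) (cQ _) => a b c d f g.
lra.
Qed.

Lemma Phi_energy_eq m u : DW m u -> {ae mu, forall t, cmod (u t) ^+ 2 <= expR m} ->
  Phi gamma m u = L2energy u + 2^-1 * (cQ gamma + m + 3) * nrm u ^+ 2.
Proof.
move=> [hu ku] ub; have [_ e] := Int_sqlog ku ub.
rewrite /Phi /L2energy /Qform -!(nrm_sqr HI) -cmod_sqr e.
move: (Kpot m u) (nrm u ^+ 2) (nrm (Dv u) ^+ 2) (cmod _ ^+ 2) (cQ _) => a c d f g.
lra.
Qed.

(** Linear bookkeeping for [energy_coercive]: [b] is the squared derivative, [X1] and [X2] the delta
    term and its modulus, [a] the logarithmic integral. A quarter and an eighth of [b] are spent out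
    of a half, whence the 8. *)
Lemma coercive_arith (E b X1 X2 a q y z w : R) : 2^-1 * b - 2^-1 * X1 - 2^-1 * a <= E ->
  X1 <= X2 -> X2 <= q + 2^-1 * b -> a <= y + w -> y <= z + 4^-1 * b ->
  0 <= q -> 0 <= z -> 0 <= w -> b <= 8 * (`|E| + q + (z + w)).
Proof. by move=> *; have := ler_norm E; lra. Qed.

(** The logarithm of |u|^2 is at most ln k + S / k, where S is the sup bound and is affine in the
    squared derivative. The bound obtained does not involve the truncation level. *)
Lemma energy_coercive (rho E0 : R) : exists D2 : R, 0 <= D2 /\ forall u, W (fn u) ->
  nrm u = rho -> L2energy u <= E0 -> nrm (Dv u) ^+ 2 <= D2.
Proof.
(* Makes 2 rho^2 / k at most 1/4, the share of the squared derivative lost to the logarithm. *)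
pose k := 8 * rho ^+ 2 + 1.
have k0 : 0 < k by rewrite ltr_wpDl// mulr_ge0// sqr_ge0.
pose z := rho ^+ 2 * (2 * rho ^+ 2 / k).
have r0 : 0 <= rho ^+ 2 := sqr_ge0 _.
have z0 : 0 <= z by apply: mulr_ge0 => //; rewrite divr_ge0 ?(ltW k0)// mulr_ge0.
have q0 : 0 <= cQ gamma * rho ^+ 2 by apply: mulr_ge0 => //; exact: cQ_ge0.
have w0 : 0 <= rho ^+ 2 * `|ln k| by apply: mulr_ge0.
pose C := 8 * (`|E0| + cQ gamma * rho ^+ 2 + (z + rho ^+ 2 * `|ln k|)).
have C0 : 0 <= C by rewrite mulr_ge0// addr_ge0// addr_ge0.
exists C; split => // u [hu hl] ur uE.
have hl' : Itg (fun t => sqlog (u t)) := hl.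
set S := 2 / 1 * nrm u ^+ 2 + 2 * 1 * nrm (Dv u) ^+ 2.
have hS := H1_bounded hu ltr01; rewrite -/S in hS.
have lnk (y : R) : 0 < y -> ln y <= ln k + y / k.
  move=> y0; have := ln_diff k0 y0; rewrite -ler_pdivlMl// => h.
  have : k^-1 * (y - k) = y / k - 1 by field; rewrite gt_eqF.
  by move=> e; rewrite e in h; lra.
have bl : Int (fun t => sqlog (u t)) <= (S / k + `|ln k|) * nrm u ^+ 2.
  rewrite nrm_sqn /sqn -(IntZ _ (Itg_sqr u)).
  (* The sup bound holds only a.e., while [Int_le] compares everywhere; [g] modifies the integrand
     on a null set by capping it. *)
  have [g [ig [gE eg]]] : exists g : R -> R, Itg g /\ (Int g = Int (fun t => sqlog (u t))) /\
      forall t, g t <= (S / k + `|ln k|) * cmod (u t) ^+ 2.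
    pose b t := (S / k + `|ln k|) * cmod (u t) ^+ 2.
    have ib : Itg b by exact: ItgZ (Itg_sqr u).
    exists (fun t => - Num.max (- sqlog (u t)) (- b t)).
    have ae1 : {ae mu, forall t, sqlog (u t) = - Num.max (- sqlog (u t)) (- b t)}.
      apply: ae_imp hS => t tS; rewrite max_l ?opprK// lerN2 /b /sqlog mulrC.
      case: (eqVneq (cmod (u t)) 0) => [->|cn0]; first by rewrite expr0n/= !mulr0.
      have zp : 0 < cmod (u t) ^+ 2 by rewrite exprn_gt0// lt_def cn0 cmod_ge0.
      apply: ler_wpM2r; first exact: ltW.
      apply: le_trans (lnk _ zp) _; rewrite addrC; apply: lerD; last exact: ler_norm.
      by rewrite ler_pM2r// invr_gt0.
    have [|h1 h2] := Int_ae hl' _ ae1.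
      by apply: measN; apply: meas_max; apply: measN; [exact: meas_sqlog|exact: Itg_meas].
    split => //; split => // t.
    by rewrite lerNl le_max lexx orbT.
  rewrite -gE; apply: Int_le => //; exact: ItgZ (Itg_sqr u).
have dl := delta_form gamma hu.
have gl : gamma * cmod (at0 u) ^+ 2 <= `|gamma| * cmod (at0 u) ^+ 2.
  by rewrite ler_wpM2r ?sqr_ge0// ler_norm.
have sk : nrm u ^+ 2 * (S / k) <= rho ^+ 2 * (2 * rho ^+ 2 / k) + 4^-1 * nrm (Dv u) ^+ 2.
  rewrite /S ur; have -> : rho ^+ 2 * ((2 / 1 * rho ^+ 2 + 2 * 1 * nrm (Dv u) ^+ 2) / k) =
     rho ^+ 2 * (2 * rho ^+ 2 / k) + (2 * rho ^+ 2 / k) * nrm (Dv u) ^+ 2.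
    by move: (nrm _ ^+ 2) => d; field; rewrite gt_eqF.
  rewrite lerD2l; apply: ler_wpM2r; first exact: sqr_ge0.
  rewrite ler_pdivrMr// /k; have := sqr_ge0 rho; move: (rho ^+ 2) => r; lra.
rewrite ur in dl bl sk.
apply: (coercive_arith _ gl dl _ sk q0 z0 w0 (a := Int (fun t => sqlog (u t)))).
  by move: uE; rewrite /L2energy (_ : gamma / 2 * _ = 2^-1 * (gamma * cmod (at0 u) ^+ 2))//; ring.
by apply: le_trans bl _; rewrite mulrDl !(mulrC _ (rho ^+ 2)).
Qed.

Definition Lg u h : R := Int (fun t => cdot (u t * (ln (cmod (u t) ^+ 2))%:C%C) (h t)).

Lemma log_rhsE u h : H1 (fn u) -> H1 (fn h) -> log_rhs gamma (fn u) (fn h) =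
  - dot (Dv u) (Dv h) + gamma * cdot (at0 u) (at0 h) + Lg u h.
Proof.
move=> hu hh; rewrite /log_rhs -!DvE// L2dotE Re_mul_conj; congr (_ + _).
by rewrite /L2dot /cintegral /=; congr Int; apply/funext => t; rewrite Re_mul_conj.
Qed.

Lemma cmeas_log u : cmeasurable (fun t => u t * (ln (cmod (u t) ^+ 2))%:C%C).
Proof.
have mc := cmeas_cmod (cmeas_fn u).
have := cmeasM (meas_ln (meas_sqr mc)) (cmeas_fn u); congr cmeasurable.
by apply/funext => t; rewrite mulrC.
Qed.

Lemma LgE m u h : LTh m u -> LTh m h -> {ae mu, forall t, cmod (u t) ^+ 2 <= expR m} ->
  Itg (fun t => cdot (u t * (ln (cmod (u t) ^+ 2))%:C%C) (h t)) /\
  Lg u h = (m + 2) * dot u h - Ppot m u h.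
Proof.
move=> hu hh ub; have i1 := ItgZ (m + 2) (Itg_dot u h); have i2 := Itg_cal hu hh.
have [||hi e] := @Int_ae R _ (fun t => cdot (u t * (ln (cmod (u t) ^+ 2))%:C%C) (h t)) (ItgB i1 i2).
- by apply: cmeas_cdot; [exact: cmeas_log|exact: cmeas_fn].
- apply: ae_imp ub => t /cal_log ->; rewrite /cdot !cpx; ring.
by split => //; rewrite /Lg e (IntB i1 i2) (IntZ _ (Itg_dot u h)).
Qed.

(** The coefficient is m + 2 and not the m + 3 of [Phi]: differentiating |u|^2 Log |u|^2 / 2
    produces, besides u Log |u|^2, one extra copy of u. *)
Lemma B_log_rhs m u h : DW m u -> DW m h -> {ae mu, forall t, cmod (u t) ^+ 2 <= expR m} ->
  Bform gamma m u h - (cQ gamma + m + 2) * dot u h = - log_rhs gamma (fn u) (fn h).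
Proof.
move=> [hu ku] [hh kh] ub; have [_ e] := LgE ku kh ub.
by rewrite log_rhsE// e /Bform /Qform; move: (dot _ _) (dot _ _) (cdot _ _) (Ppot _ _ _) (cQ _) => *; ring.
Qed.

Theorem log_flow x0 : W (fn x0) -> exists (u : R -> V) (m D2 : R),
  [/\ nrm (u 0 - x0) = 0,
      forall t, [/\ DW m (u t), Phi gamma m (u t) = Phi gamma m x0, nrm (Dv (u t)) ^+ 2 <= D2 &
        {ae mu, forall y, cmod (u t y) ^+ 2 <= expR m}],
      forall t, L2energy (u t) = L2energy x0 /\ nrm (u t) = nrm x0,
      forall t, vcont dot u t &
      forall t h, W (fn h) ->
        sderiv (fun s => dot (u s) h) t (- log_rhs gamma (fn (u t)) (fn (Ji h)))].
Proof.
move=> w0; have [D2 [D20 hD2]] := energy_coercive (nrm x0) (L2energy x0).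
(* The bound of [H1_sup] at length 1. As [D2] does not depend on the level, the choice m = ln M is
   not circular. *)
pose M := 2 / 1 * nrm x0 ^+ 2 + 2 * 1 * D2 + 1.
have M0 : 0 < M by rewrite ltr_wpDl// addr_ge0// mulr_ge0 ?sqr_ge0// divr_ge0.
pose m := ln M.
have bd u : W (fn u) -> nrm u = nrm x0 -> L2energy u <= L2energy x0 ->
    {ae mu, forall y, cmod (u y) ^+ 2 <= expR m}.
  move=> wu nu eu; apply: ae_imp (H1_bounded wu.1 ltr01) => t; rewrite /m lnK ?posrE//.
  move=> /le_trans; apply; rewrite nu /M; have := hD2 u wu nu eu.
  by move: (nrm (Dv u) ^+ 2) (nrm x0 ^+ 2) => a b; lra.
have [u [u0 uP un uc ud]] := hamiltonian_flow HI (@L2_seq_complete R) (cQ gamma + m + 2)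
  (log_hamiltonian gamma m) ((WP m x0).1 w0).
have Dx := (WP m x0).1 w0.
have ex0 := Phi_energy_eq Dx (bd x0 w0 erefl (lexx _)).
(* Truncation is inactive at the datum, where equality holds; at time [t] only the inequality
   [Phi_energy] is known so far, and it points the right way. *)
have le t : L2energy (u t) <= L2energy x0.
  have [Du Pu] := uP t; have := Phi_energy Du; rewrite Pu ex0 un.
  by rewrite lerD2r.
have bt t := bd (u t) ((WP m _).2 (uP t).1) (un t) (le t).
exists u, m, D2; split => //.
- move=> t; have [Du Pu] := uP t; split => //.
  exact: hD2 ((WP m _).2 Du) (un t) (le t).
- move=> t; split => //; have [Du Pu] := uP t.
  have := Phi_energy_eq Du (bt t); rewrite Pu ex0 un => /eqP; rewrite (inj_eq (addIr _)).
  by move=> /eqP.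
- move=> t h wh; have [Du _] := uP t; have Dh := (WP m h).1 wh.
  have DJ : DW m (Ji h) by have [a b] := Dh; split; [exact: H1_Ji|exact: LTh_Ji].
  by rewrite -(B_log_rhs Du DJ (bt t)); exact: ud.
Qed.

End LogFlow.

(** * The norm of W and its dual *)

Section OrliczScalar.
Context (R : realType).
Implicit Types s m : R.

Lemma expRN6 : expR (- 6) = expR (- 3) ^+ 2 :> R.
Proof. by rewrite expr2 -expRD; congr expR; ring. Qed.

Lemma ln_small s : 0 < s -> s <= expR (- 3) -> ln (s ^+ 2) <= - 6.
Proof.
move=> s0 se; rewrite ln_sqr//.
have : ln s <= - 3 by rewrite -(expRK (- 3)) ler_ln ?posrE ?expR_gt0.
lra.
Qed.

Lemma ln_large s : expR (- 3) <= s -> - 6 <= ln (s ^+ 2).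
Proof.
move=> se; have s0 : 0 < s by apply: lt_le_trans se; exact: expR_gt0.
rewrite ln_sqr//.
have : - 3 <= ln s by rewrite -(expRK (- 3)) ler_ln ?posrE ?expR_gt0.
lra.
Qed.

Lemma orliczA_ge s : expR (- 3) < s -> 3 * s ^+ 2 <= orliczA s <= 7 * s ^+ 2.
Proof.
move=> se; rewrite /orliczA (lt_geF se) expRN6; have e0 := expR_gt0 (- 3 : R).
move: (expR (- 3)) se e0 => e se e0.
have h1 : e * s <= s ^+ 2 by rewrite expr2 ler_wpM2r//; lra.
have h2 : e ^+ 2 <= e * s by rewrite expr2 ler_wpM2l//; lra.
have h3 : 0 <= e ^+ 2 by rewrite sqr_ge0.
apply/andP; split; lra.
Qed.

Lemma orliczA_ge0 s : 0 <= s -> 0 <= orliczA s.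
Proof.
move=> s0; case: (leP s (expR (- 3))) => se; last first.
  by have /andP[+ _] := orliczA_ge se; apply: le_trans; rewrite mulr_ge0// sqr_ge0.
rewrite /orliczA se; case: (eqVneq s 0) => [->|sn]; first by rewrite expr0n/= mul0r oppr0.
have sp : 0 < s by rewrite lt_def sn.
have := ln_small sp se; have := sqr_ge0 s; move: (s ^+ 2) (ln _) => a b a0 b6.
by rewrite -mulrN mulr_ge0//; lra.
Qed.

(** With [Th_le_orliczA]: the modular of the Luxemburg norm and the truncated potential are
    comparable, for every level. *)
Lemma orliczA_le m s : 0 <= s -> orliczA s <= (8 + `|m|) * Th m s.
Proof.
move=> s0; have h2 := sqr_le_Th m s0; have n0 := normr_ge0 m.
have t0 := Th_ge0 m s0; have nT := mulr_ge0 n0 t0.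
case: (leP s (expR (- 3))) => se; last first.
  have /andP[_] := orliczA_ge se; move=> /le_trans; apply; rewrite mulrDl; lra.
rewrite /orliczA se; case: (eqVneq s 0) => [->|sn].
  by rewrite expr0n/= mul0r oppr0 Th0 mulr0.
have sp : 0 < s by rewrite lt_def sn.
have q : m - ln (s ^+ 2) <= qf m s by rewrite /qf le_max lexx orbT.
have h1 := Th_ge m s0; have s2 := sqr_ge0 s; have m1 : - m <= `|m| by rewrite -normrN ler_norm.
move: (Th m s) (s ^+ 2) (qf m s) (ln _) `|m| h1 h2 s2 m1 q n0 t0 nT => T a b l n h1 h2 a0 m1 q n0 t0 nT.
have := ler_wpM2l a0 q; have := ler_wpM2l a0 m1; have := ler_wpM2l n0 h2.
rewrite mulrDr in h1; lra.
Qed.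

Lemma Th_le_orliczA m s : 0 <= s -> Th m s <= (9 + `|m|) * orliczA s.
Proof.
move=> s0; have n0 := normr_ge0 m.
have h : Th m s <= s ^+ 2 * (3 + qf m s) by rewrite /Th lerBlDr lerDl le_max lexx.
apply: le_trans h _.
case: (leP s (expR (- 3))) => se; last first.
  have /andP[h _] := orliczA_ge se.
  apply: le_trans (_ : (9 + `|m|) * s ^+ 2 <= _); last first.
    by apply: ler_wpM2l; [lra|]; have := sqr_ge0 s; lra.
  rewrite mulrC; apply: ler_wpM2r; first exact: sqr_ge0.
  have := ln_large (ltW se); have := ler_norm m => h1 h2.
  rewrite (_ : 9 = 3 + 6); last by ring.
  by rewrite -[leRHS]addrA lerD2l /qf ge_max; apply/andP; split; lra.
rewrite /orliczA se; case: (eqVneq s 0) => [->|sn].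
  by rewrite expr0n/= !mul0r oppr0 mulr0.
have sp : 0 < s by rewrite lt_def sn.
have l6 := ln_small sp se; rewrite mulrN -mulNr mulrCA; apply: ler_wpM2l; first exact: sqr_ge0.
have q : qf m s <= `|m| - ln (s ^+ 2).
  by rewrite /qf ge_max; have := ler_norm m => h; apply/andP; split; lra.
have : 0 <= (8 + `|m|) * (- 6 - ln (s ^+ 2)) by apply: mulr_ge0; lra.
move: (qf m s) (ln _) `|m| q l6 n0 => a b c *; lra.
Qed.

(** Unlike [cTh_mul], this gains the factor [c], so dividing by a large constant makes the modular
    small. *)
Lemma Th_mul_le m (c s : R) : 0 <= c -> c <= 1 -> 0 <= s -> Th m (c * s) <= 6 * c * Th m s.
Proof.
move=> c0 c1 s0; apply: le_trans (Th_le m (mulr_ge0 c0 s0)) _.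
have h := be_scale m c0 c1 s0; have b0 := be_ge0 m s0.
apply: le_trans (ler_wpM2l (mulr_ge0 c0 s0) h) _.
have q1 : Num.sqrt c <= 1 by rewrite -sqrtr1 ler_wsqrtr.
have q0 : 0 <= Num.sqrt c by exact: sqrtr_ge0.
apply: le_trans (_ : c * s * (2 * be m s) <= _).
  apply: ler_wpM2l; first exact: mulr_ge0.
  by apply: ler_wpM2r => //; lra.
have := be_le_Th m s0 => /(ler_wpM2l c0); move: (be m s) (Th m s) => *; lra.
Qed.

End OrliczScalar.

Section WNorm.
Context (R : realType).
Local Notation mu := (@lebesgue_measure R).
Local Notation V := (L2space R).
Local Notation dot := (@dot R).
Local Notation nrm := (nrm dot).
Local Notation HI := (@dot_inner R).
Implicit Types (u v h g : V) (m k : R).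

Definition h1n u : R := Num.sqrt (nrm u ^+ 2 + nrm (Dv u) ^+ 2).

Lemma H1normE u : H1 (fn u) -> H1norm (fn u) = (h1n u)%:E.
Proof.
move=> hu; rewrite /H1norm -DvE// !L2norm_nrm -!EFin_expe -EFinD poweR_EFin powR12_sqrt//.
by rewrite addr_ge0 ?sqr_ge0.
Qed.

Lemma H1norm_ge0 (f : R -> R[i]) : (0 <= H1norm f)%E. Proof. exact: poweR_ge0. Qed.

Lemma LAnorm_ge0 (f : R -> R[i]) : (0 <= LAnorm f)%E.
Proof. by apply: le_ereal_inf_tmp => _ [k [/ltW k0 _] <-]; rewrite lee_fin. Qed.

Lemma Wnorm_ge0 (f : R -> R[i]) : (0 <= Wnorm f)%E.
Proof. by rewrite adde_ge0 ?H1norm_ge0 ?LAnorm_ge0. Qed.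

Lemma meas_orlicz (f : R -> R) : meas f -> meas (fun x => orliczA (f x)).
Proof.
move=> mf.
have mb : measurable_fun [set: measurableTypeR R] (fun x => f x <= expR (- 3)).
  by apply: measurable_fun_ler => //; exact: measurable_cst.
apply: (measurable_fun_ifT mb).
  by apply: measN; apply: measM; [exact: meas_sqr|apply: meas_ln; exact: meas_sqr].
apply: measB; last exact: meas_cst.
by apply: measD; apply: measM => //; try exact: meas_cst; exact: meas_sqr.
Qed.

Lemma meas_orlicz_fn k h : meas (fun x => orliczA (k^-1 * cmod (h x))).
Proof.
by apply: meas_orlicz; apply: measM; [exact: meas_cst|exact: cmeas_cmod (cmeas_fn h)].
Qed.

Lemma LAnorm_le k h : 0 < k -> Itg (fun x => orliczA (k^-1 * cmod (h x))) ->
  Int (fun x => orliczA (k^-1 * cmod (h x))) <= 1 -> (LAnorm (fn h) <= k%:E)%E.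
Proof.
move=> k0 hi h1; apply: ge_ereal_inf; exists k%:E => //.
by exists k => //; split => //; rewrite IntE// lee_fin.
Qed.

Lemma LAnorm_small m k h : 0 < k -> k <= 1 -> LTh m h ->
  9 * (8 + `|m|) * Kpot m h <= k ^+ 2 -> (LAnorm (fn h) <= k%:E)%E.
Proof.
move=> k0 k1 hh hk; have n0 := normr_ge0 m.
have kp : 0 < k ^+ 2 by rewrite exprn_gt0.
have b x : orliczA (k^-1 * cmod (h x)) <= 9 * (8 + `|m|) / k ^+ 2 * cTh m (h x).
  have c0 := cmod_ge0 (h x).
  apply: le_trans (orliczA_le m _) _; first by rewrite mulr_ge0// invr_ge0 ltW.
  have := cTh_mul m k^-1 (h x); rewrite /cTh cmodZ ger0_norm ?invr_ge0 ?(ltW k0)// => hc.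
  have m8 : 0 <= 8 + `|m| by lra.
  apply: le_trans (ler_wpM2l m8 hc) _.
  rewrite mulrA; apply: ler_wpM2r; first exact: Th_ge0.
  rewrite (_ : 9 * (8 + `|m|) / k ^+ 2 = (8 + `|m|) * (9 * k^-1 ^+ 2)); last first.
    by field; rewrite gt_eqF.
  apply: ler_wpM2l => //.
  (* The doubling constant 3 (2 + k^(-2)) is at most 9 k^(-2) because k <= 1. *)
  have : 1 <= k^-1 ^+ 2 by rewrite exprn_ege1// invf_ge1.
  by move: (k^-1 ^+ 2) => a; lra.
have ib := ItgZ (9 * (8 + `|m|) / k ^+ 2) hh.
have ii : Itg (fun x => orliczA (k^-1 * cmod (h x))).
  apply: Itg_le ib; first exact: meas_orlicz_fn.
  by move=> x; rewrite ger0_norm// orliczA_ge0// mulr_ge0 ?cmod_ge0// invr_ge0 ltW.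
apply: LAnorm_le => //; apply: le_trans (Int_le ii ib b) _.
by rewrite (IntZ _ hh) mulrAC ler_pdivrMr// mul1r.
Qed.

Lemma LAnorm_large m k h : 1 <= k -> LTh m h ->
  6 * (8 + `|m|) * Kpot m h <= k -> (LAnorm (fn h) <= k%:E)%E.
Proof.
move=> k1 hh hk; have n0 := normr_ge0 m; have k0 : 0 < k := lt_le_trans ltr01 k1.
have b x : orliczA (k^-1 * cmod (h x)) <= 6 * (8 + `|m|) / k * cTh m (h x).
  have c0 := cmod_ge0 (h x).
  have ki : 0 <= k^-1 by rewrite invr_ge0 ltW.
  apply: le_trans (orliczA_le m _) _; first exact: mulr_ge0.
  have m8 : 0 <= 8 + `|m| by lra.
  have k1' : k^-1 <= 1 by rewrite invf_le1.
  apply: le_trans (ler_wpM2l m8 (Th_mul_le m ki k1' c0)) _.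
  rewrite /cTh le_eqVlt; apply/orP; left; apply/eqP; field; by rewrite gt_eqF.
have ib := ItgZ (6 * (8 + `|m|) / k) hh.
have ii : Itg (fun x => orliczA (k^-1 * cmod (h x))).
  apply: Itg_le ib; first exact: meas_orlicz_fn.
  by move=> x; rewrite ger0_norm// orliczA_ge0// mulr_ge0 ?cmod_ge0// invr_ge0 ltW.
apply: LAnorm_le => //; apply: le_trans (Int_le ii ib b) _.
by rewrite (IntZ _ hh) mulrAC ler_pdivrMr// mul1r.
Qed.

(** The infimum is below 2, so some admissible [k] is; multiplying back by it costs at most 3 (2 +
    2^2) = 18. *)
Lemma LAnorm_K m h : LTh m h -> (LAnorm (fn h) <= 1)%E -> Kpot m h <= 18 * (9 + `|m|).
Proof.
move=> hh hl; have n0 := normr_ge0 m.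
have [_ [k [k0 hk] <-]] : exists2 y, [set k%:E | k in [set k : R | 0 < k /\
    (\int[mu]_x (orliczA (k^-1 * cmod (h x)))%:E <= 1)%E]] y & (y < 2%:E)%E.
  by apply: ereal_inf_lt; apply: le_lt_trans hl _; rewrite lte_fin ltr1n.
rewrite lte_fin => k2.
have a0 x : 0 <= orliczA (k^-1 * cmod (h x)).
  by rewrite orliczA_ge0// mulr_ge0 ?cmod_ge0// invr_ge0 ltW.
have ii : Itg (fun x => orliczA (k^-1 * cmod (h x))).
  by apply/ge0_ItgP => //; [exact: meas_orlicz_fn|exact: le_lt_trans hk (ltry _)].
have i1 : Int (fun x => orliczA (k^-1 * cmod (h x))) <= 1 by move: hk; rewrite IntE// lee_fin.
apply: le_trans (_ : Int (fun x => 18 * (9 + `|m|) * orliczA (k^-1 * cmod (h x))) <= _); last first.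
  rewrite (IntZ _ ii) ler_piMr//; lra.
apply: Int_le => //; first exact: ItgZ.
move=> x; have c0 := cmod_ge0 (h x).
have hc : Th m (cmod (h x)) <= 3 * (2 + k ^+ 2) * Th m (k^-1 * cmod (h x)).
  have := cTh_mul m k (k^-1%:C%C * h x); rewrite /cTh !cmodZ !ger0_norm ?invr_ge0 ?(ltW k0)//.
  by rewrite mulrA mulfV ?gt_eqF// mul1r.
apply: le_trans hc _.
have t0 : 0 <= Th m (k^-1 * cmod (h x)) by apply: Th_ge0; rewrite mulr_ge0// invr_ge0 ltW.
apply: le_trans (_ : 18 * Th m (k^-1 * cmod (h x)) <= _).
  apply: ler_wpM2r => //.
  have : k ^+ 2 <= 2 ^+ 2 by rewrite lerXn2r ?nnegrE// ltW.
  move: (k ^+ 2) => a; lra.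
rewrite -[leRHS]mulrA ler_pM2l//; apply: Th_le_orliczA.
by rewrite mulr_ge0// invr_ge0 ltW.
Qed.

End WNorm.

(** * Strong continuity from conservation of the energy *)

Section EnergyContinuity.
Context (R : realType) (gamma m : R).
Local Notation mu := (@lebesgue_measure R).
Local Notation V := (L2space R).
Local Notation dot := (@dot R).
Local Notation nrm := (nrm dot).
Local Notation HI := (@dot_inner R).
Local Notation LTh := (LTh m).
Local Notation Kpot := (Kpot m).
Local Notation Ppot := (Ppot m).
Local Notation Qform := (Qform gamma).
Local Notation Phi := (Phi gamma m).
Implicit Types (u v h g x y : V).

Lemma pairing_split (N e s g : R) : 1 <= N -> 0 < e -> 0 <= s -> 0 <= g ->
  be m s * g <= (6 + qf m e) * (s * g) + N * (s * be m s * (s < e)%R%:R)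
    + 2 * Num.sqrt N^-1 * (g * be m g).
Proof.
move=> N1 e0 s0 g0; have N0 : 0 < N := lt_le_trans ltr01 N1.
have b3 : 0 <= 2 * Num.sqrt N^-1 * (g * be m g).
  by apply: mulr_ge0; [rewrite mulr_ge0 ?sqrtr_ge0|exact/mulr_ge0/be_ge0].
have b1 : 0 <= (6 + qf m e) * (s * g).
  by apply: mulr_ge0; [rewrite addr_ge0 ?qf_ge0|exact: mulr_ge0].
case: ltP => se /=.
  rewrite mulr1; have := pairing_strong m N1 s0 g0.
  by move: (2 * _ * _) ((6 + _) * _) (N * _) b1 b3 => *; lra.
rewrite !mulr0 addr0; apply: le_trans (_ : (6 + qf m e) * (s * g) <= _); last by rewrite lerDl.
rewrite /be (mulrC s) -mulrA; apply: ler_wpM2r; first exact: mulr_ge0.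
by rewrite lerD2l; exact: qf_anti.
Qed.

(** Counterpart of [pairing_vanish] with the roles exchanged: the nonlinearity is taken at the fixed
    [x], and the vanishing element is the test direction. [N] is the inverse square of [q], which
    makes the last term of [pairing_split] linear in [q]. *)
Lemma P_vanish x (C eta : R) : LTh x -> 0 <= C -> 0 < eta ->
  exists2 r : R, 0 < r & forall g, LTh g -> Kpot g <= C -> nrm g <= r -> `|Ppot x g| <= eta.
Proof.
move=> hx C0 eta0; have ix := Itg_self hx.
pose q := eta / (18 * C + eta).
have d0 : 0 < 18 * C + eta by lra.
have q0 : 0 < q by rewrite divr_gt0.
have q1 : q <= 1 by rewrite ler_pdivrMr//; lra.
pose N := q^-1 ^+ 2.
have N1 : 1 <= N by rewrite exprn_ege1// invf_ge1.
have N0 : 0 < N := lt_le_trans ltr01 N1.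
have sN : Num.sqrt N^-1 = q by rewrite /N exprVn invrK sqrtr_sqr gtr0_norm.
have t3 : 2 * q * (3 * C) <= eta / 3.
  have -> : 2 * q * (3 * C) = eta * (6 * C) / (18 * C + eta) by rewrite /q; field; rewrite gt_eqF.
  rewrite ler_pdivrMr//; have := mulr_ge0 (ltW eta0) (ltW eta0); lra.
clearbody N q.
have e1 : 0 < eta / 3 / N by rewrite !divr_gt0.
have [e e0 [h1 i1]] := small_values hx e1.
have t2 : N * Int (fun t => cmod (x t) * cbe m (x t) * (cmod (x t) < e)%R%:R) <= eta / 3.
  by apply: le_trans (ler_wpM2l (ltW N0) h1) _; rewrite mulrC divfK// gt_eqF.
have [M M0 ME] : exists2 M : R, 0 < M & 6 + qf m e = M.
  by exists (6 + qf m e) => //; rewrite ltr_wpDr ?qf_ge0.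
have [T T0 TE] : exists2 T : R, 0 < T & M * nrm x <= T.
  by exists (M * nrm x + 1); [rewrite ltr_wpDl// mulr_ge0 ?nrm_ge0// ltW|rewrite lerDl].
exists (eta / 3 / T); first by rewrite !divr_gt0.
move=> g hg gC gr; have ig := Itg_self hg.
have i2 : Itg (fun t => cmod (x t) * cmod (g t)) by apply: Itg_cmod2; exact: L2c_fn.
have t1 : M * Int (fun t => cmod (x t) * cmod (g t)) <= eta / 3.
  apply: le_trans (ler_wpM2l (ltW M0) (Int_cmod_CS x g)) _.
  rewrite mulrA; apply: le_trans (ler_pM _ (nrm_ge0 _ _) TE gr) _.
    by rewrite mulr_ge0 ?nrm_ge0// ltW.
  by rewrite mulrC divfK// gt_eqF.
have j1 := ItgZ M i2; have j2 := ItgZ N i1; have j3 := ItgZ (2 * q) ig.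
have ip := Itg_cal hx hg.
apply: le_trans (Int_abs ip (ItgD (ItgD j1 j2) j3) _) _.
  move=> t; apply: le_trans (cdot_norm_le _ _) _.
  apply: le_trans (ler_wpM2r (cmod_ge0 _) (cal_le m _)) _.
  by rewrite -ME -sN; exact: pairing_split (cmod_ge0 _) (cmod_ge0 _).
rewrite (IntD (ItgD j1 j2) j3) (IntD j1 j2) (IntZ _ i2) (IntZ _ i1) (IntZ _ ig).
have t4 : 2 * q * Int (fun t => cmod (g t) * cbe m (g t)) <= eta / 3.
  apply: le_trans t3; apply: ler_wpM2l; first by rewrite mulr_ge0// ltW.
  by apply: le_trans (Int_self hg) _; rewrite ler_pM2l.
move: t1 t2 t4; move: (M * _) (N * _) (2 * q * _) => *; lra.
Qed.

Lemma K_brezis_lieb x y : LTh x -> LTh y ->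
  Kpot (y - x) <= Kpot y - Kpot x + 2 * Int (fun t => cbe m (fn (y - x) t) * cmod (x t)).
Proof.
move=> hx hy; have hg := LThB hy hx; have ip := Itg_pair hg hx.
rewrite /Kpot -(IntB hy hx) -(IntZ 2 ip) -(IntD (ItgB hy hx) (ItgZ 2 ip)).
apply: Int_le => //; first exact: ItgD (ItgB hy hx) (ItgZ 2 ip).
move=> t; rewrite fnB; have := brezis_lieb m (x t) (y t - x t).
rewrite subrKC ler_norml => /andP[h _].
by move: (cTh m _) (cTh m _) (cTh m _) (cbe m _ * _) h => *; lra.
Qed.

(* As [Phi y = Phi x], the excess of [Phi] over its tangent at [x] equals
   [- Bform x (y - x)], which is small; it controls the quadratic part, and the
   Brezis-Lieb splitting transfers it to [Kpot (y - x)]. *)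
Lemma energy_continuity x (e : R) : DW m x -> 0 < e ->
  exists2 r : R, 0 < r & forall y, DW m y -> Phi y = Phi x -> nrm (y - x) <= r ->
    nrm (Dv (y - x)) ^+ 2 <= e /\ Kpot (y - x) <= e.
Proof.
move=> Dx e0; have [hx kx] := Dx; have d0 : 0 < e / 8 by rewrite divr_gt0.
have P0 : 0 <= Phi x := ham_ge0 (log_hamiltonian gamma m) Dx.
have C1 : 0 <= Num.sqrt (4 * Phi x) by exact: sqrtr_ge0.
have [r1 r10 h1] := Q_weak gamma hx hx C1 d0.
have C2 : 0 <= 13 * (2 * Phi x + 2 * Phi x) by rewrite mulr_ge0// addr_ge0// mulr_ge0.
have [r2 r20 h2] := P_vanish kx C2 d0.
have [r3 r30 h3] := pairing_vanish kx C2 d0.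
exists (Num.min r1 (Num.min r2 r3)); first by rewrite !lt_min r10 r20.
move=> y Dy Pyx; rewrite !le_min => /and3P[yr1 yr2 yr3]; have [hy ky] := Dy.
have kg := LThB ky kx.
have KC : Kpot (y - x) <= 13 * (2 * Phi x + 2 * Phi x).
  apply: le_trans (KB ky kx) _; rewrite ler_pM2l//; apply: lerD; last exact: Phi_K.
  by rewrite -Pyx; exact: Phi_K.
have q1 : `|Qform y x - Qform x x| <= e / 8.
  apply: h1 => //; apply: nrm_le => //; rewrite sqr_sqrtr ?mulr_ge0// -(nrm_sqr HI) -Pyx.
  exact: Phi_Dv.
have q2 := h2 _ kg KC yr2; have q3 := h3 _ kg KC yr3.
have bl := K_brezis_lieb kx ky; have tg := K_tangent kx ky.
have qg := Q_coercive gamma (H1B hy hx).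
have := Phi_tangent gamma Dx Dy; rewrite Pyx /Bform (QBr gamma x hy hx) (QC gamma x y) => e1.
have := sqr_ge0 (nrm (Dv (y - x))) => s0.
move: q1 q2; rewrite !ler_norml => /andP[p1 p2] /andP[p3 p4].
clear h1 h2 h3 KC yr1 yr2 yr3 Pyx.
move: (Kpot (y - x)) (Int _) bl q3 => Kg I bl q3.
move: (nrm _ ^+ 2) s0 qg e1; move: (Qform (y - x) (y - x)) => Qg n s0 qg.
move: (Phi x) (Qform y x) (Qform x x) (Ppot x (y - x)) (Kpot y) (Kpot x) p1 p2 p3 p4 tg bl P0 => *.
by split; lra.
Qed.

End EnergyContinuity.

Section ErealLimits.
Context (R : realType).
Implicit Types (f : R -> \bar R) (t : R).

Lemma ecvg0 (F : set_system R) f : Filter F -> (forall s, (0 <= f s)%E) ->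
  (forall e : R, 0 < e -> \forall s \near F, (f s <= e%:E)%E) -> f s @[s --> F] --> 0%E.
Proof.
move=> FF f0 h; have fin : \forall s \near F, f s \is a fin_num.
  move: (h 1 ltr01); apply: filterS => s fs; rewrite ge0_fin_numE//.
  exact: le_lt_trans fs (ltry _).
apply/fine_cvgP; split => //; apply/cvgrPdist_le => e e0.
apply: filterS2 fin (h _ e0) => s fs fe.
rewrite sub0r normrN ger0_norm; last exact: fine_ge0.
by rewrite -lee_fin fineK.
Qed.

Lemma ecvg0_near (F : set_system R) f : Filter F -> f s @[s --> F] --> 0%E ->
  forall e : R, 0 < e -> \forall s \near F, (f s <= e%:E)%E.
Proof.
move=> FF /fine_cvgP[fin /cvgrPdist_le h] e e0.
apply: filterS2 fin (h _ e0) => s fs; rewrite sub0r normrN => fe.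
by rewrite -(fineK fs) lee_fin; exact: le_trans (ler_norm _) fe.
Qed.

Lemma near_ball t (P : R -> Prop) (r : R) : 0 < r -> (forall s, `|s - t| < r -> P s) ->
  \forall s \near t, P s.
Proof.
by move=> r0 h; apply/nbhs_ballP; exists r => // s; rewrite /ball/= distrC; exact: h.
Qed.

Lemma near_dball t (P : R -> Prop) (r : R) : 0 < r ->
  (forall s, `|s - t| < r -> s != t -> P s) -> \forall s \near t^', P s.
Proof.
move=> r0 h; apply/nbhs_ballP; exists r => // s sr st; apply: h => //.
by move: sr; rewrite /ball/= distrC.
Qed.

Lemma near_ball_ex t (P : R -> Prop) : (\forall s \near t, P s) ->
  exists2 r : R, 0 < r & forall s, `|s - t| < r -> P s.
Proof.
by move=> /nbhs_ballP[r r0 h]; exists r => // s sr; apply: h; rewrite /ball/= distrC.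
Qed.

Lemma near_dball_ex t (P : R -> Prop) : (\forall s \near t^', P s) ->
  exists2 r : R, 0 < r & forall s, `|s - t| < r -> s != t -> P s.
Proof.
by move=> /nbhs_ballP[r r0 h]; exists r => // s sr st; apply: h => //; rewrite /ball/= distrC.
Qed.

End ErealLimits.

(** * Bounds in the dual of W *)

Section DualEstimates.
Context (R : realType) (gamma : R).
Local Notation mu := (@lebesgue_measure R).
Local Notation V := (L2space R).
Local Notation dot := (@dot R).
Local Notation nrm := (nrm dot).
Local Notation HI := (@dot_inner R).
Implicit Types (u v h g x y : V) (m : R).

(** Collects the uniform constants of the unit ball, which is all that the estimates of dual norms
    use. *)
Lemma Wnorm_unit m h : W (fn h) -> (Wnorm (fn h) <= 1)%E ->
  [/\ nrm h <= 1, nrm (Dv h) <= 1, cmod (at0 h) <= 2 & Kpot m h <= 18 * (9 + `|m|)].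
Proof.
move=> wh w1; have [hh _] := wh; have [_ kh] := (WP m h).1 wh.
have l1 : (LAnorm (fn h) <= 1)%E.
  by apply: le_trans w1; rewrite /Wnorm leeDr// H1norm_ge0.
have n1 : nrm h ^+ 2 + nrm (Dv h) ^+ 2 <= 1.
  have : (H1norm (fn h) <= 1)%E by apply: le_trans w1; rewrite /Wnorm leeDl// LAnorm_ge0.
  rewrite H1normE// lee_fin /h1n => q1.
  have p0 : 0 <= nrm h ^+ 2 + nrm (Dv h) ^+ 2 by rewrite addr_ge0 ?sqr_ge0.
  by rewrite -(sqr_sqrtr p0) expr_le1// sqrtr_ge0.
have a0 := sqr_ge0 (nrm h); have b0 := sqr_ge0 (nrm (Dv h)).
split; last exact: LAnorm_K.
- by rewrite -(@expr_le1 _ 2)// ?nrm_ge0//; move: n1 a0 b0; move: (_ ^+ 2) (_ ^+ 2) => *; lra.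
- by rewrite -(@expr_le1 _ 2)// ?nrm_ge0//; move: n1 a0 b0; move: (_ ^+ 2) (_ ^+ 2) => *; lra.
- rewrite -(@ler_pXn2r _ 2)// ?nnegrE ?cmod_ge0//.
  apply: le_trans (at0_bound hh ltr01) _.
  by move: n1 a0 b0; move: (nrm h ^+ 2) (nrm (Dv h) ^+ 2) => *; lra.
Qed.

Lemma Ji_nrm h : nrm (Ji h) = nrm h.
Proof. by congr Num.sqrt; exact: Ji_isom. Qed.

Lemma Wnorm_unit_Ji m h : W (fn h) -> (Wnorm (fn h) <= 1)%E ->
  DW m (Ji h) /\ [/\ nrm (Ji h) <= 1, nrm (Dv (Ji h)) <= 1, cmod (at0 (Ji h)) <= 2 &
    Kpot m (Ji h) <= 18 * (9 + `|m|)].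
Proof.
move=> wh w1; have [hh kh] := (WP m h).1 wh; have [a b c d] := Wnorm_unit m wh w1.
split; first by split; [exact: H1_Ji|exact: LTh_Ji].
split; first by rewrite Ji_nrm.
- by rewrite (nrm_nrm0 (Dv_Ji hh)) Ji_nrm.
- by rewrite at0_Ji// cmodi.
- rewrite (_ : Kpot m (Ji h) = Kpot m h)//; congr Int; apply/funext => t.
  by rewrite JiE /cTh cmodi.
Qed.

Lemma H1_0 : H1 (fn (0 : V)).
Proof. by apply/H1_ex; exists 0 => h _; rewrite !(dot0l HI) oppr0. Qed.

Lemma LTh_0 m : LTh m (0 : V).
Proof.
have := Itg0 R; congr Itg; apply/funext => t; by rewrite fn0 /cTh cmod0 Th0.
Qed.

Lemma K_0 m : Kpot m (0 : V) = 0.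
Proof.
by rewrite -[RHS](Int0 R); congr Int; apply/funext => t; rewrite fn0 /cTh cmod0 Th0.
Qed.

Lemma W_0 : W (fn (0 : V)).
Proof. by apply/(WP 0); split; [exact: H1_0|exact: LTh_0]. Qed.

Lemma Dv_0 : nrm (Dv (0 : V)) = 0.
Proof.
have h0 := H1_0; rewrite -[Dv 0]subr0; apply: (@wd_unique _ (0 : V)); first exact: wd_Dv.
by move=> h _; rewrite !(dot0l HI) oppr0.
Qed.

Lemma Wnorm_le m g (d k : R) : W (fn g) -> 0 <= d -> nrm g <= d -> nrm (Dv g) <= d ->
  0 < k -> k <= 1 -> 9 * (8 + `|m|) * Kpot m g <= k ^+ 2 -> (Wnorm (fn g) <= (2 * d + k)%:E)%E.
Proof.
move=> wg d0 g1 g2 k0 k1 gk; have [hg kg] := (WP m g).1 wg.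
rewrite EFinD; apply: leeD; last exact: LAnorm_small gk.
rewrite H1normE// lee_fin /h1n; have d2 : 0 <= 2 * d by lra.
rewrite -(ger0_norm d2) -sqrtr_sqr ler_wsqrtr//.
have p1 : nrm g ^+ 2 <= d ^+ 2 by rewrite lerXn2r ?nnegrE ?nrm_ge0.
have p2 : nrm (Dv g) ^+ 2 <= d ^+ 2 by rewrite lerXn2r ?nnegrE ?nrm_ge0.
have := sqr_ge0 d; move: p1 p2; rewrite exprMn.
by move: (nrm g ^+ 2) (nrm (Dv g) ^+ 2) (d ^+ 2) => *; lra.
Qed.

Lemma Wnorm_0 : (Wnorm (fn (0%R : V)) <= 1)%E.
Proof.
have := @Wnorm_le 0 0 0 1 W_0 (lexx _); rewrite (nrm0 HI) Dv_0 K_0 !mulr0 add0r.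
by apply; rewrite ?ltr01 ?sqr_ge0.
Qed.

Lemma dual_norm_ge0 (l : (R -> R[i]) -> R) : (0 <= dual_norm l)%E.
Proof.
apply: le_trans (_ : (`|l (fn (0 : V))|%:E <= _)%E); first by rewrite lee_fin.
by apply: ereal_sup_ubound; exists (fn (0 : V)) => //; split; [exact: W_0|exact: Wnorm_0].
Qed.

Lemma dual_norm_le (l : (R -> R[i]) -> R) (c : R) :
  (forall h : V, W (fn h) -> (Wnorm (fn h) <= 1)%E -> `|l (fn h)| <= c) ->
  (dual_norm l <= c%:E)%E.
Proof.
move=> hl; apply: ge_ereal_sup => _ [h [wh w1] <-]; rewrite lee_fin -(W_ex wh).
by apply: hl; rewrite W_ex.
Qed.

Lemma log_rhs_P m u h : DW m u -> DW m h -> {ae mu, forall t, cmod (u t) ^+ 2 <= expR m} ->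
  log_rhs gamma (fn u) (fn h) =
    - dot (Dv u) (Dv h) + gamma * cdot (at0 u) (at0 h) + (m + 2) * dot u h - Ppot m u h.
Proof.
by move=> [hu ku] [hh kh] ub; have [_ e] := LgE ku kh ub; rewrite log_rhsE// e !addrA.
Qed.

Lemma pairing_bound m (N : R) g h : 1 <= N -> LTh m g -> LTh m h ->
  Int (fun t => cbe m (g t) * cmod (h t)) <= 3 * N * Kpot m g + 6 * Num.sqrt N^-1 * Kpot m h.
Proof.
move=> N1 kg kh; have ig := Itg_self kg; have ih := Itg_self kh.
have N0 : 0 <= N by lra.
have q0 : 0 <= 2 * Num.sqrt N^-1 by rewrite mulr_ge0 ?sqrtr_ge0.
apply: le_trans (Int_le (Itg_pair kg kh) (ItgD (ItgZ N ig) (ItgZ (2 * Num.sqrt N^-1) ih)) _) _.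
  by move=> t; exact: pairing_strong (cmod_ge0 _) (cmod_ge0 _).
rewrite (IntD (ItgZ N ig) (ItgZ (2 * Num.sqrt N^-1) ih)) (IntZ _ ig) (IntZ _ ih).
have := ler_wpM2l N0 (Int_self kg); have := ler_wpM2l q0 (Int_self kh).
by move: (Num.sqrt _) (Kpot m g) (Kpot m h) (Int _) (Int _) => *; lra.
Qed.

Lemma rhs_terms u h (p : R) : `|- dot (Dv u) (Dv h) + gamma * cdot (at0 u) (at0 h) + p * dot u h| <=
  nrm (Dv u) * nrm (Dv h) + `|gamma| * (cmod (at0 u) * cmod (at0 h)) + `|p| * (nrm u * nrm h).
Proof.
apply: le_trans (ler_normD _ _) _; apply: lerD; last first.
  by rewrite normrM ler_wpM2l// CauchySchwarz//; exact: HI.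
apply: le_trans (ler_normD _ _) _; apply: lerD.
  by rewrite normrN CauchySchwarz//; exact: HI.
by rewrite normrM ler_wpM2l// cdot_norm_le.
Qed.

Lemma P_bound m u h : LTh m u -> LTh m h -> `|Ppot m u h| <= 3 * Kpot m u + 6 * Kpot m h.
Proof.
move=> ku kh; have := pairing_bound (lexx 1) ku kh; rewrite invr1 sqrtr1 !mulr1.
apply: le_trans; apply: Int_abs; [exact: Itg_cal|exact: Itg_pair|].
move=> t; apply: le_trans (cdot_norm_le _ _) _.
by apply: ler_wpM2r; [exact: cmod_ge0|exact: cal_le].
Qed.

Lemma log_rhs_lin m u (a : R) h k : DW m u -> DW m h -> DW m k ->
  {ae mu, forall t, cmod (u t) ^+ 2 <= expR m} ->
  log_rhs gamma (fn u) (fn (a *: h + k)) =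
    a * log_rhs gamma (fn u) (fn h) + log_rhs gamma (fn u) (fn k).
Proof.
move=> Du Dh Dk ub; have [hu ku] := Du; have [hh kh] := Dh; have [hk kk] := Dk.
rewrite !(log_rhs_P _ _ ub)//; last by split; [exact: H1_lin|exact: LTh_lin].
rewrite (dotC HI (Dv u) (Dv (a *: h + k))) dot_Dv_lin// !(dotC HI _ (Dv u)) (cdotC (at0 u)) at0_lin// cdot_linl.
rewrite !(cdotC (at0 u)) (dotDr HI) (dotZr HI) P_lin//.
move: (dot _ _) (dot _ _) (dot _ _) (dot _ _) (cdot _ _) (cdot _ _) (Ppot _ _ _) (Ppot _ _ _) => *.
by ring.
Qed.

(** The parameter [N] is free: the last term is made small by [N] uniformly over the unit ball, and
    only then the first by [d]. *)
Lemma log_rhs_diff m u v h (d N : R) : DW m u -> DW m v -> DW m h ->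
  {ae mu, forall t, cmod (u t) ^+ 2 <= expR m} -> {ae mu, forall t, cmod (v t) ^+ 2 <= expR m} ->
  nrm h <= 1 -> nrm (Dv h) <= 1 -> cmod (at0 h) <= 2 -> Kpot m h <= 18 * (9 + `|m|) ->
  0 <= d -> 1 <= N -> nrm (u - v) <= d -> nrm (Dv (u - v)) <= d -> Kpot m (u - v) <= d ->
  `|log_rhs gamma (fn u) (fn h) - log_rhs gamma (fn v) (fn h)| <=
    d * (1 + 4 * `|gamma| + `|m + 2| + 3 * N) + 6 * Num.sqrt N^-1 * (18 * (9 + `|m|)).
Proof.
move=> Du Dv0 Dh ub vb h1 h2 h3 h4 d0 N1 g1 g2 g3.
have [hu ku] := Du; have [hv kv] := Dv0; have [hh kh] := Dh.
have hg := H1B hu hv; have kg := LThB ku kv.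
rewrite (log_rhs_P Du Dh ub) (log_rhs_P Dv0 Dh vb).
have -> : - dot (Dv u) (Dv h) + gamma * cdot (at0 u) (at0 h) + (m + 2) * dot u h - Ppot m u h -
   (- dot (Dv v) (Dv h) + gamma * cdot (at0 v) (at0 h) + (m + 2) * dot v h - Ppot m v h) =
   (- dot (Dv (u - v)) (Dv h) + gamma * cdot (at0 (u - v)) (at0 h) + (m + 2) * dot (u - v) h)
   - (Ppot m u h - Ppot m v h).
  have -> : cdot (at0 (u - v)) (at0 h) = cdot (at0 u) (at0 h) - cdot (at0 v) (at0 h).
    by rewrite addrC -scaleN1r at0_lin// cdot_linl mulN1r addrC.
  rewrite dot_DvB// (dotBl HI).
  move: (dot _ _) (dot _ _) (dot _ _) (dot _ _) (cdot _ _) (cdot _ _) (Ppot _ _ _) (Ppot _ _ _) => *.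
  by ring.
apply: le_trans (ler_normB _ _) _.
have c0 : cmod (at0 (u - v)) <= 2 * d.
  rewrite -(@ler_pXn2r _ 2)// ?nnegrE ?cmod_ge0 ?mulr_ge0//.
  apply: le_trans (at0_bound hg ltr01) _.
  have p1 : nrm (u - v) ^+ 2 <= d ^+ 2 by rewrite lerXn2r ?nnegrE ?nrm_ge0.
  have p2 : nrm (Dv (u - v)) ^+ 2 <= d ^+ 2 by rewrite lerXn2r ?nnegrE ?nrm_ge0.
  by move: p1 p2; rewrite exprMn; move: (nrm (u - v) ^+ 2) (nrm (Dv _) ^+ 2) (d ^+ 2); clear => *; lra.
have t1 := rhs_terms (u - v) h (m + 2).
have s1 : nrm (Dv (u - v)) * nrm (Dv h) <= d * 1 by apply: ler_pM; rewrite ?nrm_ge0.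
have s2 : cmod (at0 (u - v)) * cmod (at0 h) <= 2 * d * 2 by apply: ler_pM; rewrite ?cmod_ge0.
have s3 : nrm (u - v) * nrm h <= d * 1 by apply: ler_pM; rewrite ?nrm_ge0.
have s4 := ler_wpM2l (normr_ge0 gamma) s2; have s5 := ler_wpM2l (normr_ge0 (m + 2)) s3.
have t2 := le_trans (P_diff ku kv kh) (pairing_bound N1 kg kh).
have N0 : 0 <= 3 * N by rewrite mulr_ge0// (le_trans ler01).
have q0 : 0 <= 6 * Num.sqrt N^-1 by rewrite mulr_ge0 ?sqrtr_ge0.
have s6 := ler_wpM2l N0 g3; have s7 := ler_wpM2l q0 h4.
move: t1 s1 s4 s5 t2 s6 s7.
move: (Num.norm (_ + _ + _)) (Num.norm (Ppot _ _ _ - _)) (6 * _ * _) (6 * _ * _) => a1 a2 a3 a4.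
move: (nrm _ * nrm _) (nrm _ * nrm _) (cmod _ * cmod _) (Kpot m (u - v)) => b1 b2 b3 b4.
move: `|m + 2| `|gamma| => c1 c2; clear; lra.
Qed.

End DualEstimates.

(** * The flow solves the equation in the required sense *)

Section FlowSolution.
Context (R : realType) (gamma : R).
Local Notation mu := (@lebesgue_measure R).
Local Notation V := (L2space R).
Local Notation dot := (@dot R).
Local Notation nrm := (nrm dot).
Local Notation HI := (@dot_inner R).
Variables (u : R -> V) (m D2 : R) (x0 : V).
Hypothesis w0 : W (fn x0).
Hypothesis u0 : nrm (u 0 - x0) = 0.
Hypothesis uP : forall t, [/\ DW m (u t), Phi gamma m (u t) = Phi gamma m x0,
  nrm (Dv (u t)) ^+ 2 <= D2 & {ae mu, forall y, cmod (u t y) ^+ 2 <= expR m}].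
Hypothesis uc : forall t, vcont dot u t.
Hypothesis un : forall t, nrm (u t) = nrm x0.
Hypothesis ud : forall t h, W (fn h) ->
  sderiv (fun s => dot (u s) h) t (- log_rhs gamma (fn (u t)) (fn (Ji h))).

Lemma flow_W t : W (fn (u t)).
Proof. by apply/(WP m); case: (uP t). Qed.

Lemma flow_modulus t (d : R) : 0 < d -> exists2 r : R, 0 < r & forall s, `|s - t| < r ->
  [/\ nrm (u s - u t) <= d, nrm (Dv (u s - u t)) <= d & Kpot m (u s - u t) <= d].
Proof.
move=> d0; have [Dt Pt _ _] := uP t.
(* [energy_continuity] bounds the squared derivative but the potential itself, hence both powers. *)
have e0 : 0 < Num.min d (d ^+ 2) by rewrite lt_min d0 exprn_gt0.
have [r1 r10 h1] := energy_continuity gamma Dt e0.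
have r20 : 0 < Num.min d r1 by rewrite lt_min d0.
have [r r0 hr] := uc t r20; exists r => // s /hr; rewrite le_min => /andP[sd sr].
have [Ds Ps _ _] := uP s.
have [] := h1 _ Ds (etrans Ps (esym Pt)) sr; rewrite !le_min => /andP[_ a] /andP[b _].
split => //; rewrite -(@ler_pXn2r _ 2)// ?nnegrE ?nrm_ge0//; exact: ltW.
Qed.

Lemma flow_continuous_W : continuous_W setT (fun t => fn (u t)).
Proof.
split=> [t _|t _]; first exact: flow_W.
have n0 := normr_ge0 m.
apply: ecvg0 => [s|e e0]; first exact: Wnorm_ge0.
have [k k0 [k1 ke]] : exists2 k : R, 0 < k & k <= 1 /\ 3 * k <= e.
  exists (Num.min 1 (e / 3)); first by rewrite lt_min ltr01 divr_gt0.
  split; first by rewrite ge_min lexx.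
  have : Num.min 1 (e / 3) <= e / 3 by rewrite ge_min lexx orbT.
  by move: (Num.min _ _) => a; lra.
have [M M0 ME] : exists2 M : R, 1 <= M & 9 * (8 + `|m|) = M by exists (9 * (8 + `|m|)); lra.
have Mp : 0 < M := lt_le_trans ltr01 M0.
have d0 : 0 < k ^+ 2 / M by rewrite divr_gt0// exprn_gt0.
have [r r0 hr] := flow_modulus t d0; apply: (near_ball r0) => s /hr[g1 g2 g3].
have -> : (fun x => u s x - u t x) = fn (u s - u t) by apply/funext => x; rewrite fnB.
have dk : k ^+ 2 / M <= k.
  rewrite ler_pdivrMr// expr2 ler_pM2l//; lra.
have wg : W (fn (u s - u t)).
  by apply/(WP m); apply: DWB; [case: (uP s)|case: (uP t)].
apply: le_trans (@Wnorm_le _ m _ k k wg (ltW k0) _ _ k0 k1 _) _.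
- exact: le_trans g1 dk.
- exact: le_trans g2 dk.
- by rewrite ME mulrC -ler_pdivlMr.
- by rewrite lee_fin; lra.
Qed.

(** The radius is uniform over the unit ball of W. This gives continuity of the time derivative in
    the dual and, by the mean value theorem, convergence of the difference quotients. *)
Lemma flow_rhs_cont t (e : R) : 0 < e -> exists2 r : R, 0 < r & forall s, `|s - t| < r ->
  forall h, W (fn h) -> (Wnorm (fn h) <= 1)%E ->
  `|log_rhs gamma (fn (u s)) (fn (Ji h)) - log_rhs gamma (fn (u t)) (fn (Ji h))| <= e.
Proof.
move=> e0; have n0 := normr_ge0 m.
pose A : R := 6 * (18 * (9 + `|m|)).
have A0 : 0 < A by rewrite /A; lra.
pose q : R := e / (2 * A + e).
have dA : 0 < 2 * A + e by lra.
have q0 : 0 < q by rewrite divr_gt0.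
have q1 : q <= 1 by rewrite ler_pdivrMr//; lra.
have qA : q * A <= e / 2.
  rewrite /q mulrAC ler_pdivrMr//; have := mulr_ge0 (ltW e0) (ltW e0); lra.
have [N N1 sN] : exists2 N : R, 1 <= N & Num.sqrt N^-1 = q.
  exists (q^-1 ^+ 2); first by rewrite exprn_ege1// invf_ge1.
  by rewrite exprVn invrK sqrtr_sqr gtr0_norm.
pose S : R := 1 + 4 * `|gamma| + `|m + 2| + 3 * N.
have S0 : 0 < S.
  have := normr_ge0 gamma; have := normr_ge0 (m + 2).
  by rewrite /S; move: `|gamma| `|m + 2| => *; lra.
clearbody q.
have d0 : 0 < e / 2 / S by rewrite !divr_gt0.
have [r r0 hr] := flow_modulus t d0; exists r => // s /hr[g1 g2 g3] h wh w1.
have [DJ [j1 j2 j3 j4]] := Wnorm_unit_Ji m wh w1.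
have [Ds _ _ bs] := uP s; have [Dt _ _ bt] := uP t.
apply: le_trans (log_rhs_diff gamma Ds Dt DJ bs bt j1 j2 j3 j4 (ltW d0) N1 g1 g2 g3) _.
rewrite -/S divfK ?gt_eqF// sN.
have -> : 6 * q * (18 * (9 + `|m|)) = q * A by rewrite /A; ring.
by rewrite [leRHS](splitr e) lerD2l.
Qed.

(** The functional i (u'' + gamma delta u + u Log |u|^2), as multiplication by i passes to the test
    function with a minus sign. *)
Definition fdu t (h : R -> R[i]) : R := - log_rhs gamma (fn (u t)) (fun x => 'i%C * h x).

Lemma fduE t h : fdu t (fn h) = - log_rhs gamma (fn (u t)) (fn (Ji h)).
Proof. by rewrite /fdu; congr (- log_rhs _ _ _); apply/funext => x; rewrite JiE. Qed.

Lemma flow_C1 : C1_Wdual setT (fun t => fn (u t)) fdu.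
Proof.
split=> t _.
- have [Dt Pt Dn bt] := uP t; have [ht kt] := Dt; split.
    move=> a h w wh ww.
    have Dh : DW m (toL2 h) by apply/WP; rewrite W_ex.
    have Dw : DW m (toL2 w) by apply/WP; rewrite W_ex.
    have -> : (fun x => a%:C%C * h x + w x) = fn (a *: toL2 h + toL2 w).
      by apply/funext => x; rewrite fnD fnZ !W_ex.
    rewrite -{2}(W_ex wh) -{2}(W_ex ww) !fduE Ji_lin.
    have JD (k : V) : DW m k -> DW m (Ji k) by move=> [c d]; split; [exact: H1_Ji|exact: LTh_Ji].
    by rewrite (log_rhs_lin gamma a Dt (JD _ Dh) (JD _ Dw) bt) opprD mulrN.
  pose C := nrm (Dv (u t)) + `|gamma| * (cmod (at0 (u t)) * 2) + `|m + 2| * nrm (u t)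
    + (3 * Kpot m (u t) + 6 * (18 * (9 + `|m|))).
  apply: le_lt_trans (@dual_norm_le _ _ C _) (ltry _) => h wh w1; rewrite fduE normrN.
  have [DJ [j1 j2 j3 j4]] := Wnorm_unit_Ji m wh w1; have [hJ kJ] := DJ.
  rewrite (log_rhs_P gamma Dt DJ bt); apply: le_trans (ler_normB _ _) _; apply: lerD.
    apply: le_trans (rhs_terms gamma _ _ _) _.
    apply: lerD; last by apply: ler_wpM2l => //; apply: ler_piMr => //; exact: nrm_ge0.
    apply: lerD; first by apply: ler_piMr => //; exact: nrm_ge0.
    by apply: ler_wpM2l => //; apply: ler_wpM2l => //; exact: cmod_ge0.
  apply: le_trans (P_bound kt kJ) _; by rewrite lerD2l ler_pM2l.
- apply: ecvg0 => [s|e e0]; first exact: dual_norm_ge0.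
  have [r r0 hr] := flow_rhs_cont t e0.
  apply: (near_dball r0) => s sr st; apply: dual_norm_le => h wh w1.
  rewrite !L2dotE fduE.
  pose f s := dot (u s) h; pose df s := - log_rhs gamma (fn (u s)) (fn (Ji h)).
  (* The intermediate time depends on [h] but stays within the radius, which does not; the bound is
     therefore uniform in [h]. *)
  have [c cs ec] : exists2 c : R, `|c - t| < r & f s - f t = df c * (s - t).
    case: (leP t s) => ts.
      have [c /andP[c1 c2] ec] := sderiv_mvt ts (fun y _ => ud y wh).
      exists c => //; apply: le_lt_trans sr; rewrite !ger0_norm ?subr_ge0//; lra.
    have [c /andP[c1 c2] ec] := sderiv_mvt (ltW ts) (fun y _ => ud y wh).
    exists c; last by move: ec; rewrite -/(f t) -/(f s) -/(df c); lra.
    by apply: le_lt_trans sr; rewrite !ler0_norm ?subr_le0 ?(ltW ts)//; lra.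
  rewrite -/(f s) -/(f t) ec mulrCA mulVf ?subr_eq0// mulr1 /df -opprD normrN.
  exact: hr cs h wh w1.
- apply: ecvg0 => [s|e e0]; first exact: dual_norm_ge0.
  have [r r0 hr] := flow_rhs_cont t e0.
  apply: (near_ball r0) => s sr; apply: dual_norm_le => h wh w1.
  by rewrite !fduE -opprD normrN; exact: hr.
Qed.

Lemma flow_solution : solution gamma (fn x0) setT (fun t => fn (u t)).
Proof.
split; first split.
- exact: openT.
- by [].
- by [].
- exact: flow_continuous_W.
- exact: nrm0_ae.
exists fdu; first exact: flow_C1.
move=> t _ h wh; rewrite /dual_muli /fdu.
rewrite (_ : (fun x => 'i%C * (- 'i%C * h x)) = h) ?addNr//.
by apply/funext => x; rewrite mulrA mulrN -expr2 sqr_i opprK mul1r.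
Qed.

Lemma flow_Wnorm_bounded : exists C : R, forall t, (Wnorm (fn (u t)) <= C%:E)%E.
Proof.
have n0 := normr_ge0 m; have Dx := (WP m x0).1 w0.
have P0 : 0 <= Phi gamma m x0 := ham_ge0 (log_hamiltonian gamma m) Dx.
pose k := 6 * (8 + `|m|) * (2 * Phi gamma m x0) + 1.
have k1 : 1 <= k by rewrite lerDr mulr_ge0// ?mulr_ge0//; lra.
exists (Num.sqrt (nrm x0 ^+ 2 + D2) + k) => t; have [Dt Pt Dn bt] := uP t; have [ht kt] := Dt.
rewrite EFinD; apply: leeD.
  by rewrite H1normE// lee_fin ler_wsqrtr// un lerD2l.
apply: (LAnorm_large k1 kt); apply: le_trans (_ : 6 * (8 + `|m|) * (2 * Phi gamma m x0) <= _).
  by apply: ler_wpM2l; [lra|rewrite -Pt; exact: Phi_K].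
by rewrite lerDl.
Qed.

End FlowSolution.

(** * Uniqueness *)

Section Uniqueness.
Context (R : realType) (gamma : R).
Local Notation mu := (@lebesgue_measure R).
Local Notation V := (L2space R).
Local Notation dot := (@dot R).
Local Notation nrm := (nrm dot).
Local Notation HI := (@dot_inner R).
Implicit Types (h g : V).

Lemma LAnormZ (a : R) h : 0 < a -> LAnorm (fn (a *: h)) = (a%:E * LAnorm (fn h))%E.
Proof.
move=> a0; rewrite /LAnorm -ereal_inf_pZl//; congr ereal_inf.
have e (k : R) t : (a * k)^-1 * cmod (fn (a *: h) t) = k^-1 * cmod (h t).
  by rewrite fnZ cmodZ gtr0_norm// invfM mulrACA mulVf ?gt_eqF// mul1r.
apply/seteqP; split=> [_ [k [k0 hk] <-]|_ [_ [k [k0 hk] <-] <-]].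
  exists (k / a)%:E; last by rewrite -EFinM mulrC divfK// gt_eqF.
  exists (k / a) => //; split; first by rewrite divr_gt0.
  have ek : k = a * (k / a) by rewrite mulrC divfK// gt_eqF.
  by move: hk; rewrite {1}ek; under eq_integral do rewrite e.
exists (a * k); last by rewrite EFinM.
split; first exact: mulr_gt0.
by under eq_integral do rewrite e.
Qed.

Lemma H1Z (a : R) h : H1 (fn h) -> H1 (fn (a *: h)).
Proof. by move=> hh; rewrite -[_ *: _]addr0; apply: H1_lin => //; exact: H1_0. Qed.

Lemma DvZ (a : R) h : H1 (fn h) -> nrm (Dv (a *: h)) = `|a| * nrm (Dv h).
Proof.
move=> hh; rewrite -(nrmZ HI); apply: nrm_nrm0; apply: (@wd_unique _ (a *: h)).
  exact/wd_Dv/H1Z.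
by move=> k tk; rewrite !(dotZl HI) (wd_Dv hh tk) mulrN.
Qed.

Lemma WnormZ (a : R) h : H1 (fn h) -> 0 < a -> Wnorm (fn (a *: h)) = (a%:E * Wnorm (fn h))%E.
Proof.
move=> hh a0; rewrite /Wnorm ge0_muleDr ?H1norm_ge0 ?LAnorm_ge0// LAnormZ//; congr (_ + _)%E.
rewrite (H1normE hh) (H1normE (H1Z a hh)) -EFinM; congr (_%:E); rewrite /h1n.
rewrite DvZ// (nrmZ HI) !exprMn -mulrDr sqrtrM ?sqr_ge0// sqrtr_sqr normr_id.
by rewrite gtr0_norm.
Qed.

Lemma WZ (a : R) h : W (fn h) -> W (fn (a *: h)).
Proof.
move=> /(WP 0)[hh kh]; apply/(WP 0); split; first exact: H1Z.
by rewrite -[_ *: _]addr0; apply: LTh_lin => //; exact: LTh_0.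
Qed.

Lemma dual_pairing (l : (R -> R[i]) -> R) (D c : R) h :
  (forall (a : R) h, W (fn h) -> l (fn (a *: h)) = a * l (fn h)) ->
  (dual_norm l <= D%:E)%E -> W (fn h) -> 0 < c -> (Wnorm (fn h) <= c%:E)%E ->
  `|l (fn h)| <= D * c.
Proof.
move=> lZ lD wh c0 hc.
have ci : 0 < c^-1 by rewrite invr_gt0.
have w1 : (Wnorm (fn (c^-1 *: h)) <= 1)%E.
  by rewrite (WnormZ wh.1 ci) lee_pdivrMl// mule1.
have : (`|l (fn (c^-1 *: h))|%:E <= D%:E)%E.
  apply: le_trans lD; apply: ereal_sup_ubound; exists (fn (c^-1 *: h)) => //.
  by split => //; exact: WZ.
by rewrite lee_fin lZ// normrM gtr0_norm// ler_pdivrMl// mulrC.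
Qed.

Lemma Wnorm_fin h : W (fn h) -> exists2 c : R, 0 < c & (Wnorm (fn h) <= c%:E)%E.
Proof.
move=> wh; have [hh kh] := (WP 0 h).1 wh; have K0 := K_ge0 0 h.
pose k := 6 * (8 + `|0 : R|) * Kpot 0 h + 1.
have k1 : 1 <= k by rewrite lerDr mulr_ge0// mulr_ge0// addr_ge0.
have hl : (LAnorm (fn h) <= k%:E)%E by apply: (LAnorm_large k1 kh); rewrite lerDl.
exists (h1n h + k); first by rewrite ltr_wpDl ?sqrtr_ge0// (lt_le_trans ltr01).
by rewrite /Wnorm H1normE// EFinD; apply: leeD.
Qed.

Section OneSolution.
Variables (I : set R) (v : R -> R -> R[i]) (dv : R -> (R -> R[i]) -> R).
Hypothesis oI : open I.
Hypothesis vW : continuous_W I v.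
Hypothesis vC : C1_Wdual I v dv.
Hypothesis vE : forall t, I t -> forall h, W h -> dual_muli (dv t) h + log_rhs gamma (v t) h = 0.

Let p t : V := toL2 (v t).
Let pE t : I t -> fn (p t) = v t. Proof. by move=> It; apply: W_ex; have [+ _] := vW; apply. Qed.
Let pW t : I t -> W (fn (p t)). Proof. by move=> It; rewrite pE//; have [+ _] := vW; apply. Qed.

Lemma W_Ji h : W (fn h) -> W (fn (Ji h)).
Proof. by move=> /(WP 0)[a b]; apply/(WP 0); split; [exact: H1_Ji|exact: LTh_Ji]. Qed.

Lemma WB g h : W (fn g) -> W (fn h) -> W (fn (g - h)).
Proof. by move=> /(WP 0) a /(WP 0) b; apply/(WP 0); exact: DWB. Qed.

Lemma sol_dvE t h : I t -> W (fn h) -> dv t (fn h) = - log_rhs gamma (fn (p t)) (fn (Ji h)).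
Proof.
move=> It wh; have := vE It (W_Ji wh); rewrite pE// => /eqP; rewrite addr_eq0 => /eqP <-.
rewrite /dual_muli; congr (dv t); apply/funext => x.
by rewrite JiE mulrA mulNr -expr2 sqr_i opprK mul1r.
Qed.

Lemma sol_dvZ t (a : R) h : I t -> W (fn h) -> dv t (fn (a *: h)) = a * dv t (fn h).
Proof.
move=> It wh; have [/(_ t It) [lin _] _ _] := vC.
have z : dv t (fn 0) = 0.
  have := lin 1 _ _ (@W_0 R) (@W_0 R); rewrite mul1r.
  rewrite (_ : (fun y : R => _) = fn (0 : V)); last first.
    by apply/funext => y; rewrite fn0 mulr0 addr0.
  by move: (dv t _) => y; lra.
have := lin a _ _ wh (@W_0 R); rewrite z addr0 => <-; congr (dv t).
by apply/funext => x; rewrite fnZ fn0 addr0.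
Qed.

(** Uniform in [h], so that [h] may vary with [s]; [sol_sqr] takes [h] equal to the increment
    itself. *)
Lemma sol_quotient t (e : R) : I t -> 0 < e -> exists2 r : R, 0 < r &
  forall s, `|s - t| < r -> I s /\ forall h (c : R), W (fn h) -> 0 < c ->
    (Wnorm (fn h) <= c%:E)%E ->
    `|dot (p s) h - dot (p t) h - (s - t) * dv t (fn h)| <= e * c * `|s - t|.
Proof.
move=> It e0; have [_ /(_ t It) hq _] := vC.
have [r1 r10 h1] := near_dball_ex (ecvg0_near _ hq e0).
have [r2 r20 h2] := near_ball_ex (open_nbhs_nbhs (conj oI It)).
exists (Num.min r1 r2); first by rewrite lt_min r10.
move=> s; rewrite lt_min => /andP[/h1 sr1 /h2 Is]; split => // h c wh c0 hc.
case: (eqVneq s t) => [->|st]; first by rewrite !subrr mul0r subr0 normr0 mulr0.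
have := sr1 st; set l := (X in dual_norm X) => lD.
have lZ (a : R) k : W (fn k) -> l (fn (a *: k)) = a * l (fn k).
  move=> wk; rewrite /l sol_dvZ// -!pE// !L2dotE !(dotZr HI).
  by move: (dot _ _) (dot _ _) (dv _ _) (_^-1) => *; ring.
have := dual_pairing lZ lD wh c0 hc; rewrite /l -!pE// !L2dotE => hl.
have st0 : 0 < `|s - t| by rewrite normr_gt0 subr_eq0.
rewrite -ler_pdivrMr// mulrC -normfV -normrM mulrBr mulrA mulVf ?subr_eq0// mul1r.
exact: hl.
Qed.

Lemma sol_sderiv t h : I t -> W (fn h) -> sderiv (fun s => dot (p s) h) t (dv t (fn h)).
Proof.
move=> It wh e e0; have [c c0 hc] := Wnorm_fin wh.
have [r r0 hr] := sol_quotient It (divr_gt0 e0 c0); exists r => // s /hr[_ /(_ h c wh c0 hc)].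
by rewrite divfK// gt_eqF.
Qed.

(** A solution is differentiable only in the dual of W, yet its squared L^2 increment is o(|s - t|):
    the increment is O(|s - t|) in the dual and is tested against itself, whose W norm tends to 0 by
    continuity. *)
Lemma sol_sqr t (e : R) : I t -> 0 < e -> exists2 r : R, 0 < r &
  forall s, `|s - t| < r -> nrm (p s - p t) ^+ 2 <= e * `|s - t|.
Proof.
move=> It e0; have [/(_ t It) [_ dfin] _ _] := vC; have [_ /(_ t It) cW] := vW.
have [D D0 hD] : exists2 D : R, 0 <= D & (dual_norm (dv t) <= D%:E)%E.
  have d0 := dual_norm_ge0 (dv t).
  exists (fine (dual_norm (dv t))); first exact: fine_ge0.
  by rewrite fineK// ge0_fin_numE.
have D1 : 0 < 1 + D by lra.
have c0 : 0 < e / (1 + D) by rewrite divr_gt0.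
have [r1 r10 h1] := sol_quotient It ltr01.
have [r2 r20 h2] := near_ball_ex (ecvg0_near _ cW c0).
exists (Num.min r1 r2); first by rewrite lt_min r10.
move=> s; rewrite lt_min => /andP[/h1[Is hq] /h2 wc].
have wg : W (fn (p s - p t)) by apply: WB; exact: pW.
have wc' : (Wnorm (fn (p s - p t)%R) <= (e / (1 + D))%:E)%E.
  rewrite (_ : fn _ = (fun z : R => v s z - v t z))//.
  by apply/funext => z; rewrite fnB !pE.
have q1 := hq _ _ wg c0 wc'.
have q2 := dual_pairing (fun a h => @sol_dvZ t a h It) hD wg c0 wc'.
rewrite (nrm_sqr HI) (dotBl HI).
have st0 := normr_ge0 (s - t).
apply: le_trans (ler_norm _) _.
rewrite -[X in `|X|](subrK ((s - t) * dv t (fn (p s - p t)))).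
apply: le_trans (ler_normD _ _) _; rewrite normrM.
have q3 := ler_wpM2l st0 q2.
apply: le_trans (lerD q1 q3) _.
rewrite le_eqVlt; apply/orP; left; apply/eqP.
by move: `|s - t| => a; field; rewrite gt_eqF.
Qed.

End OneSolution.

(** By [sol_sqr] the squared L^2 distance of two solutions is differentiable, with the derivative
    given by formal computation, even though neither solution is differentiable in L^2. *)
Lemma solution_unique (f0 : R -> R[i]) (I J : set R) (v w : R -> R -> R[i]) :
  solution gamma f0 I v -> solution gamma f0 J w -> I `<=` J ->
  forall t, I t -> ae_equal (v t) (w t).
Proof.
move=> [[oI iI I0 vW v0] [dv vC vE]] [[oJ iJ J0 wW w0] [dw wC wE]] IJ.
pose p t : V := toL2 (v t); pose q t : V := toL2 (w t).
have pE t : I t -> fn (p t) = v t by move=> It; apply: W_ex; have [+ _] := vW; apply.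
have qE t : I t -> fn (q t) = w t.
  by move=> /IJ Jt; apply: W_ex; have [+ _] := wW; apply.
have pW t : I t -> W (fn (p t)) by move=> It; rewrite pE//; have [+ _] := vW; apply.
have qW t : I t -> W (fn (q t)).
  by move=> It; rewrite qE//; have [+ _] := wW; apply; exact: IJ.
pose F t := nrm (p t - q t) ^+ 2.
pose dF t := 2 * (dv t (fn (p t - q t)) - dw t (fn (p t - q t))).
have hF t : I t -> sderiv F t (dF t).
  move=> It e e0; have Jt := IJ _ It.
  have wg : W (fn (p t - q t)) by apply: WB; [exact: pW|exact: qW].
  have e8 : 0 < e / 8 by rewrite divr_gt0.
  have [r1 r10 h1] := sol_sqr oI vW vC It e8.
  have [r2 r20 h2] := sol_sqr oJ wW wC Jt e8.
  have [r3 r30 h3] := sol_sderiv oI vW vC It wg e8.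
  have [r4 r40 h4] := sol_sderiv oJ wW wC Jt wg e8.
  exists (Num.min (Num.min r1 r2) (Num.min r3 r4)); first by rewrite !lt_min r10 r20 r30.
  move=> s; rewrite !lt_min => /andP[/andP[/h1 k1 /h2 k2] /andP[/h3 k3 /h4 k4]].
  rewrite -/(p s) -/(p t) in k1 k3; rewrite -/(q s) -/(q t) in k2 k4.
  set g := p t - q t in k3 k4 wg *; set a := p s - p t in k1; set b := q s - q t in k2.
  have Es : p s - q s = g + (a - b) by rewrite /a /b subACA -/g subrKC.
  have ag : dot a g = dot (p s) g - dot (p t) g by rewrite /a (dotBl HI).
  have bg : dot b g = dot (q s) g - dot (q t) g by rewrite /b (dotBl HI).
  rewrite -ag in k3; rewrite -bg in k4; clearbody a b.
  have ab : dot (a - b) (a - b) <= 2 * nrm a ^+ 2 + 2 * nrm b ^+ 2.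
    have := dot_ge0 HI (a + b); rewrite !(nrm_sqr HI) !(dotBl HI, dotBr HI, dotDl HI, dotDr HI).
    rewrite (dotC HI b a); move: (dot a a) (dot a b) (dot b b); clear => *; lra.
  have ab0 := dot_ge0 HI (a - b).
  have -> : F s = F t + 2 * (dot a g - dot b g) + dot (a - b) (a - b).
    rewrite /F Es !(nrm_sqr HI) -/g (dotDl HI g) !(dotDr HI _ (a - b)) (dotC HI g (a - b)).
    by rewrite (dotBl HI a b g); move: (dot g g) (dot a g) (dot b g) (dot _ _) => *; ring.
  rewrite /dF -/g; move: (F t) (dot (a - b) (a - b)) (dot a g) (dot b g) (nrm a ^+ 2) (nrm b ^+ 2)
    (dv t _) (dw t _) k1 k2 k3 k4 ab ab0 (normr_ge0 (s - t)) e0.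
  move: (s - t) `|s - t|; clear => x y f1 f2 f3 f4 f5 f6 f7 f8 k1 k2.
  rewrite !ler_norml => /andP[k3 k3'] /andP[k4 k4'] k5 k6 k7 k8.
  by apply/andP; split; lra.
(* The level is chosen at each time so that both solutions are below it; the constant 4 does not
   depend on it, so no sup bound uniform in time is required. *)
have bF t : I t -> `|dF t| <= 4 * F t + 0.
  move=> It; have Jt := IJ _ It; have wp := pW _ It; have wq := qW _ It.
  have wg := WB wp wq.
  have [m1 b1] := H1_exp_bound wp.1; have [m2 b2] := H1_exp_bound wq.1.
  pose m := Num.max m1 m2.
  have b1' : {ae mu, forall y, cmod (p t y) ^+ 2 <= expR m}.
    by apply: ae_imp b1 => y /le_trans; apply; rewrite ler_expR le_max lexx.
  have b2' : {ae mu, forall y, cmod (q t y) ^+ 2 <= expR m}.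
    by apply: ae_imp b2 => y /le_trans; apply; rewrite ler_expR le_max lexx orbT.
  have Dp := (WP m _).1 wp; have Dq := (WP m _).1 wq; have DJ := (WP m _).1 (W_Ji wg).
  rewrite /dF (sol_dvE vW vE It wg) (sol_dvE wW wE Jt wg) -/(p t) -/(q t).
  rewrite -(B_log_rhs gamma Dp DJ b1') -(B_log_rhs gamma Dq DJ b2').
  have := ham_acc (log_hamiltonian gamma m) Dp Dq.
  have : dot (p t) (Ji (p t - q t)) - dot (q t) (Ji (p t - q t)) = 0.
    rewrite -(dotBl HI); have := Ji_skew (p t - q t) (p t - q t); rewrite (dotC HI).
    by move: (dot _ _); clear => z; lra.
  rewrite /F (nrm_sqr HI) normrM ger0_norm//.
  move: (Bform _ _ _ _) (Bform _ _ _ _) (dot (p t - q t) (p t - q t)) (dot (p t) _) (dot (q t) _) (cQ gamma + m + 2).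
  clear => z1 z2 z3 z4 z5 z6 /eqP; rewrite subr_eq0 => /eqP ->.
  by rewrite subACA subrr subr0 => h; lra.
have F0 : F 0 = 0.
  rewrite /F (_ : nrm (p 0 - q 0) = 0) ?expr0n//; apply: ae_nrm0.
  by rewrite pE// qE//; apply: ae_imp (ae_and v0 w0) => y [-> ->].
have FT T : I T -> F T <= 0.
  move=> IT; have [T0|T0] := leP 0 T.
    have IS t : 0 <= t <= T -> I t by exact: iI.
    have := @gronwall R F dF 4 0 T (ler0n _ _) (lexx _) T0 (fun t k => hF t (IS t k)).
    rewrite F0 mul0r addr0 mulr0; apply => t /IS It.
    exact: le_trans (ler_norm _) (bF t It).
  have IS t : 0 <= t <= - T -> I (- t).
    by move=> /andP[t0 tT]; apply: (iI T 0 IT I0); rewrite lerNr tT oppr_le0.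
  have NT : 0 <= - T by rewrite oppr_ge0 ltW.
  have := @gronwall R (F \o -%R) (fun t => - dF (- t)) 4 0 (- T) (ler0n _ _) (lexx _) NT
    (fun t k => sderiv_refl (hF _ (IS t k))).
  rewrite /= opprK oppr0 F0 mul0r addr0 mulr0; apply => t /IS It.
  by apply: le_trans (ler_norm _) _; rewrite normrN; exact: bF.
move=> t It; rewrite -(pE t It) -(qE t It); apply: nrm0_ae.
by apply/eqP; rewrite -sqrf_eq0 eq_le sqr_ge0 andbT; exact: FT.
Qed.

End Uniqueness.

Theorem proposition1p1 (R : realType) (gamma : R) (u0 : R -> R[i]) (hu0 : W u0) :
  exists u : R -> R -> R[i],
    [/\ maximal_solution gamma u0 setT u,
        forall (I : set R) (v : R -> R -> R[i]), maximal_solution gamma u0 I v ->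
          I = setT /\ (forall t, ae_equal (v t) (u t)),
        (ereal_sup [set Wnorm (u t) | t in setT] < +oo)%E,
        forall t, energy gamma (u t) = energy gamma u0 &
        forall t, ((L2norm (u t)) ^+ 2 = (L2norm u0) ^+ 2)%E].
Proof.
have e0 := W_ex hu0; set x0 := toL2 u0 in e0.
have w0 : W (fn x0) by rewrite e0.
have [u [m [D2 [ux uP ue uc ud]]]] := log_flow gamma w0.
have un t : nrm (@dot R) (u t) = nrm (@dot R) x0 by case: (ue t).
have sol := flow_solution ux uP uc ud; rewrite e0 in sol.
exists (fun t => fn (u t)); split.
- by split => // J v _ TJ _; apply/seteqP; split.
- move=> I v [sv mv]; have IT : I `<=` setT by [].
  have uv := solution_unique sv sol IT.
  (* The global solution agrees with [v] on [I], hence extends it, and maximality of [v] leaves no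
     room for a proper extension. *)
  have IE : setT = I.
    by apply: (mv setT _ sol IT) => t It; apply: ae_imp (uv t It) => y ->.
  by split => // t; apply: uv; rewrite -IE.
- have [C hC] := flow_Wnorm_bounded w0 uP un.
  by apply: le_lt_trans (ltry C); apply: ge_ereal_sup => _ [t _ <-].
- move=> t; have [[ht _] _ _ _] := uP t; rewrite -e0 !energyE//; last by case: w0.
  by case: (ue t).
- by move=> t; rewrite -e0 !L2norm_nrm un.
Qed.
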